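(* Let $n,N\ge1$ and $R>0$. Suppose $u=(u_1,\ldots,u_N)^T\in W^{1,2}(\mathbb C^n\setminus\overline{B_R})$ is $\mathbb C^N$-valued and satisfies $$\bar\partial u=Vu\quad\text{on }\mathbb C^n\setminus\overline{B_R}$$ for some measurable $N\times N$ matrix-valued $(0,1)$-form $V$ on $\mathbb C^n\setminus\overline{B_R}$ with $|V|\le\frac{C}{|z|}$ for some $C>0$. Assume that $u$ vanishes to infinite order at infinity in the $L^2$ sense. Then $u$ vanishes identically if either $N=1$, or $N\ge2$ and $C<\frac14$.
   Context: $B_R$ is the open ball of radius $R$ centered at $0$ in $\mathbb C^n$, and $dv$ is Lebesgue measure. $W^{1,2}(\Omega)$ is the space of functions in $L^2(\Omega)$ whose first-order weak derivatives are in $L^2(\Omega)$, componentwise for vector-valued functions. An $N\times N$ matrix-valued $(0,1)$-form is $V=\sum_{j=1}^nV_j\,d\bar z_j$ with $V_j$ measurable $N\times N$ complex matrix functions; $|V|$ is the pointwise Euclidean norm of all the entries of all the $V_j$. The equation $\bar\partial u=Vu$ means $\partial u/\partial\bar z_j=V_ju$ for all $j=1,\dots,n$, in the sense of distributions (equivalently, almost everywhere). $u$ vanishes to infinite order at infinity in the $L^2$ sense if $\lim_{r\to\infty}r^m\int_{|z|>r}|u(z)|^2\,dv_z=0$ for every $m>0$. *)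

(* Defs.v *)
From HB Require Import structures.
From mathcomp Require Import all_boot all_order all_algebra.
From mathcomp Require Import complex.
From mathcomp Require Import all_classical all_reals all_analysis.

Set Implicit Arguments.
Unset Strict Implicit.
Unset Printing Implicit Defensive.

Import Order.TTheory GRing.Theory Num.Theory.
Import numFieldNormedType.Exports.

Local Open Scope classical_set_scope.
Local Open Scope ring_scope.
Local Open Scope complex_scope.

Notation Cn R n := 'rV[R[i]]_n.

(* The usual topology of C, hence the product topology on row vectors. *)
HB.instance Definition _ (R : realType) := NormedModule.copy R[i] R[i]^o.

(* Borel sigma-algebra of C, generated by the real and imaginary parts. *)
Section measurable_complex.
Variable R : realType.
Let re : R[i] -> R := fun w => complex.Re w.
Let im : R[i] -> R := fun w => complex.Im w.

Let c_set0 : g_sigma_preimageU re im set0.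
Proof. exact: sigma_algebra0. Qed.

Let c_setC A : g_sigma_preimageU re im A -> g_sigma_preimageU re im (~` A).
Proof. exact: sigma_algebraC. Qed.

Let c_bigcup (F : _^nat) : (forall i, g_sigma_preimageU re im (F i)) ->
  g_sigma_preimageU re im (\bigcup_i (F i)).
Proof. exact: sigma_algebra_bigcup. Qed.

HB.instance Definition _ := @isMeasurable.Build default_measure_display
  R[i] (g_sigma_preimageU re im) c_set0 c_setC c_bigcup.

Lemma measurable_Re : measurable_fun setT (fun w : R[i] => complex.Re w).
Proof.
by move=> _ Y mY; apply: sub_sigma_algebra; left; exists Y.
Qed.

Lemma measurable_Im : measurable_fun setT (fun w : R[i] => complex.Im w).
Proof.
by move=> _ Y mY; apply: sub_sigma_algebra; right; exists Y.
Qed.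

End measurable_complex.

(* Borel sigma-algebra of C^n, generated by the n coordinates. *)
Section measurable_Cn.
Variables (R : realType) (n : nat).
Let coord (j : 'I_n) : Cn R n -> R[i] := fun z => z 0 j.

Let cn_set0 : g_sigma_preimage coord set0.
Proof. exact: sigma_algebra0. Qed.

Let cn_setC A : g_sigma_preimage coord A -> g_sigma_preimage coord (~` A).
Proof. exact: sigma_algebraC. Qed.

Let cn_bigcup (F : _^nat) : (forall i, g_sigma_preimage coord (F i)) ->
  g_sigma_preimage coord (\bigcup_i (F i)).
Proof. exact: sigma_algebra_bigcup. Qed.

HB.instance Definition _ := @isMeasurable.Build default_measure_display
  (Cn R n) (g_sigma_preimage coord) cn_set0 cn_setC cn_bigcup.

Lemma measurable_coord (j : 'I_n) :
  measurable_fun setT (fun z : Cn R n => z 0 j).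
Proof.
move=> _ Y mY; apply: sub_sigma_algebra.
rewrite (bigD1 j)//=; left; by exists Y.
Qed.

End measurable_Cn.

Section measurable_maps.
Context d (T : measurableType d) (R : realType).

Lemma measurable_fun_complex (f : T -> R[i]) :
  measurable_fun setT (fun x => complex.Re (f x)) ->
  measurable_fun setT (fun x => complex.Im (f x)) ->
  measurable_fun setT f.
Proof.
move=> mre mim; apply: (@measurability _ _ T R[i] setT f _ erefl).
move=> _ [_ [[A mA <-]|[A mA <-]] <-]; rewrite !setTI.
- by have := mre measurableT A mA; rewrite setTI.
- by have := mim measurableT A mA; rewrite setTI.
Qed.

Lemma measurable_fun_Cn n (f : T -> Cn R n) :
  (forall j, measurable_fun setT (fun x => f x 0 j)) ->
  measurable_fun setT f.
Proof.
move=> mf; apply: (@measurability _ _ T (Cn R n) setT f _ erefl).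
move=> _ [B + <-]; rewrite setTI.
elim/big_ind : _ => // [X Y hX hY [/hX//|/hY//]|j _ [A mA <-]].
by have := mf j measurableT A mA; rewrite !setTI.
Qed.

End measurable_maps.

(* Lebesgue measure on C ~ R^2 and then, by induction on n, on C^n; *)
(* (z_0, .., z_n) in C^(n+1) is identified with (z_0, (z_1, .., z_n)). *)
Section lebesgue.
Variable R : realType.

Definition pairC (p : R * R) : R[i] := p.1 +i* p.2.

Definition consC n (p : R[i] * Cn R n) : Cn R n.+1 :=
  row_mx (\row_(_ < 1) p.1) p.2.

Lemma measurable_pairC : measurable_fun setT pairC.
Proof.
apply: measurable_fun_complex => /=.
  exact: measurable_fst.
exact: measurable_snd.
Qed.

Lemma measurable_consC n : measurable_fun setT (@consC n).
Proof.
apply: measurable_fun_Cn => j.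
case: (split_ordP (j : 'I_(1 + n))) => k ->.
  apply: (eq_measurable_fun fst); last exact: measurable_fst.
  by move=> p _; rewrite (row_mxEl (\row_(_ < 1) p.1) p.2) mxE.
apply: (eq_measurable_fun (fun p : R[i] * Cn R n => p.2 0 k)).
  by move=> p _; rewrite (row_mxEr (\row_(_ < 1) p.1) p.2).
exact: (measurableT_comp (@measurable_coord R n k) measurable_snd).
Qed.

(* The library proves that a product of sigma-finite measures is *)
(* sigma-finite, but does not export it. *)
Lemma sigma_finite_product d1 d2 (T1 : measurableType d1)
    (T2 : measurableType d2) (m1 : {sigma_finite_measure set T1 -> \bar R})
    (m2 : {sigma_finite_measure set T2 -> \bar R}) :
  sigma_finite setT (m1 \x m2)%E.
Proof.
have /sigma_finiteP[F [TF ndF Foo]] := sigma_finiteT m1.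
have /sigma_finiteP[G [TG ndG Goo]] := sigma_finiteT m2.
exists (fun n => F n `*` G n).
  rewrite -setXTT TF TG predeqE => -[x y]; split.
    move=> [/= [n _ Fnx] [k _ Gky]]; exists (maxn n k) => //; split.
    - by move: x Fnx; exact/subsetPset/ndF/leq_maxl.
    - by move: y Gky; exact/subsetPset/ndG/leq_maxr.
  by move=> [n _ []/= ? ?]; split; exists n.
move=> k; have [? ?] := Foo k; have [? ?] := Goo k.
split; first exact: measurableX.
by rewrite product_measure1E// lte_mul_pinfty// ge0_fin_numE.
Qed.

Lemma sigma_finite_pushforward d1 d2 (T1 : measurableType d1)
    (T2 : measurableType d2) (m : set T1 -> \bar R)
    (f : T1 -> T2) (g : T2 -> T1) :
  sigma_finite setT m -> measurable_fun setT g -> cancel f g ->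
  sigma_finite setT (pushforward m f).
Proof.
move=> [F TF Foo] mg fK.
exists (fun k => g @^-1` F k).
  by rewrite -preimage_bigcup -TF preimage_setT.
move=> k; have [mF Fk] := Foo k; split.
  by have := mg measurableT _ mF; rewrite setTI.
rewrite /pushforward -comp_preimage.
by rewrite (_ : g \o f = id) ?preimage_id//; apply/funext => x /=; rewrite fK.
Qed.

Definition lebesgue_C : set R[i] -> \bar R :=
  pushforward (@lebesgue_measure R \x @lebesgue_measure R)%E pairC.

HB.instance Definition _ := Measure.copy lebesgue_C
  (measure_function_pushforward__canonical__measure_function_Measure
    [the {measure set (measurableTypeR R * measurableTypeR R) -> \bar R} of
      (@lebesgue_measure R \x @lebesgue_measure R)%E] measurable_pairC).

Let lebesgue_C_sigma_finite : sigma_finite setT lebesgue_C.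
Proof.
apply: (@sigma_finite_pushforward _ _ _ _ _ _
  (fun w : R[i] => (complex.Re w, complex.Im w))).
- exact: (@sigma_finite_product _ _ _ _ (@lebesgue_measure R) (@lebesgue_measure R)).
- by apply: measurable_fun_pair; [exact: measurable_Re|exact: measurable_Im].
- by case.
Qed.

HB.instance Definition _ :=
  @Measure_isSigmaFinite.Build _ _ _ lebesgue_C lebesgue_C_sigma_finite.

Section succ.
Variables (n : nat) (m : {sigma_finite_measure set (Cn R n) -> \bar R}).

Definition lebesgue_succ : set (Cn R n.+1) -> \bar R :=
  pushforward (lebesgue_C \x m)%E (@consC n).

HB.instance Definition _ := Measure.copy lebesgue_succ
  (measure_function_pushforward__canonical__measure_function_Measure
    [the {measure set (R[i] * Cn R n) -> \bar R} of (lebesgue_C \x m)%E]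
    (@measurable_consC n)).

Let lebesgue_succ_sigma_finite : sigma_finite setT lebesgue_succ.
Proof.
apply: (@sigma_finite_pushforward _ _ _ _ _ _
  (fun z : Cn R n.+1 => (z 0 0, \row_j z 0 (lift 0 j) : Cn R n))).
- exact: (@sigma_finite_product _ _ _ _ lebesgue_C m).
- apply: measurable_fun_pair; first exact: measurable_coord.
  apply: measurable_fun_Cn => j.
  apply: (eq_measurable_fun (fun z : Cn R n.+1 => z 0 (lift 0 j))).
    by move=> z _; rewrite mxE.
  exact: measurable_coord.
- move=> [w v]; congr pair.
    rewrite (_ : 0 = lshift n 0 :> 'I_(1 + n)); last exact/val_inj.
    by rewrite (row_mxEl (\row_(_ < 1) w) v) mxE.
  apply/rowP => j; rewrite mxE.
  rewrite (_ : lift 0 j = rshift 1 j :> 'I_(1 + n)); last exact/val_inj.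
  by rewrite (row_mxEr (\row_(_ < 1) w) v).
Qed.

HB.instance Definition _ :=
  @Measure_isSigmaFinite.Build _ _ _ lebesgue_succ lebesgue_succ_sigma_finite.

End succ.

Fixpoint lebesgue_Cn n : {sigma_finite_measure set (Cn R n) -> \bar R} :=
  if n is n'.+1 then lebesgue_succ (lebesgue_Cn n')
  else \d_(0 : Cn R 0).

End lebesgue.

Section analysis.
Variables (R : realType) (n : nat).
Implicit Types (D : set (Cn R n)) (f g : Cn R n -> R[i]) (phi : Cn R n -> R).
Local Notation mu := (@lebesgue_Cn R n).

(* Euclidean norm of all entries; for z : Cn R n this is |z|. *)
Definition enorm p q (A : 'M[R[i]]_(p, q)) : R :=
  Num.sqrt (\sum_i \sum_j Normc.normc (A i j) ^+ 2).

(* The complement of the closed ball of radius r centered at 0. *)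
Definition exterior (r : R) : set (Cn R n) := [set z | r < enorm z].

(* Measurability is meant with respect to the Lebesgue sigma-algebra, i.e. up *)
(* to modification of a Borel function on a subset of a Borel null set. *)
Definition lebesgue_measurable_fun D f :=
  exists2 g, measurable_fun D g & {ae mu, forall z, D z -> f z = g z}.

Definition cintegral D f : R[i] :=
  (\int[mu]_(z in D) complex.Re (f z)) +i* (\int[mu]_(z in D) complex.Im (f z)).

Definition L2 D f := lebesgue_measurable_fun D f /\
  (\int[mu]_(z in D) (Normc.normc (f z) ^+ 2)%:E < +oo)%E.

(* The unit vectors of the real coordinates x_j and y_j, z_j = x_j + i y_j. *)
Definition xdir (j : 'I_n) : Cn R n := delta_mx 0 j.
Definition ydir (j : 'I_n) : Cn R n := (0 +i* 1) *: delta_mx 0 j.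

(* Derivative of phi at z along the real line through z directed by v. *)
Definition rline phi (v z : Cn R n) : R -> R := fun t => phi (z + t%:C *: v).
Definition rderive (v : Cn R n) phi : Cn R n -> R :=
  fun z => derive1 (rline phi v z) 0.

Fixpoint Ck (k : nat) phi : Prop :=
  continuous phi /\
  if k is k'.+1 then
    forall j v, v = xdir j \/ v = ydir j ->
      (forall z, derivable (rline phi v z) 0 1) /\ Ck k' (rderive v phi)
  else True.

(* Real-valued functions in C_c^oo(D); by linearity they suffice to test *)
(* identities between distributions. *)
Definition test_function D phi :=
  [/\ forall k, Ck k phi,
      compact (closure [set z | phi z != 0]) &
      closure [set z | phi z != 0] `<=` D].

(* For f, g locally integrable on the open set D. *)
Definition weak_derivative D (v : Cn R n) f g := forall phi,
  test_function D phi ->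
  cintegral D (fun z => f z * (rderive v phi z)%:C) =
  - cintegral D (fun z => g z * (phi z)%:C).

Definition W12 D f := L2 D f /\ forall j v, v = xdir j \/ v = ydir j ->
  exists2 g, L2 D g & weak_derivative D v f g.

(* d phi / d(bar z_j) = (d phi / d x_j + i d phi / d y_j) / 2. *)
Definition dbar (j : 'I_n) phi (z : Cn R n) : R[i] :=
  2^-1 * ((rderive (xdir j) phi z)%:C + (0 +i* 1) * (rderive (ydir j) phi z)%:C).

(* df / d(bar z_j) = g in D, in the sense of distributions. *)
Definition weak_dbar D (j : 'I_n) f g := forall phi,
  test_function D phi ->
  cintegral D (fun z => f z * dbar j phi z) =
  - cintegral D (fun z => g z * (phi z)%:C).

Section system.
Variable N : nat.
Implicit Types (u : Cn R n -> 'cV[R[i]]_N) (V : 'I_n -> Cn R n -> 'M[R[i]]_N).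

Definition vector_W12 D u := forall k, W12 D (fun z => u z k 0).

(* V = \sum_j V_j d(bar z_j) *)
Definition measurable_form D V :=
  forall j k l, lebesgue_measurable_fun D (fun z => V j z k l).

Definition form_norm V (z : Cn R n) : R :=
  Num.sqrt (\sum_j enorm (V j z) ^+ 2).

Definition dbar_equation D u V := forall j k,
  weak_dbar D j (fun z => u z k 0) (fun z => (V j z *m u z) k 0).

Definition vanishes_to_infinite_order_at_infinity u := forall m : R, 0 < m ->
  ((r `^ m)%:E * \int[mu]_(z in exterior r) (enorm (u z) ^+ 2)%:E)%E
    @[r --> +oo] --> 0%E.

End system.

End analysis.

(* Main.v *)
(* Contracting the equation with the Euler field gives
   sum_j conj z_j du/d(conj z_j) = f with |f| <= C |u|.  Restricted to almost
   every orbit a + i b |-> e^(a + i b) z this is a Cauchy-Riemann equation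
   (d_a + i d_b) U = 2 F, |F| <= C |U|, on the half cylinder a >= 0, where U
   decays faster than every exponential in a.  This is established at the level
   of the Fourier modes in b, by testing the weak equation against averages of
   test functions over the orbits; it only uses that u is in L^2.

   On the cylinder a Carleman inequality with weight e^(2 s a), s a half-integer,
   holds with constant 4 because the modes are uniformly away from s.  It applies
   to the convolutions of U in b with normalised (1 + cos b)^K, which are Laurent
   polynomials in e^(a + i b) with absolutely continuous coefficients.  If
   C < 1/4, letting s tend to infinity gives U = 0.  If N = 1, one first gauges away F / U by a
   function g solving (d_a + i d_b) g = 2 F / U and growing linearly in a, with a
   polynomial substitute (1 - g / M)^M for exp (- g); the linear growth costs
   only a bounded shift of s. *)

Require Import Defs.
From HB Require Import structures.
From mathcomp Require Import all_boot all_order all_algebra.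
From mathcomp Require Import complex.
From mathcomp Require Import all_classical all_reals all_analysis.
From mathcomp Require Import measurable_realfun.
From mathcomp Require Import ring lra.
Set Implicit Arguments.
Unset Strict Implicit.
Unset Printing Implicit Defensive.
Import Order.TTheory GRing.Theory Num.Theory.
Import numFieldNormedType.Exports.
Local Open Scope classical_set_scope.
Local Open Scope ring_scope.
Local Open Scope complex_scope.

(** * Fubini and absolute continuity *)

(** The threshold 1/4 is arithmetic: a half-integer is at distance at least 1/2 from every integer
    mode, which gives the constant 4, and squaring the source [2 * F] gives another 4, so absorption
    needs 16 C^2 < 1. The obstacle is regularity. As u is only square integrable, its restriction to
    an orbit makes sense almost everywhere, so the equation enters as an integral identity for each
    mode, with initial value at a = 0. After convolution in b finitely many modes remain, and
    Parseval reduces the Carleman inequality to one coefficient at a time. Convolution is an L2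
    contraction acting mode by mode, so the vector case passes to the limit directly. In the scalar
    case it does not commute with the potential; the resulting commutator tends to 0 in L2. The
    gauge grows linearly because only the zero mode of a bounded source accumulates: every other
    mode is integrated from the end of [0, A] where its exponential decays, and the square-summed
    kernel has an integrable singularity. Test functions are taken from a syntactic family stable
    under derivatives and complex dilations; it suffices because its products approximate indicators
    of polyhedra. *)

Section fubini_on.
Context d1 d2 (T1 : measurableType d1) (T2 : measurableType d2) (R : realType).
Variables (m1 : {sigma_finite_measure set T1 -> \bar R})
          (m2 : {sigma_finite_measure set T2 -> \bar R}).
Implicit Types (A : set T1) (B : set T2).

Lemma measurable_fun_restrict_prod A B (f : T1 * T2 -> \bar R) :
  measurable A -> measurable B -> measurable_fun setT f ->
  measurable_fun setT (f \_ (A `*` B)).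
Proof.
move=> mA mB mf; have mAB : measurable (A `*` B) by exact: measurableX.
by apply: (measurable_restrictT f mAB).1; exact: measurable_funTS.
Qed.

Lemma measurable_sec d3 (T3 : measurableType d3) (f : T1 * T2 -> T3) x :
  measurable_fun setT f -> measurable_fun setT (fun y => f (x, y)).
Proof. by move=> mf; exact: (measurableT_comp mf (pair1_measurable x)). Qed.

Lemma integral_section A B (f : T1 * T2 -> \bar R) x :
  (\int[m2]_y (f \_ (A `*` B)) (x, y))%E =
  ((fun x => \int[m2]_(y in B) f (x, y)) \_ A)%E x.
Proof.
rewrite /patch; case: ifPn => xA.
  rewrite [RHS]integral_mkcond; apply: eq_integral => y _.
  rewrite /patch in_setX/= xA/=.
  by case: ifPn.
rewrite (eq_integral (cst 0%E)) ?integral0// => y _.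
by rewrite /= in_setX/= (negbTE xA).
Qed.

Lemma integral_section' A B (f : T1 * T2 -> \bar R) y :
  (\int[m1]_x (f \_ (A `*` B)) (x, y))%E =
  ((fun y => \int[m1]_(x in A) f (x, y)) \_ B)%E y.
Proof.
rewrite /patch; case: ifPn => yB.
  rewrite [RHS]integral_mkcond; apply: eq_integral => x _.
  rewrite /patch in_setX/= yB andbT.
  by case: ifPn.
rewrite (eq_integral (cst 0%E)) ?integral0// => x _.
by rewrite /= in_setX/= (negbTE yB) andbF.
Qed.

Lemma tonelli_on A B (f : T1 * T2 -> \bar R) : measurable A -> measurable B ->
  measurable_fun setT f -> (forall z, 0 <= f z)%E ->
  (\int[m1]_(x in A) \int[m2]_(y in B) f (x, y) =
   \int[m2]_(y in B) \int[m1]_(x in A) f (x, y))%E.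
Proof.
move=> mA mB mf f0.
have mg := measurable_fun_restrict_prod mA mB mf.
have g0 z : (0 <= (f \_ (A `*` B)) z)%E by apply: erestrict_ge0.
have := @fubini_tonelli _ _ _ _ _ m1 m2 _ mg g0.
rewrite (eq_integral ((fun x => \int[m2]_(y in B) f (x, y)) \_ A)%E); last first.
  by move=> x _; rewrite integral_section.
rewrite -integral_mkcond => ->.
rewrite (eq_integral ((fun y => \int[m1]_(x in A) f (x, y)) \_ B)%E); last first.
  by move=> y _; rewrite integral_section'.
by rewrite -integral_mkcond.
Qed.

Lemma measurable_int_section B (f : T1 * T2 -> \bar R) : measurable B ->
  measurable_fun setT f -> (forall z, 0 <= f z)%E ->
  measurable_fun setT (fun x => \int[m2]_(y in B) f (x, y))%E.
Proof.
move=> mB mf f0.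
have mg := measurable_fun_restrict_prod measurableT mB mf.
have g0 z : (0 <= (f \_ (setT `*` B)) z)%E by apply: erestrict_ge0.
have := @measurable_fun_fubini_tonelli_F _ _ _ _ _ m2 _ mg g0.
apply: eq_measurable_fun => x _.
by rewrite /fubini_F integral_section patch_setT.
Qed.

Lemma measurable_Rint_section B (f : T1 * T2 -> R) : measurable B ->
  measurable_fun setT f ->
  measurable_fun setT (fun x => \int[m2]_(y in B) f (x, y)).
Proof.
move=> mB mf; apply: (measurableT_comp (fine_measurable measurableT)).
have -> : (fun x => \int[m2]_(y in B) (f (x, y))%:E)%E =
   (fun x => \int[m2]_(y in B) (EFin \o f)^\+ (x, y) -
             \int[m2]_(y in B) (EFin \o f)^\- (x, y))%E.
  by apply/funext => x; rewrite integralE; congr (_ - _)%E;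
    apply: eq_integral => y _; rewrite ?funeposE ?funenegE.
have mEf : measurable_fun setT (EFin \o f) by apply/measurable_EFinP.
apply: emeasurable_funB; apply: measurable_int_section => //.
- exact: measurable_funepos.
- exact: measurable_funeneg.
Qed.

End fubini_on.

Section fubini_on_real.
Context d1 d2 (T1 : measurableType d1) (T2 : measurableType d2) (R : realType).
Variables (m1 : {sigma_finite_measure set T1 -> \bar R})
          (m2 : {sigma_finite_measure set T2 -> \bar R}).
Implicit Types (A : set T1) (B : set T2).

(** Zero extension outside the rectangle reduces this to Fubini on the whole product. The inner
    [Rintegral] is [fine] of an extended integral, so it agrees with the latter only where the
    section is integrable; this is why the equalities pass through almost everywhere statements. *)
Lemma fubini_on A B (f : T1 * T2 -> R) : measurable A -> measurable B ->
  measurable_fun setT f ->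
  (\int[m1]_(x in A) \int[m2]_(y in B) `|f (x, y)|%:E < +oo)%E ->
  [/\ \int[m1]_(x in A) \int[m2]_(y in B) f (x, y) =
      \int[m2]_(y in B) \int[m1]_(x in A) f (x, y),
      m1.-integrable A (EFin \o (fun x => \int[m2]_(y in B) f (x, y))) &
      {ae m1, forall x, A x -> m2.-integrable B (fun y => (f (x, y))%:E)}].
Proof.
move=> mA mB mf foo.
have mEf : measurable_fun setT (EFin \o f) by apply/measurable_EFinP.
have mg := measurable_fun_restrict_prod mA mB mEf.
have ig : (m1 \x m2)%E.-integrable setT ((EFin \o f) \_ (A `*` B)).
  apply/integrable12ltyP => //; apply: le_lt_trans foo.
  rewrite [leRHS]integral_mkcond/=; rewrite le_eqVlt; apply/orP; left; apply/eqP; apply: eq_integral => x _.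
  rewrite -(integral_section m2 A B (fun z => `|f z|%:E)%E).
  apply: eq_integral => y _; rewrite /patch /=; case: ifPn => //= _.
  by rewrite normr0.
have ae1 := ae_integrable1 ig.
have sec x : A x -> m2.-integrable setT (fun y => ((EFin \o f) \_ (A `*` B)) (x, y)) ->
    m2.-integrable B (fun y => (f (x, y))%:E).
  move=> Ax; rewrite (_ : (fun y => _) = (fun y => (f (x, y))%:E) \_ B); last first.
    by apply/funext => y; rewrite /patch in_setX/= mem_set.
  by move=> /(integrable_mkcond _ mB).
have sec' y : B y -> m1.-integrable setT (fun x => ((EFin \o f) \_ (A `*` B)) (x, y)) ->
    m1.-integrable A (fun x => (f (x, y))%:E).
  move=> By; rewrite (_ : (fun x => _) = (fun x => (f (x, y))%:E) \_ A); last first.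
    by apply/funext => x; rewrite /patch in_setX/= (mem_set By) andbT.
  by move=> /(integrable_mkcond _ mA).
have aeA : {ae m1, forall x, A x -> m2.-integrable B (fun y => (f (x, y))%:E)}.
  by apply: filterS ae1 => x ix Ax; exact: sec.
have aeB : {ae m2, forall y, B y -> m1.-integrable A (fun x => (f (x, y))%:E)}.
  by apply: filterS (ae_integrable2 ig) => y iy By; exact: sec'.
have iF : m1.-integrable A (fun x => \int[m2]_(y in B) (f (x, y))%:E)%E.
  have := integrable_fubini_F ig.
  rewrite (_ : fubini_F _ _ = (fun x => \int[m2]_(y in B) (f (x, y))%:E)%E \_ A).
    by move=> /(integrable_mkcond _ mA).
  by apply/funext => x; rewrite /fubini_F integral_section.
have E1 : (\int[m1]_(x in A) (\int[m2]_(y in B) f (x, y))%:E =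
           \int[m1]_(x in A) \int[m2]_(y in B) (f (x, y))%:E)%E.
  apply: ae_eq_integral => //.
  - apply: measurable_funTS; apply/measurable_EFinP.
    exact: measurable_Rint_section.
  - exact: measurable_int iF.
  - apply: filterS aeA => x ix Ax; rewrite fineK//.
    by apply: integrable_fin_num => //; exact: ix.
split => //.
- rewrite {1}/Rintegral E1.
  have -> : (\int[m1]_(x in A) \int[m2]_(y in B) (f (x, y))%:E =
             \int[m2]_(y in B) \int[m1]_(x in A) (f (x, y))%:E)%E.
    have := Fubini ig.
    rewrite (eq_integral ((fun x => \int[m2]_(y in B) (EFin \o f) (x, y)) \_ A)%E); last first.
      by move=> x _; rewrite integral_section.
    rewrite -integral_mkcond => ->.
    rewrite (eq_integral ((fun y => \int[m1]_(x in A) (EFin \o f) (x, y)) \_ B)%E); last first.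
      by move=> y _; rewrite integral_section'.
    by rewrite -integral_mkcond.
  rewrite [RHS]/Rintegral; congr fine; apply: ae_eq_integral => //.
  - have := measurable_fubini_G ig.
    rewrite (_ : fubini_G _ _ = (fun y => \int[m1]_(x in A) (f (x, y))%:E)%E \_ B).
      by move=> /(measurable_restrictT _ mB).
    by apply/funext => y; rewrite /fubini_G integral_section'.
  - apply: measurable_funTS; apply/measurable_EFinP.
    apply: (measurable_Rint_section m1 (f := fun z => f (z.2, z.1))) => //.
    apply: measurableT_comp => //; exact: measurable_fun_pair.
  - apply: filterS aeB => y iy By; rewrite fineK//.
    by apply: integrable_fin_num => //; exact: iy.
- apply: le_integrable iF => //.
    by apply: measurable_funTS; apply/measurable_EFinP; exact: measurable_Rint_section.
  move=> x _ /=; rewrite /Rintegral; case: (integral _ _ _) => //=; by rewrite normr0 leey.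
Qed.

End fubini_on_real.

(** * Complex numbers through real and imaginary parts *)

Section complex_basics.
Variable R : realType.
Implicit Types (w v : R[i]) (x y : R).

Lemma ReM w v : complex.Re (w * v) =
  complex.Re w * complex.Re v - complex.Im w * complex.Im v.
Proof. by case: w v => [a b] [c d]. Qed.

Lemma ImM w v : complex.Im (w * v) =
  complex.Re w * complex.Im v + complex.Im w * complex.Re v.
Proof. by case: w v => [a b] [c d]. Qed.

Lemma ReD w v : complex.Re (w + v) = complex.Re w + complex.Re v.
Proof. by case: w v => [a b] [c d]. Qed.

Lemma ImD w v : complex.Im (w + v) = complex.Im w + complex.Im v.
Proof. by case: w v => [a b] [c d]. Qed.

Lemma ReN w : complex.Re (- w) = - complex.Re w.
Proof. by case: w. Qed.

Lemma ImN w : complex.Im (- w) = - complex.Im w.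
Proof. by case: w. Qed.

Definition ReImE := (ReM, ImM, ReD, ImD, ReN, ImN).

Lemma complex_ext w v : complex.Re w = complex.Re v -> complex.Im w = complex.Im v ->
  w = v.
Proof. by case: w v => [a b] [c d] /= -> ->. Qed.

Lemma Re_sum I (r : seq I) (P : pred I) (F : I -> R[i]) :
  complex.Re (\sum_(i <- r | P i) F i) = \sum_(i <- r | P i) complex.Re (F i).
Proof. by elim/big_rec2 : _ => //= i x y _ <-; rewrite ReD. Qed.

Lemma Im_sum I (r : seq I) (P : pred I) (F : I -> R[i]) :
  complex.Im (\sum_(i <- r | P i) F i) = \sum_(i <- r | P i) complex.Im (F i).
Proof. by elim/big_rec2 : _ => //= i x y _ <-; rewrite ImD. Qed.

(** The squared modulus, kept real and polynomial in the two parts so that [ring], [lra] and [nra]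
    apply to it. *)
Definition csq w : R := complex.Re w ^+ 2 + complex.Im w ^+ 2.

Lemma csq_ge0 w : 0 <= csq w.
Proof. by rewrite addr_ge0 ?sqr_ge0. Qed.

Lemma csq0 : csq 0 = 0.
Proof. by rewrite /csq/= expr0n addr0. Qed.

Lemma csqM w v : csq (w * v) = csq w * csq v.
Proof. by rewrite /csq !ReImE; ring. Qed.

Lemma csqX w n : csq (w ^+ n) = csq w ^+ n.
Proof.
elim: n => [|n ih]; first by rewrite !expr0 /csq/= expr1n expr0n addr0.
by rewrite !exprS csqM ih.
Qed.

Lemma csq_real x : csq x%:C = x ^+ 2.
Proof. by rewrite /csq/= expr0n addr0. Qed.

Lemma csqE w : csq w = Normc.normc w ^+ 2.
Proof. by case: w => a b; rewrite /csq/= sqr_sqrtr// addr_ge0 ?sqr_ge0. Qed.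

Lemma csq_eq0 w : (csq w == 0) = (w == 0).
Proof.
case: w => a b; rewrite /csq/= paddr_eq0 ?sqr_ge0// !sqrf_eq0.
by rewrite eq_complex/=.
Qed.

Lemma sqr_Re_le w : complex.Re w ^+ 2 <= csq w.
Proof. by rewrite lerDl sqr_ge0. Qed.

Lemma sqr_Im_le w : complex.Im w ^+ 2 <= csq w.
Proof. by rewrite lerDr sqr_ge0. Qed.

Definition cis x : R[i] := cos x +i* sin x.

Lemma cisD x y : cis (x + y) = cis x * cis y.
Proof. by apply: complex_ext; rewrite ?ReM ?ImM /= ?cosD ?sinD; ring. Qed.

Lemma cis0 : cis 0 = 1.
Proof. by rewrite /cis cos0 sin0. Qed.

Lemma cisX x n : cis x ^+ n = cis (n%:R * x).
Proof.
elim: n => [|n ih]; first by rewrite mul0r cis0 expr0.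
by rewrite exprS ih -cisD -[in RHS]natr1; congr cis; ring.
Qed.

Lemma csq_cis x : csq (cis x) = 1.
Proof. by rewrite /csq/= cos2Dsin2. Qed.

(** This is e^(x + i y), the coordinate of the cylinder: multiplication by it is the flow of the
    orbits, and evaluating a polynomial at it produces Fourier series in y. *)
Definition zeta x y : R[i] := (expR x)%:C * cis y.

Lemma zetaX x y n : zeta x y ^+ n = zeta (n%:R * x) (n%:R * y).
Proof.
rewrite /zeta exprMn cisX; congr (_ * _).
by rewrite -rmorphXn/= expRM_natl.
Qed.

Lemma csq_zeta x y : csq (zeta x y) = expR (2 * x).
Proof. by rewrite /zeta csqM csq_real csq_cis mulr1 -expRM_natl. Qed.

End complex_basics.

Section real_integrable.
Context d (T : measurableType d) (R : realType) (m : {measure set T -> \bar R}).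
Variables (D : set T) (mD : measurable D).
Implicit Types f g : T -> R.

Lemma integrable_measurable f : m.-integrable D (EFin \o f) ->
  measurable_fun D f.
Proof. by case/integrableP => /measurable_EFinP. Qed.

Lemma integrableDR f g : m.-integrable D (EFin \o f) ->
  m.-integrable D (EFin \o g) ->
  m.-integrable D (EFin \o (fun x => f x + g x)).
Proof. by move=> mf mg; have := integrableD mD mf mg. Qed.

Lemma integrableBR f g : m.-integrable D (EFin \o f) ->
  m.-integrable D (EFin \o g) ->
  m.-integrable D (EFin \o (fun x => f x - g x)).
Proof. by move=> mf mg; have := integrableB mD mf mg. Qed.

Lemma integrableZR (c : R) f : m.-integrable D (EFin \o f) ->
  m.-integrable D (EFin \o (fun x => c * f x)).
Proof. by move=> mf; have := integrableZl mD c mf. Qed.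

Lemma integrable_sumR I (r : seq I) (P : pred I) (f : I -> T -> R) :
  (forall i, P i -> m.-integrable D (EFin \o f i)) ->
  m.-integrable D (EFin \o (fun x => \sum_(i <- r | P i) f i x)).
Proof.
move=> mf; have := @integrable_sum _ _ _ m _ mD _ r P (fun i => EFin \o f i) mf.
by under eq_fun do rewrite sumEFin.
Qed.

Lemma Rintegral_sumR I (r : seq I) (f : I -> T -> R) :
  (forall i, m.-integrable D (EFin \o f i)) ->
  \int[m]_(x in D) (\sum_(i <- r) f i x) =
  \sum_(i <- r) \int[m]_(x in D) f i x.
Proof.
move=> mf; elim: r => [|i r ih].
  under eq_Rintegral do rewrite big_nil.
  by rewrite big_nil Rintegral_cst// mul0r.
under eq_Rintegral do rewrite big_cons.
rewrite RintegralD// ?big_cons ?ih//.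
exact: integrable_sumR.
Qed.

Lemma le_integrableR f g : measurable_fun D f ->
  (forall x, D x -> `|f x| <= g x) -> m.-integrable D (EFin \o g) ->
  m.-integrable D (EFin \o f).
Proof.
move=> mf fg; apply: le_integrable => //; first exact/measurable_EFinP.
by move=> x Dx; rewrite lee_fin (le_trans (fg x Dx))// ler_norm.
Qed.

Lemma eq_integrableR f g : (forall x, D x -> f x = g x) ->
  m.-integrable D (EFin \o f) -> m.-integrable D (EFin \o g).
Proof.
move=> fg; apply: eq_integrable => // x /set_mem Dx /=.
by rewrite fg.
Qed.

Lemma integrable_bndM f g (M : R) : measurable_fun D f ->
  (forall x, D x -> `|f x| <= M) -> m.-integrable D (EFin \o g) ->
  m.-integrable D (EFin \o (fun x => f x * g x)).
Proof.
move=> mf fM ig; apply: (@le_integrableR _ (fun x => M * `|g x|)).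
- by apply: measurable_funM => //; exact: integrable_measurable.
- by move=> x Dx; rewrite normrM ler_wpM2r// fM.
- by apply: integrableZR; exact: integrable_norm.
Qed.

Lemma bounded_integrable f (M : R) : (m D < +oo)%E -> measurable_fun D f ->
  (forall x, D x -> `|f x| <= M) -> m.-integrable D (EFin \o f).
Proof.
move=> Doo mf fM; apply: (@le_integrableR _ (cst M)) => //.
apply/integrableP; split; first by apply/measurable_EFinP.
rewrite (eq_integral (cst `|M|%:E)) ?integral_cst//.
by rewrite lte_mul_pinfty// ?lee_fin// fin_numElt ltNyr ltry.
Qed.

End real_integrable.

Lemma fubini_prod_bound d1 d2 (T1 : measurableType d1) (T2 : measurableType d2)
    (R : realType) (m1 : {sigma_finite_measure set T1 -> \bar R})
    (m2 : {sigma_finite_measure set T2 -> \bar R}) (A : set T1) (B : set T2)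
    (f : T1 * T2 -> R) (g : T1 -> R) (h : T2 -> R) :
  measurable A -> measurable B -> measurable_fun setT f ->
  m1.-integrable A (EFin \o g) -> m2.-integrable B (EFin \o h) ->
  (forall x y, A x -> B y -> `|f (x, y)| <= `|g x| * `|h y|) ->
  (\int[m1]_(x in A) \int[m2]_(y in B) `|f (x, y)|%:E < +oo)%E.
Proof.
move=> mA mB mf ig ih fgh.
have mg := integrable_measurable ig; have mh := integrable_measurable ih.
have mnf : measurable_fun setT (fun z => `|f z|%:E).
  by apply/measurable_EFinP; apply: measurableT_comp.
apply: (@le_lt_trans _ _ (\int[m1]_(x in A) (`|g x|%:E * \int[m2]_(y in B) `|h y|%:E))%E).
  apply: ge0_le_integral => //.
  - by move=> x _; apply: integral_ge0.
  - by apply: measurable_funTS; exact: (measurable_int_section m2 (f := fun z => `|f z|%:E)).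
  - by apply: emeasurable_funM => //; apply/measurable_EFinP; apply: measurableT_comp.
  - move=> x Ax; rewrite -ge0_integralZl//; last first.
      by apply/measurable_EFinP; apply: measurableT_comp.
    apply: ge0_le_integral => //.
    + by apply: measurable_funTS; exact: (measurable_sec x mnf).
    + by apply: emeasurable_funM => //; apply/measurable_EFinP; apply: measurableT_comp.
    + by move=> y By; rewrite -EFinM lee_fin fgh.
rewrite ge0_integralZr//; last 2 first.
  by apply/measurable_EFinP; apply: measurableT_comp.
  by apply: integral_ge0.
case/integrableP : ig => _ /= ig; case/integrableP : ih => _ /= ih.
by apply: lte_mul_pinfty => //; [exact: integral_ge0|rewrite ge0_fin_numE//; exact: integral_ge0].
Qed.

Section abs_continuity.
Variable R : realType.
Notation mu := (@lebesgue_measure R).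
Implicit Types (A a M : R) (f g phi psi : R -> R).

(** Absolute continuity on [0, A] in integrated form. No pointwise derivative is ever taken, so
    [phi] may be any integrable representative. *)
Definition acR A f phi := mu.-integrable `[0, A] (EFin \o phi) /\
  forall a, a \in `[0, A] -> f a = f 0 + \int[mu]_(t in `[0, a]) phi t.

Lemma integrable_sub0 A a phi : a \in `[0, A] ->
  mu.-integrable `[0, A] (EFin \o phi) -> mu.-integrable `[0, a] (EFin \o phi).
Proof.
rewrite in_itv/= => /andP[a0 aA]; apply: integrableS => //.
by apply: subset_itvl; rewrite bnd_simp.
Qed.

Lemma acR_bounded A f phi : acR A f phi ->
  exists M : R, forall a, a \in `[0, A] -> `|f a| <= M.
Proof.
move=> [iphi fE]; exists (`|f 0| + \int[mu]_(t in `[0, A]) `|phi t|) => a aA.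
rewrite fE// (le_trans (ler_normD _ _))// lerD2l.
apply: (le_trans (le_normr_Rintegral _ _)) => //.
  exact: integrable_sub0 iphi.
have ia : mu.-integrable `[0, A] (EFin \o (fun t => `|phi t|)).
  by apply: integrable_norm.
rewrite /Rintegral fine_le//.
- by apply: integrable_fin_num => //; exact: integrable_sub0 ia.
- by apply: integrable_fin_num.
- apply: ge0_subset_integral => //=.
  + by case/integrableP : ia.
  + move: aA; rewrite in_itv/= => /andP[_ aA].
    by apply: subset_itvl; rewrite bnd_simp.
Qed.

Lemma acR_measurable A f phi : 0 <= A -> acR A f phi ->
  measurable_fun `[0, A] f.
Proof.
move=> A0 [iphi fE].
apply: (eq_measurable_fun (fun a => f 0 + \int[mu]_(t in `[0, a]) phi t)).
  by move=> a aA; rewrite -fE//; exact/set_mem.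
apply: measurable_funD => //.
apply: subspace_continuous_measurable_fun => //.
exact: parameterized_integral_continuous.
Qed.

Lemma indic_graph_le (x y : R) :
  \1_[set z : R * R | z.2 <= z.1] (x, y) = (if y <= x then 1 else 0) :> R.
Proof.
by rewrite indicE; case: ifP => h; [rewrite mem_set|rewrite memNset//= h].
Qed.

Lemma restrict_leE (h : R -> R) (P : pred R) (y : R) :
  (h \_ [set y | P y]) y = if P y then h y else 0.
Proof.
by rewrite patchE; case: ifPn => [/set_mem /= ->//|/negP yP]; case: ifP => // Py; case: yP; exact/mem_set.
Qed.

(** Integration by parts through Fubini: the integral of [phi x * psi y] over the triangle y <= x in
    [0, a]^2 is computed in both orders, giving [phi x * (g x - g 0)] in one and
    [psi y * (f a - f y)] in the other. *)
Lemma acR_mul A f g phi psi : 0 <= A -> acR A f phi -> acR A g psi ->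
  acR A (fun a => f a * g a) (fun a => phi a * g a + f a * psi a).
Proof.
move=> A0 acf acg.
have mf := acR_measurable A0 acf; have mg := acR_measurable A0 acg.
have [M fM] := acR_bounded acf; have [M' gM] := acR_bounded acg.
case: (acf) => iphi fE; case: (acg) => ipsi gE.
have i1 : mu.-integrable `[0, A] (EFin \o (fun a => phi a * g a)).
  rewrite (_ : (fun a => phi a * g a) = (fun a => g a * phi a)).
    by apply: (@integrable_bndM _ _ _ mu _ _ _ _ M').
  by apply/funext => a; rewrite mulrC.
have i2 : mu.-integrable `[0, A] (EFin \o (fun a => f a * psi a)).
  by apply: (@integrable_bndM _ _ _ mu _ _ _ _ M).
split.
  by apply: (@integrableDR _ _ _ mu).
move=> a aA.
rewrite RintegralD//; [|exact: integrable_sub0 i1|exact: integrable_sub0 i2].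
have /andP[a0 aA'] : 0 <= a <= A by move: aA; rewrite in_itv.
(* The derivatives are measurable on [0, A] only, while Fubini asks for a function measurable on the
   whole plane; hence the zero extensions. *)
pose ph : R -> R := phi \_ `[0, A]; pose ps : R -> R := psi \_ `[0, A].
have mph : measurable_fun setT ph.
  apply/(measurable_restrictT _ _).1 => //.
  by apply/measurable_EFinP; case/integrableP : iphi.
have mps : measurable_fun setT ps.
  apply/(measurable_restrictT _ _).1 => //.
  by apply/measurable_EFinP; case/integrableP : ipsi.
have phE (t : R) : t \in `[0, A] -> ph t = phi t by move=> h; rewrite /ph patchE mem_set.
have psE (t : R) : t \in `[0, A] -> ps t = psi t by move=> h; rewrite /ps patchE mem_set.
clearbody ph ps.
have bnd (t : R) : t \in `[0, a] -> 0 <= t /\ t <= a.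
  by rewrite in_itv/= => /andP[].
have sub (t : R) : t \in `[0, a] -> t \in `[0, A].
  by rewrite !in_itv/= => /andP[-> ta]/=; exact: le_trans aA'.
pose L : set (R * R) := [set z | z.2 <= z.1].
have mL : measurable L.
  rewrite (_ : L = (fun z : R * R => z.1 - z.2) @^-1` `[0, +oo[).
    by rewrite -[X in measurable X]setTI; apply: measurable_funB.
  by apply/seteqP; split => z /=; rewrite in_itv/= andbT subr_ge0.
have mF : measurable_fun setT (fun z : R * R => ph z.1 * (ps z.2 * \1_L z)).
  apply: measurable_funM; first exact: measurableT_comp.
  apply: measurable_funM; first exact: measurableT_comp.
  exact: measurable_indic.
have iph : mu.-integrable `[0, a] (EFin \o ph).
  apply: (@eq_integrableR _ _ _ mu _ _ phi) => //; last exact: integrable_sub0 iphi.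
  by move=> t /sub tA; rewrite phE.
have ips : mu.-integrable `[0, a] (EFin \o ps).
  apply: (@eq_integrableR _ _ _ mu _ _ psi) => //; last exact: integrable_sub0 ipsi.
  by move=> t /sub tA; rewrite psE.
have LE x y : \1_L (x, y) = (if y <= x then 1 else 0) :> R.
  exact: indic_graph_le.
have in1 (x : R) : x \in `[0, a] ->
    \int[mu]_(y in `[0, a]) (ph x * (ps y * \1_L (x, y))) = phi x * (g x - g 0).
  move=> xa; have [x0 xa'] := bnd _ xa.
  have -> : \int[mu]_(y in `[0, a]) (ph x * (ps y * \1_L (x, y))) =
            \int[mu]_(y in `[0, x]) (phi x * psi y).
    have xe : `[0, x]%classic = `[0, a]%classic `&` [set y | y <= x].
      apply/seteqP; split => y /=; rewrite !in_itv/=.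
        by move=> /andP[y0 yx]; split => //; rewrite y0/= (le_trans yx).
      by move=> [/andP[-> _] ->].
    have inr (y : R) : y \in `[0, a] -> ph x * (ps y * \1_L (x, y)) =
        ((fun y => phi x * psi y) \_ [set y | y <= x]) y.
      move=> ya; rewrite LE (restrict_leE _ (fun y => y <= x)).
      case: (boolP (y <= x)) => yx; last by rewrite !mulr0.
      by rewrite mulr1 (phE _ (sub _ xa)) (psE _ (sub _ ya)).
    by rewrite xe Rintegral_mkcondr; apply: eq_Rintegral => y /set_mem; exact: inr.
  rewrite (RintegralZl _ _ (integrable_sub0 (sub _ xa) ipsi))//.
  by congr (_ * _); rewrite (gE _ (sub _ xa)) addrC addKr.
have in2 (y : R) : y \in `[0, a] ->
    \int[mu]_(x in `[0, a]) (ph x * (ps y * \1_L (x, y))) = psi y * (f a - f y).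
  move=> ya; have [y0 ya'] := bnd _ ya.
  have -> : \int[mu]_(x in `[0, a]) (ph x * (ps y * \1_L (x, y))) =
            \int[mu]_(x in `[y, a]) (psi y * phi x).
    have ye : `[y, a]%classic = `[0, a]%classic `&` [set x | y <= x].
      apply/seteqP; split => t /=; rewrite !in_itv/=.
        by move=> /andP[yt ->]; split => //; rewrite andbT (le_trans _ yt).
      by move=> [/andP[_ ->] ->].
    have inr (t : R) : t \in `[0, a] -> ph t * (ps y * \1_L (t, y)) =
        ((fun t => psi y * phi t) \_ [set t | y <= t]) t.
      move=> ta; rewrite LE (restrict_leE _ (fun t => y <= t)).
      case: (boolP (y <= t)) => yt; last by rewrite !mulr0.
      by rewrite mulr1 (phE _ (sub _ ta)) (psE _ (sub _ ya)) mulrC.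
    by rewrite ye Rintegral_mkcondr; apply: eq_Rintegral => t /set_mem; exact: inr.
  have iphia : mu.-integrable `[0, a] (EFin \o phi) by exact: integrable_sub0 iphi.
  have iya : mu.-integrable `[y, a] (EFin \o phi).
    by apply: integrableS iphia => //; apply: subset_itv; rewrite bnd_simp.
  have iya' : mu.-integrable `]y, a] (EFin \o phi).
    by apply: integrableS iphia => //; apply: subset_itv; rewrite bnd_simp.
  rewrite (RintegralZl _ _ iya)//; congr (_ * _).
  have -> : f a - f y = \int[mu]_(t in `[0, a]) phi t - \int[mu]_(t in `[0, y]) phi t.
    by rewrite (fE a aA) (fE y (sub _ ya)) opprD addrACA subrr add0r.
  rewrite -(Rintegral_itv_obnd_cbnd iya').
  by rewrite -(Rintegral_itvB iphia)// bnd_simp.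
have := @fubini_on _ _ _ _ _ mu mu `[0, a]%classic `[0, a]%classic _ _ _ mF.
case => //.
  apply: (@fubini_prod_bound _ _ _ _ _ mu mu _ _ _ ph ps _ _ mF iph ips) => // x y _ _.
  rewrite !normrM ler_wpM2l// ler_piMr//.
  by rewrite indicE; case: (_ \in _); rewrite ?normr1 ?normr0.
move=> E _ _.
have E1 : \int[mu]_(x in `[0, a]) \int[mu]_(y in `[0, a]) (ph (x, y).1 * (ps (x, y).2 * \1_L (x, y))) =
   \int[mu]_(x in `[0, a]) (phi x * (g x - g 0)).
  by apply: eq_Rintegral => x /set_mem; exact: in1.
have E2 : \int[mu]_(y in `[0, a]) \int[mu]_(x in `[0, a]) (ph (x, y).1 * (ps (x, y).2 * \1_L (x, y))) =
   \int[mu]_(y in `[0, a]) (psi y * (f a - f y)).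
  by apply: eq_Rintegral => y /set_mem; exact: in2.
move: E; rewrite E1 E2 => E.
have iphia := integrable_sub0 aA iphi; have ipsia := integrable_sub0 aA ipsi.
have i1a := integrable_sub0 aA i1; have i2a := integrable_sub0 aA i2.
have e1 : \int[mu]_(x in `[0, a]) (phi x * (g x - g 0)) =
    \int[mu]_(x in `[0, a]) (phi x * g x) - g 0 * \int[mu]_(x in `[0, a]) phi x.
  rewrite -RintegralZl// -RintegralB//; last exact: (@integrableZR _ _ _ mu).
  by apply: eq_Rintegral => x _; ring.
have e2 : \int[mu]_(x in `[0, a]) (psi x * (f a - f x)) =
    f a * \int[mu]_(x in `[0, a]) psi x - \int[mu]_(x in `[0, a]) (f x * psi x).
  rewrite -RintegralZl// -RintegralB//; last exact: (@integrableZR _ _ _ mu).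
  by apply: eq_Rintegral => x _; ring.
move: E; rewrite {}e1 {}e2 => E.
have fa := fE a aA; have ga := gE a aA.
set P1 := \int[mu]_(x in _) (phi x * g x) in E *.
set P2 := \int[mu]_(x in _) (f x * psi x) in E *.
set p1 := \int[mu]_(x in _) phi x in E fa.
set p2 := \int[mu]_(x in _) psi x in E ga.
have -> : P1 + P2 = g 0 * p1 + f a * p2 by clear -E; lra.
by rewrite ga fa; ring.
Qed.

End abs_continuity.

(** * The Carleman inequality for Laurent polynomials *)

Section ftc.
Variable R : realType.
Notation mu := (@lebesgue_measure R).
Implicit Types (f g F : R -> R) (a b A : R).

Lemma continuous_integrable f a b : continuous f ->
  mu.-integrable `[a, b] (EFin \o f).
Proof.
move=> cf; apply: continuous_compact_integrable; first exact: segment_compact.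
exact: continuous_subspaceT.
Qed.

Lemma is_derive_continuous F f : (forall x : R, is_derive x 1 F (f x)) ->
  continuous F.
Proof.
by move=> dF x; apply: differentiable_continuous; apply/derivable1_diffP.
Qed.

Lemma FTC2 F f a b : a <= b -> (forall x : R, is_derive x 1 F (f x)) ->
  continuous f -> \int[mu]_(x in `[a, b]) f x = F b - F a.
Proof.
move=> ab dF cf; have [<-|ab'] := eqVneq a b.
  by rewrite set_itv1 Rintegral_set1 subrr.
have cF := is_derive_continuous dF.
rewrite /Rintegral (continuous_FTC2 (F := F)) ?EFinB//.
- by rewrite lt_neqAle ab'.
- exact: continuous_subspaceT.
- split; first by [].
  + by apply: cvg_at_right_filter; exact: cF.
  + by apply: cvg_at_left_filter; exact: cF.
- by move=> x _; rewrite derive1E; case: (dF x) => _ ->.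
Qed.

Lemma acR_C1 A F f : (forall x : R, is_derive x 1 F (f x)) -> continuous f ->
  acR A F f.
Proof.
move=> dF cf; split; first exact: continuous_integrable.
move=> a; rewrite in_itv/= => /andP[a0 _].
by rewrite (FTC2 a0 dF cf) addrC subrK.
Qed.

Lemma acR_cst A (c : R) : acR A (fun=> c) (fun=> 0).
Proof. by apply: acR_C1; exact: cst_continuous. Qed.

Lemma is_derive_expRM (k x : R) :
  is_derive x 1 (fun a => expR (k * a)) (k * expR (k * x)).
Proof.
have h : is_derive x 1 ( *%R k) k.
  by apply: (is_derive_eq (@is_deriveZ _ _ _ (@id R) k x 1 1 _)); exact: mulr1.
by have := is_derive1_comp (is_derive_expR (k * x)) h; rewrite mulrC.
Qed.

Lemma acR_expR A (k : R) :
  acR A (fun a => expR (k * a)) (fun a => k * expR (k * a)).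
Proof.
apply: acR_C1 => [x|]; first exact: is_derive_expRM.
apply: (@is_derive_continuous _ (fun a => k * (k * expR (k * a)))) => x.
exact: (is_deriveZ k (is_derive_expRM k x)).
Qed.

Lemma acR_add A f g phi psi : acR A f phi -> acR A g psi ->
  acR A (fun a => f a + g a) (fun a => phi a + psi a).
Proof.
move=> [ip fE] [iq gE]; split; first by apply: (@integrableDR _ _ _ mu).
move=> a aA; rewrite RintegralD//; last 2 first.
  exact: integrable_sub0 ip.
  exact: integrable_sub0 iq.
by rewrite fE// gE//; ring.
Qed.

Lemma acR_scale A c f phi : acR A f phi ->
  acR A (fun a => c * f a) (fun a => c * phi a).
Proof.
move=> [ip fE]; split; first by apply: (@integrableZR _ _ _ mu).
move=> a aA; rewrite (RintegralZl _ _ (integrable_sub0 aA ip))//.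
by rewrite fE// mulrDr.
Qed.

(** The derivative is also square integrable, since its square is the right-hand side of the
    Carleman inequality. *)
Definition acL A f phi := acR A f phi /\
  mu.-integrable `[0, A] (EFin \o (fun a => phi a ^+ 2)).

Lemma sqr_integrableD A f g :
  mu.-integrable `[0, A] (EFin \o f) -> mu.-integrable `[0, A] (EFin \o g) ->
  mu.-integrable `[0, A] (EFin \o (fun a => f a ^+ 2)) ->
  mu.-integrable `[0, A] (EFin \o (fun a => g a ^+ 2)) ->
  mu.-integrable `[0, A] (EFin \o (fun a => (f a + g a) ^+ 2)).
Proof.
move=> i1 i2 i3 i4.
have mf := integrable_measurable i1; have mg := integrable_measurable i2.
apply: (@le_integrableR _ _ _ mu _ _ _ (fun a => 2 * f a ^+ 2 + 2 * g a ^+ 2)) => //.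
- by apply: measurable_funX; apply: measurable_funD.
- move=> x _; rewrite ger0_norm ?sqr_ge0//.
  have := sqr_ge0 (f x - g x); nra.
- by apply: (@integrableDR _ _ _ mu) => //; apply: (@integrableZR _ _ _ mu).
Qed.

Lemma acL_cst A (c : R) : acL A (fun=> c) (fun=> 0).
Proof.
split; first exact: acR_cst.
by apply: continuous_integrable; exact: cst_continuous.
Qed.

Lemma acL_add A f g phi psi : acL A f phi -> acL A g psi ->
  acL A (fun a => f a + g a) (fun a => phi a + psi a).
Proof.
move=> [fphi p2] [gpsi q2]; split; first exact: acR_add.
by apply: sqr_integrableD => //; [case: fphi|case: gpsi].
Qed.

Lemma acL_scale A c f phi : acL A f phi ->
  acL A (fun a => c * f a) (fun a => c * phi a).
Proof.
move=> [fphi p2]; split; first exact: acR_scale.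
apply: (@eq_integrableR _ _ _ mu _ _ (fun a => c ^+ 2 * phi a ^+ 2)) => //.
  by move=> x _; rewrite exprMn.
exact: (@integrableZR _ _ _ mu).
Qed.

Lemma sqr_integrable_bndM A f phi (M : R) : measurable_fun `[0, A] f ->
  (forall a, a \in `[0, A] -> `|f a| <= M) ->
  mu.-integrable `[0, A] (EFin \o (fun a => phi a ^+ 2)) ->
  mu.-integrable `[0, A] (EFin \o (fun a => (f a * phi a) ^+ 2)).
Proof.
move=> mf fM ip.
apply: (@eq_integrableR _ _ _ mu _ _ (fun a => f a ^+ 2 * phi a ^+ 2)) => //.
  by move=> x _; rewrite exprMn.
apply: (@integrable_bndM _ _ _ mu _ _ _ _ (M ^+ 2)) => //.
  exact: measurable_funX.
by move=> x xA; rewrite normrX lerXn2r ?nnegrE// ?fM// (le_trans _ (fM x xA)).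
Qed.

Lemma acL_mul A f g phi psi : 0 <= A -> acL A f phi -> acL A g psi ->
  acL A (fun a => f a * g a) (fun a => phi a * g a + f a * psi a).
Proof.
move=> A0 [acf p2] [acg q2].
have mf := acR_measurable A0 acf; have mg := acR_measurable A0 acg.
have [M fM] := acR_bounded acf; have [M' gM] := acR_bounded acg.
split; first exact: acR_mul.
have e : (fun a => phi a * g a) = (fun a => g a * phi a).
  by apply/funext => a; rewrite mulrC.
case: (acf) => iphi _; case: (acg) => ipsi _.
have i1 : mu.-integrable `[0, A] (EFin \o (fun a => phi a * g a)).
  by rewrite e; apply: (@integrable_bndM _ _ _ mu _ _ _ _ M').
have i2 : mu.-integrable `[0, A] (EFin \o (fun a => f a * psi a)).
  by apply: (@integrable_bndM _ _ _ mu _ _ _ _ M).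
apply: sqr_integrableD => //; last exact: (sqr_integrable_bndM mf fM).
have := sqr_integrable_bndM mg gM p2.
by apply: (@eq_integrableR _ _ _ mu) => // x _; rewrite mulrC.
Qed.

Definition acC A (p q : R -> R[i]) :=
  acL A (fun a => complex.Re (p a)) (fun a => complex.Re (q a)) /\
  acL A (fun a => complex.Im (p a)) (fun a => complex.Im (q a)).

Lemma acC_cst A (c : R[i]) : acC A (fun=> c) (fun=> 0).
Proof. by split; exact: acL_cst. Qed.

Lemma acC_add A p q p' q' : acC A p q -> acC A p' q' ->
  acC A (fun a => p a + p' a) (fun a => q a + q' a).
Proof.
move=> [h1 h2] [h3 h4]; split.
- have := acL_add h1 h3; rewrite /acC; congr (acL A _ _); apply/funext => a;
    by rewrite ReD.
- have := acL_add h2 h4; congr (acL A _ _); apply/funext => a; by rewrite ImD.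
Qed.

Lemma acC_mul A p q p' q' : 0 <= A -> acC A p q -> acC A p' q' ->
  acC A (fun a => p a * p' a) (fun a => q a * p' a + p a * q' a).
Proof.
move=> A0 [h1 h2] [h3 h4]; split.
- have := acL_add (acL_mul A0 h1 h3) (acL_scale (-1) (acL_mul A0 h2 h4)).
  by congr (acL A _ _); apply/funext => a; rewrite !ReImE; ring.
- have := acL_add (acL_mul A0 h1 h4) (acL_mul A0 h2 h3).
  by congr (acL A _ _); apply/funext => a; rewrite !ReImE; ring.
Qed.

Lemma acC_sum A I (r : seq I) (p q : I -> R -> R[i]) :
  (forall i, acC A (p i) (q i)) ->
  acC A (fun a => \sum_(i <- r) p i a) (fun a => \sum_(i <- r) q i a).
Proof.
move=> pq; elim: r => [|i r ih].
  have := acC_cst A 0; congr (acC A _ _); apply/funext => a; by rewrite big_nil.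
have := acC_add (pq i) ih.
by congr (acC A _ _); apply/funext => a; rewrite big_cons.
Qed.

(** Coefficientwise for all indices; uniform bounds on the sizes of [P a] and [Q a] are supplied
    separately where finite sums are needed. *)
Definition acP A (P Q : R -> {poly R[i]}) :=
  forall j, acC A (fun a => (P a)`_j) (fun a => (Q a)`_j).

Lemma acP_cst A (P : {poly R[i]}) : acP A (fun=> P) (fun=> 0).
Proof.
move=> j; have := acC_cst A P`_j; congr (acC A _ _).
by apply/funext => a; rewrite coef0.
Qed.

Lemma acP_add A P Q P' Q' : acP A P Q -> acP A P' Q' ->
  acP A (fun a => P a + P' a) (fun a => Q a + Q' a).
Proof.
move=> h h' j; have := acC_add (h j) (h' j).
by congr (acC A _ _); apply/funext => a; rewrite coefD.
Qed.

Lemma acP_mul A P Q P' Q' : 0 <= A -> acP A P Q -> acP A P' Q' ->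
  acP A (fun a => P a * P' a) (fun a => Q a * P' a + P a * Q' a).
Proof.
move=> A0 h h' j.
have := @acC_sum A _ (index_enum 'I_j.+1)
  (fun i a => (P a)`_i * (P' a)`_(j - i)%N) _ (fun i => acC_mul A0 (h i) (h' (j - i)%N)).
congr (acC A _ _); apply/funext => a; first by rewrite coefM.
by rewrite coefD !coefM -big_split.
Qed.

Lemma acP_exp A P Q n : 0 <= A -> acP A P Q ->
  acP A (fun a => P a ^+ n) (fun a => P a ^+ n.-1 * Q a *+ n).
Proof.
move=> A0 h; elim: n => [|n ih].
  by have := acP_cst A 1; congr (acP A _ _).
have := acP_mul A0 h ih; congr (acP A _ _); apply/funext => a; first by rewrite exprS.
case: n {ih} => [|n] /=; first by rewrite mulr0n mulr0 addr0 mulrC mulr1n.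
by rewrite mulrnAr mulrA -exprS [in RHS]mulrS mulrC.
Qed.

End ftc.

Section carleman.
Variable R : realType.
Notation mu := (@lebesgue_measure R).
Implicit Types (a b A k : R).

Definition circle : set R := `[0, 2 * pi]%classic.

Lemma cis_2pi (n : nat) : cis (n%:R * (2 * pi)) = 1 :> R[i].
Proof.
rewrite -cisX (_ : cis (2 * pi) = 1) ?expr1n//.
rewrite /cis (_ : 2 * pi = pi + pi :> R) ?mulr_natl ?mulr2n//.
rewrite cosD sinD cospi sinpi; apply/eqP; rewrite eq_complex /=.
by apply/andP; split; apply/eqP; ring.
Qed.

Lemma cos_2pi (n : nat) : cos (n%:R * (2 * pi)) = 1 :> R.
Proof. by have /(congr1 (@complex.Re R)) := cis_2pi n. Qed.

Lemma sin_2pi (n : nat) : sin (n%:R * (2 * pi)) = 0 :> R.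
Proof. by have /(congr1 (@complex.Im R)) := cis_2pi n. Qed.

Lemma is_derive_linM k (x : R) : is_derive x 1 (fun a => k * a) k.
Proof.
by apply: (is_derive_eq (@is_deriveZ _ _ _ (@id R) k x 1 1 _)); exact: mulr1.
Qed.

Lemma is_derive_sinM k (x : R) :
  is_derive x 1 (fun a => sin (k * a)) (k * cos (k * x)).
Proof.
by have := is_derive1_comp (is_derive_sin (k * x)) (is_derive_linM k x); rewrite mulrC.
Qed.

Lemma is_derive_cosM k (x : R) :
  is_derive x 1 (fun a => cos (k * a)) (- (k * sin (k * x))).
Proof.
have := is_derive1_comp (is_derive_cos (k * x)) (is_derive_linM k x).
by rewrite mulNr mulrC.
Qed.

Lemma continuous_sinM k : continuous (fun a : R => sin (k * a)).
Proof. by apply: is_derive_continuous => x; exact: is_derive_sinM. Qed.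

Lemma continuous_cosM k : continuous (fun a : R => cos (k * a)).
Proof. by apply: is_derive_continuous => x; exact: is_derive_cosM. Qed.

Lemma Rintegral_cosM k : k != 0 ->
  \int[mu]_(x in circle) cos (k * x) = k^-1 * sin (k * (2 * pi)).
Proof.
move=> k0; rewrite /circle.
have d (x : R) : is_derive x 1 (fun a => k^-1 * sin (k * a)) (cos (k * x)).
  apply: (is_derive_eq (is_deriveZ k^-1 (is_derive_sinM k x))).
  by rewrite /GRing.scale/= mulrA mulVf// mul1r.
rewrite (FTC2 _ d (@continuous_cosM k)).
  by rewrite mulr0 sin0 mulr0 subr0.
by rewrite mulr_ge0// pi_ge0.
Qed.

Lemma Rintegral_sinM k : k != 0 ->
  \int[mu]_(x in circle) sin (k * x) = k^-1 * (1 - cos (k * (2 * pi))).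
Proof.
move=> k0; rewrite /circle.
have d (x : R) : is_derive x 1 (fun a => - k^-1 * cos (k * a)) (sin (k * x)).
  apply: (is_derive_eq (is_deriveZ (- k^-1) (is_derive_cosM k x))).
  by rewrite /GRing.scale/= mulrNN mulrA mulVf// mul1r.
rewrite (FTC2 _ d (@continuous_sinM k)).
  by rewrite mulr0 cos0; ring.
by rewrite mulr_ge0// pi_ge0.
Qed.

Lemma circle_measure : mu circle = (2 * pi)%:E.
Proof.
rewrite /circle lebesgue_measure_itv/= lte_fin mulr_gt0// ?pi_gt0//.
by rewrite -EFinB subr0.
Qed.

Lemma Rintegral_circle_cst (c : R) : \int[mu]_(x in circle) c = c * (2 * pi).
Proof.
rewrite Rintegral_cst; last exact: measurable_itv.
by congr (_ * _); exact: (congr1 fine circle_measure).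
Qed.

Lemma cos_orthogonal (j l : nat) :
  \int[mu]_(x in circle) cos ((j%:R - l%:R) * x) = (if j == l then 2 * pi else 0).
Proof.
case: eqVneq => [->|jl].
  under eq_Rintegral do rewrite subrr mul0r cos0.
  by rewrite Rintegral_circle_cst mul1r.
rewrite Rintegral_cosM; last by rewrite subr_eq0 eqr_nat.
by rewrite mulrBl sinB !sin_2pi mul0r mulr0 subrr mulr0.
Qed.

Lemma sin_orthogonal (j l : nat) :
  \int[mu]_(x in circle) sin ((j%:R - l%:R) * x) = 0.
Proof.
case: (eqVneq j l) => [->|jl].
  under eq_Rintegral do rewrite subrr mul0r sin0.
  by rewrite Rintegral_circle_cst mul0r.
rewrite Rintegral_sinM; last by rewrite subr_eq0 eqr_nat.
by rewrite mulrBl cosB !sin_2pi !cos_2pi mulr0 addr0 mulr1 subrr mulr0.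
Qed.

Lemma parseval_poly (p : {poly R[i]}) n x : (size p <= n)%N ->
  \int[mu]_(b in circle) csq p.[zeta x b] =
  2 * pi * \sum_(j < n) expR (2 * (j%:R * x)) * csq p`_j.
Proof.
move=> pn.
pose c j l : R := complex.Re p`_j * complex.Re p`_l + complex.Im p`_j * complex.Im p`_l.
pose d j l : R := complex.Re p`_j * complex.Im p`_l - complex.Im p`_j * complex.Re p`_l.
pose e (j l : nat) : R := expR (j%:R * x) * expR (l%:R * x).
pose t (j l : nat) b : R := e j l * (c j l * cos ((j%:R - l%:R) * b) + d j l * sin ((j%:R - l%:R) * b)).
have E b : csq p.[zeta x b] = \sum_(j < n) \sum_(l < n) t j l b.
  rewrite (horner_coef_wide _ pn) /csq Re_sum Im_sum.
  rewrite !expr2 !big_distrlr/= -big_split/=; apply: eq_bigr => j _.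
  rewrite -big_split/=; apply: eq_bigr => l _.
  rewrite !zetaX /zeta !ReImE/= /t /c /d /e !mulrBl cosB sinB.
  by ring.
under eq_Rintegral do rewrite E.
have it j l : mu.-integrable circle (EFin \o (t j l)).
  apply: (@integrableZR _ _ _ mu) => //; first exact: measurable_itv.
  by apply: (@integrableDR _ _ _ mu) => //; rewrite ?/circle//;
    apply: (@integrableZR _ _ _ mu) => //; apply: continuous_integrable;
    [exact: continuous_cosM|exact: continuous_sinM].
rewrite (@Rintegral_sumR _ _ _ mu); [|exact: measurable_itv|]; last first.
  by move=> i; apply: (@integrable_sumR _ _ _ mu) => //; exact: measurable_itv.
rewrite mulr_sumr; apply: eq_bigr => j _.
rewrite (@Rintegral_sumR _ _ _ mu); [|exact: measurable_itv|by []].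
rewrite (bigD1 j)//= big1 ?addr0; last first.
  move=> l lj; rewrite RintegralZl//; [|exact: measurable_itv|]; last first.
    by apply: (@integrableDR _ _ _ mu) => //; rewrite ?/circle//;
      apply: (@integrableZR _ _ _ mu) => //; apply: continuous_integrable;
      [exact: continuous_cosM|exact: continuous_sinM].
  rewrite RintegralD//; [|exact: measurable_itv| |]; last 2 first.
    by apply: (@integrableZR _ _ _ mu) => //; [exact: measurable_itv|apply: continuous_integrable; exact: continuous_cosM].
    by apply: (@integrableZR _ _ _ mu) => //; [exact: measurable_itv|apply: continuous_integrable; exact: continuous_sinM].
  rewrite !RintegralZl//; try exact: measurable_itv; last 2 first.
    by apply: continuous_integrable; exact: continuous_sinM.
    by apply: continuous_integrable; exact: continuous_cosM.
  rewrite cos_orthogonal sin_orthogonal.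
  by rewrite (_ : _ == _ = false) ?mulr0 ?addr0 ?mulr0//; apply: contraNF lj => /eqP ?; apply/eqP/val_inj.
under eq_Rintegral do rewrite /t subrr mul0r cos0 sin0 mulr0 addr0 mulr1.
rewrite Rintegral_circle_cst /e /c -expRD.
rewrite (_ : j%:R * x + j%:R * x = 2 * (j%:R * x)); last by ring.
by rewrite /csq !expr2; ring.
Qed.

Lemma carleman_pos k (iG iH iD g0 gA : R) : 1 <= 2 * k -> 0 <= iG -> 0 <= iH ->
  0 <= g0 -> k * iG - 2 * iH <= iD -> gA = g0 + iD ->
  iG <= 4 * iH + 2 * (g0 + gA).
Proof. by move=> k2 G0 H0 g00 L ->; have : 0 <= (2 * k - 1) * iG; nra. Qed.

Lemma carleman_neg k (iG iH iD g0 gA : R) : 2 * k <= - 1 -> 0 <= iG -> 0 <= iH ->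
  0 <= gA -> iD <= k * iG + 2 * iH -> gA = g0 + iD ->
  iG <= 4 * iH + 2 * (g0 + gA).
Proof. by move=> k2 G0 H0 gA0 L E; have : 0 <= (- 2 * k - 1) * iG; nra. Qed.

Lemma sqr_ge_quarter k : 4^-1 <= k ^+ 2 -> (1 <= 2 * k) \/ (2 * k <= - 1).
Proof.
move=> k4; case: (lerP 1 (2 * k)) => [|h1]; [by left|right].
rewrite leNgt; apply/negP => h2.
have : 0 < (1 + 2 * k) * (1 - 2 * k) by apply: mulr_gt0; lra.
by nra.
Qed.

(** The derivative of [expR (2 * k * a) * csq (p a)] is 2 k times the function itself plus a cross
    term in p and q. Young's inequality bounds the cross term by 1/2 of |p|^2 plus 2 |q|^2, both
    weighted, and |k| >= 1/2 absorbs the first part. The constant 4 is 1 / k^2 at |k| = 1/2. *)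
Lemma carleman_coef A k (p q : R -> R[i]) : 0 <= A -> 4^-1 <= k ^+ 2 ->
  acC A p q ->
  \int[mu]_(a in `[0, A]) (expR (2 * k * a) * csq (p a)) <=
  4 * \int[mu]_(a in `[0, A]) (expR (2 * k * a) * csq (q a)) +
  2 * (csq (p 0) + expR (2 * k * A) * csq (p A)).
Proof.
move=> A0 k4 [[acx x2] [acy y2]].
set x := fun a => complex.Re (p a); set y := fun a => complex.Im (p a).
rewrite -/x -/y in acx acy.
set xi := fun a => complex.Re (q a) in acx x2; set eta := fun a => complex.Im (q a) in acy y2.
pose w a : R := expR (2 * k * a).
have acw : acR A w (fun a => 2 * k * w a) by exact: acR_expR.
have acG := acR_mul A0 acw (acR_add (acR_mul A0 acx acx) (acR_mul A0 acy acy)).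
pose G a := w a * (x a * x a + y a * y a).
pose H a := w a * (xi a * xi a + eta a * eta a).
have GE a : expR (2 * k * a) * csq (p a) = G a by rewrite /G /w /csq !expr2.
have HE a : expR (2 * k * a) * csq (q a) = H a by rewrite /H /w /csq !expr2.
under eq_Rintegral do rewrite GE.
under [in leRHS]eq_Rintegral do rewrite HE.
have [wM wMP] := acR_bounded acw.
have mw := acR_measurable A0 acw.
have mG := acR_measurable A0 acG; have [GM GMP] := acR_bounded acG.
have Afin : (mu `[0%R, A]%classic < +oo)%E.
  by rewrite lebesgue_measure_itv/=; case: ifP => _; rewrite ?ltry.
have iG : mu.-integrable `[0, A] (EFin \o G).
  by apply: (@bounded_integrable _ _ _ mu _ _ _ GM).
have iH : mu.-integrable `[0, A] (EFin \o H).
  apply: (@integrable_bndM _ _ _ mu _ _ _ _ wM) => //.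
  by apply: (@integrableDR _ _ _ mu).
case: acG => iD GA.
have /GA : A \in `[0, A] by rewrite in_itv/= A0 lexx.
set D := (X in EFin \o X) in iD; rewrite -/(G A) -/(G 0) -/D => {}GA.
have GN a : 0 <= G a by rewrite /G mulr_ge0 ?expR_ge0// -!expr2 addr_ge0 ?sqr_ge0.
have HN a : 0 <= H a by rewrite /H mulr_ge0 ?expR_ge0// -!expr2 addr_ge0 ?sqr_ge0.
have IG0 : 0 <= \int[mu]_(a in `[0, A]) G a by apply: Rintegral_ge0.
have IH0 : 0 <= \int[mu]_(a in `[0, A]) H a by apply: Rintegral_ge0.
have p0E : csq (p 0) = G 0.
  by rewrite -GE mulr0 expR0 mul1r.
rewrite p0E.
have wN a : 0 <= w a by exact: expR_ge0.
(* The sign of k decides which endpoint pays: the value at A for k >= 1/2, the value at 0 for k <=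
   -1/2. The conclusion keeps both because modes of both signs occur. *)
case: (sqr_ge_quarter k4) => k2.
  have L : k * \int[mu]_(a in `[0, A]) G a - 2 * \int[mu]_(a in `[0, A]) H a <= \int[mu]_(a in `[0, A]) D a.
    rewrite -RintegralZl// -RintegralZl// -RintegralB//; try by apply: (@integrableZR _ _ _ mu).
    apply: le_Rintegral => //.
      by apply: (@integrableBR _ _ _ mu) => //; apply: (@integrableZR _ _ _ mu).
    move=> a _; rewrite /D /G /H.
    have := wN a; move: (w a) (x a) (y a) (xi a) (eta a) => W X Y Z T W0.
    have : 0 <= k * (X * X + Y * Y) + 2 * (X * Z + Y * T) + 2 * (Z * Z + T * T).
      have -> : k * (X * X + Y * Y) + 2 * (X * Z + Y * T) + 2 * (Z * Z + T * T) =
        (k - 2^-1) * (X ^+ 2 + Y ^+ 2) + 2^-1 * ((X + 2 * Z) ^+ 2 + (Y + 2 * T) ^+ 2) by field.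
      by apply: addr_ge0; apply: mulr_ge0; [by move: k2; clear; lra|rewrite addr_ge0 ?sqr_ge0|rewrite invr_ge0|rewrite addr_ge0 ?sqr_ge0].
    by move=> /(mulr_ge0 W0); clear; lra.
  exact: (carleman_pos k2 IG0 IH0 (GN 0) L GA).
have L : \int[mu]_(a in `[0, A]) D a <= k * \int[mu]_(a in `[0, A]) G a + 2 * \int[mu]_(a in `[0, A]) H a.
  rewrite -RintegralZl// -RintegralZl// -RintegralD//; try by apply: (@integrableZR _ _ _ mu).
  apply: le_Rintegral => //.
    by apply: (@integrableDR _ _ _ mu) => //; apply: (@integrableZR _ _ _ mu).
  move=> a _; rewrite /D /G /H.
  have := wN a; move: (w a) (x a) (y a) (xi a) (eta a) => W X Y Z T W0.
  have : 0 <= (- k) * (X * X + Y * Y) - 2 * (X * Z + Y * T) + 2 * (Z * Z + T * T).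
    have -> : (- k) * (X * X + Y * Y) - 2 * (X * Z + Y * T) + 2 * (Z * Z + T * T) =
      (- k - 2^-1) * (X ^+ 2 + Y ^+ 2) + 2^-1 * ((X - 2 * Z) ^+ 2 + (Y - 2 * T) ^+ 2) by field.
    by apply: addr_ge0; apply: mulr_ge0; [by move: k2; clear; lra|rewrite addr_ge0 ?sqr_ge0|rewrite invr_ge0|rewrite addr_ge0 ?sqr_ge0].
  by move=> /(mulr_ge0 W0); clear; lra.
exact: (carleman_neg k2 IG0 IH0 (GN A) L GA).
Qed.

(** The weight e^(2 s a) with s = m + 1/2, times e^(- 2 L a). The second factor is the squared
    modulus of the division by e^(L (a + i b)) that turns a polynomial into a Laurent polynomial. *)
Definition cweight (L m : nat) a : R := expR ((2 * m%:R + 1 - 2 * L%:R) * a).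

(* P a, evaluated at e^(a + ib) and divided by e^(L (a + ib)), is a trigonometric
   polynomial in b annihilated by d_a + i d_b up to the term coming from Q. *)
Lemma carleman_poly A (L n m : nat) (P Q : R -> {poly R[i]}) : 0 <= A ->
  acP A P Q -> (forall a, size (P a) <= n)%N -> (forall a, size (Q a) <= n)%N ->
  \int[mu]_(a in `[0, A]) (cweight L m a * \int[mu]_(b in circle) csq (P a).[zeta a b]) <=
  4 * \int[mu]_(a in `[0, A]) (cweight L m a * \int[mu]_(b in circle) csq (Q a).[zeta a b]) +
  2 * (\int[mu]_(b in circle) csq (P 0).[zeta 0 b] +
       cweight L m A * \int[mu]_(b in circle) csq (P A).[zeta A b]).
Proof.
move=> A0 PQ Pn Qn; set w := cweight L m.
pose k (j : nat) : R := j%:R + m%:R + 2^-1 - L%:R.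
have kw j a : w a * expR (2 * (j%:R * a)) = expR (2 * k j * a).
  by rewrite /w /cweight -expRD; congr expR; rewrite /k; field.
have PE a (p : {poly R[i]}) : (size p <= n)%N -> w a * \int[mu]_(b in circle) csq p.[zeta a b] =
    \sum_(j < n) 2 * pi * (expR (2 * k j * a) * csq p`_j).
  move=> pn; rewrite (parseval_poly _ pn) mulrCA mulr_sumr mulr_sumr.
  by apply: eq_bigr => j _; rewrite -kw; ring.
have PE0 : \int[mu]_(b in circle) csq (P 0).[zeta 0 b] =
    \sum_(j < n) 2 * pi * csq (P 0)`_j.
  have e : w 0 = 1 by rewrite /w /cweight mulr0 expR0.
  rewrite -[LHS]mul1r -{1}e PE//; apply: eq_bigr => j _; by rewrite mulr0 expR0 mul1r.
under eq_Rintegral do rewrite PE//.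
under [in leRHS]eq_Rintegral do rewrite PE//.
rewrite PE0 PE//.
(* [k j] is an integer plus 1/2, so its absolute value is at least 1/2 whatever the degree j and the
   shift L. *)
have k4 j : 4^-1 <= k j ^+ 2.
  rewrite /k -natrD.
  case: (leqP L (j + m)) => h.
    rewrite addrAC -natrB//; have := ler0n R (j + m - L); move: (_%:R) => t t0.
    by nra.
  have -> : (j + m)%:R + 2^-1 - L%:R = - ((L - (j + m))%:R - 2^-1) :> R.
    by rewrite natrB 1?ltnW//; ring.
  have : 1 <= (L - (j + m))%:R :> R by rewrite ler1n subn_gt0.
  by move: (_%:R) => t t1; nra.
have ac0 (p q : R -> R[i]) j : acC A p q ->
    mu.-integrable `[0, A] (EFin \o (fun a => expR (2 * k j * a) * csq (p a))).
  move=> [[acx _] [acy _]].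
  have := acR_mul A0 (acR_expR A (2 * k j)) (acR_add (acR_mul A0 acx acx) (acR_mul A0 acy acy)).
  move=> ac; have mG := acR_measurable A0 ac; have [M MP] := acR_bounded ac.
  have Afin : (mu `[0%R, A]%classic < +oo)%E.
    by rewrite lebesgue_measure_itv/=; case: ifP => _; rewrite ?ltry.
  apply: (@eq_integrableR _ _ _ mu _ _ (fun a => expR (2 * k j * a) *
    (complex.Re (p a) * complex.Re (p a) + complex.Im (p a) * complex.Im (p a)))) => //.
  by apply: (@bounded_integrable _ _ _ mu _ _ _ M).
have ac1 (p q : R -> R[i]) j : acC A p q ->
    mu.-integrable `[0, A] (EFin \o (fun a => expR (2 * k j * a) * csq (q a))).
  move=> [[acx x2] [acy y2]].
  have ace := acR_expR A (2 * k j).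
  have mw := acR_measurable A0 ace; have [M MP] := acR_bounded ace.
  apply: (@integrable_bndM _ _ _ mu _ _ _ _ M) => //.
  by apply: (@integrableDR _ _ _ mu).
rewrite (@Rintegral_sumR _ _ _ mu)//; last first.
  by move=> j; apply: (@integrableZR _ _ _ mu) => //; exact: ac0 (PQ j).
rewrite [X in 4 * X](@Rintegral_sumR _ _ _ mu)//; last first.
  by move=> j; apply: (@integrableZR _ _ _ mu) => //; exact: ac1 (PQ j).
rewrite -big_split mulr_sumr mulr_sumr -big_split/=; apply: ler_sum => j _.
rewrite !RintegralZl//; [|exact: ac1 (PQ j)|exact: ac0 (PQ j)].
have := carleman_coef A0 (k4 j) (PQ j).
have : 0 <= 2 * pi :> R by rewrite mulr_ge0// pi_ge0.
move: (\int[_]_(_ in _) _) (\int[_]_(_ in _) _) => X Y.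
by move=> h /(ler_wpM2l h); lra.
Qed.

End carleman.

(** * Regularisation in the angular variable *)

Section real_dct.
Context d (T : measurableType d) (R : realType) (m : {measure set T -> \bar R}).

Lemma dct_R (D : set T) (f_ : nat -> T -> R) (f g : T -> R) : measurable D ->
  (forall n, measurable_fun D (f_ n)) -> measurable_fun D f ->
  {ae m, forall x, D x -> f_ n x @[n --> \oo] --> f x} ->
  m.-integrable D (EFin \o g) ->
  (forall n x, D x -> `|f_ n x| <= g x) ->
  \int[m]_(x in D) f_ n x @[n --> \oo] --> \int[m]_(x in D) f x.
Proof.
move=> mD mf_ mf cvf ig fg.
have [] := @dominated_convergence _ _ _ m D mD (fun n => EFin \o f_ n) (EFin \o f)
  (EFin \o g).
- by move=> n; apply/measurable_EFinP.
- exact/measurable_EFinP.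
- apply: filterS cvf => x h /h {}h /=.
  by apply: cvg_EFin => //; exact: nearW.
- exact: ig.
- by apply: nearW => x n Dx /=; rewrite lee_fin fg.
move=> ifin _ cv; apply: fine_cvg.
rewrite fineK; last by apply: integrable_fin_num.
exact: cv.
Qed.

End real_dct.

Lemma real_complexM (R : realType) (x y : R) : (x * y)%:C = x%:C * y%:C.
Proof. by apply: complex_ext; rewrite ?ReM ?ImM/=; ring. Qed.

Section kernel.
Variable R : realType.
Notation mu := (@lebesgue_measure R).
Notation J := (@circle R).
Implicit Types (f g : R -> R) (b t M : R) (K : nat).

Lemma measurable_circle : measurable J. Proof. exact: measurable_itv. Qed.
Hint Resolve measurable_circle : core.

Lemma circle_lty : (mu J < +oo)%E.
Proof. by rewrite circle_measure ltry. Qed.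

(** Fourier coefficients of [ker K]. Since (1 + e^(it))^2 = (2 + 2 cos t) e^(it), the K-th power
    expands binomially. The central coefficient is 1 / (2 pi), which gives the kernel mass one; all
    coefficients up to 2 K are positive and can be divided by. *)
Definition kc K (j : nat) : R := ('C(K.*2, j))%:R / (2 * pi * ('C(K.*2, K))%:R).

Definition knorm K : R := 2 * pi * ('C(K.*2, K))%:R / 2 ^+ K.

Definition ker K t : R := (1 + cos t) ^+ K / knorm K.

Lemma binK_gt0 K : 0 < ('C(K.*2, K))%:R :> R.
Proof. by rewrite ltr0n bin_gt0 -addnn leq_addr. Qed.

Lemma knorm_gt0 K : 0 < knorm K.
Proof. by rewrite divr_gt0// ?exprn_gt0// mulr_gt0// ?binK_gt0// mulr_gt0// pi_gt0. Qed.

Lemma ker_ge0 K t : 0 <= ker K t.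
Proof.
rewrite divr_ge0// ?ltW ?knorm_gt0// exprn_ge0//.
Qed.

Lemma one_add_cis t : (1 + cis t) ^+ 2 = (2 + 2 * cos t)%:C * cis t.
Proof.
apply: complex_ext; rewrite expr2 !ReImE/=; last by ring.
by have := cos2Dsin2 t; move: (cos t) (sin t) => c s h; nra.
Qed.

Lemma ker_cis K t : (ker K t)%:C * cis (K%:R * t) =
  \sum_(j < K.*2.+1) (kc K j)%:C * cis (j%:R * t).
Proof.
have E : ((2 + 2 * cos t) ^+ K)%:C * cis (K%:R * t) =
    \sum_(j < K.*2.+1) (('C(K.*2, j))%:R)%:C * cis (j%:R * t).
  rewrite rmorphXn/= -cisX -exprMn -one_add_cis -exprM mul2n exprDn.
  apply: eq_bigr => j _; rewrite expr1n mul1r cisX -mulr_natl.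
  by congr (_ * _); rewrite rmorph_nat.
have c0 : (2 * pi * ('C(K.*2, K))%:R : R) != 0.
  by rewrite gt_eqF// mulr_gt0 ?binK_gt0// mulr_gt0// pi_gt0.
have -> : ker K t = (2 * pi * ('C(K.*2, K))%:R)^-1 * (2 + 2 * cos t) ^+ K.
  rewrite /ker /knorm invf_div mulrC -[2 + _](_ : 2 * (1 + cos t) = _); last by ring.
  by rewrite exprMn; ring.
rewrite real_complexM -mulrA E mulr_sumr; apply: eq_bigr => j _.
by rewrite mulrA /kc [_ / _]mulrC real_complexM.
Qed.

Lemma kerE K t : (ker K t)%:C =
  \sum_(j < K.*2.+1) (kc K j)%:C * cis ((j%:R - K%:R) * t).
Proof.
have h : cis (K%:R * t) * cis (- (K%:R * t)) = 1 by rewrite -cisD subrr cis0.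
rewrite -[LHS]mulr1 -h mulrA ker_cis mulr_suml; apply: eq_bigr => j _.
by rewrite -mulrA -cisD mulrBl.
Qed.

Lemma ker_cos K t : ker K t =
  \sum_(j < K.*2.+1) kc K j * cos ((j%:R - K%:R) * t).
Proof.
have /(congr1 (@complex.Re R)) := kerE K t.
rewrite Re_sum/= => ->; apply: eq_bigr => j _.
by rewrite /= mul0r subr0.
Qed.

Lemma ker_sym K b t : ker K (b - t) = ker K (t - b).
Proof. by rewrite /ker -(opprB t b) cosN. Qed.

Lemma continuous_ker K : continuous (ker K).
Proof.
rewrite (_ : ker K = fun t => \sum_(j < K.*2.+1) kc K j * cos ((j%:R - K%:R) * t)); last first.
  by apply/funext => t; exact: ker_cos.
apply: (@is_derive_continuous _ _ (fun t => \sum_(j < K.*2.+1) kc K j * - ((j%:R - K%:R) * sin ((j%:R - K%:R) * t)))).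
move=> x; rewrite -[X in is_derive _ _ X _]fct_sumE.
apply: is_derive_sum => j; exact: (is_deriveZ _ (is_derive_cosM _ x)).
Qed.

Lemma ker_bounded K t : ker K t <= 2 ^+ K / knorm K.
Proof.
rewrite ler_pM2r ?invr_gt0 ?knorm_gt0// lerXn2r ?nnegrE//.
by have := cos_geN1 t; have := cos_le1 t; lra.
Qed.

Lemma measurable_ker K : measurable_fun setT (ker K).
Proof. by apply: continuous_measurable_fun; exact: continuous_ker. Qed.

Lemma measurable_kerB K : measurable_fun setT (fun z : R * R => ker K (z.1 - z.2)).
Proof.
by apply: measurableT_comp; [exact: measurable_ker|exact: measurable_funB].
Qed.

Lemma measurable_kerB1 K b : measurable_fun setT (fun t => ker K (b - t)).
Proof. exact: (measurable_sec b (measurable_kerB K)). Qed.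

Lemma integrable_ker f K b : mu.-integrable J (EFin \o f) ->
  mu.-integrable J (EFin \o (fun t => ker K (b - t) * f t)).
Proof.
move=> fi; apply: (@integrable_bndM _ _ _ mu _ _ _ _ (2 ^+ K / knorm K)) => //.
  by apply: measurable_funTS; exact: measurable_kerB1.
by move=> t _; rewrite ger0_norm ?ker_ge0// ker_bounded.
Qed.

Lemma integrable_circle_cst (c : R) : mu.-integrable J (EFin \o (fun=> c)).
Proof. by apply: continuous_integrable; exact: cst_continuous. Qed.

Lemma Rintegral_ker K b : \int[mu]_(t in J) ker K (b - t) = 1.
Proof.
have kE t : ker K (b - t) = \sum_(j < K.*2.+1) (kc K j * cos ((j%:R - K%:R) * b) * cos ((j%:R - K%:R) * t)
    + kc K j * sin ((j%:R - K%:R) * b) * sin ((j%:R - K%:R) * t)).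
  rewrite ker_cos; apply: eq_bigr => j _.
  by rewrite mulrBr cosB; ring.
under eq_Rintegral do rewrite kE.
have ic (c k : R) : mu.-integrable J (EFin \o (fun t => c * cos (k * t))).
  by apply: (@integrableZR _ _ _ mu) => //; apply: continuous_integrable; exact: continuous_cosM.
have is_ (c k : R) : mu.-integrable J (EFin \o (fun t => c * sin (k * t))).
  by apply: (@integrableZR _ _ _ mu) => //; apply: continuous_integrable; exact: continuous_sinM.
rewrite (@Rintegral_sumR _ _ _ mu)//; last first.
  by move=> j; apply: (@integrableDR _ _ _ mu).
have hK : (K < K.*2.+1)%N by rewrite ltnS -addnn leq_addr.
rewrite (bigD1 (Ordinal hK))//= big1 ?addr0; last first.
  move=> j jK; rewrite RintegralD// !RintegralZl//; last 2 first.
    by apply: continuous_integrable; exact: continuous_sinM.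
    by apply: continuous_integrable; exact: continuous_cosM.
  rewrite cos_orthogonal sin_orthogonal mulr0 addr0.
  rewrite (_ : _ == _ = false) ?mulr0//.
  by apply: contraNF jK => /eqP jK; apply/eqP/val_inj.
under eq_Rintegral do rewrite subrr !mul0r cos0 sin0 mulr0 addr0 !mulr1.
rewrite Rintegral_circle_cst /kc.
have := @pi_gt0 R; have := binK_gt0 K; move: (_%:R) => B B0 p0.
have h : 2 * pi * B != 0 :> R by rewrite gt_eqF// !mulr_gt0.
by rewrite mulrAC [B * _]mulrC divff.
Qed.

Definition Qk K f b : R := \int[mu]_(t in J) (ker K (b - t) * f t).

Lemma measurable_Qk K f : measurable_fun setT f -> measurable_fun setT (Qk K f).
Proof.
move=> mf.
have h : measurable_fun setT (fun z : R * R => ker K (z.1 - z.2) * f z.2).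
  apply: measurable_funM; first exact: measurable_kerB.
  exact: measurableT_comp.
exact: (@measurable_Rint_section _ _ _ _ _ mu J _ measurable_circle h).
Qed.

Lemma Qk_sub K f g b : mu.-integrable J (EFin \o f) -> mu.-integrable J (EFin \o g) ->
  Qk K (fun t => f t - g t) b = Qk K f b - Qk K g b.
Proof.
move=> fi gi; rewrite /Qk -RintegralB//; last 2 first.
  exact: integrable_ker.
  exact: integrable_ker.
by apply: eq_Rintegral => t _; rewrite mulrBr.
Qed.

Lemma integrable_ker1 K b : mu.-integrable J (EFin \o (fun t => ker K (b - t))).
Proof.
have := integrable_ker K b (integrable_circle_cst 1).
by apply: (@eq_integrableR _ _ _ mu) => // t _; rewrite mulr1.
Qed.

(** [ker K (b - t)] is a probability density in t, and the difference of the two sides is the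
    variance of f under it. *)
Lemma Qk_jensen K f b : mu.-integrable J (EFin \o f) ->
  mu.-integrable J (EFin \o (fun t => f t ^+ 2)) ->
  Qk K f b ^+ 2 <= Qk K (fun t => f t ^+ 2) b.
Proof.
move=> fi f2; set m := Qk K f b.
have : 0 <= \int[mu]_(t in J) (ker K (b - t) * (f t - m) ^+ 2).
  by apply: Rintegral_ge0 => t _; rewrite mulr_ge0 ?ker_ge0 ?sqr_ge0.
have i1 := integrable_ker K b f2; have i2 := integrable_ker K b fi.
have i3 := integrable_ker1 K b.
have -> : \int[mu]_(t in J) (ker K (b - t) * (f t - m) ^+ 2) =
    \int[mu]_(t in J) ((ker K (b - t) * f t ^+ 2 - (2 * m) * (ker K (b - t) * f t)) + m ^+ 2 * ker K (b - t)).
  by apply: eq_Rintegral => t _; ring.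
rewrite RintegralD//; last 2 first.
  by apply: (@integrableBR _ _ _ mu) => //; apply: (@integrableZR _ _ _ mu).
  by apply: (@integrableZR _ _ _ mu).
rewrite RintegralB//; last by apply: (@integrableZR _ _ _ mu).
rewrite !RintegralZl// Rintegral_ker -/(Qk K f b) -/m -/(Qk K (fun t => f t ^+ 2) b).
by move: (Qk _ _ _) => q; nra.
Qed.

Lemma Qk_bounded K f M b : measurable_fun setT f -> (forall t, J t -> `|f t| <= M) ->
  `|Qk K f b| <= M.
Proof.
move=> mf fM.
have fi : mu.-integrable J (EFin \o f).
  by apply: (@bounded_integrable _ _ _ mu _ _ _ M) => //; [exact: circle_lty|exact: measurable_funTS].
apply: (le_trans (le_normr_Rintegral _ (integrable_ker K b fi))) => //.
apply: (@le_trans _ _ (\int[mu]_(t in J) (M * ker K (b - t)))).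
  apply: le_Rintegral => //.
  - by apply: integrable_norm => //; exact: integrable_ker.
  - by apply: (@integrableZR _ _ _ mu) => //; exact: integrable_ker1.
  - by move=> t Jt; rewrite normrM ger0_norm ?ker_ge0// mulrC ler_wpM2r ?ker_ge0// fM.
by rewrite RintegralZl ?Rintegral_ker ?mulr1//; exact: integrable_ker1.
Qed.

Definition L2J f := measurable_fun setT f /\
  mu.-integrable J (EFin \o (fun t => f t ^+ 2)).

Lemma L2J_integrable f : L2J f -> mu.-integrable J (EFin \o f).
Proof.
move=> [mf f2]; apply: (@le_integrableR _ _ _ mu _ _ _ (fun t => 1 + f t ^+ 2)) => //.
- exact: measurable_funTS.
- move=> t _; have : 0 <= (`|f t| - 1) ^+ 2 by exact: sqr_ge0.
  rewrite -(real_normK (num_real (f t))); have := normr_ge0 (f t); move: (`|f t|) => u; nra.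
- by apply: (@integrableDR _ _ _ mu) => //; exact: integrable_circle_cst.
Qed.

Lemma L2J_bounded f M : measurable_fun setT f -> (forall t, J t -> `|f t| <= M) -> L2J f.
Proof.
move=> mf fM; split => //.
apply: (@bounded_integrable _ _ _ mu _ _ _ (M ^+ 2)) => //; first exact: circle_lty.
  by apply: measurable_funTS; exact: measurable_funX.
by move=> t Jt; rewrite normrX lerXn2r ?nnegrE// ?fM// (le_trans _ (fM t Jt)).
Qed.

Lemma L2J_sub f g : L2J f -> L2J g -> L2J (fun t => f t - g t).
Proof.
move=> [mf f2] [mg g2]; split; first exact: measurable_funB.
apply: (@le_integrableR _ _ _ mu _ _ _ (fun t => 2 * f t ^+ 2 + 2 * g t ^+ 2)) => //.
- by apply: measurable_funTS; apply: measurable_funX; exact: measurable_funB.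
- move=> t _; rewrite ger0_norm ?sqr_ge0//; have := sqr_ge0 (f t + g t); nra.
- by apply: (@integrableDR _ _ _ mu) => //; apply: (@integrableZR _ _ _ mu).
Qed.

Lemma L2J_add f g : L2J f -> L2J g -> L2J (fun t => f t + g t).
Proof.
move=> Lf Lg.
have : L2J (fun t => f t - (0 - g t)).
  apply: L2J_sub => //; apply: L2J_sub => //.
  by apply: (@L2J_bounded _ 0) => // t _; rewrite normr0.
by congr L2J; apply/funext => t; rewrite sub0r opprK.
Qed.

Definition N2 f : R := \int[mu]_(t in J) (f t ^+ 2).

Lemma N2_ge0 f : 0 <= N2 f.
Proof. by apply: Rintegral_ge0 => t _; rewrite sqr_ge0. Qed.

Lemma N2_add3 f g h (k : R -> R) : L2J f -> L2J g -> L2J h -> L2J k ->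
  (forall t, J t -> `|k t| <= `|f t| + `|g t| + `|h t|) ->
  N2 k <= 3 * N2 f + 3 * N2 g + 3 * N2 h.
Proof.
move=> [mf f2] [mg g2] [mh h2] [mk k2] kfgh.
rewrite /N2 -!RintegralZl// -!RintegralD//; try by apply: (@integrableZR _ _ _ mu).
  apply: le_Rintegral => //.
    by repeat (apply: (@integrableDR _ _ _ mu) => //); apply: (@integrableZR _ _ _ mu).
  move=> t Jt.
  have := kfgh t Jt; rewrite -(real_normK (num_real (f t))) -(real_normK (num_real (g t))).
  rewrite -(real_normK (num_real (h t))) -(real_normK (num_real (k t))).
  have := normr_ge0 (f t); have := normr_ge0 (g t); have := normr_ge0 (h t); have := normr_ge0 (k t).
  move: (`|f t|) (`|g t|) (`|h t|) (`|k t|) => x y z w w0 z0 y0 x0 le.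
  have := sqr_ge0 (x - y); have := sqr_ge0 (y - z); have := sqr_ge0 (x - z).
  have : w ^+ 2 <= (x + y + z) ^+ 2 by rewrite lerXn2r ?nnegrE ?addr_ge0.
  by nra.
by apply: (@integrableDR _ _ _ mu) => //; apply: (@integrableZR _ _ _ mu).
Qed.

(** Jensen pointwise, then Fubini: by symmetry the kernel also has mass one in its first variable,
    so integrating over b returns the norm of f. *)
Lemma Qk_L2 K f : L2J f -> L2J (Qk K f) /\ N2 (Qk K f) <= N2 f.
Proof.
move=> Lf; have [mf f2] := Lf; have fi := L2J_integrable Lf.
have mF : measurable_fun setT (fun z : R * R => ker K (z.1 - z.2) * f z.2 ^+ 2).
  apply: measurable_funM; first exact: measurable_kerB.
  by apply: measurable_funX; exact: measurableT_comp.
have [|FE Fi _] := @fubini_on _ _ _ _ _ mu mu J J _ measurable_circle measurable_circle mF.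
  apply: (@fubini_prod_bound _ _ _ _ _ mu mu _ _ _ (cst (2 ^+ K / knorm K)) (fun t => f t ^+ 2)
    measurable_circle measurable_circle mF (integrable_circle_cst _) f2).
  move=> x y _ _ /=; rewrite normrM ler_wpM2r// !ger0_norm ?ker_ge0 ?ker_bounded//.
  exact: le_trans (ker_ge0 K 0) (ker_bounded _ _).
have mQ := measurable_Qk K mf.
have L : L2J (Qk K f).
  split => //; apply: (@le_integrableR _ _ _ mu _ _ _ (Qk K (fun t => f t ^+ 2))) => //.
    by apply: measurable_funTS; exact: measurable_funX.
  by move=> b _; rewrite ger0_norm ?sqr_ge0//; exact: Qk_jensen.
split => //.
have -> : N2 f = \int[mu]_(x in J) Qk K (fun t => f t ^+ 2) x.
  rewrite /Qk [RHS]FE /N2; apply: eq_Rintegral => t _ /=.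
  under eq_Rintegral do rewrite mulrC ker_sym.
  rewrite RintegralZl//; last exact: integrable_ker1.
  by rewrite Rintegral_ker mulr1.
apply: le_Rintegral => //; first by case: L.
by move=> b _; exact: Qk_jensen.
Qed.

End kernel.

Section kernel_convergence.
Variable R : realType.
Notation mu := (@lebesgue_measure R).
Notation J := (@circle R).
Implicit Types (f g phi : R -> R) (b t M delta : R) (K : nat).
Let mJ : measurable J. Proof. exact: measurable_circle. Qed.
Hint Resolve mJ : core.

Lemma ler_cos_pi (x y : R) : 0 <= x -> x <= y -> y <= pi -> cos y <= cos x.
Proof.
move=> x0; rewrite le_eqVlt => /predU1P[->//|xy] yp; apply/ltW.
by rewrite ltr_cos// in_itv/=; apply/andP; split; lra.
Qed.

Lemma cos_le_away delta t : 0 < delta -> delta < pi ->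
  delta <= `|t| <= 2 * pi - delta -> cos t <= cos delta.
Proof.
move=> d0 dpi; have -> : cos t = cos `|t| by case: (ler0P t); rewrite ?cosN.
move: (`|t|) => u /andP[du u2].
case: (lerP u pi) => up; first by apply: ler_cos_pi => //; exact: ltW.
have -> : cos u = cos (2 * pi - u).
  rewrite cosB; have := cos_2pi R 1; have := sin_2pi R 1.
  by rewrite !mul1r => -> ->; rewrite mul1r mul0r addr0.
by apply: ler_cos_pi; lra.
Qed.

(** Away from its peaks the numerator is at most (1 + cos delta)^K, while the normalisation is
    exponentially larger. The argument is also kept below 2 pi - delta because differences of points
    of [0, 2 pi] reach -2 pi and 2 pi, where the kernel peaks again. *)
Lemma ker_away delta : 0 < delta -> delta < pi -> exists2 rho : R, 0 <= rho < 1 &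
  forall K t, delta <= `|t| <= 2 * pi - delta -> ker K t <= 2 / delta * rho ^+ K.
Proof.
move=> d0 dpi.
have c2 : 0 < 1 + cos (delta / 2).
  have : 0 < cos (delta / 2) by apply: cos_gt0_pihalf; apply/andP; split; lra.
  by lra.
have cd : cos delta < cos (delta / 2).
  rewrite ltr_cos ?in_itv/= ?ltW//; lra.
exists ((1 + cos delta) / (1 + cos (delta / 2))).
  apply/andP; split.
    by apply: divr_ge0; [have := cos_geN1 delta; lra|exact: ltW].
  by rewrite ltr_pdivrMr// mul1r ltrD2l.
move=> K t /(cos_le_away d0 dpi) ct.
(* The normalisation is the integral of (1 + cos t)^K over the circle; it is bounded below by the
   part over [0, delta / 2], where 1 + cos t >= 1 + cos (delta / 2). *)
have kn : (delta / 2) * (1 + cos (delta / 2)) ^+ K <= knorm R K.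
  have d2 : 0 <= delta / 2 by lra.
  have sub : `[0, delta / 2]%classic `<=` J.
    by apply: subset_itvl; rewrite bnd_simp; lra.
  have ik : mu.-integrable J (EFin \o (fun t => (1 + cos t) ^+ K)).
    apply: (@eq_integrableR _ _ _ mu _ _ (fun t => knorm R K * ker K t)) => //.
      by move=> x _; rewrite /ker mulrC divfK// gt_eqF// knorm_gt0.
    apply: (@integrableZR _ _ _ mu) => //; apply: continuous_integrable.
    exact: continuous_ker.
  have -> : knorm R K = \int[mu]_(t in J) (1 + cos t) ^+ K.
    have := Rintegral_ker K (0 : R).
    under eq_Rintegral do rewrite ker_sym subr0 /ker mulrC.
    rewrite RintegralZl// => /eqP; rewrite -(inj_eq (mulfI (lt0r_neq0 (knorm_gt0 R K)))).
    by rewrite mulrA divff ?lt0r_neq0 ?knorm_gt0// mul1r mulr1 => /eqP.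
  have ci : mu.-integrable `[0, delta / 2] (EFin \o (fun t => (1 + cos t) ^+ K)).
    by apply: integrableS ik.
  apply: (@le_trans _ _ (\int[mu]_(t in `[0, delta / 2]) (1 + cos t) ^+ K)).
    have -> : delta / 2 * (1 + cos (delta / 2)) ^+ K =
       \int[mu]_(t in `[0, delta / 2]) ((1 + cos (delta / 2)) ^+ K).
      rewrite (FTC2 d2 (is_derive_linM ((1 + cos (delta / 2)) ^+ K)) (@cst_continuous _ _ _)).
      by rewrite mulr0 subr0 mulrC.
    apply: le_Rintegral => //.
      by apply: continuous_integrable; exact: cst_continuous.
    move=> x; rewrite /= in_itv/= => /andP[x0 xd].
    have cx : cos (delta / 2) <= cos x by apply: ler_cos_pi => //; lra.
    by rewrite lerXn2r ?nnegrE ?(ltW c2)//; lra.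
  rewrite /Rintegral fine_le//.
  - by apply: integrable_fin_num.
  - by apply: integrable_fin_num.
  - apply: ge0_subset_integral => //=.
    + exact: measurable_int ik.
    + try by move=> x _; rewrite lee_fin exprn_ge0//; have := cos_geN1 x; lra.
rewrite /ker expr_div_n mulrA ler_pdivrMr ?knorm_gt0//.
have cK : 0 < (1 + cos (delta / 2)) ^+ K by rewrite exprn_gt0.
have : (1 + cos t) ^+ K <= (1 + cos delta) ^+ K.
  by rewrite lerXn2r ?nnegrE ?lerD2l//; have := cos_geN1 t; have := cos_geN1 delta; lra.
have : 0 <= (1 + cos delta) ^+ K.
  by rewrite exprn_ge0//; have := cos_geN1 delta; lra.
move: kn cK; move: ((1 + cos (delta / 2)) ^+ K) ((1 + cos delta) ^+ K) ((1 + cos t) ^+ K) (knorm R K).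
move=> u v w n dn u0 v0 wv; rewrite -mulrA [v / u]mulrC.
apply: (le_trans wv).
rewrite -[leLHS]mul1r -[leRHS](_ : (2 / delta / u * n) * v = _); last by ring.
rewrite ler_wpM2r// -[leLHS](_ : (2 / delta / u) * (delta / 2 * u) = 1).
  by rewrite ler_wpM2l// divr_ge0// ?(ltW u0)// divr_ge0// ltW.
by field; rewrite !gt_eqF.
Qed.

(** The usual approximate identity argument. As [phi] is not assumed periodic, b must be interior:
    at the ends of [0, 2 pi] the kernel also sees the opposite end. *)
Lemma Qk_cvg_pt phi M b : continuous phi -> (forall t, `|phi t| <= M) ->
  0 < b < 2 * pi -> Qk K phi b @[K --> \oo] --> phi b.
Proof.
move=> cphi phiM /andP[b0 b2].
have M0 : 0 <= M by rewrite (le_trans _ (phiM 0)).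
have iphi : mu.-integrable J (EFin \o phi) by exact: continuous_integrable.
apply/cvgrPdist_le => e e0.
have e2 : 0 < e / 2 by rewrite divr_gt0.
have /cvgrPdist_lt /(_ _ e2) := cphi b.
rewrite -nbhs_nearE => /nbhs_ballP[r /= r0 rP].
(* r / 2 is for the continuity of [phi] at b; b and 2 pi - b keep b - t away from the peaks at -2 pi
   and 2 pi for t in [0, 2 pi]; 1 ensures delta < pi. *)
pose delta := Num.min (r / 2) (Num.min b (Num.min (2 * pi - b) 1)).
have d0 : 0 < delta by rewrite !lt_min divr_gt0//= b0 ltr01 subr_gt0 b2.
have dr : delta < r by rewrite gt_min; apply/orP; left; lra.
have db : delta <= b by rewrite !ge_min lexx !orbT.
have db2 : delta <= 2 * pi - b by rewrite !ge_min lexx !orbT.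
have dpi : delta < pi.
  by rewrite !gt_min; apply/orP; right; apply/orP; right; apply/orP; right; have := @pi_ge2 R; lra.
have [rho /andP[rho0 rho1] kr] := ker_away d0 dpi.
have cr : 2 * M * (2 / delta * rho ^+ K) * (2 * pi) @[K --> \oo] --> (0 : R).
  rewrite -[X in _ --> X](_ : 2 * M * (2 / delta * 0) * (2 * pi) = 0); last by rewrite !(mulr0, mul0r).
  apply: cvgMr_tmp; apply: cvgMl_tmp; apply: cvgMl_tmp.
  by apply: cvg_expr; rewrite ger0_norm.
have /cvgrPdist_le /(_ _ e2) crE := cr.
near=> K.
have hK : 2 * M * (2 / delta * rho ^+ K) * (2 * pi) <= e / 2.
  rewrite (le_trans (ler_norm _))// -normrN -sub0r.
  by near: K.
have -> : phi b - Qk K phi b = \int[mu]_(t in J) (ker K (b - t) * (phi b - phi t)).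
  have i1 := integrable_ker1 K b; have i2 := integrable_ker K b iphi.
  have i3 : mu.-integrable J (EFin \o (fun t => phi b * ker K (b - t))).
    by apply: (@integrableZR _ _ _ mu).
  have -> : phi b - Qk K phi b = \int[mu]_(t in J) (phi b * ker K (b - t)) -
      \int[mu]_(t in J) (ker K (b - t) * phi t).
    by rewrite RintegralZl// Rintegral_ker mulr1.
  by rewrite -RintegralB//; apply: eq_Rintegral => t _; ring.
have im : mu.-integrable J (EFin \o (fun t => ker K (b - t) * (phi b - phi t))).
  apply: integrable_ker; apply: (@integrableBR _ _ _ mu) => //; exact: integrable_circle_cst.
apply: (le_trans (le_normr_Rintegral _ im)) => //.
apply: (@le_trans _ _ (\int[mu]_(t in J) (e / 2 * ker K (b - t) + 2 * M * (2 / delta * rho ^+ K)))).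
  have i3 : mu.-integrable J (EFin \o (fun t => e / 2 * ker K (b - t))).
    by apply: (@integrableZR _ _ _ mu) => //; exact: integrable_ker1.
  have i4 := @integrable_circle_cst R (2 * M * (2 / delta * rho ^+ K)).
  apply: le_Rintegral => //.
  - exact: integrable_norm.
  - exact: (@integrableDR _ _ _ mu).
  move=> t; rewrite /circle/= in_itv/= => /andP[t0 t2].
  rewrite normrM ger0_norm ?ker_ge0//.
  have rK : 0 <= 2 * M * (2 / delta * rho ^+ K).
    by rewrite !mulr_ge0// ?exprn_ge0// invr_ge0 ltW.
  case: (ltrP `|b - t| delta) => bt.
    have : `|phi b - phi t| <= e / 2.
      by apply: ltW; apply: rP; rewrite /ball/=; exact: lt_trans dr.
    have := ker_ge0 K (b - t); move: (ker _ _) => k k0 h.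
    by rewrite (le_trans (ler_wpM2l k0 h))// mulrC lerDl.
  have : ker K (b - t) <= 2 / delta * rho ^+ K.
    apply: kr; rewrite bt/= ler_norml; apply/andP; split; lra.
  have : `|phi b - phi t| <= 2 * M.
    by rewrite (le_trans (ler_normB _ _))// mulr_natl mulr2n lerD.
  have := ker_ge0 K (b - t); move: (ker _ _) (2 / delta * rho ^+ K) (`|phi b - phi t|) (normr_ge0 (phi b - phi t)) => k c p p0 k0 p2 kc0.
  apply: (@le_trans _ _ (c * (2 * M))); last by rewrite mulrC lerDr mulr_ge0// ltW.
  by apply: ler_pM.
have i3 : mu.-integrable J (EFin \o (fun t => e / 2 * ker K (b - t))).
  by apply: (@integrableZR _ _ _ mu) => //; exact: integrable_ker1.
rewrite RintegralD//; last exact: integrable_circle_cst.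
rewrite Rintegral_circle_cst RintegralZl//; last exact: integrable_ker1.
by rewrite Rintegral_ker mulr1; lra.
Unshelve. all: by end_near.
Qed.

Lemma Qk_cvg_cont phi M : continuous phi -> (forall t, `|phi t| <= M) ->
  N2 (fun b => Qk K phi b - phi b) @[K --> \oo] --> (0 : R).
Proof.
move=> cphi phiM.
have mphi : measurable_fun setT phi by exact: continuous_measurable_fun.
have mQ K : measurable_fun setT (Qk K phi) by exact: measurable_Qk.
rewrite [X in _ --> X](_ : 0 = \int[mu]_(t in J) (0 : R)); last by rewrite Rintegral_circle_cst mul0r.
apply: (@dct_R _ _ _ mu J _ (fun=> 0) (fun=> (2 * M) ^+ 2)) => //.
- have h K : measurable_fun setT (fun b => (Qk K phi b - phi b) ^+ 2).
    by apply: measurable_funX; exact: measurable_funB.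
  by move=> K; exact: measurable_funTS (h K).
- have n0 : mu.-negligible ([set 0] `|` [set 2 * pi]).
    by apply: negligibleU; apply/negligibleP => //; exact: lebesgue_measure_set1.
  apply: negligibleS n0 => b /=; rewrite not_implyE => -[Jb nc].
  apply: contrapT => nb; apply: nc.
  have bI : 0 < b < 2 * pi.
    move: Jb; rewrite /circle/= in_itv/= => /andP[b0 b2].
    rewrite !lt_neqAle b0 b2 !andbT; apply/andP; split; apply/negP => /eqP h; apply: nb; [left|right] => //.
  have cv := Qk_cvg_pt cphi phiM bI.
  rewrite [X in _ --> X](_ : 0 = (phi b - phi b) * (phi b - phi b)); last by rewrite subrr mul0r.
  under eq_cvg do rewrite expr2.
  by apply: cvgM; apply: cvgB => //; exact: cvg_cst.
- exact: integrable_circle_cst.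
- move=> K b Jb; rewrite normrX lerXn2r ?nnegrE ?mulr_ge0//.
    by rewrite (le_trans _ (phiM 0)).
  rewrite (le_trans (ler_normB _ _))// mulr_natl mulr2n lerD//.
  exact: Qk_bounded.
Qed.

(** Truncation to [- M, M]. Being 1-Lipschitz it preserves continuity, and it brings an
    L1-approximation back to bounded functions without increasing the error. *)
Definition clip M (x : R) : R := Num.max (- M) (Num.min M x).

Lemma clip_bounded M x : 0 <= M -> `|clip M x| <= M.
Proof.
move=> M0; rewrite ler_norml /clip le_max lexx/= ge_max ge_min lexx/= andbT; lra.
Qed.

Lemma clip_lip M x y : 0 <= M -> `|clip M x - clip M y| <= `|x - y|.
Proof.
move=> M0; rewrite /clip /Num.max /Num.min.
case: ifPn; case: ifPn; case: ifPn; case: ifPn; rewrite -?leNgt => *;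
rewrite ler_norml; have := ler_norm (x - y); have := ler_norm (y - x); rewrite (distrC y x) => *; apply/andP; split; lra.
Qed.

Lemma clip_id M x : `|x| <= M -> clip M x = x.
Proof.
rewrite ler_norml => /andP[a b]; rewrite /clip (min_idPr b); apply/max_idPr.
by [].
Qed.

Lemma clip_norm M x : 0 <= M -> `|x - clip M x| <= `|x|.
Proof.
move=> M0; rewrite /clip /Num.max /Num.min.
case: ifPn; case: ifPn; rewrite -?leNgt => *;
rewrite ler_norml; have := ler_norm x; have := ler_norm (- x); rewrite normrN => *; apply/andP; split; lra.
Qed.

Lemma continuous_clip M : 0 <= M -> continuous (clip M).
Proof.
move=> M0 x; apply/cvgrPdist_lt => e e0; near=> y.
apply: (le_lt_trans (clip_lip _ _ M0)).
by near: y; apply/nbhs_ballP; exists e.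
Unshelve. all: by end_near.
Qed.

Lemma N2_sym f g : N2 (fun t => f t - g t) = N2 (fun t => g t - f t).
Proof. by apply: eq_Rintegral => t _; rewrite -sqrrN opprB. Qed.

Lemma N2_clip f : L2J f -> N2 (fun t => f t - clip n%:R (f t)) @[n --> \oo] --> (0 : R).
Proof.
move=> [mf f2].
have mc M : 0 <= M -> measurable_fun setT (clip M).
  by move=> M0; apply: continuous_measurable_fun; exact: continuous_clip.
rewrite [X in _ --> X](_ : 0 = \int[mu]_(t in J) (0 : R)); last by rewrite Rintegral_circle_cst mul0r.
apply: (@dct_R _ _ _ mu J _ (fun=> 0) (fun t => f t ^+ 2)) => //.
- have h (n : nat) : measurable_fun setT (fun t => (f t - clip n%:R (f t)) ^+ 2).
    apply: measurable_funX; apply: measurable_funB => //.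
    by apply: measurableT_comp => //; exact: mc.
  by move=> n; exact: measurable_funTS (h n).
- apply: nearW => t _; apply: cvg_near_cst.
  near=> n; rewrite clip_id ?subrr ?expr0n//.
  by near: n; exact: nbhs_infty_ger.
- move=> n t _; rewrite ger0_norm ?sqr_ge0//.
  rewrite -(real_normK (num_real (f t - _))) -(real_normK (num_real (f t))).
  by rewrite lerXn2r ?nnegrE// clip_norm.
Unshelve. all: by end_near.
Qed.

(* Truncate, then use the density of continuous functions in L1. *)
Lemma L2J_approx f (e : R) : L2J f -> 0 < e -> exists phi M,
  [/\ continuous phi, forall t, `|phi t| <= M & N2 (fun t => f t - phi t) <= e].
Proof.
move=> Lf e0; have [mf f2] := Lf.
have e4 : 0 < e / 6 by rewrite divr_gt0.
have /cvgrPdist_le /(_ _ e4) [n _ /(_ n (leqnn n))] := N2_clip Lf.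
rewrite sub0r normrN ger0_norm ?N2_ge0// => fn.
set M : R := n%:R in fn; have M0 : 0 <= M by [].
pose fM t := clip M (f t).
have mfM : measurable_fun setT fM.
  by apply: measurableT_comp => //; apply: continuous_measurable_fun; exact: continuous_clip.
have fMM t : `|fM t| <= M by exact: clip_bounded.
have LfM : L2J fM by apply: (@L2J_bounded _ _ M).
have ifM := L2J_integrable LfM.
have [g [cg ig gcv]] := approximation_continuous_integrable mJ (circle_lty R) ifM.
pose eta := e / (6 * (2 * M + 1)).
have eta0 : 0 < eta by rewrite divr_gt0// mulr_gt0//; lra.
have [k kP] : exists k, \int[mu]_(t in J) `|fM t - g k t| <= eta.
  move/fine_cvgP : gcv => [_ /cvgrPdist_le /(_ _ eta0) [k _ /(_ k (leqnn k))]].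
  rewrite sub0r normrN => h; exists k; apply: le_trans h.
  by rewrite (le_trans _ (ler_norm _)).
pose phi t := clip M (g k t).
have phiM t : `|phi t| <= M by exact: clip_bounded.
have cphi : continuous phi.
  move=> t; apply/cvgrPdist_lt => eps eps0.
  have /cvgrPdist_lt /(_ _ eps0) := cg k t.
  by apply: filterS => y; apply: le_lt_trans; exact: clip_lip.
have mphi := continuous_measurable_fun cphi.
have Lphi : L2J phi by apply: (@L2J_bounded _ _ M).
exists phi, M; split => //.
(* Both functions are bounded by M, so one factor of the square is at most 2 M; since [clip] fixes
   [fM], the other is at most the distance from [fM] to [g k]. Closeness in L1 thus yields closeness
   in L2. *)
have h1 : N2 (fun t => fM t - phi t) <= 2 * M * eta.
  have i1 : mu.-integrable J (EFin \o (fun t => `|fM t - g k t|)).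
    apply: integrable_norm => //.
    by apply: (@integrableBR _ _ _ mu) => //; exact: ig.
  apply: (@le_trans _ _ (\int[mu]_(t in J) (2 * M * `|fM t - g k t|))); last first.
    by rewrite RintegralZl//; rewrite ler_wpM2l// mulr_ge0.
  apply: le_Rintegral => //.
  - by have [] := L2J_sub LfM Lphi.
  - by apply: (@integrableZR _ _ _ mu) => //.
  move=> t _; rewrite -(real_normK (num_real _)) expr2.
  apply: ler_pM => //.
    by rewrite (le_trans (ler_normB _ _))// mulr_natl mulr2n lerD.
  rewrite -{1}(clip_id (fMM t)); exact: clip_lip.
have h2 : 2 * M * eta <= e / 6.
  rewrite /eta; rewrite -[leLHS](_ : e / 6 * (2 * M / (2 * M + 1)) = _); last by field; lra.
  by apply: ler_piMr; [exact: ltW|rewrite ler_pdivrMr; lra].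
have := @N2_add3 R _ _ (fun=> 0) (fun t => f t - phi t) (L2J_sub Lf LfM) (L2J_sub LfM Lphi).
have L0 : L2J (fun=> 0 : R) by apply: (@L2J_bounded _ _ 0) => // t _; rewrite normr0.
have -> : N2 (fun=> 0 : R) = 0.
  by rewrite /N2; under eq_Rintegral do rewrite expr0n/=; rewrite Rintegral_circle_cst mul0r.
move=> /(_ L0 (L2J_sub Lf Lphi)) H.
have {}H : N2 (fun t => f t - phi t) <=
    3 * N2 (fun t => f t - fM t) + 3 * N2 (fun t => fM t - phi t) + 3 * 0.
  apply: H => t _; rewrite normr0 addr0 -[f t - phi t](_ : (f t - fM t) + (fM t - phi t) = _); last by ring.
  exact: ler_normD.
by move: H fn h1 h2; move: (N2 _) (N2 _) (N2 _) => a b c; lra.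
Qed.

(** Three-term argument: approximate f by a bounded continuous function, use convergence there, and
    use the L2 contraction for the error. *)
Lemma Qk_cvg f : L2J f -> N2 (fun b => Qk K f b - f b) @[K --> \oo] --> (0 : R).
Proof.
move=> Lf; apply/cvgrPdist_le => e e0.
have e18 : 0 < e / 12 by rewrite divr_gt0.
have [phi [M [cphi phiM fphi]]] := L2J_approx Lf e18.
have mphi := continuous_measurable_fun cphi.
have Lphi : L2J phi by apply: (@L2J_bounded _ _ M).
have e6 : 0 < e / 6 by rewrite divr_gt0.
have /cvgrPdist_le /(_ _ e6) cv := Qk_cvg_cont cphi phiM.
near=> K.
rewrite sub0r normrN ger0_norm ?N2_ge0//.
have h1 : N2 (fun b => Qk K phi b - phi b) <= e / 6.
  by rewrite -[leLHS]ger0_norm ?N2_ge0// -normrN -sub0r; near: K.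
have Lfp := L2J_sub Lf Lphi.
have [LQ NQ] := Qk_L2 K Lfp.
have LQf := (Qk_L2 K Lf).1; have LQp := (Qk_L2 K Lphi).1.
have := @N2_add3 R _ _ (fun b => phi b - f b) (fun b => Qk K f b - f b) LQ (L2J_sub LQp Lphi)
  (L2J_sub Lphi Lf) (L2J_sub LQf Lf).
rewrite (N2_sym phi f) => H.
have {}H : N2 (fun b => Qk K f b - f b) <= 3 * N2 (Qk K (fun t => f t - phi t)) +
    3 * N2 (fun b => Qk K phi b - phi b) + 3 * N2 (fun t => f t - phi t).
  apply: H => t _; rewrite Qk_sub; [|exact: L2J_integrable|exact: L2J_integrable].
  rewrite -[Qk K f t - f t](_ : (Qk K f t - Qk K phi t) + (Qk K phi t - phi t) + (phi t - f t) = _); last by ring.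
  by rewrite (le_trans (ler_normD _ _))// lerD2r ler_normD.
by move: H NQ fphi h1; move: (N2 _) (N2 _) (N2 _) (N2 _) => a b c d; lra.
Unshelve. all: by end_near.
Qed.

End kernel_convergence.

Section complex_circle.
Variable R : realType.
Notation mu := (@lebesgue_measure R).
Notation J := (@circle R).
Implicit Types (f g : R -> R[i]) (a b t k : R) (K : nat) (D : set R).
Let mJ : measurable J. Proof. exact: measurable_circle. Qed.
Hint Resolve mJ : core.

Definition integrableC D f := mu.-integrable D (EFin \o (fun t => complex.Re (f t))) /\
  mu.-integrable D (EFin \o (fun t => complex.Im (f t))).

Definition cint D f : R[i] :=
  (\int[mu]_(t in D) complex.Re (f t)) +i* (\int[mu]_(t in D) complex.Im (f t)).

Lemma cintZ D (c : R[i]) f : measurable D -> integrableC D f ->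
  cint D (fun t => c * f t) = c * cint D f.
Proof.
move=> mD [i1 i2]; apply: complex_ext; rewrite !ReImE/=.
  under eq_Rintegral do rewrite ReM.
  by rewrite RintegralB ?RintegralZl//; apply: (@integrableZR _ _ _ mu).
under eq_Rintegral do rewrite ImM.
by rewrite RintegralD ?RintegralZl//; apply: (@integrableZR _ _ _ mu).
Qed.

Lemma integrableCZ D (c : R[i]) f : measurable D -> integrableC D f ->
  integrableC D (fun t => c * f t).
Proof.
move=> mD [i1 i2]; split.
  apply: (@eq_integrableR _ _ _ mu _ _ (fun t => complex.Re c * complex.Re (f t) - complex.Im c * complex.Im (f t))) => //.
    by move=> t _; rewrite ReM.
  by apply: (@integrableBR _ _ _ mu) => //; apply: (@integrableZR _ _ _ mu).
apply: (@eq_integrableR _ _ _ mu _ _ (fun t => complex.Re c * complex.Im (f t) + complex.Im c * complex.Re (f t))) => //.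
  by move=> t _; rewrite ImM.
by apply: (@integrableDR _ _ _ mu) => //; apply: (@integrableZR _ _ _ mu).
Qed.

Lemma cint_sum D n (f : 'I_n -> R -> R[i]) : measurable D ->
  (forall i, integrableC D (f i)) ->
  cint D (fun t => \sum_(i < n) f i t) = \sum_(i < n) cint D (f i).
Proof.
move=> mD fi; apply: complex_ext; rewrite ?Re_sum ?Im_sum/=.
  under eq_Rintegral do rewrite Re_sum.
  by rewrite (@Rintegral_sumR _ _ _ mu)// => i; case: (fi i).
under eq_Rintegral do rewrite Im_sum.
by rewrite (@Rintegral_sumR _ _ _ mu)// => i; case: (fi i).
Qed.

Lemma eq_cint D f g : (forall t, D t -> f t = g t) -> cint D f = cint D g.
Proof.
by move=> fg; congr (_ +i* _); apply: eq_Rintegral => t /set_mem Dt; rewrite fg.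
Qed.

Definition L2c f := L2J (fun t => complex.Re (f t)) /\ L2J (fun t => complex.Im (f t)).

Definition n2 f : R := \int[mu]_(t in J) csq (f t).

Lemma n2_ge0 f : 0 <= n2 f.
Proof. by apply: Rintegral_ge0 => t _; exact: csq_ge0. Qed.

Lemma L2c_integrable f : L2c f -> mu.-integrable J (EFin \o (fun t => csq (f t))).
Proof. by move=> [[_ h1] [_ h2]]; exact: (@integrableDR _ _ _ mu). Qed.

Lemma n2E f : L2c f ->
  n2 f = N2 (fun t => complex.Re (f t)) + N2 (fun t => complex.Im (f t)).
Proof. by move=> [[_ h1] [_ h2]]; rewrite /n2 /csq RintegralD. Qed.

Lemma L2c_sub f g : L2c f -> L2c g -> L2c (fun t => f t - g t).
Proof.
move=> [h1 h2] [h3 h4]; split.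
  by have := L2J_sub h1 h3; congr L2J; apply/funext => t; rewrite ReD ReN.
by have := L2J_sub h2 h4; congr L2J; apply/funext => t; rewrite ImD ImN.
Qed.

Lemma L2cZ (c : R[i]) f : L2c f -> L2c (fun t => c * f t).
Proof.
have Z (x : R) h : L2J h -> L2J (fun t => x * h t).
  move=> [mh h2]; split; first exact: measurable_funM.
  apply: (@eq_integrableR _ _ _ mu _ _ (fun t => x ^+ 2 * h t ^+ 2)) => //.
    by move=> t _; rewrite exprMn.
  by apply: (@integrableZR _ _ _ mu).
move=> [h1 h2]; split.
  by have := L2J_sub (Z (complex.Re c) _ h1) (Z (complex.Im c) _ h2);
    congr L2J; apply/funext => t; rewrite ReM.
by have := L2J_add (Z (complex.Re c) _ h2) (Z (complex.Im c) _ h1);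
  congr L2J; apply/funext => t; rewrite ImM.
Qed.

Lemma L2c_le f g (M : R) : measurable_fun setT (fun t => complex.Re (f t)) ->
  measurable_fun setT (fun t => complex.Im (f t)) ->
  L2c g -> (forall t, J t -> csq (f t) <= M * csq (g t)) -> L2c f.
Proof.
move=> m1 m2 Lg fg; have ig := L2c_integrable Lg.
have iM : mu.-integrable J (EFin \o (fun t => M * csq (g t))) by apply: (@integrableZR _ _ _ mu).
split; split=> //; apply: (@le_integrableR _ _ _ mu _ _ _ (fun t => M * csq (g t))) => //.
- by apply: measurable_funTS; exact: measurable_funX.
- by move=> t Jt; rewrite ger0_norm ?sqr_ge0// (le_trans (sqr_Re_le _))// fg.
- by apply: measurable_funTS; exact: measurable_funX.
- by move=> t Jt; rewrite ger0_norm ?sqr_ge0// (le_trans (sqr_Im_le _))// fg.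
Qed.

Lemma n2_le f g (M : R) : L2c f -> L2c g ->
  (forall t, J t -> csq (f t) <= M * csq (g t)) -> n2 f <= M * n2 g.
Proof.
move=> Lf Lg fg; rewrite /n2 -RintegralZl//; last exact: L2c_integrable.
apply: le_Rintegral => //; first exact: L2c_integrable.
by apply: (@integrableZR _ _ _ mu) => //; exact: L2c_integrable.
Qed.

Lemma L2c_integrableC f : L2c f -> integrableC J f.
Proof. by case=> h1 h2; split; exact: L2J_integrable. Qed.

(** The difference of the two sides is [e^-1] times the square of e x - y, taken on each part. It
    replaces the triangle inequality, so that square roots of integrals never appear. *)
Lemma csqD_eps (x y : R[i]) (e : R) : 0 < e ->
  csq (x + y) <= (1 + e) * csq x + (1 + e^-1) * csq y.
Proof.
move=> e0; rewrite /csq !ReImE.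
have h (p q : R) : (p + q) ^+ 2 <= (1 + e) * p ^+ 2 + (1 + e^-1) * q ^+ 2.
  rewrite -subr_ge0.
  rewrite (_ : _ - _ = e^-1 * (e * p - q) ^+ 2); last by field; rewrite gt_eqF.
  by rewrite mulr_ge0 ?invr_ge0 ?sqr_ge0 ?ltW.
have := h (complex.Re x) (complex.Re y); have := h (complex.Im x) (complex.Im y).
by move: (e^-1) => e'; lra.
Qed.

Lemma n2D_eps f g h (e : R) : 0 < e -> L2c f -> L2c g -> L2c h ->
  (forall t, J t -> h t = f t + g t) -> n2 h <= (1 + e) * n2 f + (1 + e^-1) * n2 g.
Proof.
move=> e0 Lf Lg Lh hE; have i1 := L2c_integrable Lf; have i2 := L2c_integrable Lg.
have i3 : mu.-integrable J (EFin \o (fun t => (1 + e) * csq (f t))) by exact: (@integrableZR _ _ _ mu).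
have i4 : mu.-integrable J (EFin \o (fun t => (1 + e^-1) * csq (g t))) by exact: (@integrableZR _ _ _ mu).
rewrite /n2 -!RintegralZl// -RintegralD//; apply: le_Rintegral => //.
- exact: L2c_integrable.
- exact: (@integrableDR _ _ _ mu).
- by move=> t Jt; rewrite hE//; exact: csqD_eps.
Qed.

Definition Qc K f b : R[i] :=
  Qk K (fun t => complex.Re (f t)) b +i* Qk K (fun t => complex.Im (f t)) b.

Lemma Qc_L2 K f : L2c f -> L2c (Qc K f) /\ n2 (Qc K f) <= n2 f.
Proof.
move=> Lf; have [L1 L2] := Lf.
have [h1 e1] := Qk_L2 K L1; have [h2 e2] := Qk_L2 K L2.
have L : L2c (Qc K f) by split.
by split => //; rewrite !n2E// lerD.
Qed.

Lemma Qc_cvg f : L2c f -> n2 (fun b => Qc K f b - f b) @[K --> \oo] --> (0 : R).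
Proof.
move=> Lf; have [L1 L2] := Lf.
rewrite [X in _ --> X](_ : 0 = 0 + 0); last by rewrite addr0.
rewrite (_ : (fun K => n2 (fun b => Qc K f b - f b)) = (fun K => N2 (fun b => Qk K (fun t => complex.Re (f t)) b - complex.Re (f b)) +
   N2 (fun b => Qk K (fun t => complex.Im (f t)) b - complex.Im (f b)))).
  by apply: cvgD; exact: Qk_cvg.
apply/funext => K; rewrite n2E; last by apply: L2c_sub => //; exact: (Qc_L2 K Lf).1.
by congr (N2 _ + N2 _); apply/funext => t; rewrite ?(ReD, ReN, ImD, ImN).
Qed.

(** One side is the contraction; the other comes from [n2D_eps] applied to f = Qc f + (f - Qc f),
    with eta chosen so that eta times the norm of f is below e / 2. *)
Lemma n2_Qc_cvg f : L2c f -> n2 (Qc K f) @[K --> \oo] --> n2 f.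
Proof.
move=> Lf; apply/cvgrPdist_le => e e0.
have nf := n2_ge0 f.
pose eta := e / (2 * (n2 f + 1)).
have eta0 : 0 < eta by rewrite divr_gt0// mulr_gt0//; lra.
have eta2 : eta * n2 f <= e / 2.
  rewrite /eta -[leLHS](_ : e / 2 * (n2 f / (n2 f + 1)) = _); last by field; lra.
  by rewrite ler_piMr ?divr_ge0 ?ltW// ltr_pdivrMr; lra.
have c0 : 0 < 1 + eta^-1 by rewrite addr_gt0 ?invr_gt0.
have d0 : 0 < e / 2 / (1 + eta^-1) by rewrite !divr_gt0.
have /cvgrPdist_le /(_ _ d0) cv := Qc_cvg Lf.
near=> K; have [LQ le] := Qc_L2 K Lf.
have h : n2 (fun b => f b - Qc K f b) <= e / 2 / (1 + eta^-1).
  have -> : n2 (fun b => f b - Qc K f b) = n2 (fun b => Qc K f b - f b).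
    by apply: eq_Rintegral => t _; rewrite -opprB /csq !ReN !ImN !sqrrN.
  by rewrite -[leLHS]ger0_norm ?n2_ge0// -normrN -sub0r; near: K.
have := n2D_eps eta0 LQ (L2c_sub Lf LQ) Lf (fun t _ => esym (subrKC _ _)).
have {}h : (1 + eta^-1) * n2 (fun b => f b - Qc K f b) <= e / 2.
  by rewrite mulrC -ler_pdivlMr.
have h2 : eta * n2 (Qc K f) <= eta * n2 f by rewrite ler_pM2l.
by move=> H; rewrite ger0_norm ?subr_ge0//; lra.
Unshelve. all: by end_near.
Qed.

Definition mode k f : R[i] := cint J (fun t => cis (- (k * t)) * f t).

(** The convolution [Qc K f] is a trigonometric polynomial with modes from -K to K. Shifting the
    modes by K makes it a genuine polynomial, and the factor e^(- (j - K) x) compensates for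
    evaluation on the circle of radius e^x; see [polyK_eval]. *)
Definition polyK K (x : R) f : {poly R[i]} := \poly_(j < K.*2.+1)
  ((kc R K j * expR (- ((j%:R - K%:R) * x)))%:C * mode (j%:R - K%:R) f).

Lemma integrableC_cis k f : integrableC J f ->
  integrableC J (fun t => cis (- (k * t)) * f t).
Proof.
move=> [i1 i2].
have bc (h : R -> R) : mu.-integrable J (EFin \o h) ->
    mu.-integrable J (EFin \o (fun t => cos (- (k * t)) * h t)).
  move=> ih; apply: (@integrable_bndM _ _ _ mu _ _ _ _ 1) => //.
    under eq_fun do rewrite cosN.
    by apply: measurable_funTS; apply: continuous_measurable_fun; exact: continuous_cosM.
  by move=> t _; rewrite ler_norml cos_geN1 cos_le1.
have bs (h : R -> R) : mu.-integrable J (EFin \o h) ->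
    mu.-integrable J (EFin \o (fun t => sin (- (k * t)) * h t)).
  move=> ih; apply: (@integrable_bndM _ _ _ mu _ _ _ _ 1) => //.
    under eq_fun do rewrite -mulNr.
    by apply: measurable_funTS; apply: continuous_measurable_fun; exact: continuous_sinM.
  by move=> t _; rewrite ler_norml sin_geN1 sin_le1.
split.
  apply: (@eq_integrableR _ _ _ mu _ _ (fun t => cos (- (k * t)) * complex.Re (f t) - sin (- (k * t)) * complex.Im (f t))) => //.
    by move=> t _; rewrite ReM.
  by apply: (@integrableBR _ _ _ mu) => //; [exact: bc|exact: bs].
apply: (@eq_integrableR _ _ _ mu _ _ (fun t => cos (- (k * t)) * complex.Im (f t) + sin (- (k * t)) * complex.Re (f t))) => //.
  by move=> t _; rewrite ImM.
by apply: (@integrableDR _ _ _ mu) => //; [exact: bc|exact: bs].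
Qed.

Lemma Qc_mode K f b : L2c f -> Qc K f b =
  \sum_(j < K.*2.+1) (kc R K j)%:C * cis ((j%:R - K%:R) * b) * mode (j%:R - K%:R) f.
Proof.
move=> Lf; have fi := L2c_integrableC Lf.
have -> : Qc K f b = cint J (fun t => (ker K (b - t))%:C * f t).
  by congr (_ +i* _); apply: eq_Rintegral => t _; rewrite ?ReM ?ImM/= mul0r ?subr0 ?addr0.
transitivity (cint J (fun t => \sum_(j < K.*2.+1)
    ((kc R K j)%:C * cis ((j%:R - K%:R) * b)) * (cis (- ((j%:R - K%:R) * t)) * f t))).
  apply: eq_cint => t _; rewrite kerE mulr_suml; apply: eq_bigr => j _.
  by rewrite mulrBr cisD !mulrA.
rewrite cint_sum//; last first.
  by move=> j; apply: integrableCZ => //; exact: integrableC_cis.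
by apply: eq_bigr => j _; rewrite cintZ//; exact: integrableC_cis.
Qed.

Lemma polyK_eval K x f b : L2c f ->
  (polyK K x f).[zeta x b] = zeta x b ^+ K * Qc K f b.
Proof.
move=> Lf; rewrite Qc_mode// mulr_sumr horner_poly; apply: eq_bigr => j _.
rewrite !zetaX /zeta mulrBl real_complexM.
have -> : (expR (j%:R * x))%:C = (expR ((j%:R - K%:R) * x))%:C * (expR (K%:R * x))%:C.
  by rewrite -real_complexM -expRD; congr ((expR _)%:C); ring.
have -> : cis (j%:R * b) = cis (j%:R * b - K%:R * b) * cis (K%:R * b).
  by rewrite -cisD; congr cis; ring.
have e : (expR (- (j%:R * x - K%:R * x)))%:C * (expR (j%:R * x - K%:R * x))%:C = 1 :> R[i].
  by rewrite -real_complexM -expRD addNr expR0.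
rewrite mulrBl; move: e; set e1 := (expR (- _))%:C; set e2 := (expR (_ - _))%:C => e.
rewrite -[LHS](_ : (e1 * e2) * ((kc R K j)%:C * mode (j%:R - K%:R) f * (expR (K%:R * x))%:C * (cis (j%:R * b - K%:R * b) * cis (K%:R * b))) = _); last by ring.
by rewrite e mul1r mulrBl; ring.
Qed.

Lemma size_polyK K x f : (size (polyK K x f) <= K.*2.+1)%N.
Proof. exact: size_poly. Qed.

Lemma csq_polyK K x f b : L2c f ->
  csq (polyK K x f).[zeta x b] = expR (2 * K%:R * x) * csq (Qc K f b).
Proof.
move=> Lf; rewrite polyK_eval// csqM csqX csq_zeta -expRM_natl.
by congr (expR _ * _); ring.
Qed.

(** Bessel's inequality: one term of the Parseval sum of [Qc K f], followed by the L2 contraction.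
    Coefficients beyond the degree are 0. *)
Lemma csq_coef_polyK K f (j : nat) : L2c f ->
  2 * pi * csq (polyK K 0 f)`_j <= n2 f.
Proof.
move=> Lf; have [LQ le] := Qc_L2 K Lf; apply: le_trans le.
have -> : n2 (Qc K f) = \int[mu]_(b in J) csq (polyK K 0 f).[zeta 0 b].
  by apply: eq_Rintegral => b _; rewrite csq_polyK// mulr0 expR0 mul1r.
rewrite (parseval_poly _ (size_polyK K 0 f)).
apply: ler_wpM2l; first by rewrite mulr_ge0// pi_ge0.
case: (ltnP j K.*2.+1) => jK.
  rewrite (bigD1 (Ordinal jK))//= !mulr0 expR0 mul1r lerDl.
  by apply: sumr_ge0 => i _; rewrite mulr_ge0 ?expR_ge0 ?csq_ge0.
rewrite nth_default ?csq0; last by rewrite (leq_trans (size_polyK _ _ _)).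
by apply: sumr_ge0 => i _; rewrite mulr_ge0 ?expR_ge0 ?csq_ge0.
Qed.

Lemma coef_polyK K x f j : (polyK K x f)`_j =
  (expR (- ((j%:R - K%:R) * x)))%:C * (polyK K 0 f)`_j.
Proof.
rewrite !coef_poly; case: ifP => _; last by rewrite mulr0.
by rewrite mulr0 oppr0 expR0 mulr1 real_complexM mulrA [_ * (kc _ _ _)%:C]mulrC.
Qed.

Lemma csq_coef_polyK_le K x f (j : nat) : L2c f ->
  csq (polyK K x f)`_j <= expR (- (2 * (j%:R - K%:R) * x)) * n2 f.
Proof.
move=> Lf; rewrite coef_polyK csqM csq_real -expRM_natl.
rewrite (_ : 2%:R * - _ = - (2 * (j%:R - K%:R) * x)); last by ring.
apply: ler_wpM2l; first exact: expR_ge0.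
apply: le_trans (csq_coef_polyK K j Lf).
by rewrite ler_peMl ?csq_ge0//; have := @pi_ge2 R; lra.
Qed.

End complex_circle.

(** * Evolution of the Fourier modes *)

Import HBNNSimple.

Section ae_modification.
Context d (T : measurableType d) (R : realType) (m : {measure set T -> \bar R}).
Implicit Types (D : set T).

(** A simple function below f, multiplied by the indicator of the complement of the exceptional null
    set, lies below g everywhere and has the same integral. *)
Lemma le_ae_integralT (f g : T -> \bar R) : (forall x, 0 <= f x)%E ->
  (forall x, 0 <= g x)%E -> {ae m, forall x, (f x <= g x)%E} ->
  (\int[m]_x f x <= \int[m]_x g x)%E.
Proof.
move=> f0 g0 [N [mN N0 fgN]].
rewrite [leLHS]ge0_integralTE// [leRHS]ge0_integralTE//.
apply: ge_ereal_sup => _ [h /= hf <-].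
apply: ereal_sup_ubound => /=; exists (proj_nnsfun h (measurableC mN)).
  move=> x; have := hf x; rewrite /= mindicE.
  case: (boolP (x \in ~` N)) => xN; last by rewrite mulr0.
  rewrite mulr1 => /le_trans; apply.
  by apply: contrapT => fg; move/set_mem : xN; apply; exact: fgN.
rewrite -!integralT_nnsfun; apply: ae_eq_integral => //.
- by apply/measurable_EFinP; exact: measurable_funP.
- by apply/measurable_EFinP; exact: measurable_funP.
exists N; split => // x /=; apply: contra_notP => xN _ /=.
by rewrite mindicE mem_set ?mulr1.
Qed.

(* No measurability is needed: the integral of a nonnegative function is a
   supremum over simple functions below it. *)
Lemma ae_eq_integral_gen D (f g : T -> \bar R) :
  {ae m, forall x, D x -> f x = g x} ->
  (\int[m]_(x in D) f x = \int[m]_(x in D) g x)%E.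
Proof.
move=> fg; rewrite integral_mkcond [RHS]integral_mkcond.
have {}fg : {ae m, forall x, (f \_ D) x = (g \_ D) x}.
  apply: filterS fg => x h; rewrite !patchE; case: ifPn => // /set_mem; exact: h.
rewrite integralE [RHS]integralE.
have P (u v : T -> \bar R) : {ae m, forall x, u x = v x} ->
    (\int[m]_x u^\+ x = \int[m]_x v^\+ x)%E.
  move=> uv; apply/eqP; rewrite eq_le; apply/andP; split; apply: le_ae_integralT => //.
    by apply: filterS uv => x; rewrite !funeposE => ->.
  by apply: filterS uv => x; rewrite !funeposE => ->.
have Q (u v : T -> \bar R) : {ae m, forall x, u x = v x} ->
    (\int[m]_x u^\- x = \int[m]_x v^\- x)%E.
  move=> uv; apply/eqP; rewrite eq_le; apply/andP; split; apply: le_ae_integralT => //.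
    by apply: filterS uv => x; rewrite !funenegE => ->.
  by apply: filterS uv => x; rewrite !funenegE => ->.
by rewrite (P _ _ fg) (Q _ _ fg).
Qed.

Lemma ae_eq_Rintegral D (f g : T -> R) :
  {ae m, forall x, D x -> f x = g x} ->
  \int[m]_(x in D) f x = \int[m]_(x in D) g x.
Proof.
move=> fg; congr fine; apply: ae_eq_integral_gen.
by apply: filterS fg => x h Dx; rewrite h.
Qed.

(** Measurability is asked of the domain, and integrability of the majorant; through
    [le_ae_integralT] nothing else is needed to compare. It serves for integrands whose
    measurability would be tedious to check. *)
Lemma le_Rintegral_gen D (f g : T -> R) : measurable D ->
  (forall x, D x -> 0 <= f x <= g x) -> m.-integrable D (EFin \o g) ->
  \int[m]_(x in D) f x <= \int[m]_(x in D) g x.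
Proof.
move=> mD fg ig.
have le : (\int[m]_(x in D) (f x)%:E <= \int[m]_(x in D) (g x)%:E)%E.
  rewrite integral_mkcond [leRHS]integral_mkcond; apply: le_ae_integralT.
  - by apply: erestrict_ge0 => x /fg /andP[f0 _]; rewrite lee_fin.
  - by apply: erestrict_ge0 => x /fg /andP[f0 fg']; rewrite lee_fin (le_trans f0).
  - apply: aeW => x; rewrite !patchE; case: ifPn => // /set_mem /fg /andP[_ fg'].
    by rewrite lee_fin.
have gfin : (\int[m]_(x in D) (g x)%:E)%E \is a fin_num by apply: integrable_fin_num.
apply: fine_le => //; rewrite ge0_fin_numE.
  by apply: (le_lt_trans le); rewrite -ge0_fin_numE// (le_trans _ le)//;
    apply: integral_ge0 => x /fg /andP[f0 _]; rewrite lee_fin.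
by apply: integral_ge0 => x /fg /andP[f0 _]; rewrite lee_fin.
Qed.

Lemma ae_mono (P Q : T -> Prop) : (forall x, P x -> Q x) ->
  {ae m, forall x, P x} -> {ae m, forall x, Q x}.
Proof. by move=> PQ; apply: filterS. Qed.

Lemma ae_conj (P Q : T -> Prop) : {ae m, forall x, P x} -> {ae m, forall x, Q x} ->
  {ae m, forall x, P x /\ Q x}.
Proof. by apply: filterS2 => x. Qed.

Lemma ae_all (I : countType) (P : I -> T -> Prop) : (forall i, {ae m, forall x, P i x}) ->
  {ae m, forall x, forall i, P i x}.
Proof.
move=> h; have h' : {ae m, forall x, forall n : nat, if @unpickle I n is Some i then P i x else True}.
  by apply: ae_foralln => n; case: unpickle => [i|]; [exact: h|exact: aeW].
apply: filterS h' => x hx i; have := hx (pickle i); by rewrite pickleK.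
Qed.

End ae_modification.

Section evolution.
Variable R : realType.
Notation mu := (@lebesgue_measure R).
Notation J := (@circle R).
Implicit Types (f u W : R -> R -> R[i]) (q : R -> R) (a b t k A : R) (K : nat).
Let mJ : measurable J. Proof. exact: measurable_circle. Qed.
Hint Resolve mJ : core.

Definition mjoint f := measurable_fun setT (fun z : R * R => complex.Re (f z.1 z.2)) /\
  measurable_fun setT (fun z : R * R => complex.Im (f z.1 z.2)).

Lemma mjointM f u : mjoint f -> mjoint u -> mjoint (fun a b => f a b * u a b).
Proof.
move=> [m1 m2] [m3 m4]; split.
  under eq_fun do rewrite ReM.
  by apply: measurable_funB; apply: measurable_funM.
under eq_fun do rewrite ImM.
by apply: measurable_funD; apply: measurable_funM.
Qed.

Lemma mjointB f u : mjoint f -> mjoint u -> mjoint (fun a b => f a b - u a b).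
Proof.
move=> [m1 m2] [m3 m4]; split.
  under eq_fun do rewrite ReD ReN.
  exact: measurable_funB.
under eq_fun do rewrite ImD ImN.
exact: measurable_funB.
Qed.

Lemma mjointZ (c : R[i]) f : mjoint f -> mjoint (fun a b => c * f a b).
Proof.
by move=> mf; apply: (@mjointM (fun _ _ => c)) => //; split.
Qed.

Lemma measurable_csq f : mjoint f -> measurable_fun setT (fun z : R * R => csq (f z.1 z.2)).
Proof. by move=> [m1 m2]; apply: measurable_funD; apply: measurable_funX. Qed.

Lemma measurable_n2 f : mjoint f -> measurable_fun setT (fun a => n2 (f a)).
Proof.
move=> /measurable_csq mf; exact: (@measurable_Rint_section _ _ _ _ _ mu J _ mJ mf).
Qed.

Lemma mjoint_sec f a : mjoint f -> measurable_fun setT (fun t => complex.Re (f a t)) /\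
  measurable_fun setT (fun t => complex.Im (f a t)).
Proof.
by move=> [m1 m2]; split; [exact: (measurable_sec a m1)|exact: (measurable_sec a m2)].
Qed.

Lemma mjoint_Qc K f : mjoint f -> mjoint (fun a => Qc K (f a)).
Proof.
have h (g : R * R -> R) : measurable_fun setT g ->
    measurable_fun setT (fun z : R * R => Qk K (fun t => g (z.1, t)) z.2).
  move=> mg.
  have m1 : measurable_fun setT (fun w : (R * R) * R => ker K (w.1.2 - w.2) * g (w.1.1, w.2)).
    apply: measurable_funM.
      apply: measurableT_comp; first exact: measurable_ker.
      by apply: measurable_funB => //; exact: measurableT_comp.
    apply: measurableT_comp => //; apply: measurable_fun_pair => //=.
    exact: measurableT_comp.
  exact: (@measurable_Rint_section _ _ _ _ _ mu J _ mJ m1).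
by move=> [m1 m2]; split; [exact: (h _ m1)|exact: (h _ m2)].
Qed.

Lemma measurable_mode k f : mjoint f ->
  measurable_fun setT (fun a => complex.Re (mode k (f a))) /\
  measurable_fun setT (fun a => complex.Im (mode k (f a))).
Proof.
move=> mf.
have mcos : measurable_fun setT (fun t : R => cos (k * t)).
  by apply: continuous_measurable_fun; exact: continuous_cosM.
have msin : measurable_fun setT (fun t : R => sin (- k * t)).
  by apply: continuous_measurable_fun; exact: continuous_sinM.
have : mjoint (fun a t => cis (- (k * t)) * f a t).
  apply: mjointM => //; split => /=.
    under eq_fun do rewrite cosN.
    exact: (measurableT_comp mcos measurable_snd).
  under eq_fun do rewrite -mulNr.
  exact: (measurableT_comp msin measurable_snd).
move=> [m1 m2]; split.
  exact: (@measurable_Rint_section _ _ _ _ _ mu J _ mJ m1).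
exact: (@measurable_Rint_section _ _ _ _ _ mu J _ mJ m2).
Qed.

(** Every slice, not almost every one, is required to be in L2, so that [Qc] and [polyK] can be
    manipulated at all a. Orbit data are cut off on bad slices to meet this. *)
Definition loc2 A f := [/\ mjoint f, forall a, L2c (f a) &
  mu.-integrable `[0, A] (EFin \o (fun a => n2 (f a)))].

Lemma loc2_Qc A K f : loc2 A f -> loc2 A (fun a => Qc K (f a)).
Proof.
move=> [mf Lf If]; split.
- exact: mjoint_Qc.
- by move=> a; exact: (Qc_L2 K (Lf a)).1.
- apply: (@le_integrableR _ _ _ mu _ _ _ (fun a => n2 (f a))) => //.
    by apply: measurable_funTS; apply: measurable_n2; exact: mjoint_Qc.
  by move=> a _; rewrite ger0_norm ?n2_ge0//; exact: (Qc_L2 K (Lf a)).2.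
Qed.

Lemma loc2_le A f u (C : R) : mjoint f -> loc2 A u ->
  (forall a b, csq (f a b) <= C * csq (u a b)) -> loc2 A f.
Proof.
move=> mf [mu_ Lu Iu] fu.
have Lf a : L2c (f a).
  have [m1 m2] := mjoint_sec a mf.
  by apply: (L2c_le m1 m2 (Lu a)) => t _; exact: fu.
split => //; apply: (@le_integrableR _ _ _ mu _ _ _ (fun a => C * n2 (u a))) => //.
- by apply: measurable_funTS; exact: measurable_n2.
- by move=> a _; rewrite ger0_norm ?n2_ge0//; apply: n2_le => // t _.
- exact: (@integrableZR _ _ _ mu).
Qed.

Lemma acL_prim A (c : R) q : 0 <= A -> measurable_fun setT q ->
  mu.-integrable `[0, A] (EFin \o (fun a => q a ^+ 2)) ->
  acL A (fun a => c + \int[mu]_(t in `[0, a]) q t) q.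
Proof.
move=> A0 mq q2; split => //; split.
  apply: (@le_integrableR _ _ _ mu _ _ _ (fun t => 1 + q t ^+ 2)) => //.
  - exact: measurable_funTS.
  - move=> t _; have : 0 <= (`|q t| - 1) ^+ 2 by exact: sqr_ge0.
    rewrite -(real_normK (num_real (q t))); have := normr_ge0 (q t); move: (`|q t|) => v; nra.
  - apply: (@integrableDR _ _ _ mu) => //; apply: continuous_integrable; exact: cst_continuous.
move=> a _; congr (_ + _); rewrite set_itv1 Rintegral_set1 addr0//.
Qed.

Lemma expR_bounded A (k : R) a : a \in `[0, A] -> expR (k * a) <= expR (`|k| * A).
Proof.
rewrite in_itv/= => /andP[a0 aA]; rewrite ler_expR.
rewrite (le_trans (ler_norm _))// normrM (ger0_norm a0).
exact: ler_wpM2l.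
Qed.

(** The primitive of the convolved source, coefficient by coefficient, with initial values c. Its
    coefficients are absolutely continuous by construction, whereas the modes of the solution are
    controlled for almost every a only. *)
Definition genP K (c : nat -> R[i]) f a : {poly R[i]} :=
  \poly_(j < K.*2.+1) (c j + cint `[0, a] (fun t => 2%:C * (polyK K t (f t))`_j)).

Lemma measurable_coef_polyK K f j : mjoint f ->
  measurable_fun setT (fun t => complex.Re (polyK K t (f t))`_j) /\
  measurable_fun setT (fun t => complex.Im (polyK K t (f t))`_j).
Proof.
move=> mf; case: (ltnP j K.*2.+1) => jK; last first.
  by split; under eq_fun do rewrite coef_poly ltnNge jK/=; exact: measurable_cst.
have [m1 m2] := measurable_mode (j%:R - K%:R) mf.
have me : measurable_fun setT (fun t : R => kc R K j * expR (- (j%:R - K%:R) * t)).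
  apply: continuous_measurable_fun.
  apply: (@is_derive_continuous _ _ (fun t => kc R K j * (- (j%:R - K%:R) * expR (- (j%:R - K%:R) * t)))) => x.
  exact: (is_deriveZ _ (is_derive_expRM _ x)).
split.
  under eq_fun do rewrite coef_poly jK ReM/= mul0r subr0 -mulNr.
  exact: measurable_funM.
under eq_fun do rewrite coef_poly jK ImM/= mul0r addr0 -mulNr.
exact: measurable_funM.
Qed.

Lemma acP_genP A K c f : 0 <= A -> loc2 A f ->
  acP A (genP K c f) (fun a => 2%:C *: polyK K a (f a)).
Proof.
move=> A0 [mf Lf If] j.
case: (ltnP j K.*2.+1) => jK; last first.
  have := acC_cst A (0 : R[i]); congr (acC A _ _); apply/funext => a.
    by rewrite coef_poly ltnNge jK.
  by rewrite coefZ coef_poly ltnNge jK/= mulr0.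
have [m1 m2] := measurable_coef_polyK K j mf.
pose M : R := 4 * expR (`|- (2 * (j%:R - K%:R))| * A).
have iM : mu.-integrable `[0, A] (EFin \o (fun a => M * n2 (f a))) by exact: (@integrableZR _ _ _ mu).
have bM a : a \in `[0, A] -> 4 * csq (polyK K a (f a))`_j <= M * n2 (f a).
  move=> aA; rewrite -mulrA ler_wpM2l//.
  apply: (le_trans (csq_coef_polyK_le K a j (Lf a))).
  by rewrite ler_wpM2r ?n2_ge0// -mulNr expR_bounded.
clearbody M.
have r1 : acL A (fun a => complex.Re (c j) + \int[mu]_(t in `[0, a]) (2 * complex.Re (polyK K t (f t))`_j))
   (fun t => 2 * complex.Re (polyK K t (f t))`_j).
  apply: acL_prim => //; first exact: measurable_funM.
  apply: (@le_integrableR _ _ _ mu _ _ _ (fun a => M * n2 (f a))) => //.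
    by apply: measurable_funTS; apply: measurable_funX; exact: measurable_funM.
  move=> a /bM; rewrite ger0_norm ?sqr_ge0//; apply: le_trans.
  by rewrite exprMn -natrX ler_wpM2l// sqr_Re_le.
have r2 : acL A (fun a => complex.Im (c j) + \int[mu]_(t in `[0, a]) (2 * complex.Im (polyK K t (f t))`_j))
   (fun t => 2 * complex.Im (polyK K t (f t))`_j).
  apply: acL_prim => //; first exact: measurable_funM.
  apply: (@le_integrableR _ _ _ mu _ _ _ (fun a => M * n2 (f a))) => //.
    by apply: measurable_funTS; apply: measurable_funX; exact: measurable_funM.
  move=> a /bM; rewrite ger0_norm ?sqr_ge0//; apply: le_trans.
  by rewrite exprMn -natrX ler_wpM2l// sqr_Im_le.
have ZR (w : R[i]) : complex.Re (2%:C * w) = 2 * complex.Re w by rewrite ReM/= mul0r subr0.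
have ZI (w : R[i]) : complex.Im (2%:C * w) = 2 * complex.Im w by rewrite ImM/= mul0r addr0.
split.
  move: r1; congr (acL A _ _); apply/funext => a; last by rewrite coefZ ZR.
  by rewrite coef_poly jK ReD/=; congr (_ + _); apply: eq_Rintegral => t _; rewrite ZR.
move: r2; congr (acL A _ _); apply/funext => a; last by rewrite coefZ ZI.
by rewrite coef_poly jK ImD/=; congr (_ + _); apply: eq_Rintegral => t _; rewrite ZI.
Qed.

End evolution.

(** * The Carleman inequality for convolved solutions on the cylinder *)

Section carleman_cylinder.
Variable R : realType.
Notation mu := (@lebesgue_measure R).
Notation J := (@circle R).
Implicit Types (f u W : R -> R -> R[i]) (a b t k A : R) (K L m : nat).
Let mJ : measurable J. Proof. exact: measurable_circle. Qed.
Hint Resolve mJ : core.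

Lemma L2c_add (f g : R -> R[i]) : L2c f -> L2c g -> L2c (fun t => f t + g t).
Proof.
move=> [h1 h2] [h3 h4]; split.
  by have := L2J_add h1 h3; congr L2J; apply/funext => t; rewrite ReD.
by have := L2J_add h2 h4; congr L2J; apply/funext => t; rewrite ImD.
Qed.

Lemma L2c0 : L2c (fun=> 0 : R[i]).
Proof. by split; apply: (@L2J_bounded _ _ 0) => // t _ /=; rewrite normr0. Qed.

Lemma L2c_zeta a (j : nat) (f : R -> R[i]) : L2c f -> L2c (fun b => zeta a b ^+ j * f b).
Proof.
move=> Lf; have [[m1 _] [m2 _]] := Lf.
have mc : measurable_fun setT (fun b : R => expR (j%:R * a) * cos (j%:R * b)).
  by apply: measurable_funM => //; apply: continuous_measurable_fun; exact: continuous_cosM.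
have ms : measurable_fun setT (fun b : R => expR (j%:R * a) * sin (j%:R * b)).
  by apply: measurable_funM => //; apply: continuous_measurable_fun; exact: continuous_sinM.
have zR b : complex.Re (zeta a b ^+ j) = expR (j%:R * a) * cos (j%:R * b).
  by rewrite zetaX ReM/= mul0r subr0.
have zI b : complex.Im (zeta a b ^+ j) = expR (j%:R * a) * sin (j%:R * b).
  by rewrite zetaX ImM/= mul0r addr0.
apply: (@L2c_le _ _ f (expR (2 * a) ^+ j)) => //.
- under eq_fun do rewrite ReM zR zI.
  by apply: measurable_funB; apply: measurable_funM.
- under eq_fun do rewrite ImM zR zI.
  by apply: measurable_funD; apply: measurable_funM.
- by move=> t _; rewrite csqM csqX csq_zeta.
Qed.

Lemma L2c_horner a (p : {poly R[i]}) (f : R -> R[i]) : L2c f ->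
  L2c (fun b => p.[zeta a b] * f b).
Proof.
move=> Lf.
have -> : (fun b => p.[zeta a b] * f b) = (fun b => \sum_(j < size p) p`_j * (zeta a b ^+ j * f b)).
  apply/funext => b; rewrite horner_coef mulr_suml; apply: eq_bigr => j _.
  by rewrite mulrA.
elim: (size p) => [|n ih].
  by under eq_fun do rewrite big_ord0; exact: L2c0.
under eq_fun do rewrite big_ord_recr/=.
by apply: L2c_add => //; apply: L2cZ; exact: L2c_zeta.
Qed.

(** The equation (d_a + i d_b) u = 2 f after convolution, integrated from 0 to a: the primitive of
    the source coincides at a with the Laurent polynomial of the solution. *)
Definition solves K u f a :=
  genP K (fun j => (polyK K 0 (u 0))`_j) f a = polyK K a (u a).

Lemma genP0 K c f : genP K c f 0 = \poly_(j < K.*2.+1) c j.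
Proof.
apply/polyP => j; rewrite !coef_poly; case: ifP => // _.
by rewrite /cint set_itv1 !Rintegral_set1 addr0.
Qed.

Lemma solves0 K u f : solves K u f 0.
Proof.
rewrite /solves genP0; apply/polyP => j; rewrite !coef_poly.
by case: ifP => // ->.
Qed.

(** [PE] is a polynomial multiplier: 1 in the vector case, a power of the gauge in the scalar case.
    [carleman_poly] applies to [PE * genP], and [solves] then replaces [genP] by [polyK] almost
    everywhere under the integrals. The boundary values need exact equality: at 0 it holds by the
    choice of the initial values, at A it is assumed. *)
Lemma carleman_gauged A K L m n u f (PE QE : R -> {poly R[i]}) : 0 <= A ->
  loc2 A u -> loc2 A f -> acP A PE QE ->
  (forall a, size (PE a) <= n)%N -> (forall a, size (QE a) <= n)%N ->
  {ae mu, forall a, a \in `[0, A] -> solves K u f a} -> solves K u f A ->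
  \int[mu]_(a in `[0, A]) (cweight L m a *
    n2 (fun b => (PE a).[zeta a b] * Qc K (u a) b)) <=
  4 * \int[mu]_(a in `[0, A]) (cweight L m a *
    n2 (fun b => (QE a).[zeta a b] * Qc K (u a) b +
      (PE a).[zeta a b] * (2%:C * Qc K (f a) b))) +
  2 * (n2 (fun b => (PE 0).[zeta 0 b] * Qc K (u 0) b) +
       cweight L m A * n2 (fun b => (PE A).[zeta A b] * Qc K (u A) b)).
Proof.
move=> A0 [mu_ Lu _] lf acE szP szQ sae sA; have [_ Lf _] := lf.
pose c j := (polyK K 0 (u 0))`_j.
pose P a := PE a * genP K c f a.
pose Q a := QE a * genP K c f a + PE a * (2%:C *: polyK K a (f a)).
have acQ : acP A P Q := acP_mul A0 acE (acP_genP K c A0 lf).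
have sM (p q : {poly R[i]}) : (size p <= n)%N -> (size q <= K.*2.+1)%N -> (size (p * q)%R <= n + K.*2.+1)%N.
  move=> hp hq; apply: (leq_trans (size_polyMleq p q)).
  by apply: (leq_trans (leq_pred _)); exact: leq_add.
have sG a : (size (genP K c f a) <= K.*2.+1)%N by exact: size_poly.
have sP a : (size (P a) <= n + K.*2.+1)%N by exact: sM.
have sQ a : (size (Q a) <= n + K.*2.+1)%N.
  apply: (leq_trans (size_polyD _ _)); rewrite geq_max; apply/andP; split; apply: sM => //.
  by apply: (leq_trans (size_scale_leq _ _)); exact: size_polyK.
(* [polyK] carries the factor e^(K (a + i b)), of squared modulus e^(2 K a). Raising L to L + K in
   the weight cancels it. *)
have := carleman_poly (L + K) m A0 acQ sP sQ.
have wE a : cweight (L + K) m a * expR (2 * K%:R * a) = cweight L m a :> R.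
  by rewrite /cweight -expRD natrD; congr expR; ring.
have hP a : solves K u f a -> \int[mu]_(b in J) csq (P a).[zeta a b] =
    expR (2 * K%:R * a) * n2 (fun b => (PE a).[zeta a b] * Qc K (u a) b).
  move=> sa; rewrite /P [genP _ _ _ _]sa /n2 -RintegralZl//; last first.
    by apply: L2c_integrable; apply: L2c_horner; exact: (Qc_L2 K (Lu a)).1.
  by apply: eq_Rintegral => b _; rewrite hornerM csqM csq_polyK// csqM; ring.
have hQ a : solves K u f a -> \int[mu]_(b in J) csq (Q a).[zeta a b] =
    expR (2 * K%:R * a) * n2 (fun b => (QE a).[zeta a b] * Qc K (u a) b +
      (PE a).[zeta a b] * (2%:C * Qc K (f a) b)).
  move=> sa; rewrite /Q [genP _ _ _ _]sa /n2 -RintegralZl//; last first.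
    apply: L2c_integrable; apply: L2c_add; apply: L2c_horner.
      exact: (Qc_L2 K (Lu a)).1.
    by apply: L2cZ; exact: (Qc_L2 K (Lf a)).1.
  apply: eq_Rintegral => b _; rewrite hornerD !hornerM hornerZ !polyK_eval//.
  rewrite -[X in csq X](_ : zeta a b ^+ K * ((QE a).[zeta a b] * Qc K (u a) b +
      (PE a).[zeta a b] * (2%:C * Qc K (f a) b)) = _); last by ring.
  by rewrite csqM csqX csq_zeta -expRM_natl; congr (expR _ * _); ring.
rewrite (hP _ sA) (hP _ (solves0 K u f)) mulr0 expR0 mul1r.
rewrite [cweight (L + K) m A * _]mulrA wE.
have -> : \int[mu]_(a in `[0, A]) (cweight (L + K) m a * \int[mu]_(b in J) csq (P a).[zeta a b]) =
    \int[mu]_(a in `[0, A]) (cweight L m a * n2 (fun b => (PE a).[zeta a b] * Qc K (u a) b)).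
  apply: (@ae_eq_Rintegral _ _ _ mu).
  by apply: (@ae_mono _ _ _ mu _ _ _ sae) => a sa aA; rewrite (hP _ (sa aA)) mulrA wE.
have -> : \int[mu]_(a in `[0, A]) (cweight (L + K) m a * \int[mu]_(b in J) csq (Q a).[zeta a b]) =
    \int[mu]_(a in `[0, A]) (cweight L m a * n2 (fun b => (QE a).[zeta a b] * Qc K (u a) b +
      (PE a).[zeta a b] * (2%:C * Qc K (f a) b))).
  apply: (@ae_eq_Rintegral _ _ _ mu).
  by apply: (@ae_mono _ _ _ mu _ _ _ sae) => a sa aA; rewrite (hQ _ (sa aA)) mulrA wE.
by [].
Qed.

Definition wt (k a : R) : R := expR (k * a).

Lemma measurable_wt k : measurable_fun setT (wt k).
Proof.
apply: continuous_measurable_fun; apply: (@is_derive_continuous _ _ (fun t => k * expR (k * t))) => x.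
exact: is_derive_expRM.
Qed.

Lemma integrable_wt A k u : loc2 A u ->
  mu.-integrable `[0, A] (EFin \o (fun a => wt k a * n2 (u a))).
Proof.
move=> [mu_ Lu Iu].
apply: (@integrable_bndM _ _ _ mu _ _ _ _ (expR (`|k| * A))) => //.
  by apply: measurable_funTS; exact: measurable_wt.
by move=> a aA; rewrite ger0_norm ?expR_ge0//; exact: expR_bounded.
Qed.

Lemma integral_Qc_cvg A k u : loc2 A u ->
  \int[mu]_(a in `[0, A]) (wt k a * n2 (Qc K (u a))) @[K --> \oo] -->
  \int[mu]_(a in `[0, A]) (wt k a * n2 (u a)).
Proof.
move=> lu; have [mu_ Lu Iu] := lu.
apply: (@dct_R _ _ _ mu _ _ _ (fun a => wt k a * n2 (u a))) => //.
- have h K : measurable_fun setT (fun a => wt k a * n2 (Qc K (u a))).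
    apply: measurable_funM; first exact: measurable_wt.
    by apply: measurable_n2; exact: mjoint_Qc.
  by move=> K; exact: measurable_funTS (h K).
- have h : measurable_fun setT (fun a => wt k a * n2 (u a)).
    apply: measurable_funM; first exact: measurable_wt.
    exact: measurable_n2.
  exact: measurable_funTS h.
- by apply: nearW => a _; apply: cvgMl_tmp; exact: n2_Qc_cvg.
- exact: integrable_wt.
- move=> K a _; rewrite ger0_norm ?mulr_ge0 ?expR_ge0 ?n2_ge0//.
  by apply: ler_wpM2l; [exact: expR_ge0|exact: (Qc_L2 K (Lu a)).2].
Qed.

Lemma carleman_Qc A K m u f : 0 <= A -> loc2 A u -> loc2 A f ->
  {ae mu, forall a, a \in `[0, A] -> solves K u f a} -> solves K u f A ->
  \int[mu]_(a in `[0, A]) (wt (2 * m%:R + 1) a * n2 (Qc K (u a))) <=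
  16 * \int[mu]_(a in `[0, A]) (wt (2 * m%:R + 1) a * n2 (f a)) +
  2 * (n2 (u 0) + wt (2 * m%:R + 1) A * n2 (u A)).
Proof.
move=> A0 lu lf sae sA; have [mu_ Lu Iu] := lu; have [_ Lf If] := lf.
have s1 (a : R) : (size (1%R : {poly R[i]}) <= 1)%N by rewrite size_poly1.
have s0 (a : R) : (size (0%R : {poly R[i]}) <= 1)%N by rewrite size_poly0.
have := carleman_gauged 0 m A0 lu lf (acP_cst A 1) s1 s0 sae sA.
have w0 a : cweight 0 m a = wt (2 * m%:R + 1) a.
  by rewrite /cweight /wt mulr0 subr0.
under eq_Rintegral do rewrite w0.
under [X in 4 * X]eq_Rintegral do rewrite w0.
have e1 a : n2 (fun b => (1 : {poly R[i]}).[zeta a b] * Qc K (u a) b) = n2 (Qc K (u a)).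
  by apply: eq_Rintegral => b _; rewrite hornerC mul1r.
have e2 a : n2 (fun b => (0 : {poly R[i]}).[zeta a b] * Qc K (u a) b +
    (1 : {poly R[i]}).[zeta a b] * (2%:C * Qc K (f a) b)) = 4 * n2 (Qc K (f a)).
  rewrite /n2 -RintegralZl//; last by apply: L2c_integrable; exact: (Qc_L2 K (Lf a)).1.
  apply: eq_Rintegral => b _; rewrite !hornerC mul0r add0r mul1r csqM csq_real.
  by rewrite -natrX.
under eq_Rintegral do rewrite e1.
under [X in 4 * X]eq_Rintegral do rewrite e2.
rewrite w0 !e1 => /le_trans; apply.
have lQf := loc2_Qc K lf.
have -> : \int[mu]_(a in `[0, A]) (wt (2 * m%:R + 1) a * (4 * n2 (Qc K (f a)))) =
   4 * \int[mu]_(a in `[0, A]) (wt (2 * m%:R + 1) a * n2 (Qc K (f a))).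
  rewrite -RintegralZl//; last exact: integrable_wt.
  by apply: eq_Rintegral => a _; ring.
have h1 : \int[mu]_(a in `[0, A]) (wt (2 * m%:R + 1) a * n2 (Qc K (f a))) <=
    \int[mu]_(a in `[0, A]) (wt (2 * m%:R + 1) a * n2 (f a)).
  apply: le_Rintegral => //; try exact: integrable_wt.
  by move=> a _; apply: ler_wpM2l; [exact: expR_ge0|exact: (Qc_L2 K (Lf a)).2].
have h2 : wt (2 * m%:R + 1) A * n2 (Qc K (u A)) <= wt (2 * m%:R + 1) A * n2 (u A).
  by apply: ler_wpM2l; [exact: expR_ge0|exact: (Qc_L2 K (Lu A)).2].
have h3 := (Qc_L2 K (Lu 0)).2.
by move: h1 h2 h3; move: (\int[_]_(_ in _) _) (\int[_]_(_ in _) _); clear; move=> *; lra.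
Qed.

(** 16 is the Carleman constant 4 times the square of the 2 in [2 * F]. The bound of F by U couples
    the components; it is applied after K tends to infinity and after summation over l, so no
    commutator with the convolution appears. *)
Lemma carleman_small A m N (C : R) (U F : 'I_N -> R -> R -> R[i]) : 0 <= A ->
  (forall l, loc2 A (U l)) -> (forall l, loc2 A (F l)) ->
  (forall a b, \sum_l csq (F l a b) <= C ^+ 2 * \sum_l csq (U l a b)) ->
  (forall l K, {ae mu, forall a, a \in `[0, A] -> solves K (U l) (F l) a}) ->
  (forall l K, solves K (U l) (F l) A) ->
  (1 - 16 * C ^+ 2) *
  \int[mu]_(a in `[0, A]) (wt (2 * m%:R + 1) a * \sum_l n2 (U l a)) <=
  2 * (\sum_l n2 (U l 0) + wt (2 * m%:R + 1) A * \sum_l n2 (U l A)).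
Proof.
move=> A0 lU lF FU sae sA.
have LU l a : L2c (U l a) by have [] := lU l.
have LF l a : L2c (F l a) by have [] := lF l.
have n2F a : \sum_l n2 (F l a) <= C ^+ 2 * \sum_l n2 (U l a).
  rewrite /n2 -!(@Rintegral_sumR _ _ _ mu)//; try by move=> l; exact: L2c_integrable.
  rewrite -RintegralZl//; last first.
    by apply: (@integrable_sumR _ _ _ mu) => // l _; exact: L2c_integrable.
  apply: le_Rintegral => //.
    by apply: (@integrable_sumR _ _ _ mu) => // l _; exact: L2c_integrable.
  apply: (@integrableZR _ _ _ mu) => //.
  by apply: (@integrable_sumR _ _ _ mu) => // l _; exact: L2c_integrable.
set k := 2 * m%:R + 1.
have step l : \int[mu]_(a in `[0, A]) (wt k a * n2 (U l a)) <=
    16 * \int[mu]_(a in `[0, A]) (wt k a * n2 (F l a)) + 2 * (n2 (U l 0) + wt k A * n2 (U l A)).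
  have cv := @integral_Qc_cvg A k _ (lU l).
  rewrite -(cvg_lim (@Rhausdorff R) cv); apply: limr_le; first by apply/cvg_ex; eexists; exact: cv.
  by apply: nearW => K; apply: carleman_Qc.
have iU l : mu.-integrable `[0, A] (EFin \o (fun a => wt k a * n2 (U l a))) by exact: integrable_wt.
have iF l : mu.-integrable `[0, A] (EFin \o (fun a => wt k a * n2 (F l a))) by exact: integrable_wt.
have sU : \int[mu]_(a in `[0, A]) (wt k a * \sum_l n2 (U l a)) =
    \sum_l \int[mu]_(a in `[0, A]) (wt k a * n2 (U l a)).
  rewrite -(@Rintegral_sumR _ _ _ mu)//.
  by apply: eq_Rintegral => a _; rewrite mulr_sumr.
have sF : \sum_l \int[mu]_(a in `[0, A]) (wt k a * n2 (F l a)) <=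
    C ^+ 2 * \int[mu]_(a in `[0, A]) (wt k a * \sum_l n2 (U l a)).
  rewrite sU -(@Rintegral_sumR _ _ _ mu)// -(@Rintegral_sumR _ _ _ mu)//.
  rewrite -RintegralZl//; last exact: (@integrable_sumR _ _ _ mu).
  apply: le_Rintegral => //.
  - exact: (@integrable_sumR _ _ _ mu).
  - by apply: (@integrableZR _ _ _ mu) => //; exact: (@integrable_sumR _ _ _ mu).
  move=> a _; rewrite -!mulr_sumr mulrCA; apply: ler_wpM2l; first exact: expR_ge0.
  exact: n2F.
have : \sum_l \int[mu]_(a in `[0, A]) (wt k a * n2 (U l a)) <=
    \sum_l (16 * \int[mu]_(a in `[0, A]) (wt k a * n2 (F l a)) + 2 * (n2 (U l 0) + wt k A * n2 (U l A))).
  by apply: ler_sum => l _; exact: step.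
rewrite -sU big_split/= -!mulr_sumr big_split/= -mulr_sumr.
by move: sF; move: (\int[_]_(_ in _) _) (\sum__ _) (\sum__ _) (\sum__ _); clear; move=> *; lra.
Qed.

End carleman_cylinder.

Section vanish.
Variable R : realType.
Notation mu := (@lebesgue_measure R).
Implicit Types (n : R -> R) (k c M A T : R).

Lemma ge0_Rintegral_ae0 n T : 0 <= T -> mu.-integrable `[0, T] (EFin \o n) ->
  (forall a, a \in `[0, T] -> 0 <= n a) -> \int[mu]_(a in `[0, T]) n a <= 0 ->
  {ae mu, forall a, a \in `[0, T] -> n a = 0}.
Proof.
move=> T0 i0 n0 le0.
have mn : measurable_fun `[0, T] (EFin \o n) by case/integrableP : i0.
have : (\int[mu]_(a in `[0%R, T]) `|(n a)%:E| = 0)%E.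
  have e : (\int[mu]_(a in `[0%R, T]) `|(n a)%:E| = (\int[mu]_(a in `[0, T]) n a)%:E)%E.
    rewrite fineK; last by apply: integrable_fin_num.
    by apply: eq_integral => a /set_mem aT; rewrite abse_EFin ger0_norm// n0.
  rewrite e; congr (_%:E); apply/eqP; rewrite eq_le le0/=.
  by apply: Rintegral_ge0 => a aT; exact: n0.
move=> /(ae_eq_integral_abs mu (measurable_itv `[0, T]) mn).
by apply: (@ae_mono _ _ _ mu) => a h aT; have /= [] := h aT.
Qed.

Lemma le_small (x M : R) (y : nat -> R) : 0 <= M -> (forall k : R, exists j, k <= y j) ->
  (forall j, y j * x <= M) -> x <= 0.
Proof.
move=> M0 yk yM; rewrite leNgt; apply/negP => x0.
have [j jP] := yk ((M + 1) / x).
have := yM j; rewrite leNgt => /negP; apply.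
apply: (@lt_le_trans _ _ (M + 1)); first by lra.
by rewrite -ler_pdivrMr.
Qed.

(* Along points A tending to infinity the boundary term at A is at most 1, hence
   the weighted integrals stay bounded as the exponent grows. *)
Lemma carleman_vanish n c M : measurable_fun setT n -> (forall a, 0 <= n a) ->
  (forall k, (\int[mu]_(a in `[0%R, +oo[) (expR (k * a) * n a)%:E < +oo)%E) -> 0 <= M ->
  (forall m : nat, {ae mu, forall A, 0 <= A ->
    \int[mu]_(a in `[0, A]) (expR ((2 * m%:R + 1 - c) * a) * n a) <=
    M * (n 0 + expR ((2 * m%:R + 1 + c) * A) * n A)}) ->
  {ae mu, forall a, 0 <= a -> n a = 0}.
Proof.
move=> mn n0 fin M0 H.
have mwn k : measurable_fun setT (fun a => (expR (k * a) * n a)%:E).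
  apply/measurable_EFinP; apply: measurable_funM => //.
  exact: (measurable_wt k).
have mwnD k (D : set R) : measurable_fun D (fun a => (expR (k * a) * n a)%:E).
  exact: measurable_funTS.
have wn0 k a : 0 <= expR (k * a) * n a by rewrite mulr_ge0 ?expR_ge0.
have ii k : mu.-integrable `[0, +oo[ (EFin \o (fun a => expR (k * a) * n a)).
  apply/integrableP; split => //; first exact: mwnD.
  apply: le_lt_trans (fin k); rewrite le_eqVlt; apply/orP; left; apply/eqP.
  by apply: eq_integral => a _ /=; rewrite ger0_norm.
have iA k A : mu.-integrable `[0, A] (EFin \o (fun a => expR (k * a) * n a)).
  by apply: integrableS (ii k) => //; apply: subset_itvl; rewrite bnd_simp.
have subA k T A : T <= A -> \int[mu]_(a in `[0, T]) (expR (k * a) * n a) <=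
    \int[mu]_(a in `[0, A]) (expR (k * a) * n a).
  move=> TA; rewrite /Rintegral fine_le//.
  - by apply: integrable_fin_num => //; exact: iA.
  - by apply: integrable_fin_num => //; exact: iA.
  - apply: ge0_subset_integral => //; try exact: mwnD.
    - by move=> a _; rewrite lee_fin.
    - by apply: subset_itvl; rewrite bnd_simp.
have step1 (m : nat) T : 0 <= T ->
    \int[mu]_(a in `[0, T]) (expR ((2 * m%:R + 1 - c) * a) * n a) <= M * (n 0 + 1).
  move=> T0; rewrite leNgt; apply/negP => big.
  (* If the claimed bound failed at T it would fail for every larger A, since the integrals increase
     with A. The boundary term would then be at least 1 for almost every A >= T, contradicting its
     integrability on the half-line. *)
  have aeA : {ae mu, forall A, A \in `[T, +oo[ -> (1 <= (expR ((2 * m%:R + 1 + c) * A) * n A)%:E)%E}.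
    apply: (@ae_mono _ _ _ mu _ _ _ (H m)) => A HA; rewrite in_itv/= andbT => TA.
    rewrite lee_fin leNgt; apply/negP => small.
    have := HA (le_trans T0 TA); rewrite leNgt => /negP; apply.
    apply: (@le_lt_trans _ _ (M * (n 0 + 1))).
      by apply: ler_wpM2l => //; rewrite lerD2l ltW.
    apply: (lt_le_trans big).
    exact: subA.
  have : (\int[mu]_(A in `[T, +oo[) 1 <=
      \int[mu]_(A in `[T, +oo[) (expR ((2 * m%:R + 1 + c) * A) * n A)%:E)%E.
    apply: ae_ge0_le_integral => //; try exact: mwnD.
    by move=> a _; rewrite lee_fin.
  rewrite integral_cst//= lebesgue_measure_itv/= ltry mul1e => h.
  have : (\int[mu]_(A in `[T, +oo[) (expR ((2 * m%:R + 1 + c) * A) * n A)%:E <=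
      \int[mu]_(A in `[0%R, +oo[) (expR ((2 * m%:R + 1 + c) * A) * n A)%:E)%E.
    apply: ge0_subset_integral => //; try exact: mwnD.
      by move=> a _; rewrite lee_fin.
    by apply: subset_itvr; rewrite bnd_simp.
  by move=> /(le_trans h); rewrite leNgt => /negP; apply; exact: fin.
(* Since e^(k a) >= k a, the uniform bound gives k times the integral of [a * n a] at most a
   constant, for k arbitrarily large. The spurious factor a costs only the point a = 0, removed as a
   null set. *)
have step2 (T : nat) : {ae mu, forall a, a \in `[0, T%:R] -> a * n a = 0}.
  have iT := iA 0 T%:R.
  have ian : mu.-integrable `[0, T%:R] (EFin \o (fun a => a * n a)).
    apply: (@integrable_bndM _ _ _ mu _ _ _ _ T%:R) => //.
      by move=> a; rewrite /= in_itv/= => /andP[a0 aT]; rewrite ger0_norm.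
    by apply: (@eq_integrableR _ _ _ mu _ _ (fun a => expR (0 * a) * n a)) => // a _; rewrite mul0r expR0 mul1r.
  have le0 : \int[mu]_(a in `[0, T%:R]) (a * n a) <= 0.
    apply: (@le_small _ (M * (n 0 + 1)) (fun m => 2 * m%:R + 1 - c)).
    - by rewrite mulr_ge0// addr_ge0.
    - move=> k; exists (Num.bound `|k + c|).
      have := archi_boundP (normr_ge0 (k + c)); have := ler_norm (k + c).
      by move: (_%:R) => v; have := normr_ge0 (k + c); lra.
    - move=> m; apply: le_trans (step1 m T%:R _) => //.
      rewrite -RintegralZl//; apply: le_Rintegral => //.
        exact: (@integrableZR _ _ _ mu).
      move=> a _; rewrite mulrA; apply: ler_wpM2r => //.
      by apply: le_trans (expR_ge1Dx _); rewrite lerDr.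
  apply: ge0_Rintegral_ae0 => // a; rewrite in_itv/= => /andP[a0 _].
  exact: mulr_ge0.
have := @ae_all _ _ _ mu nat _ step2.
have ae0 : {ae mu, forall a : R, a != 0}.
  have n0' : mu.-negligible [set (0 : R)] by apply/negligibleP => //; exact: lebesgue_measure_set1.
  by apply: negligibleS n0' => a /= /negP; rewrite negbK => /eqP.
move=> h; have := @ae_conj _ _ _ mu _ _ h ae0.
apply: (@ae_mono _ _ _ mu) => a [ha a0] age0.
have : a * n a = 0.
  apply: (ha (Num.bound a)); rewrite in_itv/= age0/=; apply: ltW.
  exact: archi_boundP.
by move/eqP; rewrite mulf_eq0 (negbTE a0)/= => /eqP.
Qed.

End vanish.

(** * The commutator of convolution with a bounded potential *)

Section commutator.
Variable R : realType.
Notation mu := (@lebesgue_measure R).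
Notation J := (@circle R).
Implicit Types (f g : R -> R[i]) (a b t C : R) (K : nat).
Let mJ : measurable J. Proof. exact: measurable_circle. Qed.
Hint Resolve mJ : core.

Lemma L2c_approx f (e : R) : L2c f -> 0 < e -> exists phi M,
  [/\ L2c phi, 0 <= M, forall t, csq (phi t) <= M & n2 (fun t => f t - phi t) <= e].
Proof.
move=> Lf e0; have [L1 L2] := Lf.
have e2 : 0 < e / 2 by rewrite divr_gt0.
have [p1 [M1 [c1 b1 h1]]] := L2J_approx L1 e2.
have [p2 [M2 [c2 b2 h2]]] := L2J_approx L2 e2.
have Lp : L2c (fun t => p1 t +i* p2 t).
  have m1 := continuous_measurable_fun c1; have m2 := continuous_measurable_fun c2.
  by split => /=; [apply: (@L2J_bounded _ _ M1)|apply: (@L2J_bounded _ _ M2)].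
exists (fun t => p1 t +i* p2 t), (M1 ^+ 2 + M2 ^+ 2); split => //.
- by rewrite addr_ge0 ?sqr_ge0.
- move=> t; rewrite /csq/= -(real_normK (num_real (p1 t))) -(real_normK (num_real (p2 t))).
  have M10 : 0 <= M1 by rewrite (le_trans _ (b1 0)).
  have M20 : 0 <= M2 by rewrite (le_trans _ (b2 0)).
  by rewrite lerD// lerXn2r ?nnegrE.
- rewrite n2E; last exact: L2c_sub.
  under [X in N2 X + _]eq_fun do rewrite ReD ReN/=.
  under [X in _ + N2 X]eq_fun do rewrite ImD ImN/=.
  by lra.
Qed.

Lemma sqr_le_norm (x y : R) : 0 <= y -> x ^+ 2 <= y ^+ 2 -> `|x| <= y.
Proof. by move=> y0 h; rewrite ler_norml; apply/andP; split; nra. Qed.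

Lemma commut_arith (C2 e ee x1 x2 x3 x4 x5 x6 Me : R) : 0 < e -> 0 <= ee -> 0 <= C2 * ee ->
  (1 + 100 * C2) * ee = e / 20 -> Me <= e / 20 -> x2 <= ee -> x6 <= Me ->
  x5 <= 6 * C2 * ee -> x4 <= (1 + 1) * x5 + (1 + 1) * x6 -> x3 <= 2 * C2 * ee ->
  x1 <= 3 * x2 + 3 * x3 + 3 * x4 -> x1 <= e.
Proof. lra. Qed.

Lemma csqD3 (x y z : R[i]) : csq (x + y + z) <= 3 * csq x + 3 * csq y + 3 * csq z.
Proof.
rewrite /csq !ReImE; move: (complex.Re x) (complex.Re y) (complex.Re z) (complex.Im x) (complex.Im y) (complex.Im z) => p q r s t u.
have := sqr_ge0 (p - q); have := sqr_ge0 (q - r); have := sqr_ge0 (p - r).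
have := sqr_ge0 (s - t); have := sqr_ge0 (t - u); have := sqr_ge0 (s - u).
nra.
Qed.

Lemma csqN (x : R[i]) : csq (- x) = csq x.
Proof. by rewrite /csq ReN ImN !sqrrN. Qed.

Lemma csqB (x y : R[i]) : csq (x - y) <= 2 * csq x + 2 * csq y.
Proof.
have := csq_ge0 (x + y); rewrite /csq !ReImE => h; nra.
Qed.

Lemma csq_Qc_bounded K W C b : measurable_fun setT (fun t => complex.Re (W t)) ->
  measurable_fun setT (fun t => complex.Im (W t)) -> 0 <= C ->
  (forall t, csq (W t) <= C ^+ 2) -> csq (Qc K W b) <= 2 * C ^+ 2.
Proof.
move=> m1 m2 C0 WC.
have h (x : R) : x ^+ 2 <= C ^+ 2 -> `|x| <= C.
  by move=> h; exact: sqr_le_norm.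
have h1 : `|Qk K (fun t => complex.Re (W t)) b| <= C.
  by apply: Qk_bounded => // t _; apply: h; exact: le_trans (sqr_Re_le _) (WC t).
have h2 : `|Qk K (fun t => complex.Im (W t)) b| <= C.
  by apply: Qk_bounded => // t _; apply: h; exact: le_trans (sqr_Im_le _) (WC t).
rewrite /csq/= mulr2n mulrDl mul1r lerD// -(real_normK (num_real _)) lerXn2r ?nnegrE//.
Qed.

Lemma L2c_bndM g f C : measurable_fun setT (fun t => complex.Re (g t)) ->
  measurable_fun setT (fun t => complex.Im (g t)) ->
  L2c f -> (forall t, csq (g t) <= C) -> L2c (fun t => g t * f t).
Proof.
move=> m1 m2 Lf gC; have [[m3 _] [m4 _]] := Lf.
apply: (@L2c_le _ _ f C) => //.
- by under eq_fun do rewrite ReM; apply: measurable_funB; apply: measurable_funM.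
- by under eq_fun do rewrite ImM; apply: measurable_funD; apply: measurable_funM.
- by move=> t _; rewrite csqM ler_wpM2r ?csq_ge0.
Qed.

Lemma n2_bndM g f C : measurable_fun setT (fun t => complex.Re (g t)) ->
  measurable_fun setT (fun t => complex.Im (g t)) ->
  L2c f -> (forall t, csq (g t) <= C) -> n2 (fun t => g t * f t) <= C * n2 f.
Proof.
move=> m1 m2 Lf gC; apply: n2_le => //; first exact: (L2c_bndM m1 m2 Lf gC).
by move=> t _; rewrite csqM ler_wpM2r ?csq_ge0.
Qed.

Lemma n2D3 f g h k : L2c f -> L2c g -> L2c h -> L2c k ->
  (forall t, J t -> k t = f t + g t + h t) -> n2 k <= 3 * n2 f + 3 * n2 g + 3 * n2 h.
Proof.
move=> /L2c_integrable i1 /L2c_integrable i2 /L2c_integrable i3 /L2c_integrable i4 kE.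
have j1 : mu.-integrable J (EFin \o (fun t => 3 * csq (f t))) by exact: (@integrableZR _ _ _ mu).
have j2 : mu.-integrable J (EFin \o (fun t => 3 * csq (g t))) by exact: (@integrableZR _ _ _ mu).
have j3 : mu.-integrable J (EFin \o (fun t => 3 * csq (h t))) by exact: (@integrableZR _ _ _ mu).
have j4 : mu.-integrable J (EFin \o (fun t => 3 * csq (f t) + 3 * csq (g t))) by exact: (@integrableDR _ _ _ mu).
rewrite /n2 -!RintegralZl// -!RintegralD//; apply: le_Rintegral => //.
  exact: (@integrableDR _ _ _ mu).
by move=> t Jt; rewrite kE//; exact: csqD3.
Qed.

Lemma n2_limit_small (x : nat -> R) : (forall K, 0 <= x K) ->
  (forall e, 0 < e -> \forall K \near \oo, x K <= e) -> x K @[K --> \oo] --> (0 : R).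
Proof.
move=> x0 H; apply/cvgrPdist_le => e /H; apply: filterS => K.
by rewrite sub0r normrN ger0_norm.
Qed.

Lemma cvg_small (x : nat -> R) (e : R) : (forall K, 0 <= x K) -> x K @[K --> \oo] --> (0 : R) ->
  0 < e -> \forall K \near \oo, x K <= e.
Proof.
move=> x0 /cvgrPdist_le cv /cv; apply: filterS => K.
by rewrite sub0r normrN ger0_norm.
Qed.

(** In the scalar case f = W u, but the gauge is built from the convolved W. This is the discrepancy
    between the convolved source and the product of the convolutions. *)
Definition commut K (W u : R -> R[i]) b : R[i] :=
  Qc K (fun t => W t * u t) b - Qc K W b * Qc K u b.

Section fixed_W.
Variables (W u : R -> R[i]) (C : R).
Hypotheses (m1 : measurable_fun setT (fun t => complex.Re (W t)))
  (m2 : measurable_fun setT (fun t => complex.Im (W t))) (C0 : 0 <= C)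
  (WC : forall t, csq (W t) <= C ^+ 2) (Lu : L2c u).

Let LF : L2c (fun t => W t * u t). Proof. exact: (L2c_bndM m1 m2 Lu WC). Qed.

Let LW : L2c W.
Proof.
have h (x : R) : x ^+ 2 <= C ^+ 2 -> `|x| <= C.
  by move=> h; exact: sqr_le_norm.
split; apply: (@L2J_bounded _ _ C) => // t _; apply: h.
  exact: le_trans (sqr_Re_le _) (WC t).
exact: le_trans (sqr_Im_le _) (WC t).
Qed.

Let mQ1 K : measurable_fun setT (fun t => complex.Re (Qc K W t)).
Proof. exact: (Qc_L2 K LW).1.1.1. Qed.

Let mQ2 K : measurable_fun setT (fun t => complex.Im (Qc K W t)).
Proof. exact: (Qc_L2 K LW).1.2.1. Qed.

Let QWC K t : csq (Qc K W t) <= 2 * C ^+ 2. Proof. exact: csq_Qc_bounded. Qed.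

Lemma L2c_commut K : L2c (commut K W u).
Proof.
apply: L2c_sub; first exact: (Qc_L2 K LF).1.
apply: (L2c_bndM (mQ1 K) (mQ2 K) _ (QWC K)); exact: (Qc_L2 K Lu).1.
Qed.

Lemma n2_commut K : n2 (commut K W u) <= 6 * C ^+ 2 * n2 u.
Proof.
have LQu := Qc_L2 K Lu; have LQF := Qc_L2 K LF.
have L2 : L2c (fun b => - Qc K W b * Qc K u b).
  under eq_fun do rewrite mulNr -mulN1r.
  by apply: L2cZ; apply: (L2c_bndM (mQ1 K) (mQ2 K) _ (QWC K)); exact: LQu.1.
have := n2D_eps ltr01 LQF.1 L2 (L2c_commut K).
rewrite invr1 => /(_ _) h.
have {}h : n2 (commut K W u) <= (1 + 1) * n2 (Qc K (fun t => W t * u t)) +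
   (1 + 1) * n2 (fun b => - Qc K W b * Qc K u b) by apply: h => t _; rewrite /commut mulNr.
have h1 : n2 (Qc K (fun t => W t * u t)) <= C ^+ 2 * n2 u.
  by apply: (le_trans LQF.2); exact: (n2_bndM m1 m2 Lu WC).
have h2 : n2 (fun b => - Qc K W b * Qc K u b) <= 2 * C ^+ 2 * n2 u.
  apply: (@le_trans _ _ (2 * C ^+ 2 * n2 (Qc K u))); last first.
    by apply: ler_wpM2l; [rewrite mulr_ge0 ?sqr_ge0|exact: LQu.2].
  apply: n2_le => //; first exact: LQu.1.
  by move=> t _; rewrite mulNr csqN csqM ler_wpM2r ?csq_ge0.
by move: h h1 h2; move: (n2 _) (n2 _) (n2 _) (n2 _) (C ^+ 2); move=> *; lra.
Qed.

(** Write the commutator as (Q(Wu) - Wu) - QW (Qu - u) - (QW - W) u. The first two terms tend to 0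
    because Q converges in L2 and QW is bounded uniformly in K; the third needs an approximation of
    u. *)
Lemma commut_cvg : n2 (commut K W u) @[K --> \oo] --> (0 : R).
Proof.
apply: n2_limit_small; first by move=> K; exact: n2_ge0.
move=> e e0.
pose D : R := 1 + 100 * C ^+ 2.
have D0 : 0 < D by rewrite /D; have := sqr_ge0 C; lra.
have d0 : 0 < e / (20 * D) by rewrite divr_gt0// mulr_gt0.
(* QW - W is uniformly bounded but small in L2 only, so its product with an L2 function u is treated
   by replacing u with a bounded [phi]. *)
have [phi [M [Lp M0 pM up]]] := L2c_approx Lu d0.
have dM : 0 < e / (20 * (M + 1)) by rewrite divr_gt0// mulr_gt0//; lra.
have cF := cvg_small (fun K => n2_ge0 _) (Qc_cvg LF) d0.
have cu := cvg_small (fun K => n2_ge0 _) (Qc_cvg Lu) d0.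
have cW := cvg_small (fun K => n2_ge0 _) (Qc_cvg LW) dM.
near=> K.
have hF : n2 (fun b => Qc K (fun t => W t * u t) b - W b * u b) <= e / (20 * D) by near: K.
have hu : n2 (fun b => Qc K u b - u b) <= e / (20 * D) by near: K.
have hW : n2 (fun b => Qc K W b - W b) <= e / (20 * (M + 1)) by near: K.
have LQu := (Qc_L2 K Lu).1; have LQF := (Qc_L2 K LF).1; have LQW := (Qc_L2 K LW).1.
have Ldu := L2c_sub LQu Lu; have Lup := L2c_sub Lu Lp; have LdW := L2c_sub LQW LW.
have LdF := L2c_sub LQF LF.
have Ln (f : R -> R[i]) : L2c f -> L2c (fun t => - f t).
  by move=> Lf; under eq_fun do rewrite -mulN1r; exact: L2cZ.
have nn (f : R -> R[i]) : n2 (fun t => - f t) = n2 f.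
  by apply: eq_Rintegral => t _; rewrite csqN.
have LA : L2c (fun b => Qc K W b * (Qc K u b - u b)) by exact: (L2c_bndM (mQ1 K) (mQ2 K) Ldu (QWC K)).
have LB : L2c (fun b => (Qc K W b - W b) * u b).
  have [[n1 _] [n2' _]] := LdW.
  apply: (L2c_bndM n1 n2' Lu (C := 6 * C ^+ 2)) => t.
  apply: (le_trans (csqB _ _)); have := QWC K t; have := WC t; lra.
have hA : n2 (fun b => Qc K W b * (Qc K u b - u b)) <= 2 * C ^+ 2 * (e / (20 * D)).
  apply: (le_trans (n2_bndM (mQ1 K) (mQ2 K) Ldu (QWC K))).
  by apply: ler_wpM2l => //; rewrite mulr_ge0// sqr_ge0.
have [[w1 _] [w2 _]] := LdW.
have dWC t : csq (Qc K W t - W t) <= 6 * C ^+ 2.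
  apply: (le_trans (csqB _ _)); have := QWC K t; have := WC t; lra.
have LB1 : L2c (fun b => (Qc K W b - W b) * (u b - phi b)) by exact: (L2c_bndM w1 w2 Lup dWC).
have [[p1 _] [p2 _]] := Lp.
have LB2 : L2c (fun b => phi b * (Qc K W b - W b)) by exact: (L2c_bndM p1 p2 LdW pM).
have hB1 : n2 (fun b => (Qc K W b - W b) * (u b - phi b)) <= 6 * C ^+ 2 * (e / (20 * D)).
  apply: (le_trans (n2_bndM w1 w2 Lup dWC)).
  by apply: ler_wpM2l => //; rewrite mulr_ge0// sqr_ge0.
have hB2 : n2 (fun b => phi b * (Qc K W b - W b)) <= M * (e / (20 * (M + 1))).
  apply: (le_trans (n2_bndM p1 p2 LdW pM)).
  by apply: ler_wpM2l.
have hB := n2D_eps ltr01 LB1 LB2 LB; rewrite invr1 in hB.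
have {}hB : n2 (fun b => (Qc K W b - W b) * u b) <=
    (1 + 1) * n2 (fun b => (Qc K W b - W b) * (u b - phi b)) + (1 + 1) * n2 (fun b => phi b * (Qc K W b - W b)).
  by apply: hB => t _; ring.
have := n2D3 LdF (Ln _ LA) (Ln _ LB) (L2c_commut K); rewrite !nn.
move=> H; have {}H : n2 (commut K W u) <= 3 * n2 (fun t => Qc K (fun t => W t * u t) t - W t * u t) +
   3 * n2 (fun b => Qc K W b * (Qc K u b - u b)) + 3 * n2 (fun b => (Qc K W b - W b) * u b).
  by apply: H => t _; rewrite /commut; ring.
have f1 : M * (e / (20 * (M + 1))) <= e / 20.
  rewrite -[leLHS](_ : e / 20 * (M / (M + 1)) = _); last by field; lra.
  by rewrite ler_piMr ?divr_ge0 ?ltW// ltr_pdivrMr; lra.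
have f2 : (1 + 100 * C ^+ 2) * (e / (20 * D)) = e / 20 by rewrite -/D; field; rewrite gt_eqF.
have e20 : 0 <= e / (20 * D) by exact: ltW.
have c20 := mulr_ge0 (sqr_ge0 C) e20.
exact: (commut_arith e0 e20 c20 f2 f1 hF hB2 hB1 hB hA H).
Unshelve. all: by end_near.
Qed.

End fixed_W.
End commutator.

(** * The scalar gauge *)

Section geometric_bound.
Variable R : realType.
Notation mu := (@lebesgue_measure R).
Implicit Types (x y d c a b : R) (K : nat).

Lemma FTC2_on (F f : R -> R) a b : a <= b ->
  (forall x, a <= x <= b -> is_derive x 1 F (f x)) ->
  (forall x, a <= x <= b -> {for x, continuous f}) ->
  mu.-integrable `[a, b] (EFin \o f) /\ \int[mu]_(x in `[a, b]) f x = F b - F a.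
Proof.
move=> ab dF cf.
have wf : {within `[a, b], continuous f}.
  by apply/continuous_in_subspaceT => x; rewrite inE/= in_itv/=; exact: cf.
split.
  by apply: continuous_compact_integrable => //; exact: segment_compact.
have [<-|ab'] := eqVneq a b.
  by rewrite set_itv1 Rintegral_set1 subrr.
have cF x : a <= x <= b -> {for x, continuous F}.
  move=> /dF dFx; apply: differentiable_continuous; apply/derivable1_diffP.
  by case: dFx.
rewrite /Rintegral (continuous_FTC2 (F := F)) ?EFinB//.
- by rewrite lt_neqAle ab'.
- split.
  + by move=> x; rewrite in_itv/= => /andP[ax xb]; have /dF[] : a <= x <= b by rewrite !ltW.
  + by apply: cvg_at_right_filter; apply: cF; rewrite lexx ab.
  + by apply: cvg_at_left_filter; apply: cF; rewrite lexx ab.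
- move=> x; rewrite in_itv/= => /andP[ax xb].
  have /dF dx : a <= x <= b by rewrite !ltW.
  by rewrite derive1E; case: dx => _ ->.
Qed.

(** The derivative of atan (sqrt y). It behaves like y^(-1/2) at 0 and y^(-3/2) at infinity, hence
    is integrable on the half-line with an explicit primitive; it majorises the square root of a
    geometric sum. *)
Definition gam y : R := (2 * Num.sqrt y * (1 + y))^-1.

Lemma gam_ge0 y : 0 <= y -> 0 <= gam y.
Proof. by move=> y0; rewrite invr_ge0 mulr_ge0 ?mulr_ge0 ?sqrtr_ge0 ?addr_ge0. Qed.

Lemma sqr_gam y : 0 < y -> gam y ^+ 2 = (4 * y * (1 + y) ^+ 2)^-1.
Proof.
move=> y0; rewrite /gam exprVn !exprMn sqr_sqrtr ?ltW//.
by congr ((_ * _ * _)^-1); ring.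
Qed.

Lemma is_derive_atan_sqrt c d x : 0 < c * x + d ->
  is_derive x 1 (fun t => atan (Num.sqrt (c * t + d))) (c * gam (c * x + d)).
Proof.
move=> h.
have d1 : is_derive x 1 (fun t => c * t + d) c.
  have := is_deriveD (is_derive_linM c x) (is_derive_cst d x 1).
  by rewrite addr0.
have d2 := @is_derive1_comp _ Num.sqrt (fun t => c * t + d) x _ _ (is_derive1_sqrt h) d1.
have := @is_derive1_comp _ (@atan R) (fun t => Num.sqrt (c * t + d)) x _ _ (is_derive1_atan (Num.sqrt (c * x + d))) d2.
move=> H; apply: (is_derive_eq H).
have s0 : Num.sqrt (c * x + d) != 0 by rewrite gt_eqF// sqrtr_gt0.
have y0 : 1 + (c * x + d) != 0 by rewrite gt_eqF// addr_gt0.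
rewrite sqr_sqrtr ?ltW// /gam; move: s0 y0; move: (Num.sqrt _) (1 + _) => s y s0 y0.
by field; rewrite ?s0 ?y0.
Qed.

Lemma continuous_gam c d x : 0 < c * x + d ->
  {for x, continuous (fun t => c * gam (c * t + d))}.
Proof.
move=> h; apply: differentiable_continuous; apply/derivable1_diffP.
have d1 : is_derive x 1 (fun t => c * t + d) c.
  have := is_deriveD (is_derive_linM c x) (is_derive_cst d x 1).
  by rewrite addr0.
have d2 := @is_derive1_comp _ Num.sqrt (fun t => c * t + d) x _ _ (is_derive1_sqrt h) d1.
have d3 := is_deriveM (is_deriveZ (2 : R) d2) (is_deriveD (is_derive_cst (1 : R) x 1) d1).
have s0 : Num.sqrt (c * x + d) != 0 by rewrite gt_eqF// sqrtr_gt0.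
have n0 : 2 * Num.sqrt (c * x + d) * (1 + (c * x + d)) != 0.
  by rewrite !mulf_neq0// gt_eqF// addr_gt0.
have d4 := is_deriveZ c (@is_deriveV _ (fun t => 2 * Num.sqrt (c * t + d) * (1 + (c * t + d))) x _ _ n0 d3).
by case: d4.
Qed.

(** The primitive of the integrand is c times atan of a square root, and two values of atan differ
    by less than pi. The cases c = 1 and c = -1 serve the distances t - a and a - t. *)
Lemma Rintegral_gam c d a b : a <= b -> (forall x, a <= x <= b -> 0 < c * x + d) ->
  c ^+ 2 = 1 ->
  mu.-integrable `[a, b] (EFin \o (fun t => gam (c * t + d))) /\
  \int[mu]_(t in `[a, b]) gam (c * t + d) <= pi.
Proof.
move=> ab cd c1.
have [i E] := FTC2_on ab (fun x h => is_derive_atan_sqrt (cd x h)) (fun x h => continuous_gam (cd x h)).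
have e t : gam (c * t + d) = c * (c * gam (c * t + d)).
  by rewrite mulrA -expr2 c1 mul1r.
split.
  apply: (@eq_integrableR _ _ _ mu _ _ (fun t => c * (c * gam (c * t + d)))) => //.
  exact: (@integrableZR _ _ _ mu).
under eq_Rintegral do rewrite e.
rewrite RintegralZl// E.
have := atan_gtNpi2 (Num.sqrt (c * a + d)); have := atan_ltpi2 (Num.sqrt (c * a + d)).
have := atan_gtNpi2 (Num.sqrt (c * b + d)); have := atan_ltpi2 (Num.sqrt (c * b + d)).
move: (atan _) (atan _) => p q q1 q0 p1 p0.
have : c = 1 \/ c = -1.
  have : (c - 1) * (c + 1) == 0 by apply/eqP; rewrite -[RHS](subrr 1) -{3}c1; ring.
  by rewrite mulf_eq0 subr_eq0 addr_eq0 => /orP[]/eqP ->; [left|right].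
by case=> ->; lra.
Qed.

(** The sum is about 1 / (2 x) for small x, is at most K, and decays like e^(- 2 x). The shift by 1
    / (K + 1) keeps the right-hand side finite at x = 0 while its integral stays bounded uniformly
    in K. The argument yields 32; the perfect square 36 makes the square root clean. *)
Lemma geo_bound K x : 0 <= x ->
  \sum_(k < K) expR (- (2 * k.+1%:R * x)) <= 36 * gam (x + K.+1%:R^-1) ^+ 2.
Proof.
move=> x0; set s := expR (- (2 * x)).
have s0 : 0 < s by exact: expR_gt0.
have K0 : 0 < K.+1%:R :> R by rewrite ltr0n.
have d0 : 0 < K.+1%:R^-1 :> R by rewrite invr_gt0.
have d1 : K.+1%:R^-1 <= 1 :> R by rewrite invf_le1// ler1n.
have sE : \sum_(k < K) expR (- (2 * k.+1%:R * x)) = s * \sum_(k < K) s ^+ k.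
  rewrite mulr_sumr; apply: eq_bigr => k _; rewrite -exprS /s -expRM_natl.
  by congr expR; ring.
set T := \sum_(k < K) s ^+ k in sE *.
have s1 : s <= 1.
  apply: (@le_trans _ _ (expR 0)); last by rewrite expR0.
  by rewrite ler_expR oppr_le0 mulr_ge0.
have T0 : 0 <= T by apply: sumr_ge0 => k _; rewrite exprn_ge0 ?ltW.
have TK : T * K.+1%:R^-1 <= 1.
  rewrite ler_pdivrMr// mul1r; apply: (@le_trans _ _ K%:R); last by rewrite ler_nat.
  apply: (@le_trans _ _ (\sum_(k < K) 1)); last by rewrite sumr_const card_ord.
  by apply: ler_sum => k _; rewrite exprn_ile1// ltW.
have gT : (1 - s) * T <= 1.
  have := subrX1 s K; rewrite -/T => h.
  have : 0 <= s ^+ K by rewrite exprn_ge0 ?ltW.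
  by lra.
have xs : 2 * x * s <= 1 - s.
  have h : 1 + 2 * x <= expR (2 * x) by exact: expR_ge1Dx.
  have e : expR (2 * x) * s = 1 by rewrite /s -expRD subrr expR0.
  by have := ler_wpM2r (ltW s0) h; rewrite e; lra.
have TsT : T <= 1 + s * T.
  rewrite /T; case: (K) => [|k]; first by rewrite !big_ord0; lra.
  rewrite [leLHS]big_ord_recl expr0 lerD2l.
  rewrite big_ord_recr/= mulrDr mulr_sumr.
  rewrite -[leLHS]addr0 lerD//; last by rewrite mulr_ge0 ?exprn_ge0 ?ltW.
  by apply: ler_sum => i _; rewrite -exprS.
have xs0 : 0 <= 2 * x * s by rewrite mulr_ge0 ?(ltW s0)// mulr_ge0.
have h1 : 2 * x * (s * T) <= s * (2 * x + 1).
  have a1 : 2 * x * (s * T) <= 2 * x * s * (1 + s * T).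
    by rewrite mulrA ler_wpM2l.
  have a2 : 2 * x * s * T <= 1.
    by apply: le_trans gT; rewrite ler_wpM2r.
  have a3 : s * (2 * x * s * T) <= s * 1 by rewrite ler_wpM2l// ltW.
  apply: (le_trans a1); rewrite mulr1 in a3; move: a3; rewrite -subr_ge0 => a3.
  rewrite -subr_ge0; apply: (le_trans a3); rewrite le_eqVlt; apply/orP; left; apply/eqP; ring.
have h2 : K.+1%:R^-1 * (s * T) <= s.
  by rewrite mulrC -mulrA -[leRHS]mulr1 ler_wpM2l// ltW.
have y0 : 0 < x + K.+1%:R^-1 by rewrite ltr_wpDl.
rewrite sE sqr_gam//; move: h2 d0 d1 y0; move: (K.+1%:R^-1) => d h2 d0 d1 y0.
have h3 : (x + d) * (s * T) <= s * (x + 2) by lra.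
have p3 : 0 < 4 * (x + d) * (1 + (x + d)) ^+ 2 by rewrite !mulr_gt0//; lra.
rewrite ler_pdivlMr//.
(* Cubing 1 + x / 2 <= e^(x / 2) gives at most e^(3 x / 2), which s = e^(- 2 x) compensates. *)
have h4 : s * (x + 2) ^+ 3 <= 8.
  have h : 1 + x / 2 <= expR (x / 2) by exact: expR_ge1Dx.
  have h' : (1 + x / 2) ^+ 3 <= expR (x / 2) ^+ 3.
    by rewrite lerXn2r ?nnegrE ?expR_ge0//; lra.
  have e : expR (x / 2) ^+ 3 * s <= 1.
    apply: (@le_trans _ _ (expR 0)); last by rewrite expR0.
    by rewrite -expRM_natl /s -expRD ler_expR; lra.
  have h6 := ler_wpM2r (ltW s0) h'.
  have h5 : (1 + x / 2) ^+ 3 * s <= 1 by exact: le_trans h6 e.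
  rewrite -[leLHS](_ : 8 * ((1 + x / 2) ^+ 3 * s) = _); last by field.
  by rewrite -[leRHS]mulr1 ler_wpM2l.
have h5 : (1 + (x + d)) ^+ 2 <= (x + 2) ^+ 2.
  by rewrite lerXn2r ?nnegrE//; lra.
have h6 : (x + d) * (s * T) * (1 + (x + d)) ^+ 2 <= s * (x + 2) * (x + 2) ^+ 2.
  by apply: ler_pM => //; rewrite ?sqr_ge0 ?mulr_ge0 ?(ltW s0) ?(ltW y0).
rewrite -[leLHS](_ : 4 * ((x + d) * (s * T) * (1 + (x + d)) ^+ 2) = _); last by ring.
have e : s * (x + 2) * (x + 2) ^+ 2 = s * (x + 2) ^+ 3 by ring.
by rewrite e in h6; lra.
Qed.

End geometric_bound.

Section gauge.
Variable R : realType.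
Notation mu := (@lebesgue_measure R).
Notation J := (@circle R).
Implicit Types (a b t x : R).
Let mJ : measurable J. Proof. exact: measurable_circle. Qed.
Hint Resolve mJ : core.

Lemma csq_cauchy_schwarz n (x y : 'I_n -> R[i]) :
  csq (\sum_i x i * y i) <= (\sum_i csq (x i)) * (\sum_i csq (y i)).
Proof.
elim: n x y => [|n ih] x y; first by rewrite !big_ord0 csq0 mulr0.
rewrite !big_ord_recr/=.
have := ih (fun i => x (widen_ord (leqnSn n) i)) (fun i => y (widen_ord (leqnSn n) i)).
have P0 : 0 <= \sum_(i < n) csq (x (widen_ord (leqnSn n) i)) by apply: sumr_ge0 => i _; exact: csq_ge0.
have Q0 : 0 <= \sum_(i < n) csq (y (widen_ord (leqnSn n) i)) by apply: sumr_ge0 => i _; exact: csq_ge0.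
move: P0 Q0; move: (\sum_(i < n) csq _) (\sum_(i < n) csq _) (\sum_(i < n) _ * _) => Q P X P0 Q0 XPQ.
have := csqM (x ord_max) (y ord_max); have := csq_ge0 (x ord_max); have := csq_ge0 (y ord_max).
move: (x ord_max * _) (csq (x _)) (csq (y _)) => z p q q0 p0 zE.
have E : csq (X + z) = csq X + csq z + 2 * (complex.Re X * complex.Re z + complex.Im X * complex.Im z).
  by rewrite /csq !ReImE; ring.
set r := _ + _ * complex.Im z in E.
have rr : r ^+ 2 <= csq X * csq z.
  rewrite -subr_ge0 (_ : _ - _ = (complex.Re X * complex.Im z - complex.Im X * complex.Re z) ^+ 2) ?sqr_ge0//.
  by rewrite /r /csq; ring.
have : r <= (P * q + p * Q) / 2.
  have h0 : 0 <= (P * q + p * Q) / 2 by rewrite divr_ge0// addr_ge0// mulr_ge0.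
  apply: le_trans (ler_norm _) _; apply: sqr_le_norm => //; apply: (le_trans rr).
  rewrite zE; apply: (@le_trans _ _ (P * Q * (p * q))).
    by apply: ler_wpM2r => //; rewrite mulr_ge0.
  rewrite -subr_ge0 (_ : _ - _ = ((P * q - p * Q) / 2) ^+ 2) ?sqr_ge0//.
  by field.
by rewrite E zE; move: (csq X) XPQ => cX XPQ; lra.
Qed.

Lemma sum_low K (F : nat -> R) :
  \sum_(j < K.*2.+1) (if (j <= K)%N then F (K - j)%N else 0) = \sum_(k < K.+1) F k.
Proof.
transitivity (\sum_(j < K.*2.+1 | (j < K.+1)%N) F (K - j)%N).
  by rewrite [RHS]big_mkcond.
rewrite -(big_ord_widen _ (fun j => F (K - j)%N)); last first.
  by rewrite ltnS -addnn leq_addr.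
rewrite (reindex_inj rev_ord_inj)/=; apply: eq_bigr => k _; congr F.
by rewrite subSS subKn// -ltnS.
Qed.

Lemma sum_high K (F : nat -> R) :
  \sum_(j < K.*2.+1) (if (j <= K)%N then 0 else F (j - K)%N) = \sum_(k < K) F k.+1.
Proof.
rewrite -(big_mkord xpredT (fun j => if (j <= K)%N then 0 else F (j - K)%N)).
rewrite (@big_cat_nat _ _ _ K.+1)//=; last by rewrite ltnS -addnn leq_addr.
rewrite big1_seq ?add0r; last first.
  by move=> j /=; rewrite mem_index_iota ltnS => /andP[_ ->].
rewrite -{1}[K.+1]add0n big_addn subSS -addnn addnK big_mkord.
apply: eq_bigr => k _; rewrite leqNgt addnS ltnS leq_addl/=.
by rewrite subSn ?leq_addl// addnK.
Qed.

Lemma integrableC_sub (f : R -> R[i]) (A B : set R) : measurable A -> measurable B ->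
  A `<=` B -> integrableC B f -> integrableC A f.
Proof. by move=> mA mB AB [h1 h2]; split; [apply: integrableS h1|apply: integrableS h2]. Qed.

Lemma eq_integrableC (f g : R -> R[i]) (D : set R) : (forall t, f t = g t) ->
  integrableC D f -> integrableC D g.
Proof. by move=> /funext ->. Qed.

Lemma integrableC_sum n (f : 'I_n -> R -> R[i]) (D : set R) : measurable D ->
  (forall i, integrableC D (f i)) -> integrableC D (fun t => \sum_i f i t).
Proof.
move=> mD fi; split.
  apply: (@eq_integrableR _ _ _ mu _ _ (fun t => \sum_i complex.Re (f i t))) => //.
    by move=> t _; rewrite Re_sum.
  by apply: (@integrable_sumR _ _ _ mu) => // j _; case: (fi j).
apply: (@eq_integrableR _ _ _ mu _ _ (fun t => \sum_i complex.Im (f i t))) => //.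
  by move=> t _; rewrite Im_sum.
by apply: (@integrable_sumR _ _ _ mu) => // j _; case: (fi j).
Qed.

Lemma cint_split (f : R -> R[i]) A a : a \in `[0, A] -> integrableC `[0, A] f ->
  cint `[0, A] f = cint `[0, a] f + cint `[a, A] f.
Proof.
rewrite in_itv/= => /andP[a0 aA] [i1 i2].
have h (g : R -> R) : mu.-integrable `[0, A] (EFin \o g) ->
    \int[mu]_(t in `[0, A]) g t = \int[mu]_(t in `[0, a]) g t + \int[mu]_(t in `[a, A]) g t.
  move=> ig; have E := Rintegral_itvB (x := a) ig.
  have -> : \int[mu]_(t in `[a, A]) g t = \int[mu]_(t in `]a, A]) g t.
    rewrite Rintegral_itv_obnd_cbnd//; apply: integrableS ig => //.
    by apply: subset_itv; rewrite bnd_simp.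
  by rewrite -E ?bnd_simp// addrC subrK.
by apply: complex_ext; rewrite !ReImE/=; exact: h.
Qed.

Lemma Rintegral_le_abs (f g : R -> R) (D : set R) (M : R) : measurable D ->
  mu.-integrable D (EFin \o f) -> mu.-integrable D (EFin \o g) ->
  (forall t, D t -> `|f t| <= g t) -> \int[mu]_(t in D) g t <= M ->
  `|\int[mu]_(t in D) f t| <= M.
Proof.
move=> mD i1 i2 fg gM; apply: (le_trans (le_normr_Rintegral _ i1)) => //.
apply: le_trans gM; apply: le_Rintegral => //.
exact: integrable_norm.
Qed.

Section bound.
Variables (K : nat) (A C : R) (W : R -> R -> R[i]).
Hypotheses (A0 : 0 <= A) (C0 : 0 <= C) (lW : loc2 A W)
  (WC : forall a b, csq (W a b) <= C ^+ 2).

(** Solves (d_a + i d_b) g = 2 [Qc K W] mode by mode. Modes up to 0, that is j <= K, are integrated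
    from 0; for positive modes the initial value turns the integral from 0 to a into minus the
    integral from a to A. Thus every kernel e^(k (a - t)) that occurs is at most 1. *)
Definition gpoly : R -> {poly R[i]} := genP K (fun j => if (j <= K)%N then 0 else
  - cint `[0, A] (fun t => 2%:C * (polyK K t (W t))`_j)) W.

Let v (j : nat) t := (polyK K 0 (W t))`_j.

(** Parseval for the convolution, contraction, and |W| <= C on a circle of length 2 pi, whose length
    cancels against the Parseval factor. *)
Lemma sum_csq_mode t : \sum_(j < K.*2.+1) csq (v j t) <= C ^+ 2.
Proof.
have [_ LW _] := lW; have [LQ le] := Qc_L2 K (LW t).
have p0 : 0 < 2 * pi :> R by rewrite mulr_gt0// pi_gt0.
have E : n2 (Qc K (W t)) = 2 * pi * \sum_(j < K.*2.+1) csq (v j t).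
  transitivity (\int[mu]_(b in J) csq (polyK K 0 (W t)).[zeta 0 b]).
    by apply: eq_Rintegral => b _; rewrite csq_polyK// mulr0 expR0 mul1r.
  rewrite (parseval_poly _ (size_polyK K 0 (W t))); congr (_ * _).
  by apply: eq_bigr => j _; rewrite !mulr0 expR0 mul1r.
have : n2 (W t) <= C ^+ 2 * (2 * pi).
  rewrite -Rintegral_circle_cst; apply: le_Rintegral => //.
  - exact: L2c_integrable.
  - exact: integrable_circle_cst.
by move=> /(le_trans le); rewrite E mulrC ler_pM2r.
Qed.

Let x1 a b t (j : nat) : R[i] := if (j <= K)%N then
  (expR ((j%:R - K%:R) * (a - t)))%:C * cis ((j%:R - K%:R) * b) * 2%:C else 0.
Let x2 a b t (j : nat) : R[i] := if (j <= K)%N then 0 else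
  (expR ((j%:R - K%:R) * (a - t)))%:C * cis ((j%:R - K%:R) * b) * 2%:C.

Let csq_x (k : R) a t b : csq ((expR (k * (a - t)))%:C * cis (k * b) * 2%:C) =
  4 * expR (2 * k * (a - t)).
Proof.
rewrite !csqM !csq_real csq_cis mulr1 -expRM_natl mulrC -natrX.
by congr (_ * expR _); ring.
Qed.

Let dl : R := K.+1%:R^-1.

Let dl0 : 0 < dl. Proof. by rewrite invr_gt0 ltr0n. Qed.

(** The zero mode j = K contributes 4, the negative modes at most 4 * 36 gam^2 by [geo_bound]; both
    fit into one square because [gam] is nonnegative. The zero mode is what makes the gauge grow. *)
Let sum_x1 a b t : t <= a -> \sum_(j < K.*2.+1) csq (x1 a b t j) <=
  (2 * (1 + 6 * gam (- 1 * t + (a + dl)))) ^+ 2.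
Proof.
move=> ta.
have -> : \sum_(j < K.*2.+1) csq (x1 a b t j) = \sum_(k < K.+1) 4 * expR (- (2 * k%:R * (a - t))).
  rewrite -(sum_low K (fun k => 4 * expR (- (2 * k%:R * (a - t))))).
  apply: eq_bigr => j _; rewrite /x1; case: ifP => jK; last by rewrite csq0.
  by rewrite csq_x natrB//; congr (_ * expR _); ring.
rewrite big_ord_recl/= mulr0 mul0r oppr0 expR0 -mulr_sumr.
have at0 : 0 <= a - t by rewrite subr_ge0.
have := geo_bound K at0; rewrite -/dl (_ : a - t + dl = -1 * t + (a + dl)); last by ring.
have : 0 <= gam (- 1 * t + (a + dl)) by apply: gam_ge0; have := dl0; lra.
by move: (gam _) (\sum_(k < K) _) => g s g0 sg; nra.
Qed.

Let sum_x2 a b t : a <= t -> \sum_(j < K.*2.+1) csq (x2 a b t j) <=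
  (12 * gam (1 * t + (dl - a))) ^+ 2.
Proof.
move=> ta.
have -> : \sum_(j < K.*2.+1) csq (x2 a b t j) = \sum_(k < K) 4 * expR (- (2 * k.+1%:R * (t - a))).
  rewrite -(sum_high K (fun k => 4 * expR (- (2 * k%:R * (t - a))))).
  apply: eq_bigr => j _; rewrite /x2; case: leqP => jK; first by rewrite csq0.
  by rewrite csq_x natrB 1?ltnW//; congr (_ * expR _); ring.
rewrite -mulr_sumr.
have at0 : 0 <= t - a by rewrite subr_ge0.
have := geo_bound K at0; rewrite -/dl (_ : t - a + dl = 1 * t + (dl - a)); last by ring.
by move: (gam _) (\sum_(k < K) _) => g s sg; rewrite exprMn -natrX; lra.
Qed.

Let iq j : integrableC `[0, A] (fun t => 2%:C * (polyK K t (W t))`_j).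
Proof.
have [[[i1 _] _] [[i2 _] _]] := acP_genP K (fun=> 0) A0 lW j.
by split; [move: i1|move: i2]; congr (_.-integrable _ _); apply/funext => t /=; rewrite coefZ.
Qed.

Let xv a b (j : nat) t : (expR ((j%:R - K%:R) * (a - t)))%:C * cis ((j%:R - K%:R) * b) * 2%:C * v j t =
  (expR ((j%:R - K%:R) * a))%:C * cis ((j%:R - K%:R) * b) * (2%:C * (polyK K t (W t))`_j).
Proof.
rewrite [in RHS]coef_polyK -/(v j t).
have -> : (expR ((j%:R - K%:R) * (a - t)))%:C = (expR ((j%:R - K%:R) * a))%:C * (expR (- ((j%:R - K%:R) * t)))%:C.
  by rewrite -real_complexM -expRD; congr ((expR _)%:C); ring.
by ring.
Qed.

Let i1 a b j : integrableC `[0, A] (fun t => x1 a b t j * v j t).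
Proof.
rewrite /x1; case: leqP => jK; last first.
  rewrite (_ : (fun t => _) = fun=> 0); last by apply/funext => t; exact: mul0r.
  by split; apply: continuous_integrable; exact: cst_continuous.
apply: (eq_integrableC (fun t => esym (xv a b j t))).
exact: integrableCZ.
Qed.

Let i2 a b j : integrableC `[0, A] (fun t => x2 a b t j * v j t).
Proof.
rewrite /x2; case: leqP => jK.
  rewrite (_ : (fun t => _) = fun=> 0); last by apply/funext => t; exact: mul0r.
  by split; apply: continuous_integrable; exact: cst_continuous.
apply: (eq_integrableC (fun t => esym (xv a b j t))).
exact: integrableCZ.
Qed.

Let zetajK a b (j : nat) : zeta a b ^+ j =
  zeta a b ^+ K * ((expR ((j%:R - K%:R) * a))%:C * cis ((j%:R - K%:R) * b)).
Proof.
rewrite !zetaX /zeta mulrACA -real_complexM -expRD -cisD.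
by congr ((expR _)%:C * cis _); ring.
Qed.

Let S1 a b t := \sum_(j < K.*2.+1) x1 a b t j * v j t.
Let S2 a b t := \sum_(j < K.*2.+1) x2 a b t j * v j t.

Let subl a : a \in `[0, A] -> `[0, a]%classic `<=` `[0, A]%classic.
Proof. by rewrite in_itv/= => /andP[_ aA]; apply: subset_itvl; rewrite bnd_simp. Qed.

Let subr_ a : a \in `[0, A] -> `[a, A]%classic `<=` `[0, A]%classic.
Proof. by rewrite in_itv/= => /andP[a0 _]; apply: subset_itvr; rewrite bnd_simp. Qed.

(** Kernel representation of the gauge: the nonpositive modes see the source on [0, a], the positive
    ones on [a, A]. The common factor zeta^K is the usual shift from Laurent polynomials to
    polynomials. *)
Let gpolyE a b : a \in `[0, A] -> (gpoly a).[zeta a b] =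
  zeta a b ^+ K * (cint `[0, a] (S1 a b) - cint `[a, A] (S2 a b)).
Proof.
move=> aA.
have j1 j : integrableC `[0, a] (fun t => x1 a b t j * v j t).
  exact: integrableC_sub (subl aA) (i1 a b j).
have j2 j : integrableC `[a, A] (fun t => x2 a b t j * v j t).
  exact: integrableC_sub (subr_ aA) (i2 a b j).
rewrite /S1 /S2 !cint_sum//; try by move=> j; [exact: j1|exact: j2].
rewrite horner_poly -sumrB mulr_sumr; apply: eq_bigr => j _.
rewrite (zetajK a b j) mulrCA; congr (_ * _).
have q1 : integrableC `[0, a] (fun t => 2%:C * (polyK K t (W t))`_j) := integrableC_sub (measurable_itv _) (measurable_itv _) (subl aA) (iq j).
have q2 : integrableC `[a, A] (fun t => 2%:C * (polyK K t (W t))`_j) := integrableC_sub (measurable_itv _) (measurable_itv _) (subr_ aA) (iq j).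
have z0 D : cint D (fun t => 0 * v j t) = 0.
  rewrite (_ : (fun t => _) = fun=> 0); last by apply/funext => t; exact: mul0r.
  by apply: complex_ext; rewrite /= /Rintegral integral0_eq.
have zq (D : set R) : measurable D -> integrableC D (fun t => 2%:C * (polyK K t (W t))`_j) ->
    cint D (fun t => (expR ((j%:R - K%:R) * (a - t)))%:C * cis ((j%:R - K%:R) * b) * 2%:C * v j t) =
    cint D (fun t => 2%:C * (polyK K t (W t))`_j) * ((expR ((j%:R - K%:R) * a))%:C * cis ((j%:R - K%:R) * b)).
  move=> mD iD; rewrite (eq_cint (fun t _ => xv a b j t)) [RHS]mulrC; exact: cintZ.
rewrite /x1 /x2; case: leqP => jK; rewrite z0 zq//.
  by rewrite add0r subr0.
by rewrite sub0r (cint_split aA (iq j)) opprD addrAC addNr add0r mulNr.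
Qed.

Let le_of_csq (z : R[i]) (y : R) : 0 <= y -> csq z <= y ^+ 2 ->
  `|complex.Re z| <= y /\ `|complex.Im z| <= y.
Proof.
move=> y0 zy; split; apply: sqr_le_norm => //.
  exact: le_trans (sqr_Re_le _) zy.
exact: le_trans (sqr_Im_le _) zy.
Qed.

(** Cauchy-Schwarz over the modes bounds the integrand by C times the square-summed kernel.
    Integrating in t, the zero mode gives 2 C a, and the remaining modes give at most 12 C pi on
    each side of a, together 24 C pi. *)
Lemma gpoly_bound a b : a \in `[0, A] -> exists g : R[i],
  [/\ (gpoly a).[zeta a b] = zeta a b ^+ K * g,
     `|complex.Re g| <= 2 * C * (a + 12 * pi) & `|complex.Im g| <= 2 * C * (a + 12 * pi)].
Proof.
move=> aA; exists (cint `[0, a] (S1 a b) - cint `[a, A] (S2 a b)).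
have /andP[a0 a1] : 0 <= a <= A by move: aA; rewrite in_itv.
have [ig1 G1] : mu.-integrable `[0, a] (EFin \o (fun t => gam (- 1 * t + (a + dl)))) /\
    \int[mu]_(t in `[0, a]) gam (- 1 * t + (a + dl)) <= pi.
  apply: Rintegral_gam => //; last by ring.
  by move=> x /andP[x0 xa]; have := dl0; lra.
have [ig2 G2] : mu.-integrable `[a, A] (EFin \o (fun t => gam (1 * t + (dl - a)))) /\
    \int[mu]_(t in `[a, A]) gam (1 * t + (dl - a)) <= pi.
  apply: Rintegral_gam => //; last by ring.
  by move=> x /andP[x0 xa]; have := dl0; lra.
have j1 : integrableC `[0, a] (S1 a b).
  apply: (integrableC_sub _ _ (subl aA)) => //.
  by apply: integrableC_sum => // j; exact: i1.
have j2 : integrableC `[a, A] (S2 a b).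
  apply: (integrableC_sub _ _ (subr_ aA)) => //.
  by apply: integrableC_sum => // j; exact: i2.
pose h1 t : R := 2 * C * (1 + 6 * gam (- 1 * t + (a + dl))).
pose h2 t : R := 12 * C * gam (1 * t + (dl - a)).
have b1 t : t \in `[0, a] -> `|complex.Re (S1 a b t)| <= h1 t /\ `|complex.Im (S1 a b t)| <= h1 t.
  rewrite in_itv/= => /andP[t0 ta].
  have g0 : 0 <= gam (- 1 * t + (a + dl)) by apply: gam_ge0; have := dl0; lra.
  apply: le_of_csq; first by rewrite !mulr_ge0// addr_ge0// mulr_ge0.
  apply: (le_trans (csq_cauchy_schwarz _ _)).
  rewrite /h1 -[leRHS](_ : (2 * (1 + 6 * gam (- 1 * t + (a + dl)))) ^+ 2 * C ^+ 2 = _); last by ring.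
  apply: ler_pM; [by apply: sumr_ge0 => j _; exact: csq_ge0|by apply: sumr_ge0 => j _; exact: csq_ge0|exact: sum_x1|exact: sum_csq_mode].
have b2 t : t \in `[a, A] -> `|complex.Re (S2 a b t)| <= h2 t /\ `|complex.Im (S2 a b t)| <= h2 t.
  rewrite in_itv/= => /andP[t0 ta].
  have g0 : 0 <= gam (1 * t + (dl - a)) by apply: gam_ge0; have := dl0; lra.
  apply: le_of_csq; first by rewrite !mulr_ge0.
  apply: (le_trans (csq_cauchy_schwarz _ _)).
  rewrite /h2 -[leRHS](_ : (12 * gam (1 * t + (dl - a))) ^+ 2 * C ^+ 2 = _); last by ring.
  apply: ler_pM; [by apply: sumr_ge0 => j _; exact: csq_ge0|by apply: sumr_ge0 => j _; exact: csq_ge0|exact: sum_x2|exact: sum_csq_mode].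
have ic (c : R) : mu.-integrable `[0, a] (EFin \o (fun=> c)).
  by apply: continuous_integrable; exact: cst_continuous.
have i6 : mu.-integrable `[0, a] (EFin \o (fun t => 6 * gam (- 1 * t + (a + dl)))) by exact: (@integrableZR _ _ _ mu).
have i16 : mu.-integrable `[0, a] (EFin \o (fun t => 1 + 6 * gam (- 1 * t + (a + dl)))) by exact: (@integrableDR _ _ _ mu).
have ih1 : mu.-integrable `[0, a] (EFin \o h1) by exact: (@integrableZR _ _ _ mu).
have ih2 : mu.-integrable `[a, A] (EFin \o h2) by exact: (@integrableZR _ _ _ mu).
have H1 : \int[mu]_(t in `[0, a]) h1 t <= 2 * C * (a + 6 * pi).
  rewrite /h1 RintegralZl//; apply: ler_wpM2l; first by rewrite mulr_ge0.
  rewrite RintegralD// RintegralZl//.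
  have -> : \int[mu]_(t in `[0, a]) (1 : R) = a.
    by rewrite (FTC2 a0 (is_derive_linM 1) (@cst_continuous _ _ _)) !mul1r subr0.
  by rewrite lerD2l ler_wpM2l.
have H2 : \int[mu]_(t in `[a, A]) h2 t <= 12 * C * pi.
  by rewrite /h2 RintegralZl//; apply: ler_wpM2l => //; rewrite mulr_ge0.
have k1 := Rintegral_le_abs (measurable_itv _) j1.1 ih1 (fun t h => (b1 t h).1) H1.
have k2 := Rintegral_le_abs (measurable_itv _) j1.2 ih1 (fun t h => (b1 t h).2) H1.
have k3 := Rintegral_le_abs (measurable_itv _) j2.1 ih2 (fun t h => (b2 t h).1) H2.
have k4 := Rintegral_le_abs (measurable_itv _) j2.2 ih2 (fun t h => (b2 t h).2) H2.
have e : 2 * C * (a + 12 * pi) = 2 * C * (a + 6 * pi) + 12 * C * pi by ring.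
split; first exact: gpolyE.
- rewrite ReD ReN/= e; apply: (le_trans (ler_normB _ _)); exact: lerD.
- rewrite ImD ImN/= e; apply: (le_trans (ler_normB _ _)); exact: lerD.
Qed.

End bound.
End gauge.

Section gauged_inequality.
Variable R : realType.
Notation mu := (@lebesgue_measure R).
Notation J := (@circle R).
Implicit Types (a b t x y : R).
Let mJ : measurable J. Proof. exact: measurable_circle. Qed.
Hint Resolve mJ : core.

Lemma mjoint_poly n (P : R -> {poly R[i]}) : (forall a, size (P a) <= n)%N ->
  (forall j, measurable_fun setT (fun a => complex.Re (P a)`_j) /\
             measurable_fun setT (fun a => complex.Im (P a)`_j)) ->
  mjoint (fun a b => (P a).[zeta a b]).
Proof.
move=> szP mP.
have me (k : R) : measurable_fun setT (fun z : R * R => expR (k * z.1)).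
  exact: (measurableT_comp (measurable_wt k) measurable_fst).
have mc (k : R) : measurable_fun setT (fun z : R * R => cos (k * z.2)).
  by apply: (measurableT_comp (f := fun t => cos (k * t))) => //; apply: continuous_measurable_fun; exact: continuous_cosM.
have ms (k : R) : measurable_fun setT (fun z : R * R => sin (k * z.2)).
  by apply: (measurableT_comp (f := fun t => sin (k * t))) => //; apply: continuous_measurable_fun; exact: continuous_sinM.
have mz (j : nat) : mjoint (fun a b => zeta a b ^+ j).
  split.
    have h : measurable_fun setT (fun z : R * R => expR (j%:R * z.1) * cos (j%:R * z.2)) by exact: measurable_funM.
    by move: h; congr measurable_fun; apply/funext => z; rewrite zetaX ReM/= mul0r subr0.
  have h : measurable_fun setT (fun z : R * R => expR (j%:R * z.1) * sin (j%:R * z.2)) by exact: measurable_funM.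
  by move: h; congr measurable_fun; apply/funext => z; rewrite zetaX ImM/= mul0r addr0.
have mt (j : nat) : mjoint (fun a b => (P a)`_j * zeta a b ^+ j).
  apply: mjointM => //; have [m1 m2] := mP j; split.
    exact: (measurableT_comp m1 measurable_fst).
  exact: (measurableT_comp m2 measurable_fst).
have E a b : (P a).[zeta a b] = \sum_(j < n) (P a)`_j * zeta a b ^+ j by exact: horner_coef_wide.
have : mjoint (fun a b => \sum_(j < n) (P a)`_j * zeta a b ^+ j).
  split.
    have h : measurable_fun setT (fun z : R * R => \sum_(j < n) complex.Re ((P z.1)`_j * zeta z.1 z.2 ^+ j)).
      by apply: measurable_sum => j; case: (mt j).
    by move: h; congr measurable_fun; apply/funext => z; rewrite Re_sum.
  have h : measurable_fun setT (fun z : R * R => \sum_(j < n) complex.Im ((P z.1)`_j * zeta z.1 z.2 ^+ j)).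
    by apply: measurable_sum => j; case: (mt j).
  by move: h; congr measurable_fun; apply/funext => z; rewrite Im_sum.
by congr mjoint; apply/funext => a; apply/funext => b.
Qed.

Lemma measurable_prim (q : R -> R) : measurable_fun setT q ->
  measurable_fun setT (fun a => \int[mu]_(t in `[0, a]) q t).
Proof.
move=> mq.
have mL : measurable [set z : R * R | z.2 <= z.1].
  rewrite (_ : [set z | _] = (fun z : R * R => z.1 - z.2) @^-1` `[0, +oo[).
    by rewrite -[X in measurable X]setTI; apply: measurable_funB.
  by apply/seteqP; split => z /=; rewrite in_itv/= andbT subr_ge0.
have mF : measurable_fun setT (fun z : R * R => q z.2 * \1_[set z : R * R | z.2 <= z.1] z).
  apply: measurable_funM; first exact: (measurableT_comp mq measurable_snd).
  exact: measurable_indic.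
have := @measurable_Rint_section _ _ _ _ _ mu `[0, +oo[%classic _ (measurable_itv _) mF.
congr measurable_fun; apply/funext => a.
have xe : `[0, a]%classic = `[0, +oo[%classic `&` [set y | y <= a].
  apply/seteqP; split => y /=; rewrite !in_itv/= ?andbT.
    by move=> /andP[y0 yx].
  by move=> [-> ->].
have inr (y : R) : y \in `[0, +oo[ -> q y * \1_[set z : R * R | z.2 <= z.1] (a, y) =
    (q \_ [set y | y <= a]) y.
  move=> _; rewrite indic_graph_le (restrict_leE _ (fun y => y <= a)).
  by case: ifP; rewrite ?mulr1 ?mulr0.
by rewrite xe Rintegral_mkcondr; apply: eq_Rintegral => y /set_mem; exact: inr.
Qed.

Lemma mjointX (f : R -> R -> R[i]) n : mjoint f -> mjoint (fun a b => f a b ^+ n).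
Proof.
move=> mf; elim: n => [|n ih]; first by split; under eq_fun do rewrite expr0; exact: measurable_cst.
have := mjointM mf ih; congr mjoint; apply/funext => a; apply/funext => b.
by rewrite exprS.
Qed.

Lemma mjoint_gpoly K A (W : R -> R -> R[i]) : mjoint W ->
  mjoint (fun a b => (gpoly K A W a).[zeta a b]).
Proof.
move=> mW; apply: (@mjoint_poly K.*2.+1); first by move=> a; exact: size_poly.
move=> j; have [m1 m2] := measurable_coef_polyK K j mW.
have ZR (w : R[i]) : complex.Re (2%:C * w) = 2 * complex.Re w by rewrite ReM/= mul0r subr0.
have ZI (w : R[i]) : complex.Im (2%:C * w) = 2 * complex.Im w by rewrite ImM/= mul0r addr0.
have n1 : measurable_fun setT (fun t => complex.Re (2%:C * (polyK K t (W t))`_j)).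
  by under eq_fun do rewrite ZR; exact: measurable_funM.
have n2 : measurable_fun setT (fun t => complex.Im (2%:C * (polyK K t (W t))`_j)).
  by under eq_fun do rewrite ZI; exact: measurable_funM.
case: (ltnP j K.*2.+1) => jK; last first.
  by split; under eq_fun do rewrite coef_poly ltnNge jK/=; exact: measurable_cst.
split.
  under eq_fun do rewrite coef_poly jK ReD.
  by apply: measurable_funD => //; exact: measurable_prim.
under eq_fun do rewrite coef_poly jK ImD.
by apply: measurable_funD => //; exact: measurable_prim.
Qed.

(* Powers (1 - g/M)^M stand in for exp(-g): they keep the gauge polynomial. *)
Lemma gauge_bounds (M : nat) (B : R) (g : R[i]) : (0 < M)%N -> 0 <= B -> 4 * B <= M%:R ->
  `|complex.Re g| <= B -> `|complex.Im g| <= B ->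
  let e := 1 - (M%:R^-1)%:C * g in
  [/\ expR (- (4 * B)) <= csq (e ^+ M), csq (e ^+ M) <= expR (4 * B) &
      csq (e ^+ M.-1) <= 2 * csq (e ^+ M)].
Proof.
move=> M0 B0 BM gR gI e.
have M0' : 0 < M%:R :> R by rewrite ltr0n.
pose y := B / M%:R.
have y0 : 0 <= y by rewrite divr_ge0// ltW.
have y4 : 4 * y <= 1 by rewrite /y mulrA ler_pdivrMr// mul1r.
have eR : complex.Re e = 1 - M%:R^-1 * complex.Re g by rewrite ReD ReN ReM/= mul0r subr0.
have eI : complex.Im e = - (M%:R^-1 * complex.Im g) by rewrite ImD ImN ImM/= mul0r addr0 add0r.
have xR : `|M%:R^-1 * complex.Re g| <= y.
  by rewrite normrM gtr0_norm ?invr_gt0// /y mulrC ler_wpM2r// invr_ge0 ltW.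
have xI : `|M%:R^-1 * complex.Im g| <= y.
  by rewrite normrM gtr0_norm ?invr_gt0// /y mulrC ler_wpM2r// invr_ge0 ltW.
(* With |Re g| and |Im g| at most B = y M, the modulus of e lies between 1 - y and 1 + 2 y.
   Comparing these with e^(- 2 y) and e^(2 y) and taking 2 M-th powers gives the exponents -4 B and
   4 B, independently of M. *)
have lo : (1 - y) ^+ 2 <= csq e.
  rewrite /csq eR eI; move: xR xI; rewrite !ler_norml => /andP[a1 a2] /andP[b1 b2].
  by move: (M%:R^-1 * _) (M%:R^-1 * _) a1 a2 b1 b2 => p q a1 a2 b1 b2; nra.
have hi : csq e <= (1 + 2 * y) ^+ 2.
  rewrite /csq eR eI; move: xR xI; rewrite !ler_norml => /andP[a1 a2] /andP[b1 b2].
  by move: (M%:R^-1 * _) (M%:R^-1 * _) a1 a2 b1 b2 => p q a1 a2 b1 b2; nra.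
have yM : y * M%:R = B by rewrite /y divfK// gt_eqF.
have y1 : expR (- (2 * y)) <= 1 - y.
  have h : 1 + 2 * y <= expR (2 * y) by exact: expR_ge1Dx.
  rewrite expRN -[leLHS]mul1r ler_pdivrMr ?expR_gt0//.
  by move: h; move: (expR _) => E h; nra.
have y2 : 1 + 2 * y <= expR (2 * y) by exact: expR_ge1Dx.
have e0 : 0 <= csq e by exact: csq_ge0.
split.
- rewrite csqX; have -> : expR (- (4 * B)) = (expR (- (2 * y)) ^+ 2) ^+ M.
    by rewrite -exprM -expRM_natl natrM -yM; congr expR; ring.
  rewrite lerXn2r ?nnegrE ?exprn_ge0 ?expR_ge0//; apply: le_trans lo.
  by rewrite lerXn2r ?nnegrE ?expR_ge0//; lra.
- rewrite csqX; have -> : expR (4 * B) = (expR (2 * y) ^+ 2) ^+ M.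
    by rewrite -exprM -expRM_natl natrM -yM; congr expR; ring.
  rewrite lerXn2r ?nnegrE ?exprn_ge0 ?expR_ge0//; apply: (le_trans hi).
  by rewrite lerXn2r ?nnegrE ?expR_ge0//; lra.
- rewrite !csqX -{2}(prednK M0) exprS.
  have : 1 <= 2 * csq e by apply: (@le_trans _ _ (2 * (1 - y) ^+ 2)); [nra|rewrite ler_wpM2l].
  have : 0 <= csq e ^+ M.-1 by rewrite exprn_ge0.
  by move: (csq e ^+ M.-1) => p p0 h; rewrite mulrA ler_peMl.
Qed.

Lemma csq_le2 (g : R[i]) y : `|complex.Re g| <= y -> `|complex.Im g| <= y ->
  csq g <= 2 * y ^+ 2.
Proof.
move=> h1 h2; have y0 : 0 <= y by rewrite (le_trans _ h1).
rewrite /csq -(real_normK (num_real (complex.Re g))) -(real_normK (num_real (complex.Im g))).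
by rewrite mulr2n mulrDl mul1r lerD// lerXn2r ?nnegrE.
Qed.

(** X is the gauged integral. It reappears on the right with coefficient 4 * 8^-1 = 1/2 and is
    absorbed; [E0] is the price of passing between gauged and ungauged quantities. *)
Lemma gauge_arith (E0 I X b0 bA IR IH n0 nA : R) : 0 < E0 ->
  X <= 4 * IH + 2 * (b0 + bA) -> IH <= 8 * E0 * IR + 8^-1 * X -> I <= E0 * X ->
  b0 <= E0 * n0 -> bA <= E0 * nA -> I <= E0 ^+ 2 * (64 * IR + 4 * (n0 + nA)).
Proof.
move=> E0p h1 h2 h3 h4 h5.
have hX : X <= E0 * (64 * IR + 4 * (n0 + nA)) by lra.
by apply: (le_trans h3); rewrite expr2 -mulrA ler_pM2l.
Qed.

(** The bound of [gpoly_bound]. As 4 B = 8 C a + 96 C pi, the factor e^(4 B) is a shift of the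
    exponent of the weight by 8 C times the constant [gaugeE]. *)
Definition gaugeB (C a : R) : R := 2 * C * (a + 12 * pi).
Definition gaugeE (C : R) : R := expR (96 * C * pi).

Section fixed.
Variables (A C : R) (u W : R -> R -> R[i]) (m : nat).
Hypotheses (A0 : 0 <= A) (C0 : 0 <= C) (lu : loc2 A u) (lW : loc2 A W)
  (WC : forall a b, csq (W a b) <= C ^+ 2).
Let f a b := W a b * u a b.
Let k : R := 2 * m%:R + 1.
Local Notation B := (gaugeB C).
Local Notation E0 := (gaugeE C).

Let lf : loc2 A f.
Proof.
apply: (@loc2_le _ _ _ u (C ^+ 2)) => //.
  by apply: mjointM; [case: lW|case: lu].
by move=> a b; rewrite csqM ler_wpM2r ?csq_ge0.
Qed.

Let B_ge0 a : 0 <= a -> 0 <= B a.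
Proof.
by move=> a0; rewrite /gaugeB !mulr_ge0// addr_ge0// mulr_ge0// pi_ge0.
Qed.

Let expB a : expR (4 * B a) = E0 * expR (8 * C * a).
Proof. by rewrite /gaugeE -expRD; congr expR; rewrite /gaugeB; ring. Qed.

Let mjoint_commut K : mjoint (fun a => commut K (W a) (u a)).
Proof.
have [mW _ _] := lW; have [mu_ _ _] := lu; have [mf _ _] := lf.
by apply: mjointB; [exact: mjoint_Qc mf|apply: mjointM; exact: mjoint_Qc].
Qed.

Let secW a : measurable_fun setT (fun t => complex.Re (W a t)) /\
  measurable_fun setT (fun t => complex.Im (W a t)).
Proof. by apply: mjoint_sec; case: lW. Qed.

Let Lcom K a : L2c (commut K (W a) (u a)).
Proof. by have [m1 m2] := secW a; have [_ Lu _] := lu; exact: (L2c_commut m1 m2 C0 (WC a) (Lu a)). Qed.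

(** Multiplying the solution by e^M, where e = 1 - g / M, removes the zeroth-order term up to two
    errors: the commutator, and a term with the factor 1 - e = g / M, which a large M makes small
    enough to absorb. The resulting constants do not depend on M or A. *)
Lemma carleman_gauge_K K :
  {ae mu, forall a, a \in `[0, A] -> solves K u f a} -> solves K u f A ->
  \int[mu]_(a in `[0, A]) (wt (k - 8 * C) a * n2 (Qc K (u a))) <=
  E0 ^+ 2 * (64 * \int[mu]_(a in `[0, A]) (wt (k + 8 * C) a * n2 (commut K (W a) (u a))) +
  4 * (n2 (Qc K (u 0)) + wt (k + 8 * C) A * n2 (Qc K (u A)))).
Proof.
move=> sae sA.
have [mu_ Lu Iu] := lu; have [_ Lf If] := lf.
(* Large enough for 4 B <= M, required by [gauge_bounds], and for 32 B C <= M, which makes |1 - e|^2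
   C^2 at most 1/512. *)
pose M := (Num.bound (4 * B A * (1 + 8 * C))).+1.
have M0 : 0 < M%:R :> R by rewrite ltr0n.
have C8 : 0 <= 8 * C by rewrite mulr_ge0.
have BA0 := B_ge0 A0.
have MB : 4 * B A * (1 + 8 * C) <= M%:R.
  apply: ltW; apply: (lt_trans (archi_boundP _)); last by rewrite ltr_nat.
  by apply: mulr_ge0; [apply: mulr_ge0|apply: addr_ge0].
have Mn : (0 < M)%N by [].
clearbody M.
pose c : R[i] := - (M%:R^-1)%:C.
pose g0 := gpoly K A W.
(* 'X^K plays the role of 1 once zeta^K is factored out, so [P a] evaluates to zeta^K (1 - g / M).
   In the derivative of its M-th power the factor M cancels the 1 / M, leaving -2 times the (M-1)-th
   power times the convolved W. *)
pose P a : {poly R[i]} := 'X^K + c%:P * g0 a.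
pose Q a : {poly R[i]} := 0 + (0 * g0 a + c%:P * (2%:C *: polyK K a (W a))).
have acPQ : acP A P Q.
  apply: acP_add; first exact: acP_cst.
  apply: acP_mul => //; first exact: acP_cst.
  exact: acP_genP.
pose PE a := P a ^+ M; pose QE a := P a ^+ M.-1 * Q a *+ M.
have acE : acP A PE QE by exact: acP_exp.
have sg a : (size (g0 a) <= K.*2.+1)%N by exact: size_poly.
have scM (q : {poly R[i]}) : (size (c%:P * q)%R <= size q)%N.
  by rewrite mul_polyC; exact: size_scale_leq.
have sP a : (size (P a) <= K.*2.+1)%N.
  apply: (leq_trans (size_polyD _ _)); rewrite geq_max size_polyXn ltnS -addnn leq_addr/=.
  by rewrite addnn; exact: leq_trans (scM _) (sg a).
have sQ a : (size (Q a) <= K.*2.+1)%N.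
  rewrite /Q mul0r !add0r; apply: (leq_trans (scM _)).
  by apply: (leq_trans (size_scale_leq _ _)); exact: size_polyK.
have sX a i : (size (P a ^+ i) <= (K.*2 * i).+1)%N.
  apply: (leq_trans (size_poly_exp_leq _ _)); rewrite ltnS leq_mul2r; apply/orP; right.
  by have := sP a; case: (size _).
pose nn := ((K.*2 * M).+1 + (K.*2 * M.-1).+1 + K.*2.+1)%N.
have sPE a : (size (PE a) <= nn)%N.
  by apply: (leq_trans (sX a M)); rewrite /nn -addnA leq_addr.
have sQE a : (size (QE a) <= nn)%N.
  rewrite /QE -mulr_natl -polyCMn mul_polyC.
  apply: (leq_trans (size_scale_leq _ _)); apply: (leq_trans (size_polyMleq _ _)).
  apply: (leq_trans (leq_pred _)); rewrite /nn -addnA; apply: leq_trans (leq_addl _ _).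
  by apply: leq_add.
have := carleman_gauged (K * M) m A0 lu lf acE sPE sQE sae sA.
set X := \int[mu]_(a in `[0, A]) (cweight _ _ _ * n2 (fun b => _.[_] * _)).
have wtE a : cweight (K * M) m a * expR (2 * (K * M)%:R * a) = wt k a :> R.
  by rewrite /cweight /wt -expRD; congr expR; rewrite /k; ring.
have gb a b : a \in `[0, A] -> exists e : R[i],
   [/\ (P a).[zeta a b] = zeta a b ^+ K * e,
      expR (- (4 * B a)) <= csq (e ^+ M), csq (e ^+ M) <= expR (4 * B a),
      csq (e ^+ M.-1) <= 2 * csq (e ^+ M) & csq (1 - e) * C ^+ 2 <= 1 / 512].
  move=> aA; have [g [gE gR gI]] := gpoly_bound K A0 C0 lW WC b aA.
  have /andP[a0 aA'] : 0 <= a <= A by move: aA; rewrite in_itv.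
  have Ba := B_ge0 a0.
  have BaA : B a <= B A by rewrite /gaugeB ler_wpM2l ?mulr_ge0// lerD2r.
  have BM : 4 * B a <= M%:R by nra.
  have BC : 32 * (B a * C) <= M%:R by nra.
  have [h1 h2 h3] := gauge_bounds Mn Ba BM gR gI.
  exists (1 - (M%:R^-1)%:C * g); split => //.
    rewrite /P hornerD hornerXn hornerM hornerC gE /c; ring.
  rewrite opprB subrKC csqM csq_real -mulrA.
  have gC : csq g * C ^+ 2 <= 2 * (B a * C) ^+ 2.
    by rewrite exprMn [leRHS]mulrA; apply: ler_wpM2r; [exact: sqr_ge0|exact: csq_le2].
  have BC2 : 1024 * (B a * C) ^+ 2 <= M%:R ^+ 2.
    have -> : 1024 * (B a * C) ^+ 2 = (32 * (B a * C)) ^+ 2 by ring.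
    have p0 : 0 <= 32 * (B a * C) by apply: mulr_ge0 => //; exact: mulr_ge0.
    by rewrite lerXn2r ?nnegrE// ltW.
  rewrite exprVn mulrC ler_pdivrMr ?exprn_gt0//.
  by move: gC BC2; move: (csq g * _) ((B a * C) ^+ 2) (M%:R ^+ 2) => *; lra.
pose H a b := (QE a).[zeta a b] * Qc K (u a) b + (PE a).[zeta a b] * (2%:C * Qc K (f a) b).
pose Y a b := (PE a).[zeta a b] * Qc K (u a) b.
have LQu a : L2c (Qc K (u a)) := (Qc_L2 K (Lu a)).1.
have LQf a : L2c (Qc K (f a)) := (Qc_L2 K (Lf a)).1.
have LY a : L2c (Y a) by exact: L2c_horner.
have LH a : L2c (H a) by apply: L2c_add; apply: L2c_horner => //; exact: L2cZ.
pose z a : R := expR (2 * (K * M)%:R * a).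
have z0 a : 0 < z a by exact: expR_gt0.
have csqz a b : csq ((zeta a b ^+ K) ^+ M) = z a.
  by rewrite -exprM csqX csq_zeta -expRM_natl; congr expR; ring.
have PEE a b e : (P a).[zeta a b] = zeta a b ^+ K * e ->
    (PE a).[zeta a b] = (zeta a b ^+ K) ^+ M * e ^+ M.
  by move=> PaE; rewrite /PE horner_exp PaE exprMn.
have F1 a b : a \in `[0, A] -> csq (Qc K (u a) b) <= E0 * expR (8 * C * a) / z a * csq (Y a b).
  move=> /(gb a b)[e [Pe h1 _ _ _]].
  rewrite /Y (PEE _ _ _ Pe) !csqM csqz -expB.
  rewrite -[leRHS](_ : (expR (4 * B a) * csq (e ^+ M)) * csq (Qc K (u a) b) = _); last first.
    by field; rewrite gt_eqF.
  rewrite ler_peMl ?csq_ge0//.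
  have := ler_wpM2l (expR_ge0 (4 * B a)) h1.
  by rewrite -expRD addrN expR0.
have F2 a b : a \in `[0, A] -> csq (Y a b) <= z a * (E0 * expR (8 * C * a)) * csq (Qc K (u a) b).
  move=> /(gb a b)[e [Pe _ h2 _ _]].
  rewrite /Y (PEE _ _ _ Pe) !csqM csqz -expB.
  by rewrite ler_wpM2r ?csq_ge0// ler_wpM2l// ltW.
have F3 a b : a \in `[0, A] -> csq (H a b) <=
    8 * z a * (E0 * expR (8 * C * a)) * csq (commut K (W a) (u a) b) + 8^-1 * csq (Y a b).
  move=> /(gb a b)[e [Pe _ h2 h3 h4]].
  have QEE : (QE a).[zeta a b] = (zeta a b ^+ K) ^+ M * e ^+ M.-1 * (- 2%:C * Qc K (W a) b).
    have [_ LW _] := lW.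
    rewrite /QE hornerMn hornerM horner_exp Pe /Q mul0r !add0r hornerM hornerC hornerZ polyK_eval//.
    rewrite exprMn (_ : (zeta a b ^+ K) ^+ M = (zeta a b ^+ K) ^+ M.-1 * zeta a b ^+ K); last by rewrite -exprSr prednK.
    rewrite -[LHS]mulr_natl.
    have cM : M%:R * c = -1.
      rewrite /c mulrN -[M%:R](rmorph_nat (real_complex R)) -real_complexM mulfV ?gt_eqF//.
    rewrite -[LHS](_ : (M%:R * c) * ((zeta a b ^+ K) ^+ M.-1 * e ^+ M.-1 * (2%:C * (zeta a b ^+ K * Qc K (W a) b))) = _); last by ring.
    by rewrite cM; ring.
  (* The convolved source is [commut] plus the product QW Qu. Combined with e^M - e^(M-1) = - (1 -
     e) e^(M-1), the two large terms cancel except for the factor 1 - e. *)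
  have -> : H a b = 2%:C * (zeta a b ^+ K) ^+ M *
      (e ^+ M * commut K (W a) (u a) b - (1 - e) * e ^+ M.-1 * (Qc K (W a) b * Qc K (u a) b)).
    rewrite /H QEE (PEE _ _ _ Pe) /commut -/(f a) (_ : e ^+ M = e * e ^+ M.-1); last by rewrite -exprS prednK.
    by ring.
  rewrite csqM csqM csq_real csqz.
  have QW : csq (Qc K (W a) b) <= 2 * C ^+ 2.
    by have [m1 m2] := secW a; exact: csq_Qc_bounded.
  rewrite /Y (PEE _ _ _ Pe) !csqM csqz.
  have hB := csqB (e ^+ M * commut K (W a) (u a) b) ((1 - e) * e ^+ M.-1 * (Qc K (W a) b * Qc K (u a) b)).
  rewrite !csqM in hB.
  have U0 := csq_ge0 (Qc K (u a) b); have e0 := csq_ge0 (e ^+ M); have R0 := csq_ge0 (commut K (W a) (u a) b).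
  have W0 := csq_ge0 (Qc K (W a) b); have d0 := csq_ge0 (1 - e); have e1 := csq_ge0 (e ^+ M.-1).
  rewrite -expB.
  have zz := z0 a.
  move: (csq (_ - _ * _)) hB zz => X0 hB.
  have k1 : csq (e ^+ M) * csq (commut K (W a) (u a) b) <= expR (4 * B a) * csq (commut K (W a) (u a) b).
    by rewrite ler_wpM2r.
  have k2 : csq (1 - e) * csq (e ^+ M.-1) * (csq (Qc K (W a) b) * csq (Qc K (u a) b)) <=
      128^-1 * (csq (e ^+ M) * csq (Qc K (u a) b)).
    have j1 : csq (1 - e) * csq (Qc K (W a) b) <= 256^-1.
      have := ler_wpM2l d0 QW; lra.
    have j2 := ler_pM (mulr_ge0 d0 W0) e1 j1 h3.
    have := ler_wpM2r U0 j2.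
    rewrite [X in X <= _](_ : _ = csq (1 - e) * csq (e ^+ M.-1) * (csq (Qc K (W a) b) * csq (Qc K (u a) b))); last by ring.
    by rewrite [X in _ <= X](_ : _ = 128^-1 * (csq (e ^+ M) * csq (Qc K (u a) b))); last by field.
  move: k1 k2 hB; move: (csq (e ^+ M) * csq (commut _ _ _ _)) (csq (1 - e) * csq (e ^+ M.-1) * _) => p q k1 k2 hB zz.
  have hX : X0 <= 2 * (expR (4 * B a) * csq (commut K (W a) (u a) b)) + 64^-1 * (csq (e ^+ M) * csq (Qc K (u a) b)) by lra.
  have := ler_wpM2l (ltW zz) hX.
  move: (csq (e ^+ M)) (csq (Qc K (u a) b)) (csq (commut _ _ _ _)) (expR _) (z a) (mulr_ge0 (ltW zz) (mulr_ge0 e0 U0)) => *; lra.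
have G1 a : a \in `[0, A] -> wt (k - 8 * C) a * n2 (Qc K (u a)) <= E0 * (cweight (K * M) m a * n2 (Y a)).
  move=> aA; have := n2_le (LQu a) (LY a) (fun b _ => F1 a b aA).
  move=> /(ler_wpM2l (expR_ge0 ((k - 8 * C) * a))) /le_trans; apply.
  rewrite le_eqVlt; apply/orP; left; apply/eqP.
  rewrite -/(wt (k - 8 * C) a) !mulrA; congr (_ * _).
  have := wtE a; rewrite -/(z a) => /(congr1 (fun x => x / z a)); rewrite mulfK ?gt_eqF// => ->.
  rewrite [LHS](_ : _ = E0 * (wt (k - 8 * C) a * expR (8 * C * a)) / z a); last by ring.
  by rewrite -!mulrA; congr (_ * _); rewrite mulrA; congr (_ / _); rewrite /wt -expRD; congr expR; ring.
have zE a : cweight (K * M) m a * z a = wt k a by exact: wtE.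
have wkE a : wt k a * expR (8 * C * a) = wt (k + 8 * C) a.
  by rewrite /wt -expRD; congr expR; ring.
have cw0 a : 0 <= cweight (K * M) m a :> R by exact: expR_ge0.
have G2 a : a \in `[0, A] -> cweight (K * M) m a * n2 (Y a) <= E0 * (wt (k + 8 * C) a * n2 (Qc K (u a))).
  move=> aA; have := n2_le (LY a) (LQu a) (fun b _ => F2 a b aA).
  move=> /(ler_wpM2l (cw0 a)) /le_trans; apply.
  by rewrite le_eqVlt; apply/orP; left; apply/eqP; rewrite -wkE -zE; ring.
have G3 a : a \in `[0, A] -> cweight (K * M) m a * n2 (H a) <=
    8 * E0 * (wt (k + 8 * C) a * n2 (commut K (W a) (u a))) + 8^-1 * (cweight (K * M) m a * n2 (Y a)).
  move=> aA.
  have hH : n2 (H a) <= 8 * z a * (E0 * expR (8 * C * a)) * n2 (commut K (W a) (u a)) + 8^-1 * n2 (Y a).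
    have i1 := L2c_integrable (Lcom K a); have i2 := L2c_integrable (LY a).
    rewrite /n2 -!RintegralZl// -RintegralD//; last 2 first.
      exact: (@integrableZR _ _ _ mu).
      exact: (@integrableZR _ _ _ mu).
    apply: le_Rintegral => //.
    - exact: L2c_integrable.
    - by apply: (@integrableDR _ _ _ mu) => //; apply: (@integrableZR _ _ _ mu).
    - by move=> b _; exact: F3.
  move: hH => /(ler_wpM2l (cw0 a)) /le_trans; apply.
  by rewrite le_eqVlt; apply/orP; left; apply/eqP; rewrite -wkE -zE; ring.
have mY : mjoint Y.
  apply: mjointM; last exact: mjoint_Qc.
  have [mW _ _] := lW.
  have mP : mjoint (fun a b => (P a).[zeta a b]).
    have mz : mjoint (fun a b => ('X^K : {poly R[i]}).[zeta a b]).
      apply: (@mjoint_poly K.+1); first by move=> a; rewrite size_polyXn.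
      by move=> j; split; exact: measurable_cst.
    have := mjointB mz (mjointZ (- c) (mjoint_gpoly K A mW)).
    congr mjoint; apply/funext => a; apply/funext => b.
    by rewrite /P hornerD hornerM hornerC mulNr opprK.
  have := mjointX M mP; congr mjoint; apply/funext => a; apply/funext => b.
  by rewrite /PE horner_exp.
have iU : mu.-integrable `[0, A] (EFin \o (fun a => wt (k + 8 * C) a * n2 (Qc K (u a)))).
  by apply: integrable_wt; exact: loc2_Qc.
have iEU : mu.-integrable `[0, A] (EFin \o (fun a => E0 * (wt (k + 8 * C) a * n2 (Qc K (u a))))).
  exact: (@integrableZR _ _ _ mu).
have iY : mu.-integrable `[0, A] (EFin \o (fun a => cweight (K * M) m a * n2 (Y a))).
  apply: (@le_integrableR _ _ _ mu _ _ _ (fun a => E0 * (wt (k + 8 * C) a * n2 (Qc K (u a))))) => //.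
    have h : measurable_fun setT (fun a => cweight (K * M) m a * n2 (Y a)).
      by apply: measurable_funM; [exact: measurable_wt|exact: measurable_n2].
    exact: measurable_funTS h.
  move=> a aA; rewrite ger0_norm; first exact: G2.
  by apply: mulr_ge0 => //; exact: n2_ge0.
have lR : loc2 A (fun a => commut K (W a) (u a)).
  split => //.
  apply: (@le_integrableR _ _ _ mu _ _ _ (fun a => 6 * C ^+ 2 * n2 (u a))) => //.
  - by apply: measurable_funTS; exact: measurable_n2.
  - move=> a _; rewrite ger0_norm ?n2_ge0//.
    by have [m1 m2] := secW a; exact: n2_commut.
  - exact: (@integrableZR _ _ _ mu).
have iR := integrable_wt (k + 8 * C) lR.
have i8R : mu.-integrable `[0, A] (EFin \o (fun a => 8 * E0 * (wt (k + 8 * C) a * n2 (commut K (W a) (u a))))).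
  exact: (@integrableZR _ _ _ mu).
have i8Y : mu.-integrable `[0, A] (EFin \o (fun a => 8^-1 * (cweight (K * M) m a * n2 (Y a)))).
  exact: (@integrableZR _ _ _ mu).
(* [le_Rintegral_gen] is used because measurability of [n2 (H a)] in a has not been established; its
   majorant is integrable. *)
have hH : \int[mu]_(a in `[0, A]) (cweight (K * M) m a * n2 (H a)) <=
   8 * E0 * \int[mu]_(a in `[0, A]) (wt (k + 8 * C) a * n2 (commut K (W a) (u a))) + 8^-1 * X.
  rewrite /X -/(Y) -!RintegralZl// -RintegralD//; apply: le_Rintegral_gen => //.
    move=> a aA; apply/andP; split; last exact: G3.
    by apply: mulr_ge0 => //; exact: n2_ge0.
  exact: (@integrableDR _ _ _ mu).
have hX : \int[mu]_(a in `[0, A]) (wt (k - 8 * C) a * n2 (Qc K (u a))) <= E0 * X.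
  rewrite /X -/(Y) -RintegralZl//; apply: le_Rintegral => //.
  - by apply: integrable_wt; exact: loc2_Qc.
  - exact: (@integrableZR _ _ _ mu).
have a00 : 0 \in `[0, A] by rewrite in_itv/= lexx.
have aAA : A \in `[0, A] by rewrite in_itv/= lexx A0.
have b0 : n2 (Y 0) <= E0 * n2 (Qc K (u 0)).
  by have := G2 0 a00; rewrite /cweight /wt !mulr0 !expR0 !mul1r.
have bA := G2 A aAA.
have E00 : 0 < E0 by exact: expR_gt0.
move=> hC; exact: (gauge_arith E00 hC hH hX b0 bA).
Qed.

(** Let K tend to infinity: the convolutions converge in the weighted norm, and the commutator
    integral tends to 0 by dominated convergence, with majorant 6 C^2 times the weighted norm of
    u. *)
Lemma carleman_gauge :
  (forall K, {ae mu, forall a, a \in `[0, A] -> solves K u f a}) -> (forall K, solves K u f A) ->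
  \int[mu]_(a in `[0, A]) (wt (k - 8 * C) a * n2 (u a)) <=
  4 * E0 ^+ 2 * (n2 (u 0) + wt (k + 8 * C) A * n2 (u A)).
Proof.
move=> sae sA; have [mu_ Lu Iu] := lu.
pose x K := \int[mu]_(a in `[0, A]) (wt (k + 8 * C) a * n2 (commut K (W a) (u a))).
have cx : x K @[K --> \oo] --> (0 : R).
  rewrite [X in _ --> X](_ : 0 = \int[mu]_(a in `[0, A]) (0 : R)); last by rewrite /Rintegral integral0_eq.
  have i6 : mu.-integrable `[0, A] (EFin \o (fun a => 6 * C ^+ 2 * (wt (k + 8 * C) a * n2 (u a)))).
    by apply: (@integrableZR _ _ _ mu) => //; exact: integrable_wt.
  apply: (@dct_R _ _ _ mu _ _ _ (fun a => 6 * C ^+ 2 * (wt (k + 8 * C) a * n2 (u a)))) => //.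
  - have h K : measurable_fun setT (fun a => wt (k + 8 * C) a * n2 (commut K (W a) (u a))).
      by apply: measurable_funM; [exact: measurable_wt|exact: measurable_n2].
    by move=> K; exact: measurable_funTS (h K).
  - apply: nearW => a _; rewrite -[X in _ --> X](mulr0 (wt (k + 8 * C) a)).
    by apply: cvgMl_tmp; have [m1 m2] := secW a; exact: (commut_cvg m1 m2 C0 (WC a) (Lu a)).
  - move=> K a _; rewrite ger0_norm; last by apply: mulr_ge0; [exact: expR_ge0|exact: n2_ge0].
    rewrite mulrCA; apply: ler_wpM2l; first exact: expR_ge0.
    by have [m1 m2] := secW a; exact: n2_commut.
have c1 := @integral_Qc_cvg _ A (k - 8 * C) u lu.
pose y : R := 4 * (n2 (u 0) + wt (k + 8 * C) A * n2 (u A)).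
have c2 : E0 ^+ 2 * (64 * x K + y) @[K --> \oo] --> E0 ^+ 2 * (64 * 0 + y).
  by apply: cvgMl_tmp; apply: cvgD; [apply: cvgMl_tmp|exact: cvg_cst].
have -> : 4 * E0 ^+ 2 * (n2 (u 0) + wt (k + 8 * C) A * n2 (u A)) = E0 ^+ 2 * (64 * 0 + y).
  by rewrite /y; ring.
apply: (ler_cvg_to c1 c2); apply: nearW => K.
apply: (le_trans (carleman_gauge_K (sae K) (sA K))).
apply: ler_wpM2l; first by rewrite exprn_ge0// expR_ge0.
rewrite lerD2l /y ler_wpM2l//; apply: lerD; first exact: (Qc_L2 K (Lu 0)).2.
by apply: ler_wpM2l; [exact: expR_ge0|exact: (Qc_L2 K (Lu A)).2].
Qed.

End fixed.
End gauged_inequality.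

(** * Unique continuation on the half cylinder *)

Section cylinder.
Variable R : realType.
Notation mu := (@lebesgue_measure R).
Notation J := (@circle R).
Implicit Types (a b t A : R).
Let mJ : measurable J. Proof. exact: measurable_circle. Qed.
Hint Resolve mJ : core.

Lemma measurable_inv : measurable_fun setT (fun x : R => x^-1).
Proof.
rewrite (_ : setT = [set x : R | x != 0] `|` [set 0]); last first.
  by apply/seteqP; split => // x _ /=; case: (eqVneq x 0) => [->|]; [right|left].
have m0 : measurable [set x : R | x != 0].
  rewrite (_ : [set x : R | _] = ~` [set 0]); first exact: measurableC.
  by apply/seteqP; split => x /= /eqP.
apply/measurable_funU => //; split.
  apply: open_continuous_measurable_fun.
    rewrite (_ : [set x : R | _] = ~` [set 0]); last by apply/seteqP; split => x /= /eqP.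
    by rewrite openC; exact: closed_eq.
  by move=> x; rewrite inE/= => x0; apply: inv_continuous.
exact: measurable_fun_set1.
Qed.

Lemma L2c_dom (f : R -> R[i]) (h : R -> R) :
  measurable_fun setT (fun t => complex.Re (f t)) ->
  measurable_fun setT (fun t => complex.Im (f t)) ->
  mu.-integrable J (EFin \o h) -> (forall t, csq (f t) <= h t) -> L2c f.
Proof.
move=> m1 m2 ih fh; split; split=> //; apply: (@le_integrableR _ _ _ mu _ _ _ h) => //.
- by apply: measurable_funTS; exact: measurable_funX.
- by move=> t Jt; rewrite ger0_norm ?sqr_ge0// (le_trans (sqr_Re_le _))// fh.
- by apply: measurable_funTS; exact: measurable_funX.
- by move=> t Jt; rewrite ger0_norm ?sqr_ge0// (le_trans (sqr_Im_le _))// fh.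
Qed.

(** On the mode e^(i k b) the operator d_a + i d_b acts as d/da - k; this is the equation with
    source [2 * f], multiplied by the integrating factor e^(- k a) and integrated from 0. *)
Definition mode_solution (u f : R -> R -> R[i]) (k a : R) :=
  (expR (- (k * a)))%:C * mode k (u a) = mode k (u 0) +
    cint `[0, a] (fun t => 2%:C * ((expR (- (k * t)))%:C * mode k (f t))).

Lemma kc_gt0 K j : (j <= K.*2)%N -> 0 < kc R K j.
Proof.
by move=> jK; rewrite divr_gt0 ?ltr0n ?bin_gt0// mulr_gt0 ?binK_gt0// mulr_gt0// pi_gt0.
Qed.

(** The j-th coefficient of each side is [kc R K j] times the corresponding side of the equation for
    the mode j - K. Positivity of [kc] lets this factor be taken in and out of the integral. *)
Lemma solves_of_modes K (u f : R -> R -> R[i]) a : 0 <= a -> loc2 a f ->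
  (forall j, mode_solution u f (j%:R - K%:R) a) -> solves K u f a.
Proof.
move=> a0 lf H; apply/polyP => j; rewrite !coef_poly; case: ifP => // jK.
rewrite [in RHS]real_complexM -[RHS]mulrA H mulrDr jK mulr0 oppr0 expR0 mulr1; congr (_ + _).
have kc0 : (kc R K j)%:C != 0 :> R[i].
  by rewrite -csq_eq0 csq_real sqrf_eq0 gt_eqF// kc_gt0.
have iq : integrableC `[0, a] (fun t => 2%:C * (polyK K t (f t))`_j).
  have [[[i1 _] _] [[i2 _] _]] := acP_genP K (fun=> 0) a0 lf j.
  by split; [move: i1|move: i2]; congr (_.-integrable _ _); apply/funext => t /=; rewrite coefZ.
have e t : 2%:C * (polyK K t (f t))`_j = (kc R K j)%:C *
    (2%:C * ((expR (- ((j%:R - K%:R) * t)))%:C * mode (j%:R - K%:R) (f t))).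
  by rewrite coef_poly jK real_complexM; ring.
rewrite -cintZ//; first by apply: eq_cint => t _; rewrite -e coef_poly jK.
have := integrableCZ ((kc R K j)%:C^-1) (measurable_itv _) iq.
by apply: eq_integrableC => t; rewrite e mulKf.
Qed.

Theorem cylinder_unique_continuation N (C : R) (U F : 'I_N -> R -> R -> R[i]) :
  0 <= C -> (forall l, mjoint (U l)) -> (forall l, mjoint (F l)) ->
  (forall l a, L2c (U l a)) ->
  (forall a b, \sum_l csq (F l a b) <= C ^+ 2 * \sum_l csq (U l a b)) ->
  (forall k, (\int[mu]_(a in `[0%R, +oo[) (expR (k * a) * \sum_l n2 (U l a))%:E < +oo)%E) ->
  (forall l (j K : nat), {ae mu, forall a, 0 <= a ->
     mode_solution (U l) (F l) (j%:R - K%:R) a}) ->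
  N = 1%N \/ C < 1 / 4 ->
  {ae mu, forall a, 0 <= a -> \sum_l n2 (U l a) = 0}.
Proof.
move=> C0 mU mF LU FU fin modes cases.
have iU l a : mu.-integrable J (EFin \o (fun b => csq (U l a b))) by exact: L2c_integrable.
have iCU a : mu.-integrable J (EFin \o (fun b => C ^+ 2 * \sum_l csq (U l a b))).
  by apply: (@integrableZR _ _ _ mu) => //; apply: (@integrable_sumR _ _ _ mu).
have cF l a b : csq (F l a b) <= C ^+ 2 * \sum_l csq (U l a b).
  apply: le_trans (FU a b); rewrite (bigD1 l)//= lerDl.
  by apply: sumr_ge0 => i _; exact: csq_ge0.
have LF l a : L2c (F l a).
  by have [m1 m2] := mjoint_sec a (mF l); apply: (L2c_dom m1 m2 (iCU a)) => b.
have nF l a : n2 (F l a) <= C ^+ 2 * \sum_l n2 (U l a).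
  rewrite /n2 -(@Rintegral_sumR _ _ _ mu)// -RintegralZl//; last exact: (@integrable_sumR _ _ _ mu).
  by apply: le_Rintegral => //; exact: L2c_integrable.
pose n a := \sum_l n2 (U l a).
have mn : measurable_fun setT n by apply: measurable_sum => l; exact: measurable_n2.
have n0 a : 0 <= n a by apply: sumr_ge0 => l _; exact: n2_ge0.
have inA A : mu.-integrable `[0, A] (EFin \o n).
  apply/integrableP; split; first by apply: measurable_funTS; apply/measurable_EFinP.
  apply: le_lt_trans (fin 0); apply: (@le_trans _ _ (\int[mu]_(a in `[0%R, +oo[) `|(n a)%:E|)%E).
    apply: ge0_subset_integral => //; last by apply: subset_itvl; rewrite bnd_simp.
    by apply: measurableT_comp => //; apply: measurable_funTS; apply/measurable_EFinP.
  rewrite le_eqVlt; apply/orP; left; apply/eqP; apply: eq_integral => a _.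
  by rewrite mul0r expR0 mul1r abse_EFin ger0_norm.
have lU A l : loc2 A (U l).
  split => //; apply: (@le_integrableR _ _ _ mu _ _ _ n) => //.
    by apply: measurable_funTS; exact: measurable_n2.
  move=> a _; rewrite ger0_norm ?n2_ge0// /n (bigD1 l)//= lerDl.
  by apply: sumr_ge0 => i _; exact: n2_ge0.
have lF A l : loc2 A (F l).
  split => //; apply: (@le_integrableR _ _ _ mu _ _ _ (fun a => C ^+ 2 * n a)) => //.
  - by apply: measurable_funTS; exact: measurable_n2.
  - by move=> a _; rewrite ger0_norm ?n2_ge0//; exact: nF.
  - exact: (@integrableZR _ _ _ mu).
(* Countably many exceptional null sets, one for each component, mode and degree, are merged into
   one. *)
have sol : {ae mu, forall a, 0 <= a -> forall l K, solves K (U l) (F l) a}.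
  have h := @ae_all _ _ _ mu _ _ (fun p : 'I_N * (nat * nat) => modes p.1 p.2.1 p.2.2).
  apply: (@ae_mono _ _ _ mu _ _ _ h) => a ha a0 l K.
  by apply: solves_of_modes => // j; exact: (ha (l, (j, K))).
have solA l K A : {ae mu, forall a, a \in `[0, A] -> solves K (U l) (F l) a}.
  apply: (@ae_mono _ _ _ mu _ _ _ sol) => a ha; rewrite in_itv/= => /andP[a0 _].
  exact: ha.
case: cases => [N1|C4].
- subst N.
  pose u := U ord0; pose f := F ord0.
  (* The quotient f / u, written as f conj(u) / |u|^2. It is 0 where u = 0, because the inverse of 0
     is 0, and there f = 0 as well by the pointwise bound. This division needs a single
     component. *)
  pose W a b : R[i] := ((csq (u a b))^-1)%:C * (f a b * (complex.Re (u a b) +i* - complex.Im (u a b))).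
  have uc (w : R[i]) : (complex.Re w +i* - complex.Im w) * w = (csq w)%:C.
    by apply: complex_ext; rewrite !ReImE/= /csq; ring.
  have ccj (w : R[i]) : csq (complex.Re w +i* - complex.Im w) = csq w by rewrite /csq/= sqrrN.
  have fu a b : csq (f a b) <= C ^+ 2 * csq (u a b) by have := FU a b; rewrite !big_ord1.
  have Wu a b : W a b * u a b = f a b.
    case: (eqVneq (u a b) 0) => u0.
      rewrite u0 mulr0; apply/esym/eqP; rewrite -csq_eq0 eq_le csq_ge0 andbT.
      by apply: le_trans (fu a b) _; rewrite u0 csq0 mulr0.
    rewrite /W -!mulrA uc mulrCA -real_complexM mulVf ?mulr1//.
    by rewrite csq_eq0.
  have WC a b : csq (W a b) <= C ^+ 2.
    case: (eqVneq (u a b) 0) => u0.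
      by rewrite /W u0 csq0 invr0 mul0r csq0 sqr_ge0.
    have c0 : 0 < csq (u a b) by rewrite lt_neqAle csq_ge0 andbT eq_sym csq_eq0.
    rewrite /W !csqM csq_real ccj.
    rewrite -[leLHS](_ : csq (f a b) / csq (u a b) = _); last by field; rewrite gt_eqF.
    by rewrite ler_pdivrMr.
  have mW : mjoint W.
    apply: mjointM.
      split; last exact: measurable_cst.
      exact: (measurableT_comp measurable_inv (measurable_csq (mU ord0))).
    apply: mjointM; first exact: (mF ord0).
    have [m1 m2] := mU ord0; split; first exact: m1.
    exact: (measurable_funN m2).
  have LW a : L2c (W a).
    have [m1 m2] := mjoint_sec a mW.
    by apply: (L2c_dom m1 m2 (integrable_circle_cst (C ^+ 2))) => b; exact: WC.
  have lW A : loc2 A W.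
    split => //; apply: (@le_integrableR _ _ _ mu _ _ _ (fun=> C ^+ 2 * (2 * pi))) => //.
    - by apply: measurable_funTS; exact: measurable_n2.
    - move=> a _; rewrite ger0_norm ?n2_ge0// -Rintegral_circle_cst; apply: le_Rintegral => //.
      + exact: L2c_integrable.
      + exact: integrable_circle_cst.
    - by apply: continuous_integrable; exact: cst_continuous.
  have fE : F ord0 = fun a b => W a b * u a b.
    by apply/funext => a; apply/funext => b; rewrite Wu.
  have nE a : n a = n2 (u a) by rewrite /n big_ord1.
  apply: (@carleman_vanish _ n (8 * C) (4 * gaugeE C ^+ 2)) => //.
    by rewrite mulr_ge0// sqr_ge0.
  move=> m; apply: (@ae_mono _ _ _ mu _ _ _ sol) => A sA A0.
  have := @carleman_gauge _ A C u W m A0 C0 (lU A ord0) (lW A) WC.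
  rewrite -fE => /(_ (fun K => solA ord0 K A) (sA A0 ord0)).
  rewrite !nE; under eq_Rintegral do rewrite -nE.
  exact.
(* The denominator is positive exactly because 0 <= C < 1/4. Without a gauge there is no shift of
   the exponent, so [carleman_vanish] is applied with c = 0. *)
- pose M := 2 / (1 - 16 * C ^+ 2).
  have c0 : 0 < 1 - 16 * C ^+ 2 by nra.
  apply: (@carleman_vanish _ n 0 M) => //; first by rewrite divr_ge0// ltW.
  move=> m; apply: (@ae_mono _ _ _ mu _ _ _ sol) => A sA A0.
  rewrite subr0 addr0 /M mulrAC ler_pdivlMr// mulrC.
  apply: (carleman_small m A0 (fun l => lU A l) (fun l => lF A l) FU) => // l K.
  exact: sA.
Qed.

End cylinder.

(** * Scaling of Lebesgue measure *)

Section affine.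
Variable R : realType.
Notation mu := (@lebesgue_measure R).
Implicit Types (a b x y : R).

Definition affine a b x : measurableTypeR R := a * x + b.

Lemma measurable_affine a b : measurable_fun setT (affine a b).
Proof. by apply: measurable_funD => //; apply: measurable_funM. Qed.

Lemma affine_preimage a b x y : 0 < a ->
  affine a b @^-1` `]x, y] = `](x - b) / a, (y - b) / a]%classic.
Proof.
move=> a0; apply/seteqP; split => t; rewrite /= !in_itv/= /affine.
  by rewrite ltr_pdivrMr// ler_pdivlMr// ltrBlDr lerBrDr mulrC.
by rewrite ltr_pdivrMr// ler_pdivlMr// ltrBlDr lerBrDr mulrC.
Qed.

Lemma affine_preimageN a b x y : a < 0 ->
  affine a b @^-1` `]x, y] = `[(y - b) / a, (x - b) / a[%classic.
Proof.
move=> a0; apply/seteqP; split => t; rewrite /= !in_itv/= /affine.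
  by rewrite ltr_ndivlMr// ler_ndivrMr// ltrBlDr lerBrDr mulrC andbC.
by rewrite ltr_ndivlMr// ler_ndivrMr// ltrBlDr lerBrDr mulrC andbC.
Qed.

(** Uniqueness of Lebesgue measure: the two measures are compared on half-open intervals. For
    negative slope the preimage is half-open on the other side, with the same length. *)
Lemma lebesgue_affine a b (A : set (measurableTypeR R)) : a != 0 -> measurable A ->
  mu A = (`|a|%:E * mu (affine a b @^-1` A))%E.
Proof.
move=> a0 mA.
pose nu := measure_function_pushforward__canonical__measure_function_Measure
    [the {measure set (measurableTypeR R) -> \bar R} of mu] (measurable_affine a b).
pose nu' : {measure set (measurableTypeR R) -> \bar R} := mscale (NngNum (normr_ge0 a)) nu.
rewrite (@lebesgue_measure_unique _ nu')// => _ [[x y] _ <-].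
change (mu `]x, y] = (`|a|%:E * mu (affine a b @^-1` `]x, y]))%E).
have [a1|a1|a1] := ltrgtP a 0; last by rewrite a1 eqxx in a0.
  rewrite affine_preimageN// !lebesgue_measure_itv/= !lte_fin.
  rewrite ltr_nM2r ?invr_lt0// ltrD2r; case: ifP => _; last by rewrite mule0.
  rewrite -!EFinB -EFinM ltr0_norm//; congr (_%:E); field.
  by rewrite lt_eqF.
rewrite affine_preimage// !lebesgue_measure_itv/= !lte_fin.
rewrite ltr_pM2r ?invr_gt0// ltrD2r; case: ifP => _; last by rewrite mule0.
rewrite -!EFinB -EFinM gtr0_norm//; congr (_%:E); field.
by rewrite gt_eqF.
Qed.

Lemma ge0_integral_affine a b (f : R -> \bar R) : a != 0 -> measurable_fun setT f ->
  (forall x, 0 <= f x)%E ->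
  (\int[mu]_x f x = `|a|%:E * \int[mu]_x f (a * x + b)%R)%E.
Proof.
move=> a0 mf f0.
pose nu := measure_function_pushforward__canonical__measure_function_Measure
    [the {measure set (measurableTypeR R) -> \bar R} of mu] (measurable_affine a b).
pose nu' : {measure set (measurableTypeR R) -> \bar R} := mscale (NngNum (normr_ge0 a)) nu.
transitivity (\int[nu']_x f x)%E.
  by apply: eq_measure_integral => A mA _; exact: lebesgue_affine.
rewrite ge0_integral_mscale//; congr (_ * _)%E.
have := @ge0_integral_pushforward _ _ (measurableTypeR R) (measurableTypeR R) R (affine a b)
  (measurable_affine a b) [the {measure set (measurableTypeR R) -> \bar R} of mu] setT f measurableT mf.
by apply.
Qed.

End affine.

Section scaling_C.
Variable R : realType.
Notation mu := (@lebesgue_measure R).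
Implicit Types (l w : R[i]).
Local Open Scope ereal_scope.

Lemma measurable_csqC : measurable_fun setT (@csq R).
Proof.
by apply: measurable_funD; apply: measurable_funX; [exact: measurable_Re|exact: measurable_Im].
Qed.

Lemma measurable_mulC l : measurable_fun setT (fun w => l * w)%R.
Proof.
apply: measurable_fun_complex.
  under eq_fun do rewrite ReM.
  apply: measurable_funB; apply: measurable_funM => //; [exact: measurable_Re|exact: measurable_Im].
under eq_fun do rewrite ImM.
by apply: measurable_funD; apply: measurable_funM => //; [exact: measurable_Im|exact: measurable_Re].
Qed.

Lemma ge0_integral_lebesgue_C (f : R[i] -> \bar R) : measurable_fun setT f ->
  (forall w, 0 <= f w) ->
  \int[@lebesgue_C R]_w f w = \int[mu]_x \int[mu]_y f (x +i* y)%R.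
Proof.
move=> mf f0.
have E := @ge0_integral_pushforward _ _ (measurableTypeR R * measurableTypeR R)%type _ R
  (@pairC R) (@measurable_pairC R) [the {measure set (measurableTypeR R * measurableTypeR R) -> \bar R} of (mu \x mu)%E] setT f measurableT mf.
rewrite /lebesgue_C E//; apply: (@fubini_tonelli1 _ _ _ _ _ mu mu (f \o @pairC R)) => //.
- exact: (measurableT_comp mf (@measurable_pairC R)).
- by move=> z; exact: f0.
Qed.

Let mpair (f : R[i] -> \bar R) : measurable_fun setT f ->
  measurable_fun setT (fun z : R * R => f (z.1 +i* z.2)%R).
Proof. by move=> mf; exact: (measurableT_comp mf (@measurable_pairC R)). Qed.

(** Multiplication by a + i b is a real linear map of determinant a^2 + b^2. It is factored into
    affine substitutions in one real variable, with Tonelli swaps in between; for a = 0 the two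
    coordinates are exchanged instead. *)
Lemma ge0_integral_scale_C (f : R[i] -> \bar R) l : l != 0%R -> measurable_fun setT f ->
  (forall w, 0 <= f w) ->
  \int[@lebesgue_C R]_w f w = (csq l)%:E * \int[@lebesgue_C R]_w f (l * w)%R.
Proof.
move=> l0 mf f0.
have mfl : measurable_fun setT (fun w => f (l * w)%R) := measurableT_comp mf (measurable_mulC l).
rewrite !ge0_integral_lebesgue_C//.
have c0 : csq l != 0%R by rewrite csq_eq0.
case: l => a b in l0 c0 mfl *.
have mf2 := mpair mf.
pose g x y : \bar R := f (x +i* y)%R.
have g0 x y : 0 <= g x y by exact: f0.
have mg1 y : measurable_fun setT (fun x => g x y) by exact: (measurableT_comp mf2 (pair2_measurable y)).
have mg2 x : measurable_fun setT (g x) by exact: (measurableT_comp mf2 (pair1_measurable x)).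
have E (x y : R) : f ((a +i* b) * (x +i* y))%R = g (a * x - b * y)%R (b * x + a * y)%R.
  by rewrite /g; congr f; apply: complex_ext; rewrite !ReImE/=; ring.
under [in RHS]eq_integral do under eq_integral do rewrite E.
rewrite -/(\int[mu]_x \int[mu]_y g x y).
have swap (h : R * R -> \bar R) : measurable_fun setT h -> (forall z, 0 <= h z) ->
    \int[mu]_x \int[mu]_y h (x, y) = \int[mu]_y \int[mu]_x h (x, y).
  by move=> mh h0; exact: fubini_tonelli.
have mlin (p q r s : R) : measurable_fun setT (fun z : R * R => g (p * z.1 + q * z.2)%R (r * z.1 + s * z.2)%R).
  have hl : measurable_fun setT (fun z : R * R => (p * z.1 + q * z.2, r * z.1 + s * z.2)%R).
    by apply: measurable_fun_pair; apply: measurable_funD; apply: measurable_funM.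
  exact: (measurableT_comp mf2 hl).
have mlin' (p q r s : R) : measurable_fun setT (fun z : R * R => g (p * z.2 + q * z.1)%R (r * z.2 + s * z.1)%R).
  have hl : measurable_fun setT (fun z : R * R => (p * z.2 + q * z.1, r * z.2 + s * z.1)%R).
    by apply: measurable_fun_pair; apply: measurable_funD; apply: measurable_funM.
  exact: (measurableT_comp mf2 hl).
have msec (h : R -> R -> \bar R) : measurable_fun setT (fun z : R * R => h z.1 z.2) ->
    (forall x y, 0 <= h x y) -> measurable_fun setT (fun x => \int[mu]_y h x y).
  by move=> mh h0; exact: (@measurable_int_section _ _ _ _ _ mu setT (fun z : R * R => h z.1 z.2) measurableT mh).
have [a0|a0] := eqVneq a 0%R.
  have b0 : b != 0%R by apply: contraNneq c0 => b0; rewrite /csq/= a0 b0 expr0n addr0.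
  have G0 y : 0 <= \int[mu]_x g x y by apply: integral_ge0.
  have mG : measurable_fun setT (fun y => \int[mu]_x g x y).
    have mgs : measurable_fun setT (fun z : R * R => g z.2 z.1).
      by have := mlin' 1%R 0%R 0%R 1%R; congr measurable_fun; apply/funext => z; congr (g _ _); ring.
    exact: (@measurable_int_section _ _ _ _ _ mu setT (fun z : R * R => g z.2 z.1) measurableT mgs).
  transitivity (\int[mu]_y \int[mu]_x g x y); first exact: (swap (fun z => g z.1 z.2)).
  rewrite (@ge0_integral_affine _ b 0%R)//.
  have -> : (csq (a +i* b))%:E = `|b|%:E * `|b|%:E :> \bar R.
    by rewrite -EFinM -expr2 real_normK ?num_real// /csq/= a0 expr0n add0r.
  rewrite -muleA; congr (_ * _).
  rewrite -ge0_integralZl//; last 2 first.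
    apply: (msec (fun x y => g (a * x - b * y)%R (b * x + a * y)%R)) => //.
    by have := mlin a (- b)%R b a; congr measurable_fun; apply/funext => z; rewrite mulNr.
    by move=> x _; apply: integral_ge0.
  apply: eq_integral => x _.
  rewrite (@ge0_integral_affine _ (- b)%R 0%R (fun x' => g x' (b * x + 0)%R)) ?oppr_eq0// normrN.
  congr (_ * _); apply: eq_integral => y _; congr (g _ _); rewrite a0; ring.
(* After the substitution x' = a x - b y, the second coordinate b x + a y becomes (b / a) x' + c y.
   The two slopes a and c multiply to the determinant. *)
pose c := ((a ^+ 2 + b ^+ 2) / a)%R.
have cn0 : c != 0%R by rewrite mulf_neq0 ?invr_eq0.
have -> : (csq (a +i* b))%:E = `|c|%:E * `|a|%:E :> \bar R.
  rewrite -EFinM -normrM /c divfK// ger0_norm// addr_ge0 ?sqr_ge0//.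
have -> : \int[mu]_x \int[mu]_y g (a * x - b * y)%R (b * x + a * y)%R =
    \int[mu]_y \int[mu]_x g (a * x - b * y)%R (b * x + a * y)%R.
  apply: (swap (fun z => g (a * z.1 - b * z.2)%R (b * z.1 + a * z.2)%R)) => //.
  by have := mlin a (- b)%R b a; congr measurable_fun; apply/funext => z; rewrite mulNr.
rewrite -muleA -ge0_integralZl//; last 2 first.
  apply: (msec (fun y x => g (a * x - b * y)%R (b * x + a * y)%R)) => //.
  by have := mlin' a (- b)%R b a; congr measurable_fun; apply/funext => z; rewrite mulNr.
  by move=> y _; apply: integral_ge0.
have -> : \int[mu]_y (`|a|%:E * \int[mu]_x g (a * x - b * y)%R (b * x + a * y)%R) =
    \int[mu]_y \int[mu]_x g x (c * y + b / a * x)%R.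
  apply: eq_integral => y _.
  rewrite [RHS](@ge0_integral_affine _ a (- (b * y))%R)//; last first.
    have := measurableT_comp (mlin 1%R 0%R (b / a)%R c) (pair2_measurable y).
    by congr measurable_fun; apply/funext => x /=; congr (g _ _); ring.
  congr (_ * _); apply: eq_integral => x _; congr (g _ _).
  by rewrite /c; field.
have -> : \int[mu]_y \int[mu]_x g x (c * y + b / a * x)%R =
    \int[mu]_x \int[mu]_y g x (c * y + b / a * x)%R.
  symmetry; apply: (swap (fun z => g z.1 (c * z.2 + b / a * z.1)%R)) => //.
  by have := mlin 1%R 0%R (b / a)%R c; congr measurable_fun; apply/funext => z; congr (g _ _); ring.
rewrite -ge0_integralZl//; last 2 first.
  apply: (msec (fun x y => g x (c * y + b / a * x)%R)) => //.
  by have := mlin 1%R 0%R (b / a)%R c; congr measurable_fun; apply/funext => z; congr (g _ _); ring.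
  by move=> y _; apply: integral_ge0.
by apply: eq_integral => x _; exact: (@ge0_integral_affine _ c (b / a * x)%R (g x)).
Qed.

End scaling_C.

Section scaling_Cn.
Variable R : realType.
Implicit Types (l w : R[i]) (n : nat).
Local Open Scope ereal_scope.

Lemma ge0_integral_lebesgue_succ n (f : Cn R n.+1 -> \bar R) : measurable_fun setT f ->
  (forall z, 0 <= f z) ->
  \int[@lebesgue_Cn R n.+1]_z f z =
  \int[@lebesgue_C R]_w \int[@lebesgue_Cn R n]_v f (consC (w, v)).
Proof.
move=> mf f0.
have E := @ge0_integral_pushforward _ _ (R[i] * Cn R n)%type (Cn R n.+1) R
  (@consC R n) (@measurable_consC R n)
  [the {measure set (R[i] * Cn R n) -> \bar R} of (@lebesgue_C R \x @lebesgue_Cn R n)%E] setT f measurableT mf.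
rewrite /= /lebesgue_succ E//.
apply: (@fubini_tonelli1 _ _ _ _ _ (@lebesgue_C R) (@lebesgue_Cn R n) (f \o @consC R n)) => //.
- exact: (measurableT_comp mf (@measurable_consC R n)).
- by move=> z; exact: f0.
Qed.

Lemma measurable_scale n l : measurable_fun setT (fun z : Cn R n => l *: z)%R.
Proof.
apply: measurable_fun_Cn => j; under eq_fun do rewrite mxE.
exact: (measurableT_comp (measurable_mulC l) (@measurable_coord R n j)).
Qed.

Lemma scale_consC n l w (v : Cn R n) : (l *: consC (w, v) = consC (l * w, l *: v))%R.
Proof.
by apply/rowP => j; rewrite mxE /consC /row_mx !mxE; case: splitP => k _; rewrite !mxE.
Qed.

(** Induction on the dimension along the definition of the measure: a dilation acts separately on
    the first coordinate and on the rest, each complex coordinate contributing |l|^2. *)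
Lemma ge0_integral_scale n l (f : Cn R n -> \bar R) : l != 0%R -> measurable_fun setT f ->
  (forall z, 0 <= f z) ->
  \int[@lebesgue_Cn R n]_z f z =
  ((csq l) ^+ n)%:E * \int[@lebesgue_Cn R n]_z f (l *: z)%R.
Proof.
move=> l0; elim: n f => [|n ih] f mf f0.
  rewrite expr0 mul1e; apply: eq_integral => z _; congr f.
  by apply/rowP => -[].
have mfl : measurable_fun setT (fun z : Cn R n.+1 => f (l *: z)%R) := measurableT_comp mf (measurable_scale l).
rewrite !ge0_integral_lebesgue_succ//.
have mfc : measurable_fun setT (fun p : R[i] * Cn R n => f (consC p)) := measurableT_comp mf (@measurable_consC R n).
have mG : measurable_fun setT (fun w => \int[@lebesgue_Cn R n]_v f (consC (w, v))).
  exact: (@measurable_int_section _ _ _ _ _ (@lebesgue_Cn R n) setT (fun p => f (consC p)) measurableT mfc).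
have mG' : measurable_fun setT (fun w => \int[@lebesgue_Cn R n]_v f (consC (l * w, v))%R).
  exact: (measurableT_comp mG (measurable_mulC l)).
have mG2 : measurable_fun setT (fun w => \int[@lebesgue_Cn R n]_v f (consC (l * w, l *: v))%R).
  have h : measurable_fun setT (fun p : R[i] * Cn R n => f (l *: consC p)%R) := measurableT_comp mfl (@measurable_consC R n).
  have := @measurable_int_section _ _ _ _ _ (@lebesgue_Cn R n) setT (fun p => f (l *: consC p)%R) measurableT h.
  move=> /(_ (fun z => f0 _)); congr measurable_fun; apply/funext => w.
  by apply: eq_integral => v _; rewrite scale_consC.
rewrite (ge0_integral_scale_C l0 mG); last by move=> w; apply: integral_ge0.
rewrite exprS EFinM -muleA; congr (_ * _).
rewrite -ge0_integralZl//; last 3 first.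
- by under eq_fun do (under eq_integral do rewrite scale_consC).
- by move=> w _; apply: integral_ge0.
- by rewrite lee_fin exprn_ge0// csq_ge0.
apply: eq_integral => w _.
rewrite (ih (fun v => f (consC (l * w, v))%R))//; last first.
  exact: (measurable_sec (l * w)%R mfc).
by congr (_ * _); apply: eq_integral => v _; rewrite scale_consC.
Qed.

End scaling_Cn.

Section scaling_real.
Variables (R : realType) (n : nat).
Notation nu := (@lebesgue_Cn R n).
Implicit Types (l : R[i]) (f : Cn R n -> R).

Lemma measurable_scaled d (T : measurableType d) (g : Cn R n -> T) l :
  measurable_fun setT g -> measurable_fun setT (fun z : Cn R n => g (l *: z)).
Proof. by move=> mg; exact: (measurableT_comp mg (measurable_scale l)). Qed.

Lemma integrable_scale f l : l != 0 -> measurable_fun setT f ->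
  nu.-integrable setT (EFin \o f) -> nu.-integrable setT (EFin \o (fun z => f (l *: z))).
Proof.
move=> l0 mf /integrableP[_ fi]; apply/integrableP; split.
  by apply/measurable_EFinP; exact: measurable_scaled.
have mn : measurable_fun setT (fun z => `|f z|%:E).
  by apply/measurable_EFinP; exact: measurableT_comp.
have := ge0_integral_scale l0 mn (fun z => normr_ge0 _).
have c0 : 0 < csq l ^+ n by rewrite exprn_gt0// lt_neqAle csq_ge0 andbT eq_sym csq_eq0.
move=> E; have := fi; rewrite [X in (X < _)%E](_ : _ = (\int[nu]_z `|f z|%:E)%E)//.
rewrite E; have key (c : R) (x : \bar R) : 0 < c -> (c%:E * x < +oo)%E -> (x < +oo)%E.
  by case: x => [x c1 _||]; rewrite ?ltry ?ltNyr// => c1; rewrite gt0_muley.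
exact: key.
Qed.

Lemma Rintegral_scale f l : l != 0 -> measurable_fun setT f ->
  nu.-integrable setT (EFin \o f) ->
  \int[nu]_z f z = csq l ^+ n * \int[nu]_z f (l *: z).
Proof.
move=> l0 mf fi; have fli := integrable_scale l0 mf fi.
have mE : measurable_fun setT (EFin \o f) by apply/measurable_EFinP.
have P := ge0_integral_scale l0 (measurable_funepos mE) (funepos_ge0 _).
have Q := ge0_integral_scale l0 (measurable_funeneg mE) (funeneg_ge0 _).
have h1 := integrable_pos_fin_num measurableT fli.
have h2 := integrable_neg_fin_num measurableT fli.
rewrite /Rintegral integralE [in RHS]integralE P Q.
have -> : (fun z => (EFin \o f)^\+%E (l *: z)) = (fun z => (f (l *: z))%:E)^\+%E.
  by apply/funext => z; rewrite !funeposE.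
have -> : (fun z => (EFin \o f)^\-%E (l *: z)) = (fun z => (f (l *: z))%:E)^\-%E.
  by apply/funext => z; rewrite !funenegE.
rewrite -muleBr ?fin_num_adde_defr//.
  by rewrite fineM// fin_numB h1 h2.
Qed.

End scaling_real.

Section boxes.
Variable R : realType.
Implicit Types (M : R) (n : nat).
Notation mu := (@lebesgue_measure R).

Definition boxC M : set R[i] := [set w | complex.Re w \in `[- M, M] /\ complex.Im w \in `[- M, M]].
Definition box n M : set (Cn R n) := [set z | forall j, boxC M (z 0 j)].

Lemma measurable_boxC M : measurable (boxC M).
Proof.
have -> : boxC M = (complex.Re (R := R)) @^-1` `[- M, M] `&` (complex.Im (R := R)) @^-1` `[- M, M] by [].
apply: measurableI.
  by rewrite -[X in measurable X]setTI; apply: measurable_Re.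
by rewrite -[X in measurable X]setTI; apply: measurable_Im.
Qed.

Lemma measurable_box n M : measurable (@box n M).
Proof.
have -> : @box n M = \bigcap_(j in [set: 'I_n]) ((fun z : Cn R n => z 0 j) @^-1` boxC M).
  by apply/seteqP; split => z h j; [move=> _|]; exact: h.
apply: fin_bigcap_measurable => // j _.
by rewrite -[X in measurable X]setTI; apply: measurable_coord => //; exact: measurable_boxC.
Qed.

Lemma boxC_lty M : (@lebesgue_C R (boxC M) < +oo)%E.
Proof.
pose I : set R := `[- M, M]%classic.
have -> : @lebesgue_C R (boxC M) = ((mu \x mu) (I `*` I))%E.
  by congr (_ \x _)%E; apply/seteqP; split => -[x y].
have mI : (mu I < +oo)%E.
  by rewrite /I lebesgue_measure_itv/=; case: ifP => _ //; rewrite -EFinB ltry.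
rewrite product_measure1E//; [|exact: measurable_itv|exact: measurable_itv].
by apply: lte_mul_pinfty => //; rewrite ge0_fin_numE.
Qed.

Lemma box_lty n M : (@lebesgue_Cn R n (@box n M) < +oo)%E.
Proof.
elim: n => [|n ih] /=; first by rewrite diracE ltry.
have -> : lebesgue_succ (@lebesgue_Cn R n) (@box n.+1 M) =
    (@lebesgue_C R \x @lebesgue_Cn R n)%E (boxC M `*` @box n M).
  congr (_ \x _)%E; apply/seteqP; split => -[w v] /=.
    move=> h; split => /=.
      have := h (lshift n (@ord0 0)); rewrite /consC.
      by rewrite (row_mxEl (\row_(_ < 1) w) v) mxE.
    move=> j; have := h (rshift 1 j).
    by rewrite /consC (row_mxEr (\row_(_ < 1) w) v).
  move=> [hw hv] j; rewrite /consC /row_mx mxE.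
  by case: splitP => k _; rewrite ?mxE.
rewrite product_measure1E//; [|exact: measurable_boxC|exact: measurable_box].
by rewrite lte_mul_pinfty// ?ge0_fin_numE// boxC_lty.
Qed.

Definition csqn n (z : Cn R n) : R := \sum_j csq (z 0 j).

Lemma csqn_ge0 n (z : Cn R n) : 0 <= csqn z.
Proof. by apply: sumr_ge0 => j _; exact: csq_ge0. Qed.

Lemma enorm_row n (z : Cn R n) : enorm z ^+ 2 = csqn z.
Proof.
rewrite /enorm big_ord1 sqr_sqrtr; last by apply: sumr_ge0 => j _; rewrite sqr_ge0.
by apply: eq_bigr => j _; rewrite csqE.
Qed.

Lemma enorm_ge0 p q (A : 'M[R[i]]_(p, q)) : 0 <= enorm A.
Proof. exact: sqrtr_ge0. Qed.

Lemma exteriorE n (r : R) (z : Cn R n) : 0 <= r -> exterior r z <-> r ^+ 2 < csqn z.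
Proof.
move=> r0; rewrite -enorm_row /exterior/= ltr_pXn2r// nnegrE//; exact: enorm_ge0.
Qed.

Lemma csqn_scale n l (z : Cn R n) : csqn (l *: z) = csq l * csqn z.
Proof. by rewrite /csqn mulr_sumr; apply: eq_bigr => j _; rewrite mxE csqM. Qed.

Lemma measurable_csqn n : measurable_fun setT (@csqn n).
Proof.
apply: measurable_sum => j.
exact: (measurableT_comp (@measurable_csqC R) (@measurable_coord R n j)).
Qed.

Lemma csq_coord_le n (z : Cn R n) j : csq (z 0 j) <= csqn z.
Proof. by rewrite /csqn (bigD1 j)//= lerDl sumr_ge0// => i _; exact: csq_ge0. Qed.

Lemma csqn_box n M (z : Cn R n) : 0 <= M -> csqn z <= M ^+ 2 -> box M z.
Proof.
move=> M0 zM j; have := le_trans (csq_coord_le z j) zM; rewrite /boxC/= !in_itv/= -!ler_norml.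
move=> h; split; apply: sqr_le_norm => //.
  exact: le_trans (sqr_Re_le _) h.
exact: le_trans (sqr_Im_le _) h.
Qed.

Lemma measurable_exterior n (r : R) : 0 <= r -> measurable (@exterior R n r).
Proof.
move=> r0; have -> : @exterior R n r = @csqn n @^-1` `]r ^+ 2, +oo[.
  by apply/seteqP; split => z /=; rewrite in_itv/= andbT => /(exteriorE _ r0).
by rewrite -[X in measurable X]setTI; apply: measurable_csqn.
Qed.

End boxes.

(** * A class of smooth functions *)

Section bump.
Variable R : realType.
Implicit Types (x y : R) (m : nat).

(** The flat functions x^(-m) e^(-1/x). Carrying the power m closes the family under differentiation
    up to linear combinations, which makes smoothness an induction on syntax. *)
Definition bm m x : R := if 0 < x then x ^- m * expR (- x^-1) else 0.

(** With k = m + 2, e^(-1/x) is the k-th power of e^(-1/(k x)), which is at most k x since e^y >= y.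
    Two powers of x survive the division by x^m. *)
Lemma bm_small m x : 0 < x -> bm m x <= m.+2%:R ^+ m.+2 * x ^+ 2.
Proof.
move=> x0; rewrite /bm x0.
have k0 : 0 < m.+2%:R :> R by rewrite ltr0n.
have kx : 0 < m.+2%:R * x by rewrite mulr_gt0.
have h : expR (- x^-1) <= (m.+2%:R * x) ^+ m.+2.
  have -> : - x^-1 = m.+2%:R * - (m.+2%:R * x)^-1.
    by field; rewrite !gt_eqF.
  rewrite expRM_natl lerXn2r ?nnegrE ?expR_ge0 ?(ltW kx)//.
  rewrite expRN -[leRHS]invrK lef_pV2 ?posrE ?expR_gt0 ?invr_gt0//.
  by apply: le_trans (expR_ge1Dx _); rewrite lerDr.
apply: (le_trans (ler_wpM2l _ h)); first by rewrite invr_ge0 exprn_ge0// ltW.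
rewrite exprMn le_eqVlt; apply/orP; left; apply/eqP.
rewrite -addn2 exprD [x ^+ (m + 2)]exprD mulrCA; congr (_ * _).
by rewrite mulrA mulVf ?mul1r// expf_neq0// gt_eqF.
Qed.

Lemma bm_ge0 m x : 0 <= bm m x.
Proof. by rewrite /bm; case: ifP => // x0; rewrite mulr_ge0 ?expR_ge0// invr_ge0 exprn_ge0// ltW. Qed.

Lemma bm_le0 m x : x <= 0 -> bm m x = 0.
Proof. by rewrite /bm leNgt => /negbTE ->. Qed.

Lemma bm0_le1 x : bm 0 x <= 1.
Proof.
rewrite /bm; case: ifP => // x0; rewrite expr0 invr1 mul1r expR_le1 oppr_le0 invr_ge0 ltW//.
Qed.

Lemma bm_abs m x : `|bm m x| <= m.+2%:R ^+ m.+2 * x ^+ 2.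
Proof.
rewrite ger0_norm ?bm_ge0//; case: (ltrP 0 x) => x0; first exact: bm_small.
by rewrite bm_le0// mulr_ge0 ?sqr_ge0// exprn_ge0.
Qed.

Lemma is_derive_bm m x : is_derive x 1 (bm m) (bm m.+2 x - m%:R * bm m.+1 x).
Proof.
have [x0|x0|->] := ltrgtP x 0.
- rewrite !bm_le0 ?ltW// mulr0 subr0.
  apply: (near_eq_is_derive _ (is_derive_cst (0 : R) x 1)).
  by near=> y; rewrite /= bm_le0// ltW//; near: y; exact: lt_nbhsl.
- have xn0 : x != 0 by rewrite gt_eqF.
  have d1 : is_derive x 1 (fun y => y^-1) (- x ^- 2 *: 1).
    by apply: is_deriveV => //; exact: is_derive_id.
  have d2 := is_deriveN d1.
  have d3 := @is_derive1_comp _ expR (fun y => - y^-1) x _ _ (is_derive_expR _) d2.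
  have d4 : is_derive x 1 (fun y => (y ^+ m)^-1) (- (x ^+ m) ^- 2 *: (m%:R * x ^+ m.-1)).
    apply: is_deriveV; first exact: expf_neq0.
    have := @is_deriveX _ _ id m x 1 1 (is_derive_id x 1).
    rewrite (_ : id ^+ m = (fun y : R => y ^+ m)); last by rewrite exprfctE.
    by move=> H; apply: (is_derive_eq H); rewrite /GRing.scale/= mulr1.
  have d5 : is_derive x 1 (fun y => (y ^+ m)^-1 * expR (- y^-1)) (bm m.+2 x - m%:R * bm m.+1 x); last first.
    apply: (near_eq_is_derive _ d5).
    by near=> y; rewrite /bm; case: ifPn => //; rewrite (_ : 0 < y)//; near: y; exact: lt_nbhsr.
  apply: (is_derive_eq (is_deriveM d4 d3)).
  rewrite /bm x0 /GRing.scale/=; move: (expR _) => E.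
  case: m d4 => [|m] _ /=.
    rewrite !expr0 !mul0r subr0; field; done.
  rewrite !exprS; move: (expf_neq0 m xn0) (m.+1%:R : R); move: (x ^+ m) => p p0 q; field.
  by rewrite ?xn0 ?p0.
- rewrite !bm_le0// mulr0 subr0.
  pose K : R := m.+2%:R ^+ m.+2.
  have K0 : 0 < K by rewrite exprn_gt0.
  (* At 0 the quadratic bound [bm_abs] forces the difference quotient to 0 from both sides, for
     every m. *)
  have cv : (fun h => h^-1 *: (bm m (h *: 1 + 0) - bm m 0)) @ 0^' --> (0 : R).
    apply/cvgrPdist_lt => e e0; near=> h.
    have hn0 : h != 0 by near: h; exact: nbhs_dnbhs_neq.
    rewrite sub0r normrN (bm_le0 m (lexx 0)) subr0 addr0 /GRing.scale/= mulr1 normrM normfV.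
    rewrite mulrC ltr_pdivrMr ?normr_gt0//; apply: (le_lt_trans (bm_abs m h)).
    rewrite -(real_normK (num_real h)) expr2 mulrA ltr_pM2r ?normr_gt0//.
    rewrite -/K mulrC -ltr_pdivlMr//.
    by near: h; apply: dnbhs0_lt; rewrite divr_gt0.
  apply: DeriveDef; first by apply/cvg_ex; exists 0.
  exact: (cvg_lim (@norm_hausdorff _ _) cv).
Unshelve. all: by end_near.
Qed.

Lemma continuous_bm m : continuous (bm m).
Proof. exact: is_derive_continuous (is_derive_bm m). Qed.

End bump.

(** Syntax for a supply of smooth real functions on C^n: real polynomials composed with the flat
    functions. Derivatives and complex dilations are again expressions, so the tests needed below
    are handled by structural recursion. *)
Inductive sexpr (R : realType) (n : nat) :=
| SCst of R
| SLin of Cn R n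
| SAdd of sexpr R n & sexpr R n
| SMul of sexpr R n & sexpr R n
| SBmp of nat & sexpr R n.

Arguments SCst {R n}.
Arguments SLin {R n}.
Arguments SAdd {R n}.
Arguments SMul {R n}.
Arguments SBmp {R n}.

Section smooth_expressions.
Variables (R : realType) (n : nat).
Implicit Types (e : sexpr R n) (c z v : Cn R n) (l : R[i]).

Definition lin c z : R := complex.Re (\sum_j c 0 j * z 0 j).

Fixpoint seval e z : R := match e with
  | SCst a => a
  | SLin c => lin c z
  | SAdd e1 e2 => seval e1 z + seval e2 z
  | SMul e1 e2 => seval e1 z * seval e2 z
  | SBmp m e1 => bm m (seval e1 z)
  end.

Fixpoint sder v e : sexpr R n := match e with
  | SCst a => SCst 0
  | SLin c => SCst (lin c v)
  | SAdd e1 e2 => SAdd (sder v e1) (sder v e2)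
  | SMul e1 e2 => SAdd (SMul (sder v e1) e2) (SMul e1 (sder v e2))
  | SBmp m e1 => SMul (sder v e1) (SAdd (SBmp m.+2 e1) (SMul (SCst (- m%:R)) (SBmp m.+1 e1)))
  end.

Fixpoint sscale l e : sexpr R n := match e with
  | SCst a => SCst a
  | SLin c => SLin (l *: c)
  | SAdd e1 e2 => SAdd (sscale l e1) (sscale l e2)
  | SMul e1 e2 => SMul (sscale l e1) (sscale l e2)
  | SBmp m e1 => SBmp m (sscale l e1)
  end.

Lemma linD c z v : lin c (z + v) = lin c z + lin c v.
Proof.
by rewrite /lin -ReD -big_split/=; congr complex.Re; apply: eq_bigr => j _; rewrite mxE mulrDr.
Qed.

Lemma lin_real c (t : R) z : lin c (t%:C *: z) = t * lin c z.
Proof.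
rewrite /lin !Re_sum mulr_sumr; apply: eq_bigr => j _.
by rewrite mxE !ReImE/=; ring.
Qed.

Lemma lin_scale l c z : lin (l *: c) z = lin c (l *: z).
Proof. by congr complex.Re; apply: eq_bigr => j _; rewrite !mxE; ring. Qed.

Lemma seval_scale l e z : seval (sscale l e) z = seval e (l *: z).
Proof.
by elim: e => //= [c|e1 -> e2 ->|e1 -> e2 ->|m e1 ->] //; exact: lin_scale.
Qed.

(** Along any curve g, it suffices to differentiate the linear forms; the rest is the chain rule.
    The same statement then serves straight lines and the orbits. *)
Lemma is_derive_seval e (g : R -> Cn R n) (t : R) v :
  (forall c, is_derive t 1 (fun s => lin c (g s)) (lin c v)) ->
  is_derive t 1 (fun s => seval e (g s)) (seval (sder v e) (g t)).
Proof.
move=> dg; elim: e => [a|c|e1 d1 e2 d2|e1 d1 e2 d2|m e1 d1] /=.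
- exact: is_derive_cst.
- exact: dg.
- exact: is_deriveD d1 d2.
- apply: (is_derive_eq (is_deriveM d1 d2)); rewrite /GRing.scale/=; ring.
- have := @is_derive1_comp _ (bm m) (fun s => seval e1 (g s)) t _ _ (is_derive_bm m _) d1.
  by move=> H; apply: (is_derive_eq H); ring.
Qed.

Lemma is_derive_rline e v z (t : R) :
  is_derive t 1 (rline (seval e) v z) (seval (sder v e) (z + t%:C *: v)).
Proof.
apply: (@is_derive_seval e (fun t => z + t%:C *: v)) => c.
have := is_deriveD (is_derive_cst (lin c z) t 1) (is_deriveZ (lin c v) (is_derive_id t 1)).
rewrite (_ : _ + _ = (fun s => lin c (z + s%:C *: v))); last first.
  by apply/funext => s; rewrite /= linD lin_real mulrC.
by move=> H; apply: (is_derive_eq H); rewrite add0r /GRing.scale/= mulr1.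
Qed.

Lemma rderive_seval v e : rderive v (seval e) = seval (sder v e).
Proof.
apply/funext => z; rewrite /rderive derive1E.
by have [_ ->] := is_derive_rline e v z 0; rewrite scale0r addr0.
Qed.

Lemma Re_continuous : continuous (fun w : R[i] => complex.Re w).
Proof.
move=> w U /nbhs_ballP[eps /= e0 sU]; apply/nbhs_ballP; exists eps%:C => /=.
  by rewrite ltcR.
move=> y; rewrite -ball_normE/= => h; apply: sU; rewrite /ball/= -ReN -ReD.
apply: le_lt_trans (_ : Normc.normc (w - y) < eps); last by rewrite -ltcR.
apply: sqr_le_norm; first by case: (w - y) => a b; exact: sqrtr_ge0.
by rewrite -csqE; exact: sqr_Re_le.
Qed.

Lemma Im_continuous : continuous (fun w : R[i] => complex.Im w).
Proof.
move=> w U /nbhs_ballP[eps /= e0 sU]; apply/nbhs_ballP; exists eps%:C => /=.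
  by rewrite ltcR.
move=> y; rewrite -ball_normE/= => h; apply: sU; rewrite /ball/= -ImN -ImD.
apply: le_lt_trans (_ : Normc.normc (w - y) < eps); last by rewrite -ltcR.
apply: sqr_le_norm; first by case: (w - y) => a b; exact: sqrtr_ge0.
by rewrite -csqE; exact: sqr_Im_le.
Qed.

Lemma linE c z : lin c z = \sum_j (complex.Re (c 0 j) * complex.Re (z 0 j) -
  complex.Im (c 0 j) * complex.Im (z 0 j)).
Proof. by rewrite /lin Re_sum; apply: eq_bigr => j _; rewrite ReM. Qed.

Lemma continuous_sumR (T : topologicalType) (I : Type) (r : seq I) (f : I -> T -> R) :
  (forall j, continuous (f j)) -> continuous (fun t => \sum_(j <- r) f j t).
Proof.
move=> cf; elim: r => [|j r ih] t.
  by rewrite (_ : (fun _ => _) = cst 0); [exact: cst_continuous|apply/funext => y; rewrite big_nil].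
rewrite (_ : (fun _ => _) = (fun t => f j t + \sum_(j <- r) f j t)); last first.
  by apply/funext => y; rewrite big_cons.
exact: (cvgD (cf j t) (ih t)).
Qed.

Lemma continuous_lin c : continuous (lin c).
Proof.
rewrite (_ : lin c = fun z => \sum_j (complex.Re (c 0 j) * complex.Re (z 0 j) -
  complex.Im (c 0 j) * complex.Im (z 0 j))); last by apply/funext => z; exact: linE.
apply: continuous_sumR => j z.
have cj : {for z, continuous (fun z : Cn R n => z 0 j)} by exact: coord_continuous.
have cR := @continuous_comp _ _ _ (fun z : Cn R n => z 0 j) _ z cj (@Re_continuous (z 0 j)).
have cI := @continuous_comp _ _ _ (fun z : Cn R n => z 0 j) _ z cj (@Im_continuous (z 0 j)).
have c1 := @cst_continuous (Cn R n) R (complex.Re (c 0 j)) z.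
have c2 := @cst_continuous (Cn R n) R (complex.Im (c 0 j)) z.
exact: (cvgB (cvgM c1 cR) (cvgM c2 cI)).
Qed.

Lemma continuous_seval e : continuous (seval e).
Proof.
elim: e => [a|c|e1 d1 e2 d2|e1 d1 e2 d2|m e1 d1] z /=.
- exact: cst_continuous.
- exact: continuous_lin.
- exact: (cvgD (d1 z) (d2 z)).
- exact: (cvgM (d1 z) (d2 z)).
- exact: (@continuous_comp _ _ _ (seval e1) (bm m) z (d1 z) (@continuous_bm R m (seval e1 z))).
Qed.

Lemma Ck_seval k e : Ck k (seval e).
Proof.
elim: k e => [|k ih] e /=; first by split => //; exact: continuous_seval.
split; first exact: continuous_seval.
move=> j v _; split; last by rewrite rderive_seval.
by move=> z; have [] := is_derive_rline e v z 0.
Qed.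

Lemma measurable_lin c : measurable_fun setT (lin c).
Proof.
rewrite (_ : lin c = fun z => \sum_j (complex.Re (c 0 j) * complex.Re (z 0 j) -
  complex.Im (c 0 j) * complex.Im (z 0 j))); last by apply/funext => z; exact: linE.
apply: measurable_sum => j; have mj := @measurable_coord R n j.
apply: measurable_funB; apply: measurable_funM => //.
  exact: (measurableT_comp (@measurable_Re R) mj).
exact: (measurableT_comp (@measurable_Im R) mj).
Qed.

Lemma measurable_seval e : measurable_fun setT (seval e).
Proof.
elim: e => [a|c|e1 d1 e2 d2|e1 d1 e2 d2|m e1 d1] /=.
- exact: measurable_cst.
- exact: measurable_lin.
- exact: measurable_funD.
- exact: measurable_funM.
- apply: (measurableT_comp _ d1); apply: continuous_measurable_fun; exact: continuous_bm.
Qed.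

Lemma seval_bounded e (M : R) : exists2 B : R, 0 <= B &
  forall z, csqn z <= M ^+ 2 -> `|seval e z| <= B.
Proof.
elim: e => [a|c|e1 [B1 b1 h1] e2 [B2 b2 h2]|e1 [B1 b1 h1] e2 [B2 b2 h2]|m e1 [B1 b1 h1]] /=.
- by exists `|a|.
- exists (\sum_j (`|complex.Re (c 0 j)| * `|M| + `|complex.Im (c 0 j)| * `|M|)).
    by apply: sumr_ge0 => j _; rewrite addr_ge0// mulr_ge0.
  move=> z zM; rewrite linE; apply: (le_trans (ler_norm_sum _ _ _)).
  apply: ler_sum => j _; apply: (le_trans (ler_normB _ _)); rewrite !normrM.
  have h := le_trans (csq_coord_le z j) zM.
  have hM : csq (z 0 j) <= `|M| ^+ 2 by rewrite real_normK ?num_real.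
  apply: lerD; apply: ler_wpM2l => //; apply: sqr_le_norm => //.
    exact: le_trans (sqr_Re_le _) hM.
  exact: le_trans (sqr_Im_le _) hM.
- exists (B1 + B2); first exact: addr_ge0.
  by move=> z zM; apply: (le_trans (ler_normD _ _)); rewrite lerD ?h1 ?h2.
- exists (B1 * B2); first exact: mulr_ge0.
  by move=> z zM; rewrite normrM ler_pM ?h1 ?h2.
- exists (m.+2%:R ^+ m.+2 * B1 ^+ 2); first by rewrite mulr_ge0 ?sqr_ge0// exprn_ge0.
  move=> z zM; apply: (le_trans (bm_abs _ _)); apply: ler_wpM2l; first by rewrite exprn_ge0.
  by rewrite -(real_normK (num_real (seval _ _))) lerXn2r ?nnegrE// h1.
Qed.

Lemma lin_xdir c j : lin c (xdir R j) = complex.Re (c 0 j).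
Proof.
rewrite /lin (bigD1 j)//= big1 ?addr0; last first.
  by move=> i ij; rewrite mxE eqxx/= (negbTE ij) mulr0.
by rewrite mxE !eqxx mulr1.
Qed.

Lemma lin_ydir c j : lin c (ydir R j) = - complex.Im (c 0 j).
Proof.
rewrite /lin (bigD1 j)//= big1 ?addr0; last first.
  by move=> i ij; rewrite !mxE eqxx/= (negbTE ij) !mulr0.
by rewrite !mxE !eqxx mulr1 ReM/=; ring.
Qed.

Lemma sder_basis v e z : seval (sder v e) z =
  \sum_j (complex.Re (v 0 j) * seval (sder (xdir R j) e) z +
          complex.Im (v 0 j) * seval (sder (ydir R j) e) z).
Proof.
elim: e => [a|c|e1 d1 e2 d2|e1 d1 e2 d2|m e1 d1] /=.
- by rewrite big1// => j _; rewrite !mulr0 addr0.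
- by rewrite linE; apply: eq_bigr => j _; rewrite lin_xdir lin_ydir; ring.
- by rewrite d1 d2 -big_split/=; apply: eq_bigr => j _; ring.
- rewrite d1 d2 mulr_suml mulr_sumr -big_split/=; apply: eq_bigr => j _; ring.
- by rewrite d1 mulr_suml; apply: eq_bigr => j _; ring.
Qed.

Lemma sder_scale l v e z : seval (sder v (sscale l e)) z = seval (sder (l *: v) e) (l *: z).
Proof.
elim: e => [a|c|e1 d1 e2 d2|e1 d1 e2 d2|m e1 d1] //=.
- exact: lin_scale.
- by rewrite d1 d2.
- by rewrite d1 d2 !seval_scale.
- by rewrite d1 !seval_scale.
Qed.

(* The sum of the [conj z_j * d/d(conj z_j)], i.e. half of the derivative in the
   direction z plus i times half of the derivative in the direction i z. *)
Definition Ebar e z : R[i] :=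
  2^-1 * ((seval (sder z e) z)%:C + (0 +i* 1) * (seval (sder ((0 +i* 1) *: z) e) z)%:C).

(** The Euler field commutes with complex dilations. This invariance allows the weak equation to be
    tested against a test function transported along the orbits. *)
Lemma Ebar_scale l e z : Ebar (sscale l e) z = Ebar e (l *: z).
Proof.
by rewrite /Ebar !sder_scale !scalerA [l * _]mulrC.
Qed.

Lemma dbar_seval j e z : dbar j (seval e) z =
  2^-1 * ((seval (sder (xdir R j) e) z)%:C + (0 +i* 1) * (seval (sder (ydir R j) e) z)%:C).
Proof. by rewrite /dbar !rderive_seval. Qed.

Lemma half_half : (2^-1 : R[i]) = (2^-1 : R)%:C.
Proof.
have h : 2 != 0 :> R[i] by rewrite pnatr_eq0.
apply: (mulfI h); rewrite mulfV//.
rewrite (_ : (2 : R[i]) = (2 : R)%:C); last by rewrite rmorph_nat.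
by rewrite -real_complexM mulfV.
Qed.

Lemma Ebar_dbar e z : Ebar e z =
  \sum_j (complex.Re (z 0 j) -i* complex.Im (z 0 j)) * dbar j (seval e) z.
Proof.
rewrite (eq_bigr (fun j => (complex.Re (z 0 j) -i* complex.Im (z 0 j)) *
  ((2^-1 : R)%:C * ((seval (sder (xdir R j) e) z)%:C + (0 +i* 1) * (seval (sder (ydir R j) e) z)%:C)))); last first.
  by move=> j _; rewrite dbar_seval half_half.
rewrite /Ebar (sder_basis z) (sder_basis ((0 +i* 1) *: z)) half_half.
apply: complex_ext; rewrite ?Re_sum ?Im_sum.
  rewrite !ReM !ReD !ReM !ImD !ImM /= !(mul0r, mulr0, subr0, add0r, mul1r, sub0r, addr0) mulr_sumr.
  by apply: eq_bigr => j _; ring.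
rewrite !ImM !ReD !ReM !ImD !ImM /= !(mul0r, mulr0, subr0, add0r, mul1r, sub0r, addr0) mulr_sumr.
by apply: eq_bigr => j _; rewrite mxE ?ReImE/=; ring.
Qed.

End smooth_expressions.

Section test_functions.
Variables (R : realType) (n : nat).
Implicit Types (e : sexpr R n) (z c v : Cn R n) (r s M : R).

Lemma linC c z : lin c z = lin z c.
Proof. by congr complex.Re; apply: eq_bigr => j _; rewrite mulrC. Qed.

Definition snorm2 : sexpr R n := foldr (fun j acc => SAdd
  (SAdd (SMul (SLin (xdir R j)) (SLin (xdir R j))) (SMul (SLin (ydir R j)) (SLin (ydir R j)))) acc)
  (SCst 0) (enum 'I_n).

Lemma seval_snorm2 z : seval snorm2 z = csqn z.
Proof.
rewrite /snorm2 /csqn -big_enum/=; elim: (enum _) => [|j l ih] /=; first by rewrite big_nil.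
rewrite big_cons ih; congr (_ + _).
by rewrite !(linC _ z) lin_xdir lin_ydir /csq; ring.
Qed.

Lemma continuous_csqn : continuous (@csqn R n).
Proof.
have -> : @csqn R n = seval snorm2 by apply/funext => z; rewrite seval_snorm2.
exact: continuous_seval.
Qed.

Lemma compact_boxC M : compact (boxC M).
Proof.
pose I : set R := `[- M, M]%classic.
have cI : compact I by exact: segment_compact.
have -> : boxC M = (fun p : R * R => p.1 +i* p.2) @` (I `*` I).
  apply/seteqP; split => [w [h1 h2]|w [[x y] [/= h1 h2] <-]]; last by split.
  by exists (complex.Re w, complex.Im w) => //; case: w h1 h2.
apply: continuous_compact; last exact: compact_setX.
apply: continuous_subspaceT => p U /nbhs_ballP[eps /= e0 sU].
have [d d0 dE] : exists2 d : R, 0 < d & eps = d%:C.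
  exists (complex.Re eps); first by move: e0; rewrite ltcE => /andP[].
  by move: e0; case: eps {sU} => a b; rewrite ltcE/= => /andP[/eqP -> _].
have d2 : 0 < d / 2 by rewrite divr_gt0.
apply/nbhs_ballP; exists (d / 2) => //= q [h1 h2]; apply: sU.
rewrite dE -ball_normE/= ltcR; move: h1 h2; rewrite /ball/= => h1 h2.
have : csq (p.1 +i* p.2 - (q.1 +i* q.2)) < d ^+ 2.
  rewrite /csq/=; have := ltr_pM (normr_ge0 _) (normr_ge0 _) h1 h1; have := ltr_pM (normr_ge0 _) (normr_ge0 _) h2 h2.
  rewrite -!expr2 !real_normK ?num_real// => *; nra.
move: (csq_ge0 (p.1 +i* p.2 - (q.1 +i* q.2))) => c0 h.
by rewrite -[ltRHS](ger0_norm (ltW d0)) -sqrtr_sqr ltr_sqrt// exprn_gt0.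
Qed.

Lemma compact_box M : compact (@box R n M).
Proof.
have := @rV_compact R[i] n (fun=> boxC M) (fun=> @compact_boxC M).
by congr compact; apply/funext => z; apply/propext; split => h j; have := h j; rewrite -?zero_ord0.
Qed.

(** Vanishing outside a closed annulus s <= |z| <= M with s > r: a concrete form of compact support
    in the exterior that is easy to transport by dilations. *)
Definition admissible r e := exists s M, [/\ r < s, 0 <= M &
  forall z, seval e z != 0 -> s ^+ 2 <= csqn z /\ csqn z <= M ^+ 2].

Lemma admissible_test r e : 0 < r -> admissible r e -> test_function (exterior r) (seval e).
Proof.
move=> r0 [s [M [rs M0 sM]]].
pose S := [set z | s ^+ 2 <= csqn z /\ csqn z <= M ^+ 2] : set (Cn R n).
have cS : closed S.
  have -> : S = @csqn R n @^-1` `[s ^+ 2, M ^+ 2]%classic.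
    by apply/seteqP; split => z; rewrite /S/= in_itv/= => /andP.
  apply: closed_comp => [z _|]; first exact: continuous_csqn.
  exact: interval_closed.
have sub : closure [set z | seval e z != 0] `<=` S.
  by rewrite [X in _ `<=` X](iffLR (closure_id _) cS); apply: closureS => z /=; exact: sM.
split.
- by move=> k; exact: Ck_seval.
- apply: (subclosed_compact _ (@compact_box M)); first exact: closed_closure.
  by move=> z /sub[_ zM]; exact: csqn_box.
- move=> z /sub[sz _]; apply/exteriorE; first exact: ltW.
  by apply: lt_le_trans sz; rewrite ltr_pXn2r ?nnegrE ?ltW// (lt_trans r0).
Qed.

(** For |l| <= 1 composing with z -> l z pushes the support outwards, so it stays in the exterior.
    This is why only the flow with nonnegative time is used. *)
Lemma admissible_scale r e l : 0 < r -> l != 0 -> csq l <= 1 -> admissible r e ->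
  admissible r (sscale l e).
Proof.
move=> r0 l0 l1 [s [M [rs M0 sM]]].
have c0 : 0 < csq l by rewrite lt_neqAle csq_ge0 andbT eq_sym csq_eq0.
exists s, (M / Num.sqrt (csq l)); split => //; first by rewrite divr_ge0// sqrtr_ge0.
move=> z; rewrite seval_scale => /sM; rewrite csqn_scale => -[h1 h2]; split.
  by apply: (le_trans h1); rewrite ler_piMl// csqn_ge0.
by rewrite expr_div_n sqr_sqrtr ?csq_ge0// ler_pdivlMr// mulrC.
Qed.

Lemma admissible_mulr r e1 e2 : admissible r e2 -> admissible r (SMul e1 e2).
Proof.
move=> [s [M [rs M0 sM]]]; exists s, M; split => // z /=.
by rewrite mulf_eq0 negb_or => /andP[_ /sM].
Qed.

Lemma dbar_mul_lin j c e z : dbar j (seval (SMul (SLin c) e)) z =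
  2^-1 * ((lin c (xdir R j))%:C + (0 +i* 1) * (lin c (ydir R j))%:C) * (seval e z)%:C +
  (lin c z)%:C * dbar j (seval e) z.
Proof.
rewrite /dbar !rderive_seval half_half; apply: complex_ext; rewrite !ReImE/=; ring.
Qed.

End test_functions.

(** * The fundamental lemma *)

Section fundamental_lemma.
Variables (R : realType) (n : nat).
Notation nu := (@lebesgue_Cn R n).
Implicit Types (e : sexpr R n) (es : seq (sexpr R n)) (z : Cn R n) (m : nat).

(** As m grows, [bm 0 (m.+1%:R * x)] tends to 1 for x > 0 and is 0 otherwise, so the product tends
    boundedly to the indicator of the set where all the expressions of the list are positive. *)
Definition bprod m es : sexpr R n :=
  foldr (fun e acc => SMul (SBmp 0 (SMul (SCst m.+1%:R) e)) acc) (SCst 1) es.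

Definition positivity es : set (Cn R n) := [set z | all (fun e => 0 < seval e z) es].

Lemma bprod_itv m es z : 0 <= seval (bprod m es) z <= 1.
Proof.
elim: es => [|e es /andP[h1 h2]] /=; first by rewrite ler01 lexx.
rewrite mulr_ge0 ?bm_ge0//= (le_trans (ler_pM (bm_ge0 _ _) h1 (bm0_le1 _) h2))// mulr1//.
Qed.

Lemma bprod_neq0 m es z : seval (bprod m es) z != 0 -> positivity es z.
Proof.
rewrite /positivity/=; elim: es => //= e es ih.
rewrite mulf_eq0 negb_or => /andP[h /ih ->]; rewrite andbT.
by apply: contraNT h; rewrite -leNgt => h; rewrite bm_le0// pmulr_rle0.
Qed.

Lemma cvg_bm0 (x : R) : bm 0 (m.+1%:R * x) @[m --> \oo] --> ((0 < x)%R%:R : R).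
Proof.
case: ltrP => x0 /=; last first.
  rewrite (_ : (fun m => _) = cst 0); first exact: cvg_cst.
  by apply/funext => m /=; rewrite bm_le0// pmulr_rle0.
rewrite (_ : (fun m => _) = (fun m => expR (- (x^-1 * harmonic m)))).
  rewrite -[X in _ --> X](expR0 R) -[X in expR X]oppr0 -[X in - X](mulr0 x^-1).
  apply: continuous_cvg; first exact: continuous_expR.
  by apply: cvgN; apply: cvgM; [exact: cvg_cst|exact: cvg_harmonic].
apply/funext => m /=; rewrite /bm mulr_gt0// expr0 invr1 mul1r invfM [in RHS]mulrC//.
Qed.

Lemma cvg_bprod es z :
  seval (bprod m es) z @[m --> \oo] --> ((all (fun e => 0 < seval e z) es)%:R : R).
Proof.
elim: es => [|e es ih] /=; first exact: cvg_cst.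
by rewrite -mulnb natrM; apply: cvgM; [exact: cvg_bm0|exact: ih].
Qed.

Lemma measurable_positivity es : measurable (positivity es).
Proof.
rewrite /positivity; elim: es => [|e es ih] /=.
  by rewrite [X in measurable X](_ : _ = setT)//; apply/seteqP; split.
rewrite [X in measurable X](_ : _ = (seval e @^-1` `]0, +oo[) `&`
  [set z | all (fun e => 0 < seval e z) es]); last first.
  by apply/seteqP; split => z /=; rewrite in_itv/= andbT => /andP.
apply: measurableI => //; rewrite -[X in measurable X]setTI; apply: measurable_seval => //.
Qed.

Definition loc_int (h : Cn R n -> R) := forall M : R,
  nu.-integrable [set z | csqn z <= M ^+ 2] (EFin \o h).

Definition annulus (s M : R) : seq (sexpr R n) :=
  [:: SAdd (snorm2 R n) (SCst (- s ^+ 2)); SAdd (SCst (M ^+ 2)) (SMul (SCst (- 1)) (snorm2 R n))].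

Lemma positivity_annulus s M es z : positivity (annulus s M ++ es) z <->
  [/\ s ^+ 2 < csqn z, csqn z < M ^+ 2 & positivity es z].
Proof.
rewrite /positivity/= seval_snorm2 mulN1r !subr_gt0.
by split => [/and3P[]|[-> -> ->]].
Qed.

Lemma admissible_annulus r s M m es : r < s -> 0 <= M ->
  admissible r (bprod m (annulus s M ++ es)).
Proof.
move=> rs M0; exists s, M; split => // z /bprod_neq0/positivity_annulus[h1 h2 _].
by split; exact: ltW.
Qed.

Lemma measurable_disc (M : R) : measurable [set z : Cn R n | csqn z <= M ^+ 2].
Proof.
rewrite [X in measurable X](_ : _ = (@csqn R n) @^-1` `]-oo, M ^+ 2]).
  by rewrite -[X in measurable X]setTI; apply: measurable_csqn.
by apply/seteqP; split => z /=; rewrite in_itv.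
Qed.

(** Dominated convergence for the tests [bprod]. The two annulus expressions in the list make every
    approximant admissible and confine the supports to one disc, where h is integrable. *)
Lemma integral_positivity_eq0 (h : Cn R n -> R) r s M es : 0 < r -> r < s -> 0 <= M ->
  measurable_fun setT h -> loc_int h ->
  (forall e, admissible r e -> (\int[nu]_z (h z * seval e z)%:E = 0)%E) ->
  (\int[nu]_(z in positivity (annulus s M ++ es)) (h z)%:E = 0)%E.
Proof.
move=> r0 rs M0 mh hi h0.
set es' := annulus s M ++ es.
pose D := [set z : Cn R n | csqn z <= M ^+ 2].
have mD : measurable D by exact: measurable_disc.
have DI : nu.-integrable setT ((fun z => `|h z|%:E) \_ D)%E.
  exact: (iffLR (integrable_mkcond _ mD) (integrable_abse (hi M))).
have := @dominated_convergence _ _ R nu setT measurableT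
  (fun m z => (h z * seval (bprod m es') z)%:E)
  (fun z => (h z * (all (fun e => 0 < seval e z) es')%:R)%:E) _ _ _ _ DI _.
case=> //.
- by move=> m; apply/measurable_EFinP; apply: measurable_funM => //; exact: measurable_seval.
- apply/measurable_EFinP; apply: measurable_funM => //.
  rewrite (_ : (fun z => _) = \1_(positivity es')); first exact: measurable_indic (measurable_positivity _).
  by apply/funext => z; rewrite indicE /positivity mem_setE.
- apply: aeW => z _; apply: cvg_EFin; first by apply: nearW.
  by apply: cvgM; [exact: cvg_cst|exact: cvg_bprod].
- apply: aeW => z m _; rewrite /patch; case: ifPn => [_|zD].
    rewrite lee_fin normrM ler_piMr// ger0_norm; by have /andP[] := bprod_itv m es' z.
  rewrite lee_fin normr_le0 mulf_eq0; apply/orP; right.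
  apply: contraNT zD => /bprod_neq0/positivity_annulus[_ /ltW zM _].
  by rewrite inE.
move=> _ _; rewrite (_ : [sequence _]_m = cst 0%E); last first.
  by apply/funext => m; exact: (h0 _ (admissible_annulus m es rs M0)).
move=> cv; rewrite integral_mkcond.
rewrite [RHS](cvg_unique (@ereal_hausdorff R) (cvg_cst _) cv); apply: eq_integral => z _.
rewrite /patch; case: ifPn => [/set_mem|zP].
  by rewrite {1}/positivity/= => ->; rewrite mulr1.
have -> : all (fun e => 0 < seval e z) es' = false by apply: contraNF zP => h1; exact/mem_set.
by rewrite mulr0.
Qed.

(** Positivity of these expressions describes a finite intersection of open real half-spaces. Such
    sets are stable under intersection, which is what the Dynkin argument requires. *)
Definition half_spaces (L : seq (Cn R n * R)) := [seq SAdd (SLin q.1) (SCst (- q.2)) | q <- L].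

Definition half_space_sets : set (set (Cn R n)) :=
  [set B | exists L, B = positivity (half_spaces L)].

Lemma half_space_setsI : setI_closed half_space_sets.
Proof.
move=> _ _ [L1 ->] [L2 ->]; exists (L1 ++ L2); rewrite /half_spaces map_cat /positivity.
by apply/seteqP; split => z /=; rewrite all_cat => /andP.
Qed.

Lemma half_space_sets_measurable : measurable = <<s half_space_sets>>.
Proof.
apply/seteqP; split; last first.
  apply: smallest_sub; first exact: sigma_algebra_measurable.
  by move=> _ [L ->]; exact: measurable_positivity.
pose T := g_sigma_algebraType half_space_sets.
have mlin c : measurable_fun setT ((fun z : T => lin c z) : T -> R).
  apply: (measurability (@RGenOInfty.G R)); first exact: RGenOInfty.measurableE.
  move=> _ [_ [p ->] <-]; rewrite setTI; apply: sub_sigma_algebra; exists [:: (c, p)].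
  by apply/seteqP; split => z; rewrite /positivity/= in_itv/= !andbT subr_gt0.
have mid : measurable_fun setT (fun z : T => (z : Cn R n)).
  apply: measurable_fun_Cn => j; apply: measurable_fun_complex.
    rewrite (_ : (fun z => _) = lin (xdir R j)); first exact: mlin.
    by apply/funext => z; rewrite linC lin_xdir.
  rewrite (_ : (fun z => _) = (fun z => - lin (ydir R j) z)).
    by apply: measurable_funN; exact: mlin.
  by apply/funext => z; rewrite linC lin_ydir opprK.
move=> B mB; have := mid measurableT B mB; rewrite setTI; exact.
Qed.

(** The integral of h vanishes over the annulus intersected with each set of a pi-system generating
    the Borel sets. Dynkin's theorem extends this to all Borel sets, and a function whose integrals
    over all measurable subsets vanish is 0 almost everywhere. *)
Lemma annulus_vanish (h : Cn R n -> R) r s M : 0 < r -> r < s -> 0 <= M ->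
  measurable_fun setT h -> loc_int h ->
  (forall e, admissible r e -> (\int[nu]_z (h z * seval e z)%:E = 0)%E) ->
  {ae nu, forall z, s ^+ 2 < csqn z -> csqn z < M ^+ 2 -> h z = 0}.
Proof.
move=> r0 rs M0 mh hi h0.
pose A := positivity (annulus s M).
have mA : measurable A by exact: measurable_positivity.
have H0 es := @integral_positivity_eq0 h r s M es r0 rs M0 mh hi h0.
have HA : (\int[nu]_(z in A) (h z)%:E = 0)%E by have := H0 [::]; rewrite cats0.
have hA : nu.-integrable A (EFin \o h).
  apply: (integrableS (measurable_disc M) mA _ (hi M)) => z.
  by rewrite /A -(cats0 (annulus s M)) => /positivity_annulus[_ /ltW].
have H B : measurable B -> (\int[nu]_(z in A `&` B) (h z)%:E = 0)%E.
  move=> mB; have := mB; rewrite half_space_sets_measurable.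
  pose P := [set B | \int[nu]_(z in A `&` B) (h z)%:E = 0]%E.
  apply: (@dynkin_induction _ _ half_space_sets P half_space_sets_measurable half_space_setsI).
  - by rewrite /P/= setIT.
  - move=> _ [L ->]; rewrite /P/=.
    have -> : A `&` positivity (half_spaces L) = positivity (annulus s M ++ half_spaces L).
      rewrite /A -{1}(cats0 (annulus s M)); apply/seteqP; split => z.
        by move=> [/positivity_annulus[h1 h2 _] h3]; apply/positivity_annulus.
      by move=> /positivity_annulus[h1 h2 h3]; split => //; apply/positivity_annulus.
    exact: H0.
  - move=> S mS; rewrite /P/= => S0.
    move: HA; rewrite -{1}(setIT A) -(setUv S) setIUr integral_setU ?S0 ?add0e//.
    + exact: measurableI.
    + by apply: measurableI => //; exact: measurableC.
    + by rewrite -setIUr setUv setIT; have /integrableP[] := hA.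
    + by apply/disj_set2P; rewrite setIACA setICr !setI0.
  - move=> F mF tF F0; rewrite /P/= setI_bigcupr integral_bigcup//.
    + by rewrite eseries0// => k _ _; exact: F0.
    + exact: trivIset_setIl.
    + by move=> k; exact: measurableI.
    + by rewrite -setI_bigcupr; apply: integrableS hA => //; apply: measurableI => //; exact: bigcup_measurable.
have E : ae_eq nu A (EFin \o h) (cst 0%E).
  apply: integral_ae_eq => // E EA mE; rewrite integral0.
  by have := H _ mE; rewrite setIidr.
apply: (@ae_mono _ _ _ nu _ _ _ E) => z hz h1 h2.
have : A z by rewrite /A -(cats0 (annulus s M)); apply/positivity_annulus.
by move=> /hz[].
Qed.

(** The exterior is exhausted by countably many annuli r + 1/(k+1) < |z| < k, on each of which
    [annulus_vanish] applies. *)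
Lemma fundamental_lemma (h : Cn R n -> R) r : 0 < r ->
  measurable_fun setT h -> loc_int h ->
  (forall e, admissible r e -> (\int[nu]_z (h z * seval e z)%:E = 0)%E) ->
  {ae nu, forall z, exterior r z -> h z = 0}.
Proof.
move=> r0 mh hi h0.
have H (k : nat) := @annulus_vanish h r (r + k.+1%:R^-1) k%:R r0 _ (ler0n _ _) mh hi h0.
have H' : {ae nu, forall z, forall k : nat, (r + k.+1%:R^-1) ^+ 2 < csqn z -> csqn z < k%:R ^+ 2 -> h z = 0}.
  by apply: (@ae_all _ _ _ nu) => k; apply: H => j; rewrite ltrDl invr_gt0 ltr0n.
apply: (@ae_mono _ _ _ nu _ _ _ H') => z hz rz.
have e0 : 0 < enorm z - r by rewrite subr_gt0.
(* k exceeds both |z| and 1 / (|z| - r), so z lies in the k-th annulus. *)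
pose k := (Num.truncn (Num.max (enorm z) (enorm z - r)^-1)).+1.
have kb : Num.max (enorm z) (enorm z - r)^-1 < k%:R.
  by apply: truncnS_gt.
move: kb; rewrite gt_max => /andP[k1 k2].
have z0 : 0 <= enorm z by exact: enorm_ge0.
apply: (hz k); rewrite -enorm_row ltrXn2r ?nnegrE//.
- by rewrite addr_ge0 ?ltW// ltW.
- rewrite -ltrBrDl invf_plt ?posrE//; apply: (lt_trans k2); rewrite ltr_nat//.
Qed.

End fundamental_lemma.

(** * Complex integrals *)

Section complex_integral.
Variable R : realType.
Implicit Types (v w : R[i]).

(** An equivalent of the modulus that is additive in the two parts, so that integrability of a
    complex function splits without square roots. *)
Definition cabs w : R := `|complex.Re w| + `|complex.Im w|.

Lemma cabs_ge0 w : 0 <= cabs w.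
Proof. by rewrite addr_ge0. Qed.

Lemma cabsM v w : cabs (v * w) <= cabs v * cabs w.
Proof.
rewrite /cabs ReM ImM.
apply: (@le_trans _ _ (`|complex.Re v * complex.Re w| + `|complex.Im v * complex.Im w| +
  (`|complex.Re v * complex.Im w| + `|complex.Im v * complex.Re w|))).
  by apply: lerD; [exact: ler_normB|exact: ler_normD].
by rewrite !normrM; lra.
Qed.

Lemma cabsD v w : cabs (v + w) <= cabs v + cabs w.
Proof.
rewrite /cabs ReD ImD; apply: (le_trans (lerD (ler_normD _ _) (ler_normD _ _))); lra.
Qed.

Lemma cabsN w : cabs (- w) = cabs w.
Proof. by rewrite /cabs ReN ImN !normrN. Qed.

Lemma cabs_real (x : R) : cabs x%:C = `|x|.
Proof. by rewrite /cabs/= normr0 addr0. Qed.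

Lemma cabs0 : cabs 0 = 0.
Proof. by rewrite /cabs/= normr0 addr0. Qed.

Lemma cabs_cis (x : R) : cabs (cis x) <= 2.
Proof.
rewrite /cabs/= [leRHS](_ : 2 = 1 + 1)//; apply: lerD; rewrite ler_norml.
  by rewrite cos_geN1 cos_le1.
by rewrite sin_geN1 sin_le1.
Qed.

Lemma cabs_csq w : cabs w <= 1 + csq w.
Proof.
have h (x : R) : `|x| <= 2^-1 + x ^+ 2.
  rewrite -(real_normK (num_real x)); move: `|x| => y; have := sqr_ge0 (y - 2^-1); nra.
by rewrite /cabs /csq; have := h (complex.Re w); have := h (complex.Im w); lra.
Qed.

Lemma real_complex_measurable d (T : measurableType d) (f : T -> R) :
  measurable_fun setT f -> measurable_fun setT (fun x => (f x)%:C).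
Proof. by move=> mf; apply: measurable_fun_complex. Qed.

Section one.
Context d (T : measurableType d).
Implicit Types (f g : T -> R[i]) (D : set T).

Lemma measurable_Rec f : measurable_fun setT f -> measurable_fun setT (fun x => complex.Re (f x)).
Proof. by move=> mf; exact: (measurableT_comp (@measurable_Re R) mf). Qed.

Lemma measurable_Imc f : measurable_fun setT f -> measurable_fun setT (fun x => complex.Im (f x)).
Proof. by move=> mf; exact: (measurableT_comp (@measurable_Im R) mf). Qed.

Lemma measurable_complexM f g : measurable_fun setT f -> measurable_fun setT g ->
  measurable_fun setT (fun x => f x * g x).
Proof.
move=> mf mg; have := measurable_Rec mf; have := measurable_Imc mf.
have := measurable_Rec mg; have := measurable_Imc mg => g2 g1 f2 f1.
apply: measurable_fun_complex.
  by under eq_fun do rewrite ReM; apply: measurable_funB; apply: measurable_funM.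
by under eq_fun do rewrite ImM; apply: measurable_funD; apply: measurable_funM.
Qed.

Lemma measurable_complexD f g : measurable_fun setT f -> measurable_fun setT g ->
  measurable_fun setT (fun x => f x + g x).
Proof.
move=> mf mg; have := measurable_Rec mf; have := measurable_Imc mf.
have := measurable_Rec mg; have := measurable_Imc mg => g2 g1 f2 f1.
apply: measurable_fun_complex.
  by under eq_fun do rewrite ReD; apply: measurable_funD.
by under eq_fun do rewrite ImD; apply: measurable_funD.
Qed.

Lemma measurable_complexN f : measurable_fun setT f -> measurable_fun setT (fun x => - f x).
Proof.
move=> mf; have := measurable_Rec mf; have := measurable_Imc mf => f2 f1.
apply: measurable_fun_complex.
  by under eq_fun do rewrite ReN; apply: measurable_funN.
by under eq_fun do rewrite ImN; apply: measurable_funN.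
Qed.

Lemma measurable_cabs f : measurable_fun setT f -> measurable_fun setT (fun x => cabs (f x)).
Proof.
move=> mf; apply: measurable_funD; apply: measurableT_comp => //.
  exact: measurable_Rec.
exact: measurable_Imc.
Qed.

Variable m : {measure set T -> \bar R}.

Definition cI D f : R[i] :=
  (\int[m]_(x in D) complex.Re (f x)) +i* (\int[m]_(x in D) complex.Im (f x)).

Definition cfin D f := (\int[m]_(x in D) (cabs (f x))%:E < +oo)%E.

Lemma eq_cI D f g : (forall x, D x -> f x = g x) -> cI D f = cI D g.
Proof.
by move=> fg; congr (_ +i* _); apply: eq_Rintegral => t /set_mem Dt; rewrite fg.
Qed.

Lemma cfin_integrable D f : measurable D -> measurable_fun setT f -> cfin D f ->
  m.-integrable D (EFin \o (fun x => complex.Re (f x))) /\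
  m.-integrable D (EFin \o (fun x => complex.Im (f x))).
Proof.
move=> mD mf fi; split; apply/integrableP; split.
- by apply: measurable_funTS; apply/measurable_EFinP; exact: measurable_Rec.
- apply: le_lt_trans fi; apply: ge0_le_integral => //.
  + apply: measurable_funTS; apply/measurable_EFinP; apply: measurableT_comp => //; exact: measurable_Rec.
  + by apply: measurable_funTS; apply/measurable_EFinP; exact: measurable_cabs.
  + by move=> x _; rewrite lee_fin lerDl.
- by apply: measurable_funTS; apply/measurable_EFinP; exact: measurable_Imc.
- apply: le_lt_trans fi; apply: ge0_le_integral => //.
  + apply: measurable_funTS; apply/measurable_EFinP; apply: measurableT_comp => //; exact: measurable_Imc.
  + by apply: measurable_funTS; apply/measurable_EFinP; exact: measurable_cabs.
  + by move=> x _; rewrite lee_fin lerDr.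
Qed.

Lemma cfin_le D f (h : T -> R) : measurable D -> measurable_fun setT f -> measurable_fun setT h ->
  (forall x, D x -> cabs (f x) <= h x) ->
  (\int[m]_(x in D) (cabs (f x))%:E <= \int[m]_(x in D) (h x)%:E)%E.
Proof.
move=> mD mf mh fh; apply: ge0_le_integral => //.
- by move=> x _; rewrite lee_fin cabs_ge0.
- by apply: measurable_funTS; apply/measurable_EFinP; exact: measurable_cabs.
- by apply: measurable_funTS; apply/measurable_EFinP.
Qed.

Lemma cI_D D f g : measurable D -> measurable_fun setT f -> measurable_fun setT g ->
  cfin D f -> cfin D g -> cI D (fun x => f x + g x) = cI D f + cI D g.
Proof.
move=> mD mf mg /(cfin_integrable mD mf)[f1 f2] /(cfin_integrable mD mg)[g1 g2].
apply: complex_ext; rewrite !ReImE/=.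
  by under eq_Rintegral do rewrite ReD; rewrite RintegralD.
by under eq_Rintegral do rewrite ImD; rewrite RintegralD.
Qed.

Lemma cI_Z D c f : measurable D -> measurable_fun setT f -> cfin D f ->
  cI D (fun x => c * f x) = c * cI D f.
Proof.
move=> mD mf /(cfin_integrable mD mf)[f1 f2].
apply: complex_ext; rewrite !ReImE/=.
  under eq_Rintegral do rewrite ReM.
  by rewrite RintegralB ?RintegralZl//; apply: integrableZR.
under eq_Rintegral do rewrite ImM.
by rewrite RintegralD ?RintegralZl//; apply: integrableZR.
Qed.

(** If a measurable function is not integrable, its extended integral is infinite and [fine] sends
    it to 0. Both sides are then 0, and the identity holds in every case. *)
Lemma Rintegral_realZ D (c : R) (f : T -> R) : measurable D -> measurable_fun setT f ->
  \int[m]_(x in D) (c * f x) = c * \int[m]_(x in D) f x.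
Proof.
move=> mD mf; have [fi|nfi] := pselect (m.-integrable D (EFin \o f)).
  by rewrite RintegralZl.
have [->|c0] := eqVneq c 0.
  by rewrite mul0r; under eq_Rintegral do rewrite mul0r; rewrite /Rintegral integral0.
have ninf (h : T -> R) : measurable_fun setT h -> ~ m.-integrable D (EFin \o h) ->
    \int[m]_(x in D) h x = 0.
  move=> mh nh; rewrite /Rintegral integralE.
  have mhE : measurable_fun D (EFin \o h) by apply: measurable_funTS; apply/measurable_EFinP.
  have p0 : (0 <= \int[m]_(x in D) (EFin \o h)^\+ x)%E by apply: integral_ge0 => x _; exact: funepos_ge0.
  have q0 : (0 <= \int[m]_(x in D) (EFin \o h)^\- x)%E by apply: integral_ge0 => x _; exact: funeneg_ge0.
  have E : (\int[m]_(x in D) `|(EFin \o h) x| = \int[m]_(x in D) (EFin \o h)^\+ x + \int[m]_(x in D) (EFin \o h)^\- x)%E.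
    rewrite -ge0_integralD//; first by apply: eq_integral => x _; rewrite -[LHS]/((abse \o (EFin \o h)) x) fune_abse.
    + exact: measurable_funepos.
    + exact: measurable_funeneg.
  have : ~~ (\int[m]_(x in D) `|(EFin \o h) x| < +oo)%E by apply/negP => hf; apply: nh; apply/integrableP.
  rewrite E -leNgt leye_eq => /eqP.
  by move: p0 q0; case: (integral _ _ _) => [x||] //; case: (integral _ _ _) => [y||].
rewrite (ninf f)// mulr0 ninf//; first exact: measurable_funM.
move=> H; apply: nfi; have := integrableZR mD c^-1 H.
by congr (m.-integrable _ _); apply/funext => x /=; rewrite mulKf.
Qed.

Lemma cI_realZ D (c : R) f : measurable D -> measurable_fun setT f ->
  cI D (fun x => c%:C * f x) = c%:C * cI D f.
Proof.
move=> mD mf; apply: complex_ext; rewrite !ReImE/= !mul0r ?subr0 ?addr0.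
  rewrite -Rintegral_realZ//; last exact: measurable_Rec.
  by apply: eq_Rintegral => x _; rewrite ReM/=; ring.
rewrite -Rintegral_realZ//; last exact: measurable_Imc.
by apply: eq_Rintegral => x _; rewrite ImM/=; ring.
Qed.

Lemma cI_N D f : measurable D -> measurable_fun setT f -> cI D (fun x => - f x) = - cI D f.
Proof.
move=> mD mf; have := cI_realZ (-1) mD mf.
rewrite (_ : (-1)%:C = -1 :> R[i]); last by apply: complex_ext; rewrite !ReImE/= ?oppr0.
by rewrite mulN1r => <-; apply: eq_cI => x _; rewrite mulN1r.
Qed.

Lemma cabs_cI D f : measurable D -> measurable_fun setT f ->
  ((cabs (cI D f))%:E <= \int[m]_(x in D) (cabs (f x))%:E)%E.
Proof.
move=> mD mf.
have h (g : T -> R) : measurable_fun setT g ->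
    (`|\int[m]_(x in D) g x|%:E <= \int[m]_(x in D) `|g x|%:E)%E.
  move=> mg; have mgE : measurable_fun D (EFin \o g) by apply: measurable_funTS; apply/measurable_EFinP.
  apply: le_trans (le_abse_integral m mD mgE).
  rewrite /Rintegral; case: (integral _ _ _) => [x||] //=; rewrite normr0 leey//.
rewrite EFinD (_ : (fun x => (cabs (f x))%:E) = (fun x => `|complex.Re (f x)|%:E + `|complex.Im (f x)|%:E)%E)//.
rewrite ge0_integralD//; last 2 first.
- apply: measurable_funTS; apply/measurable_EFinP; apply: measurableT_comp => //; exact: measurable_Rec.
- apply: measurable_funTS; apply/measurable_EFinP; apply: measurableT_comp => //; exact: measurable_Imc.
by apply: leeD; apply: h; [exact: measurable_Rec|exact: measurable_Imc].
Qed.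

End one.

Section two.
Context d1 d2 (T1 : measurableType d1) (T2 : measurableType d2).
Variables (m1 : {sigma_finite_measure set T1 -> \bar R}) (m2 : {sigma_finite_measure set T2 -> \bar R}).
Variables (A : set T1) (B : set T2) (f : T1 * T2 -> R[i]) (K : \bar R).
Hypotheses (mA : measurable A) (mB : measurable B) (mf : measurable_fun setT f).

Lemma measurable_cI : measurable_fun setT (fun x => cI m2 B (fun y => f (x, y))).
Proof.
apply: measurable_fun_complex => /=.
  exact: (@measurable_Rint_section _ _ _ _ _ m2 B _ mB (measurable_Rec mf)).
exact: (@measurable_Rint_section _ _ _ _ _ m2 B _ mB (measurable_Imc mf)).
Qed.

Hypotheses (A_lty : (m1 A < +oo)%E) (K0 : (0 <= K)%E) (K_lty : (K < +oo)%E)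
  (fK : forall x, A x -> (\int[m2]_(y in B) (cabs (f (x, y)))%:E <= K)%E).

Let mc : measurable_fun setT (fun p : T1 * T2 => (cabs (f p))%:E).
Proof. by apply/measurable_EFinP; exact: measurable_cabs. Qed.

Let mcy y : measurable_fun setT (fun x => f (x, y)).
Proof. exact: (measurableT_comp mf (pair2_measurable y)). Qed.

Let bound : (\int[m1]_(x in A) \int[m2]_(y in B) (cabs (f (x, y)))%:E <= K * m1 A)%E.
Proof.
rewrite -[X in (_ <= X)%E]integral_cst//; apply: ge0_le_integral => //.
- by move=> x _; apply: integral_ge0 => y _; rewrite lee_fin cabs_ge0.
- apply: measurable_funTS; apply: (@measurable_int_section _ _ _ _ _ m2 B (fun p => (cabs (f p))%:E)) => //.
  by move=> p; rewrite lee_fin cabs_ge0.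
Qed.

Let bound_lty : (K * m1 A < +oo)%E.
Proof. by rewrite lte_mul_pinfty// ge0_fin_numE. Qed.

Lemma cI_swap : cI m1 A (fun x => cI m2 B (fun y => f (x, y))) =
  cI m2 B (fun y => cI m1 A (fun x => f (x, y))).
Proof.
have h (g : T1 * T2 -> R) : measurable_fun setT g -> (forall p, `|g p| <= cabs (f p)) ->
    \int[m1]_(x in A) \int[m2]_(y in B) g (x, y) = \int[m2]_(y in B) \int[m1]_(x in A) g (x, y).
  move=> mg gf; have [] := @fubini_on _ _ _ _ _ m1 m2 A B g mA mB mg _ => //.
  apply: le_lt_trans bound_lty; apply: le_trans bound.
  have mgE : measurable_fun setT (fun p => `|g p|%:E).
    by apply/measurable_EFinP; exact: measurableT_comp.
  apply: ge0_le_integral => //.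
  - by move=> x _; apply: integral_ge0.
  - by apply: measurable_funTS; apply: (@measurable_int_section _ _ _ _ _ m2 B (fun p => `|g p|%:E)).
  - apply: measurable_funTS; apply: (@measurable_int_section _ _ _ _ _ m2 B (fun p => (cabs (f p))%:E)) => //.
    by move=> p; rewrite lee_fin cabs_ge0.
  - move=> x _; apply: ge0_le_integral => //.
    + by apply: measurable_funTS; exact: (measurable_sec x mgE).
    + by apply: measurable_funTS; exact: (measurable_sec x mc).
    + by move=> y _; rewrite lee_fin.
apply: complex_ext => /=.
  by apply: (h (fun p => complex.Re (f p))) => [|p]; [exact: measurable_Rec|rewrite lerDl].
by apply: (h (fun p => complex.Im (f p))) => [|p]; [exact: measurable_Imc|rewrite lerDr].
Qed.

Lemma cI_bound : (\int[m2]_(y in B) (cabs (cI m1 A (fun x => f (x, y))))%:E <= K * m1 A)%E.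
Proof.
apply: le_trans bound; rewrite (@tonelli_on _ _ _ _ _ m1 m2 A B (fun p => (cabs (f p))%:E))//; last first.
  by move=> p; rewrite lee_fin cabs_ge0.
have mswap : measurable_fun setT (fun p : T2 * T1 => f (p.2, p.1)).
  by apply: (measurableT_comp mf); apply: measurable_fun_pair; [exact: measurable_snd|exact: measurable_fst].
apply: ge0_le_integral => //.
- by move=> y _; rewrite lee_fin cabs_ge0.
- apply: measurable_funTS; apply/measurable_EFinP; apply: measurable_cabs.
  apply: measurable_fun_complex => /=.
    exact: (@measurable_Rint_section _ _ _ _ _ m1 A _ mA (measurable_Rec mswap)).
  exact: (@measurable_Rint_section _ _ _ _ _ m1 A _ mA (measurable_Imc mswap)).
- apply: measurable_funTS.
  apply: (@measurable_int_section _ _ _ _ _ m1 A (fun p => (cabs (f (p.2, p.1)))%:E)) => //.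
    by apply/measurable_EFinP; exact: measurable_cabs.
  by move=> p; rewrite lee_fin cabs_ge0.
- by move=> y _; apply: cabs_cI.
Qed.

End two.

End complex_integral.

(** * Test functions along orbits *)

Section orbits.
Variables (R : realType) (n : nat).
Implicit Types (e : sexpr R n) (z : Cn R n) (t b c k a : R).
Notation mu := (@lebesgue_measure R).
Notation J := (@circle R).

(** [sder] takes a constant direction; here the direction z varies, and expanding it in coordinates
    gives an expression again. [SLin (ydir R j)] evaluates to minus the j-th imaginary part, hence
    the factor -1. [angular] does the same for the direction i z. *)
Definition radial e : sexpr R n := foldr (fun j acc => SAdd
  (SAdd (SMul (SLin (xdir R j)) (sder (xdir R j) e))
        (SMul (SMul (SCst (- 1)) (SLin (ydir R j))) (sder (ydir R j) e))) acc)
  (SCst 0) (enum 'I_n).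

Definition angular e : sexpr R n := foldr (fun j acc => SAdd
  (SAdd (SMul (SLin (ydir R j)) (sder (xdir R j) e))
        (SMul (SLin (xdir R j)) (sder (ydir R j) e))) acc)
  (SCst 0) (enum 'I_n).

Lemma radialE e z : seval (radial e) z = seval (sder z e) z.
Proof.
rewrite sder_basis -big_enum/= /radial; elim: (enum _) => [|j l ih] /=; first by rewrite big_nil.
by rewrite big_cons ih; congr (_ + _); rewrite !(linC _ z) lin_xdir lin_ydir; ring.
Qed.

Lemma angularE e z : seval (angular e) z = seval (sder ((0 +i* 1) *: z) e) z.
Proof.
rewrite sder_basis -big_enum/= /angular; elim: (enum _) => [|j l ih] /=; first by rewrite big_nil.
rewrite big_cons ih; congr (_ + _).
by rewrite !(linC _ z) lin_xdir lin_ydir mxE ReM ImM/=; ring.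
Qed.

Lemma Ebar_radial e z : Ebar e z = (2^-1 * seval (radial e) z) +i* (2^-1 * seval (angular e) z).
Proof.
by rewrite /Ebar -radialE -angularE half_half; apply: complex_ext; rewrite !ReImE/=; ring.
Qed.

Lemma sder_neg v e z : seval (sder (- v) e) z = - seval (sder v e) z.
Proof.
rewrite 2!(sder_basis _ e) -sumrN; apply: eq_bigr => j _.
by rewrite !mxE ReN ImN; ring.
Qed.

Lemma lin_neg (q z : Cn R n) : lin q (- z) = - lin q z.
Proof. by rewrite !linE -sumrN; apply: eq_bigr => j _; rewrite !mxE ReN ImN; ring. Qed.

Lemma lin_zeta (c : Cn R n) t b z : lin c (zeta (- t) (- b) *: z) =
  expR (- 1 * t) * (cos (1 * b) * complex.Re (\sum_j c 0 j * z 0 j) +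
    sin (1 * b) * complex.Im (\sum_j c 0 j * z 0 j)).
Proof.
have -> : lin c (zeta (- t) (- b) *: z) = complex.Re (zeta (- t) (- b) * \sum_j c 0 j * z 0 j).
  by congr complex.Re; rewrite mulr_sumr; apply: eq_bigr => j _; rewrite mxE; ring.
by rewrite !ReImE/= cosN sinN mulN1r !mul1r; ring.
Qed.

Lemma is_derive_orbit_t e z t b :
  is_derive t 1 (fun s => seval e (zeta (- s) (- b) *: z))
    (- seval (radial e) (zeta (- t) (- b) *: z)).
Proof.
rewrite radialE -sder_neg; apply: (@is_derive_seval _ _ e (fun s => zeta (- s) (- b) *: z)) => c.
rewrite lin_neg.
have -> : (fun s => lin c (zeta (- s) (- b) *: z)) = (fun s => expR (- 1 * s) *
    (cos (1 * b) * complex.Re (\sum_j c 0 j * z 0 j) + sin (1 * b) * complex.Im (\sum_j c 0 j * z 0 j))).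
  by apply/funext => s; rewrite lin_zeta.
rewrite lin_zeta; move: (_ + _) => x.
have := is_deriveZ x (is_derive_expRM (- 1) t).
rewrite (_ : _ \*: _ = (fun s => expR (- 1 * s) * x)); last by apply/funext => s; rewrite /= /GRing.scale/= mulrC.
by move=> H; apply: (is_derive_eq H); rewrite /GRing.scale/=; ring.
Qed.

Lemma is_derive_orbit_b e z t b :
  is_derive b 1 (fun s => seval e (zeta (- t) (- s) *: z))
    (- seval (angular e) (zeta (- t) (- b) *: z)).
Proof.
rewrite angularE -sder_neg; apply: (@is_derive_seval _ _ e (fun s => zeta (- t) (- s) *: z)) => c.
rewrite lin_neg -lin_scale lin_zeta.
have -> : (fun s => lin c (zeta (- t) (- s) *: z)) = (fun s => expR (- 1 * t) *
    (cos (1 * s) * complex.Re (\sum_j c 0 j * z 0 j) + sin (1 * s) * complex.Im (\sum_j c 0 j * z 0 j))).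
  by apply/funext => s; rewrite lin_zeta.
have -> : \sum_j ((0 +i* 1) *: c) 0 j * z 0 j = (0 +i* 1) * \sum_j c 0 j * z 0 j.
  by rewrite mulr_sumr; apply: eq_bigr => j _; rewrite mxE mulrA.
rewrite ReM ImM/=; move: (complex.Re _) (complex.Im _) (expR _) => x y E.
have := is_deriveZ E (is_deriveD (is_deriveZ x (is_derive_cosM 1 b)) (is_deriveZ y (is_derive_sinM 1 b))).
rewrite (_ : _ \*: _ = (fun s => E * (cos (1 * s) * x + sin (1 * s) * y))); last first.
  by apply/funext => s; rewrite /= /GRing.scale/= ![_ * x]mulrC ![_ * y]mulrC.
by move=> H; apply: (is_derive_eq H); rewrite /GRing.scale/=; ring.
Qed.

Lemma measurable_zeta : measurable_fun setT (fun p : R * R => zeta p.1 p.2).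
Proof.
apply: measurable_complexM.
  apply: real_complex_measurable; apply: (measurableT_comp (@measurable_expR R)); exact: measurable_fst.
apply: measurable_fun_complex => /=.
  apply: (measurableT_comp (continuous_measurable_fun (@continuous_cos R))); exact: measurable_snd.
apply: (measurableT_comp (continuous_measurable_fun (@continuous_sin R))); exact: measurable_snd.
Qed.

Lemma measurable_orbit : measurable_fun setT (fun p : (R * R) * Cn R n => zeta p.1.1 p.1.2 *: p.2).
Proof.
apply: measurable_fun_Cn => j; under eq_fun do rewrite mxE.
apply: measurable_complexM.
  by apply: (measurableT_comp measurable_zeta); exact: measurable_fst.
by apply: (measurableT_comp (@measurable_coord R n j)); exact: measurable_snd.
Qed.

Lemma measurable_orbitN : measurable_fun setT (fun p : (R * R) * Cn R n => zeta (- p.1.1) (- p.1.2) *: p.2).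
Proof.
have h : measurable_fun setT (fun p : (R * R) * Cn R n => ((- p.1.1, - p.1.2), p.2)).
  apply: measurable_fun_pair; last exact: measurable_snd.
  apply: measurable_fun_pair; apply: measurable_funN.
    by apply: (measurableT_comp measurable_fst); exact: measurable_fst.
  by apply: (measurableT_comp measurable_snd); exact: measurable_fst.
exact: (measurableT_comp measurable_orbit h).
Qed.

(* Functions of (t, b) that are regular enough for the divergence theorem on
   the cylinder [0, a] x J. *)
Definition tame a (f : R -> R -> R) := [/\ measurable_fun setT (fun p : R * R => f p.1 p.2),
  exists K, forall t b, 0 <= t <= a -> `|f t b| <= K,
  forall b, continuous (fun t => f t b) & forall t, continuous (f t)].

Lemma tameM a f h : tame a f -> tame a h -> tame a (fun t b => f t b * h t b).
Proof.
move=> [m1 [K1 b1] c1 d1] [m2 [K2 b2] c2 d2]; split.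
- exact: measurable_funM.
- by exists (K1 * K2) => t b ta; rewrite normrM ler_pM ?b1 ?b2.
- by move=> b t; exact: (cvgM (c1 b t) (c2 b t)).
- by move=> t b; exact: (cvgM (d1 t b) (d2 t b)).
Qed.

Lemma tameD a f h : tame a f -> tame a h -> tame a (fun t b => f t b + h t b).
Proof.
move=> [m1 [K1 b1] c1 d1] [m2 [K2 b2] c2 d2]; split.
- exact: measurable_funD.
- by exists (K1 + K2) => t b ta; rewrite (le_trans (ler_normD _ _))// lerD ?b1 ?b2.
- by move=> b t; exact: (cvgD (c1 b t) (c2 b t)).
- by move=> t b; exact: (cvgD (d1 t b) (d2 t b)).
Qed.

Lemma tame_cst a x : tame a (fun _ _ => x).
Proof. by split => //; [exists `|x|%R |move=> b t; exact: cst_continuous|move=> t b; exact: cst_continuous]. Qed.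

Lemma tame_expR a c : tame a (fun t _ => expR (c * t)).
Proof.
have cE : continuous (fun t => expR (c * t)) by exact: (is_derive_continuous (is_derive_expRM c)).
split => //.
- by apply: (measurableT_comp (continuous_measurable_fun cE)); exact: measurable_fst.
- exists (expR (`|c| * a)) => t _ /andP[t0 ta]; rewrite ger0_norm ?expR_ge0// ler_expR.
  by apply: (le_trans (ler_wpM2r t0 (ler_norm c))); rewrite ler_wpM2l.
- by move=> t b; exact: cst_continuous.
Qed.

Lemma tame_cos a k : tame a (fun _ b => cos (k * b)).
Proof.
have cE := @continuous_cosM R k.
split => //.
- by apply: (measurableT_comp (continuous_measurable_fun cE)); exact: measurable_snd.
- by exists 1 => t b _; rewrite ler_norml cos_geN1 cos_le1.
- by move=> b t; exact: cst_continuous.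
Qed.

Lemma tame_sin a k : tame a (fun _ b => sin (k * b)).
Proof.
have cE := @continuous_sinM R k.
split => //.
- by apply: (measurableT_comp (continuous_measurable_fun cE)); exact: measurable_snd.
- by exists 1 => t b _; rewrite ler_norml sin_geN1 sin_le1.
- by move=> b t; exact: cst_continuous.
Qed.

Lemma tame_seval a e z : tame a (fun t b => seval e (zeta (- t) (- b) *: z)).
Proof.
split.
- have h : measurable_fun setT (fun p : R * R => (p, z)) by exact: pair2_measurable.
  exact: (measurableT_comp (@measurable_seval R n e) (measurableT_comp measurable_orbitN h)).
- have [B B0 hB] := seval_bounded e (Num.sqrt (csqn z)).
  exists B => t b /andP[t0 _]; apply: hB.
  rewrite csqn_scale csq_zeta sqr_sqrtr ?csqn_ge0// ler_piMl ?csqn_ge0//.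
  by rewrite expR_le1; lra.
- by move=> b; exact: (is_derive_continuous (fun t => is_derive_orbit_t e z t b)).
- by move=> t; exact: (is_derive_continuous (fun b => is_derive_orbit_b e z t b)).
Qed.

Lemma mu_circle_lty : (mu J < +oo)%E.
Proof. by rewrite /circle lebesgue_measure_itv/=; case: ifP => _ //; rewrite -EFinB ltry. Qed.

Lemma tame_integrable_b a f t : tame a f -> 0 <= t <= a -> mu.-integrable J (EFin \o f t).
Proof.
move=> [mf [K bf] _ cf] ta; apply: continuous_compact_integrable; first exact: segment_compact.
by apply: continuous_subspaceT => b; exact: cf.
Qed.

(** Fubini and the fundamental theorem of calculus in each variable. The part in b integrates to 0
    by periodicity, the part in t leaves the two boundary circles. *)
Lemma cylinder_divergence a (A A1 B B1 : R -> R -> R) : 0 <= a ->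
  tame a A -> tame a A1 -> tame a B1 ->
  (forall t b, is_derive t 1 (fun s => A s b) (A1 t b)) ->
  (forall t b, is_derive b 1 (B t) (B1 t b)) ->
  (forall t, B t (2 * pi) = B t 0) ->
  \int[mu]_(b in J) A a b - \int[mu]_(b in J) A 0 b =
  \int[mu]_(t in `[0, a]) \int[mu]_(b in J) (A1 t b + B1 t b).
Proof.
move=> a0 gA gA1 gB1 dA dB per.
have mJ : measurable J by exact: measurable_circle.
have aa : 0 <= a <= a by rewrite a0 lexx.
have zz : (0 : R) <= 0 <= a by rewrite lexx a0.
rewrite -RintegralB//; [|exact: (tame_integrable_b gA)|exact: (tame_integrable_b gA)].
transitivity (\int[mu]_(b in J) \int[mu]_(t in `[0, a]) A1 t b).
  apply: eq_Rintegral => b _.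
  have [_ _ cA _] := gA1.
  by have [_ ->] := FTC2_on a0 (fun t _ => dA t b) (fun t _ => cA b t).
have [mA1 [K bK] _ _] := gA1.
have fin : (\int[mu]_(t in `[0%R, a]) \int[mu]_(b in J) `|(fun p => A1 p.1 p.2) (t, b)|%:E < +oo)%E.
  apply: (@fubini_prod_bound _ _ _ _ _ mu mu `[0, a] J (fun p : R * R => A1 p.1 p.2) (cst K) (cst 1)) => //.
  - apply: continuous_compact_integrable; first exact: segment_compact.
    by apply: continuous_subspaceT => t; exact: cst_continuous.
  - apply: continuous_compact_integrable; first exact: segment_compact.
    by apply: continuous_subspaceT => t; exact: cst_continuous.
  - move=> t b; rewrite /= in_itv/= => ta _; rewrite normr1 mulr1.
    by apply: le_trans (bK t b ta) _; exact: ler_norm.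
have [E _ _] := @fubini_on _ _ _ _ _ mu mu `[0, a] J (fun p => A1 p.1 p.2) (measurable_itv _) mJ mA1 fin.
rewrite -{}E.
apply: eq_Rintegral => t /set_mem; rewrite /= in_itv/= => ta.
rewrite RintegralD//; [|exact: (tame_integrable_b gA1)|exact: (tame_integrable_b gB1)].
have [_ cB] : True /\ forall t, continuous (B1 t) by split => //; case: gB1.
have pp : 0 <= 2 * pi :> R by rewrite mulr_ge0// pi_ge0.
have [_ ->] := FTC2_on pp (fun b _ => dB t b) (fun b _ => cB t b).
by rewrite per subrr addr0.
Qed.

End orbits.

Section orbit_identity.
Variables (R : realType) (n : nat).
Implicit Types (e : sexpr R n) (z : Cn R n) (t b c k a : R).
Notation mu := (@lebesgue_measure R).
Notation J := (@circle R).

Definition torus_weight c k t b : R[i] := (expR (c * t))%:C * cis (k * b).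

Definition orbit_inv z t b : Cn R n := zeta (- t) (- b) *: z.

(** The sum over j of d/d(conj z_j) applied to conj z_j * e, that is, minus the formal transpose of
    the Euler field applied to e. *)
Definition homog e z : R[i] := (n%:R * seval e z)%:C + Ebar e z.

Lemma cis_opp2pi : cis (- (2 * pi)) = 1 :> R[i].
Proof.
have := cis_2pi R 1; rewrite mul1r => h.
by rewrite -[LHS]mul1r -{1}h -cisD subrr cis0.
Qed.

(** Applying d_t + i d_b to the weight times e along the inverse orbit gives the factor c - k = -2 n
    from the weight and -2 [Ebar] from e, together -2 [homog]. Integration over the cylinder
    concludes; the weight is periodic because k is an integer. *)
Lemma orbit_identity e z a c k : 0 <= a -> cis (k * (2 * pi)) = 1 -> c = k - 2 * n%:R ->
  cint J (fun b => torus_weight c k a b * (seval e (orbit_inv z a b))%:C) -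
  cint J (fun b => torus_weight c k 0 b * (seval e (orbit_inv z 0 b))%:C) =
  cint `[0, a] (fun t => cint J (fun b =>
    (- 2)%:C * (torus_weight c k t b * homog e (orbit_inv z t b)))).
Proof.
move=> a0 k1 ck.
pose P t b := seval e (zeta (- t) (- b) *: z).
pose X t b := seval (radial e) (zeta (- t) (- b) *: z).
pose Y t b := seval (angular e) (zeta (- t) (- b) *: z).
pose E t := expR (c * t); pose C b := cos (k * b); pose S b := sin (k * b).
have tE : tame a (fun t _ => E t) := tame_expR a c.
have tC : tame a (fun _ b => C b) := tame_cos a k.
have tS : tame a (fun _ b => S b) := tame_sin a k.
have tP : tame a P := tame_seval a e z.
have tX : tame a X := tame_seval a (radial e) z.
have tY : tame a Y := tame_seval a (angular e) z.
have dEt t : is_derive t 1 E (c * E t) := is_derive_expRM c t.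
have dPt t b : is_derive t 1 (fun s => P s b) (- X t b) := is_derive_orbit_t e z t b.
have dPb t b : is_derive b 1 (P t) (- Y t b) := is_derive_orbit_b e z t b.
have dCb b : is_derive b 1 C (- (k * S b)) := is_derive_cosM k b.
have dSb b : is_derive b 1 S (k * C b) := is_derive_sinM k b.
have Pper t : P t (2 * pi) = P t 0.
  by rewrite /P /zeta oppr0 cis_opp2pi cis0.
have Cper : C (2 * pi) = C 0.
  by rewrite /C mulr0 cos0; have := congr1 (@complex.Re R) k1.
have Sper : S (2 * pi) = S 0.
  by rewrite /S mulr0 sin0; have := congr1 (@complex.Im R) k1.
have w1 t b : torus_weight c k t b * (seval e (orbit_inv z t b))%:C =
    (E t * C b * P t b) +i* (E t * S b * P t b).
  by apply: complex_ext; rewrite !ReImE/= /E /C /S /P /orbit_inv; ring.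
have w2 t b : (- 2)%:C * (torus_weight c k t b * homog e (orbit_inv z t b)) =
    (E t * C b * (c * P t b - X t b) + (- (E t * (k * C b * P t b - S b * Y t b)))) +i*
    (E t * S b * (c * P t b - X t b) + E t * (- (k * S b) * P t b - C b * Y t b)).
  rewrite /homog Ebar_radial /torus_weight /cis /orbit_inv.
  by apply: complex_ext; rewrite !ReImE/= /E /C /S /P /X /Y ck; field.
have tc (x : R) : tame a (fun _ _ => x) := tame_cst a x.
have neg f : tame a f -> tame a (fun t b => - f t b).
  move=> tf; have := tameM (tc (-1)) tf; congr tame.
  by apply/funext => t; apply/funext => b; rewrite mulN1r.
have tcPX : tame a (fun t b => c * P t b - X t b) by apply: tameD; [exact: tameM|exact: neg].
have dA t b (x : R) : is_derive t 1 (fun s => E s * x * P s b) (E t * x * (c * P t b - X t b)).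
  have h := is_deriveM (is_deriveM (dEt t) (is_derive_cst x t 1)) (dPt t b).
  apply: (is_derive_eq h).
  rewrite -[LHS]/(E t * x * - X t b + P t b * (E t * 0 + x * (c * E t))); ring.
have dB t b (f : R -> R) l : is_derive b 1 f l ->
    is_derive b 1 (fun s => E t * f s * P t s) (E t * (l * P t b - f b * Y t b)).
  move=> df; have h := is_deriveM (is_deriveM (is_derive_cst (E t) b 1) df) (dPb t b).
  apply: (is_derive_eq h).
  rewrite -[LHS]/(E t * f b * - Y t b + P t b * (E t * l + f b * 0)); ring.
have tECP : tame a (fun t b => E t * C b * P t b) by apply: tameM => //; apply: tameM.
have tESP : tame a (fun t b => E t * S b * P t b) by apply: tameM => //; apply: tameM.
clearbody P X Y E C S.
rewrite (eq_cint (fun b _ => w1 a b)) (eq_cint (fun b _ => w1 0 b)).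
rewrite [RHS](eq_cint (fun t _ => eq_cint (fun b _ => w2 t b))).
apply: complex_ext; rewrite ?(ReD, ImD) ?(ReN, ImN) /cint/=.
- apply: (@cylinder_divergence _ a (fun t b => E t * C b * P t b) _
    (fun t b => - (E t * S b * P t b))) => //.
  + by apply: tameM => //; apply: tameM.
  + apply: (neg (fun t b => _)); apply: tameM => //; apply: tameD; first by apply: tameM => //; apply: tameM.
    by apply: (neg (fun t b => _)); apply: tameM.
  + by move=> t; rewrite Sper Pper.
- apply: (@cylinder_divergence _ a (fun t b => E t * S b * P t b) _
    (fun t b => E t * C b * P t b)) => //.
  + by apply: tameM => //; apply: tameM.
  + apply: tameM => //; apply: tameD; last by apply: (neg (fun t b => _)); apply: tameM.
    by apply: tameM => //; apply: (neg (fun t b => _)); apply: tameM.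
  + by move=> t; rewrite Cper Pper.
Qed.

End orbit_identity.

Section weak_modes.
Variables (R : realType) (n : nat).
Implicit Types (e : sexpr R n) (z : Cn R n) (t b c k q a M : R) (w g psi : Cn R n -> R[i]).
Notation mu := (@lebesgue_measure R).
Notation nu := (@lebesgue_Cn R n).
Notation J := (@circle R).
Let mJ : measurable J. Proof. exact: measurable_circle. Qed.
Hint Resolve mJ : core.

Definition disc M : set (Cn R n) := [set z | csqn z <= M ^+ 2].

Definition loc1 w := measurable_fun setT w /\ forall M, cfin nu (disc M) w.

Lemma zeta_neq0 t b : zeta t b != 0 :> R[i].
Proof. by rewrite -csq_eq0 csq_zeta gt_eqF// expR_gt0. Qed.

Lemma zetaNK t b z : zeta (- t) (- b) *: (zeta t b *: z) = z.
Proof.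
rewrite scalerA /zeta mulrACA -cisD -real_complexM -expRD !addNr expR0 cis0 mulr1.
by rewrite scale1r.
Qed.

Lemma cfin_scale l w : l != 0 -> measurable_fun setT w ->
  (\int[nu]_z (cabs (w z))%:E = (csq l ^+ n)%:E * \int[nu]_z (cabs (w (l *: z)))%:E)%E.
Proof.
move=> l0 mw; apply: ge0_integral_scale => //.
  by apply/measurable_EFinP; exact: measurable_cabs.
by move=> z; rewrite lee_fin cabs_ge0.
Qed.

Lemma cI_scale l w : l != 0 -> measurable_fun setT w -> cfin nu setT w ->
  cI nu setT w = (csq l ^+ n)%:C * cI nu setT (fun z => w (l *: z)).
Proof.
move=> l0 mw /(cfin_integrable measurableT mw)[i1 i2].
apply: complex_ext; rewrite !ReImE/= !mul0r ?subr0 ?addr0.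
  by rewrite (Rintegral_scale l0)//; exact: measurable_Rec.
by rewrite (Rintegral_scale l0)//; exact: measurable_Imc.
Qed.

Lemma integral_supp w psi M (B : R) : measurable_fun setT w -> measurable_fun setT psi ->
  0 <= B -> (forall z, cabs (psi z) <= B) -> (forall z, psi z != 0 -> disc M z) ->
  (\int[nu]_z (cabs (w z * psi z))%:E <= B%:E * \int[nu]_(z in disc M) (cabs (w z))%:E)%E.
Proof.
move=> mw mp B0 pB pM; have mD : measurable (disc M) by exact: measurable_disc.
have mc : measurable_fun setT (fun z => (cabs (w z))%:E) by apply/measurable_EFinP; exact: measurable_cabs.
rewrite -ge0_integralZl//; last 2 first.
- exact: measurable_funTS.
- by move=> z _; rewrite lee_fin cabs_ge0.
rewrite [leRHS]integral_mkcond; apply: ge0_le_integral => //.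
- by move=> z _; rewrite lee_fin cabs_ge0.
- by apply/measurable_EFinP; apply: measurable_cabs; exact: measurable_complexM.
- apply/(measurable_restrictT _ mD); apply: measurable_funTS.
  by apply: measurable_funeM.
- move=> z _; rewrite /patch; case: ifPn => zD.
    by rewrite lee_fin mulrC (le_trans (cabsM _ _))// ler_wpM2r ?cabs_ge0.
  have -> : psi z = 0 by apply/eqP; apply: contraNT zD => /pM; rewrite inE.
  by rewrite mulr0 cabs0.
Qed.

Section triple.
Variables (a : R) (f : (R * R) * Cn R n -> R[i]) (B : set (Cn R n)) (K : R).
Hypotheses (a0 : 0 <= a) (mB : measurable B) (mf : measurable_fun setT f) (K0 : 0 <= K)
  (fK : forall t b, 0 <= t <= a -> (\int[nu]_(z in B) (cabs (f ((t, b), z)))%:E <= K%:E)%E).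

Let mf1 t : measurable_fun setT (fun p : R * Cn R n => f ((t, p.1), p.2)).
Proof.
apply: (measurableT_comp mf); apply: measurable_fun_pair; last exact: measurable_snd.
by apply: measurable_fun_pair => //; exact: measurable_fst.
Qed.

Let f2 (p : R * Cn R n) := cint J (fun b => f ((p.1, b), p.2)).

Let mf2 : measurable_fun setT f2.
Proof.
apply: (@measurable_cI R _ _ _ _ mu J (fun p : (R * Cn R n) * R => f ((p.1.1, p.2), p.1.2))) => //.
apply: (measurableT_comp mf); apply: measurable_fun_pair; first apply: measurable_fun_pair.
- by apply: (measurableT_comp measurable_fst); exact: measurable_fst.
- exact: measurable_snd.
- by apply: (measurableT_comp measurable_snd); exact: measurable_fst.
Qed.

Lemma circle_swap t : 0 <= t <= a ->
  cint J (fun b => cI nu B (fun z => f ((t, b), z))) =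
  cI nu B (fun z => cint J (fun b => f ((t, b), z))).
Proof.
move=> ta; apply: (@cI_swap R _ _ _ _ mu nu J B (fun p => f ((t, p.1), p.2)) K%:E) => //.
- exact: (mf1 t).
- exact: mu_circle_lty.
- by rewrite ltry.
- by move=> b _; exact: fK.
Qed.

Lemma circle_bound t : 0 <= t <= a ->
  (\int[nu]_(z in B) (cabs (cint J (fun b => f ((t, b), z))))%:E <= K%:E * mu J)%E.
Proof.
move=> ta; apply: (@cI_bound R _ _ _ _ mu nu J B (fun p => f ((t, p.1), p.2)) K%:E) => //; first exact: (mf1 t).
by move=> b _; exact: fK.
Qed.

Let KJ_lty : (K%:E * mu J < +oo)%E.
Proof. by rewrite lte_mul_pinfty ?lee_fin// mu_circle_lty. Qed.

Let itv_lty : (mu `[0%R, a] < +oo)%E.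
Proof. by rewrite lebesgue_measure_itv/=; case: ifP => _ //; rewrite -EFinB ltry. Qed.

Lemma triple_swap :
  cint `[0, a] (fun t => cint J (fun b => cI nu B (fun z => f ((t, b), z)))) =
  cI nu B (fun z => cint `[0, a] (fun t => cint J (fun b => f ((t, b), z)))).
Proof.
transitivity (cint `[0, a] (fun t => cI nu B (fun z => f2 (t, z)))).
  by apply: eq_cint => t; rewrite /= in_itv/= => ta; rewrite circle_swap.
apply: (@cI_swap R _ _ _ _ mu nu `[0, a] B f2 (K%:E * mu J)%E) => //.
- by rewrite mule_ge0.
- by move=> t; rewrite /= in_itv/= => ta; exact: circle_bound.
Qed.

Lemma triple_bound : (\int[nu]_(z in B)
  (cabs (cint `[0%R, a] (fun t => cint J (fun b => f ((t, b), z)))))%:E < +oo)%E.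
Proof.
apply: (@le_lt_trans _ _ (K%:E * mu J * mu `[0%R, a])%E); last first.
  by rewrite lte_mul_pinfty// ?mule_ge0// ge0_fin_numE// mule_ge0.
apply: (@cI_bound R _ _ _ _ mu nu `[0, a] B f2 (K%:E * mu J)%E) => //.
by move=> t; rewrite /= in_itv/= => ta; exact: circle_bound.
Qed.

Lemma measurable_circle_int t : measurable_fun setT (fun z => cint J (fun b => f ((t, b), z))).
Proof. exact: (measurable_sec t mf2). Qed.

Lemma measurable_triple_int :
  measurable_fun setT (fun z => cint `[0, a] (fun t => cint J (fun b => f ((t, b), z)))).
Proof.
apply: (@measurable_cI R _ _ _ _ mu `[0, a] (fun p : Cn R n * R => f2 (p.2, p.1))) => //.
by apply: (measurableT_comp mf2); apply: measurable_fun_pair; [exact: measurable_snd|exact: measurable_fst].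
Qed.

End triple.

Lemma cfin_bounded d (T : measurableType d) (m : {measure set T -> \bar R}) D (f : T -> R[i]) (K : R) :
  measurable D -> (m D < +oo)%E -> measurable_fun setT f -> (forall x, D x -> cabs (f x) <= K) ->
  cfin m D f.
Proof.
move=> mD Dlty mf fK; rewrite /cfin.
apply: (@le_lt_trans _ _ (`|K|%:E * m D)%E); last by rewrite lte_mul_pinfty.
rewrite -integral_cst//; apply: (@cfin_le _ _ _ m _ _ (cst `|K|)) => // x /fK h.
exact: le_trans h (ler_norm _).
Qed.

Lemma cabs_torus_weight c k t b a : 0 <= t <= a -> cabs (torus_weight c k t b) <= expR (`|c| * a) * 2.
Proof.
move=> /andP[t0 ta]; apply: (le_trans (cabsM _ _)); apply: ler_pM; rewrite ?cabs_ge0 ?cabs_cis//.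
rewrite cabs_real ger0_norm ?expR_ge0// ler_expR.
by apply: (le_trans (ler_wpM2r t0 (ler_norm c))); rewrite ler_wpM2l.
Qed.

Lemma measurable_torus_weight c k : measurable_fun setT (fun p : R * R => torus_weight c k p.1 p.2).
Proof.
have h : measurable_fun setT (fun p : R * R => (c * p.1, k * p.2)).
  by apply: measurable_fun_pair; apply: measurable_funM.
exact: (measurableT_comp (@measurable_zeta R) h).
Qed.

End weak_modes.

Section weak_solution.
Variables (R : realType) (n : nat) (r : R) (w g : Cn R n -> R[i]).
Implicit Types (e : sexpr R n) (z : Cn R n) (t b c k q a M : R) (h psi : Cn R n -> R[i]).
Notation mu := (@lebesgue_measure R).
Notation nu := (@lebesgue_Cn R n).
Notation J := (@circle R).
Let mJ : measurable J. Proof. exact: measurable_circle. Qed.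
Hint Resolve mJ : core.

Hypotheses (r0 : 0 < r) (lw : loc1 w) (lg : loc1 g).
Hypothesis weak : forall e, admissible r e ->
  cI nu setT (fun z => w z * homog e z) = - cI nu setT (fun z => g z * (seval e z)%:C).

Lemma measurable_homog e : measurable_fun setT (@homog R n e).
Proof.
apply: measurable_complexD.
  by apply: real_complex_measurable; apply: measurable_funM => //; exact: measurable_seval.
rewrite (_ : Ebar e = fun z => (2^-1 * seval (radial e) z) +i* (2^-1 * seval (angular e) z)); last first.
  by apply/funext => z; exact: Ebar_radial.
by apply: measurable_fun_complex => /=; apply: measurable_funM => //; exact: measurable_seval.
Qed.

(** If |z| > M then the expression vanishes on a neighbourhood of z along the line, so its
    directional derivative at z is 0. *)
Lemma sder_supp e M v z : (forall z, seval e z != 0 -> disc M z) ->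
  seval (sder v e) z != 0 -> disc M z.
Proof.
move=> eM; apply: contraNP; rewrite /disc/= => /negP; rewrite -ltNge => zM.
have d1 := is_derive_rline e v z 0; rewrite scale0r addr0 in d1.
have cs : continuous (rline (seval (snorm2 R n)) v z) := is_derive_continuous (is_derive_rline _ v z).
have d0 : is_derive (0 : R) 1 (rline (seval e) v z) 0.
  apply: (near_eq_is_derive _ (is_derive_cst (0 : R) (0 : R) 1)).
  have h : M ^+ 2 < rline (seval (snorm2 R n)) v z 0.
    by rewrite /rline scale0r addr0 seval_snorm2.
  have hn := cs 0 _ (lt_nbhsr h).
  near=> s; apply/esym/eqP; apply/negPn/negP => /eM.
  rewrite /disc/= leNgt -seval_snorm2 => /negP; apply; near: s; exact: hn.
by have [_ <-] := d1; have [_ ->] := d0.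
Unshelve. all: by end_near.
Qed.

Lemma admissible_supp e : admissible r e -> exists M B, [/\ 0 <= M, 0 <= B,
  (forall z, seval e z != 0 -> disc M z), (forall z, homog e z != 0 -> disc M z) &
  (forall z, cabs (seval e z)%:C <= B) /\ (forall z, cabs (homog e z) <= B)].
Proof.
move=> [s [M [rs M0 sM]]].
have eM z : seval e z != 0 -> disc M z by move=> /sM[].
have hM z : homog e z != 0 -> disc M z.
  rewrite /homog Ebar_radial radialE angularE; apply: contraNP => zM.
  have s0 v : seval (sder v e) z = 0.
    by apply/eqP; apply: contrapT => /negP /(sder_supp eM).
  have e0 : seval e z = 0 by apply/eqP; apply: contrapT => /negP /eM.
  by rewrite !s0 e0 !mulr0; apply/eqP/complex_ext; rewrite !ReImE/= addr0.
have [B1 B10 b1] := seval_bounded e M.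
have [B2 B20 b2] := seval_bounded (radial e) M.
have [B3 B30 b3] := seval_bounded (angular e) M.
have B0 : 0 <= B1 + n%:R * B1 + (B2 + B3) by rewrite !addr_ge0// mulr_ge0.
exists M, (B1 + n%:R * B1 + (B2 + B3)); split => //; split => z.
  have [/eM zM|] := boolP (seval e z != 0).
    rewrite cabs_real; apply: (le_trans (b1 z zM)).
    by rewrite -addrA lerDl !addr_ge0// mulr_ge0.
  by rewrite negbK => /eqP ->; rewrite cabs0.
have [/hM zM|] := boolP (homog e z != 0); last first.
  by rewrite negbK => /eqP ->; rewrite cabs0.
apply: (le_trans (cabsD _ _)); apply: lerD.
  rewrite cabs_real normrM normr_nat (le_trans (ler_wpM2l _ (b1 z zM)))//.
  by rewrite lerDr.
rewrite Ebar_radial /cabs/= !normrM ger0_norm ?invr_ge0//.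
have := b2 z zM; have := b3 z zM; have := normr_ge0 (seval (radial e) z); have := normr_ge0 (seval (angular e) z).
lra.
Qed.

Lemma loc1_fine h M : loc1 h -> exists2 K, 0 <= K & (\int[nu]_(z in disc M) (cabs (h z))%:E = K%:E)%E.
Proof.
move=> [_ /(_ M)]; rewrite /cfin => hM.
have p0 : (0 <= \int[nu]_(z in disc M) (cabs (h z))%:E)%E.
  by apply: integral_ge0 => z _; rewrite lee_fin cabs_ge0.
exists (fine (\int[nu]_(z in disc M) (cabs (h z))%:E)%E); first exact: fine_ge0.
by rewrite fineK// ge0_fin_numE.
Qed.

Lemma measurable_scaled_inv psi t b : measurable_fun setT psi ->
  measurable_fun setT (fun z => psi (orbit_inv z t b)).
Proof. by move=> mp; exact: (measurable_scaled _ mp). Qed.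

Lemma disc_orbit a M z t b : 0 <= t <= a -> disc M (orbit_inv z t b) -> disc (M * expR a) z.
Proof.
move=> /andP[t0 ta]; rewrite /disc/= /orbit_inv csqn_scale csq_zeta exprMn => h.
have e0 : 0 < expR (2 * - t) := expR_gt0 _.
rewrite -ler_pdivlMl// in h; apply: (le_trans h); rewrite -expRN mulrC.
apply: ler_wpM2l; first exact: sqr_ge0.
by rewrite -expRM_natl ler_expR; lra.
Qed.

Lemma orbit_pair_bound a h psi M (B : R) : loc1 h -> measurable_fun setT psi -> 0 <= B ->
  (forall z, cabs (psi z) <= B) -> (forall z, psi z != 0 -> disc M z) ->
  exists2 K, 0 <= K & forall t b, 0 <= t <= a ->
    (\int[nu]_z (cabs (h z * psi (orbit_inv z t b)))%:E <= K%:E)%E.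
Proof.
move=> lh mp B0 pB pM; have [K K0 KE] := loc1_fine (M * expR a) lh.
exists (B * K); first exact: mulr_ge0.
move=> t b ta; rewrite EFinM -KE; apply: integral_supp => //.
- by have [] := lh.
- exact: measurable_scaled_inv.
- by move=> z /pM; exact: disc_orbit.
Qed.

Lemma orbit_pair_scale h psi t b : measurable_fun setT h -> measurable_fun setT psi ->
  (\int[nu]_z (cabs (h z * psi (orbit_inv z t b)))%:E =
   (csq (zeta t b) ^+ n)%:E * \int[nu]_z (cabs (h (zeta t b *: z) * psi z))%:E)%E.
Proof.
move=> mh mp; rewrite (cfin_scale (zeta_neq0 t b)); last first.
  by apply: measurable_complexM => //; exact: measurable_scaled_inv.
by congr (_ * _)%E; apply: eq_integral => z _; rewrite /orbit_inv zetaNK.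
Qed.

(** The change of variables moves the orbit from the test function to h; its Jacobian e^(2 n t) is
    at least 1 for t >= 0, so the bound is inherited. *)
Lemma orbit_pair_bound' a h psi M (B : R) : loc1 h -> measurable_fun setT psi -> 0 <= B ->
  (forall z, cabs (psi z) <= B) -> (forall z, psi z != 0 -> disc M z) ->
  exists2 K, 0 <= K & forall t b, 0 <= t <= a ->
    (\int[nu]_z (cabs (h (zeta t b *: z) * psi z))%:E <= K%:E)%E.
Proof.
move=> lh mp B0 pB pM; have [K K0 KE] := orbit_pair_bound a lh mp B0 pB pM.
exists K => // t b ta; apply: le_trans (KE t b ta).
rewrite orbit_pair_scale//; last by have [] := lh.
rewrite csq_zeta -[leLHS]mul1e; apply: lee_wpmul2r.
  by apply: integral_ge0 => z _; rewrite lee_fin cabs_ge0.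
by case/andP: ta => t0 _; rewrite lee_fin exprn_ege1// -[leLHS]expR0 ler_expR mulr_ge0.
Qed.

(** The Jacobian |zeta|^(2 n) = e^(2 n t) accounts for the 2 n in the exponent of the weight. *)
Lemma torus_weight_split q t b :
  torus_weight (q - 2 * n%:R) q t b * ((csq (zeta t b) ^+ n)%:C) = torus_weight q q t b.
Proof.
rewrite /torus_weight csq_zeta -expRM_natl mulrAC -real_complexM -expRD.
by congr ((expR _)%:C * _); ring.
Qed.

(** Substituting [zeta t b *: z] for z transfers the motion from the test function to h, and the
    Jacobian turns the weight into the one of [orbit_mode]. *)
Lemma pairing h e q t b : loc1 h -> admissible r e -> 0 <= t ->
  cI nu setT (fun z => torus_weight (q - 2 * n%:R) q t b * (h z * (seval e (orbit_inv z t b))%:C)) =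
  cI nu setT (fun z => (seval e z)%:C * (torus_weight q q t b * h (zeta t b *: z))).
Proof.
move=> lh ae t0; have [M [B [M0 B0 eM _ [eB _]]]] := admissible_supp ae.
have [mh _] := lh.
have me : measurable_fun setT (fun z => (seval e z)%:C).
  by apply: real_complex_measurable; exact: measurable_seval.
have eM' z : (seval e z)%:C != 0 :> R[i] -> disc M z.
  by move=> h0; apply: eM; apply: contraNneq h0 => ->.
have tt : 0 <= t <= t by rewrite t0 lexx.
have [K1 _ k1] := orbit_pair_bound t lh me B0 eB eM'.
have [K2 _ k2] := orbit_pair_bound' t lh me B0 eB eM'.
have m1 : measurable_fun setT (fun z => h z * (seval e (orbit_inv z t b))%:C).
  by apply: measurable_complexM => //; exact: (measurable_scaled_inv _ _ me).
have m2 : measurable_fun setT (fun z => h (zeta t b *: z) * (seval e z)%:C).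
  by apply: measurable_complexM => //; exact: measurable_scaled.
rewrite cI_Z//; last exact: le_lt_trans (k1 t b tt) (ltry _).
rewrite (cI_scale (zeta_neq0 t b))//; last exact: le_lt_trans (k1 t b tt) (ltry _).
have -> : (fun z => h (zeta t b *: z) * (seval e (orbit_inv (zeta t b *: z) t b))%:C) =
    (fun z => h (zeta t b *: z) * (seval e z)%:C).
  by apply/funext => z; rewrite /orbit_inv zetaNK.
rewrite mulrA torus_weight_split -cI_Z//; last exact: le_lt_trans (k2 t b tt) (ltry _).
by apply: eq_cI => z _; ring.
Qed.

(** The transported expression is admissible because |zeta (- t) (- b)| <= 1 for t >= 0, and [homog]
    commutes with the transport; the weak equation is applied to it before [pairing] moves the orbit
    onto g. *)
Lemma pairing_homog e q t b : admissible r e -> 0 <= t ->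
  cI nu setT (fun z => torus_weight (q - 2 * n%:R) q t b * (w z * homog e (orbit_inv z t b))) =
  - cI nu setT (fun z => (seval e z)%:C * (torus_weight q q t b * g (zeta t b *: z))).
Proof.
move=> ae t0; have [M [B [M0 B0 eM hM [eB hB]]]] := admissible_supp ae.
have [mw _] := lw; have [mg _] := lg.
have tt : 0 <= t <= t by rewrite t0 lexx.
have [K1 _ k1] := orbit_pair_bound t lw (measurable_homog e) B0 hB hM.
have me : measurable_fun setT (fun z => (seval e z)%:C).
  by apply: real_complex_measurable; exact: measurable_seval.
have eM' z : (seval e z)%:C != 0 :> R[i] -> disc M z.
  by move=> h0; apply: eM; apply: contraNneq h0 => ->.
have [K2 _ k2] := orbit_pair_bound t lg me B0 eB eM'.
have ae' : admissible r (sscale (zeta (- t) (- b)) e).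
  apply: admissible_scale => //; first exact: zeta_neq0.
  by rewrite csq_zeta expR_le1; lra.
rewrite -(pairing q b lg ae t0) !cI_Z//.
- rewrite -[RHS]mulrN; apply: (congr1 (fun x => _ * x)).
  transitivity (cI nu setT (fun z => w z * homog (sscale (zeta (- t) (- b)) e) z)).
    by apply: eq_cI => z _; rewrite /homog Ebar_scale seval_scale.
  by rewrite weak//; congr (- _); apply: eq_cI => z _; rewrite seval_scale.
- by apply: measurable_complexM => //; exact: (measurable_scaled_inv _ _ me).
- exact: le_lt_trans (k2 t b tt) (ltry _).
- by apply: measurable_complexM => //; exact: (measurable_scaled_inv _ _ (measurable_homog e)).
- exact: le_lt_trans (k1 t b tt) (ltry _).
Qed.

End weak_solution.

Section orbit_modes.
Variables (R : realType) (n : nat) (r : R) (w g : Cn R n -> R[i]).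
Implicit Types (e : sexpr R n) (z : Cn R n) (t b c k q a M : R) (h psi : Cn R n -> R[i]).
Notation mu := (@lebesgue_measure R).
Notation nu := (@lebesgue_Cn R n).
Notation J := (@circle R).
Let mJ : measurable J. Proof. exact: measurable_circle. Qed.
Hint Resolve mJ : core.

(** By [orbit_modeE], e^(q t) times the mode -q of h along the orbit of z. The exponential is the
    integrating factor that leaves only the source in the evolution of this mode. *)
Definition orbit_mode q t h z : R[i] :=
  cint J (fun b => torus_weight q q t b * h (zeta t b *: z)).

Definition orbit_source q a h z : R[i] :=
  cint `[0, a] (fun t => cint J (fun b => 2%:C * (torus_weight q q t b * h (zeta t b *: z)))).

Let mtw c k : measurable_fun setT (fun p : (R * R) * Cn R n => torus_weight c k p.1.1 p.1.2).
Proof. exact: (measurableT_comp (measurable_torus_weight c k) measurable_fst). Qed.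

Let mz psi : measurable_fun setT psi -> measurable_fun setT (fun p : (R * R) * Cn R n => psi p.2).
Proof. by move=> mp; exact: (measurableT_comp mp measurable_snd). Qed.

Let morb h : measurable_fun setT h ->
  measurable_fun setT (fun p : (R * R) * Cn R n => h (zeta p.1.1 p.1.2 *: p.2)).
Proof. by move=> mh; exact: (measurableT_comp mh (@measurable_orbit R n)). Qed.

Let morbN h : measurable_fun setT h ->
  measurable_fun setT (fun p : (R * R) * Cn R n => h (orbit_inv p.2 p.1.1 p.1.2)).
Proof. by move=> mh; exact: (measurableT_comp mh (@measurable_orbitN R n)). Qed.

Let mE e : measurable_fun setT (fun z => (seval e z)%:C).
Proof. by apply: real_complex_measurable; exact: measurable_seval. Qed.

Let mtwh q h : measurable_fun setT h -> measurable_fun setT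
  (fun p : (R * R) * Cn R n => torus_weight q q p.1.1 p.1.2 * h (zeta p.1.1 p.1.2 *: p.2)).
Proof. by move=> mh; apply: measurable_complexM => //; exact: morb. Qed.

Let twbound a (f : R -> R -> Cn R n -> R[i]) c k (B : set (Cn R n)) (K : R) (x : R[i]) :
  measurable B -> (forall t b, measurable_fun setT (f t b)) ->
  (forall t b, 0 <= t <= a -> (\int[nu]_(z in B) (cabs (f t b z))%:E <= K%:E)%E) ->
  forall t b, 0 <= t <= a -> (\int[nu]_(z in B) (cabs (x * (torus_weight c k t b * f t b z)))%:E <=
    (cabs x * (expR (`|c| * a) * 2) * K)%:E)%E.
Proof.
move=> mB mf fK t b ta; rewrite [leRHS]EFinM.
have K0 : 0 <= cabs x * (expR (`|c| * a) * 2) by rewrite mulr_ge0 ?cabs_ge0// mulr_ge0// expR_ge0.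
apply: (@le_trans _ _ ((cabs x * (expR (`|c| * a) * 2))%:E * \int[nu]_(z in B) (cabs (f t b z))%:E)%E); last first.
  by rewrite lee_wpmul2l// ?lee_fin//; exact: fK.
have mc : measurable_fun setT (fun z => (cabs (f t b z))%:E).
  by apply/measurable_EFinP; exact: measurable_cabs.
rewrite -ge0_integralZl//; [|exact: measurable_funTS|by move=> z _; rewrite lee_fin cabs_ge0].
apply: (@cfin_le _ _ _ nu _ _ (fun z => cabs x * (expR (`|c| * a) * 2) * cabs (f t b z))) => //.
- by apply: measurable_complexM => //; apply: measurable_complexM.
- by apply: measurable_funM => //; exact: measurable_cabs.
- move=> z _; apply: (le_trans (cabsM _ _)); rewrite -[leRHS]mulrA; apply: ler_wpM2l; first exact: cabs_ge0.
  apply: (le_trans (cabsM _ _)); apply: ler_wpM2r; first exact: cabs_ge0.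
  exact: cabs_torus_weight.
Qed.

Lemma disc_orbit_bound a M h : loc1 h -> exists2 K, 0 <= K & forall t b, 0 <= t <= a ->
  (\int[nu]_(z in disc M) (cabs (h (zeta t b *: z)))%:E <= K%:E)%E.
Proof.
move=> lh; have mD : measurable (disc M : set (Cn R n)) by exact: measurable_disc.
pose psi z : R[i] := (\1_(disc M) z : R)%:C.
have mpsi : measurable_fun setT psi by apply: real_complex_measurable; exact: measurable_indic.
have p1 z : cabs (psi z) <= 1.
  by rewrite cabs_real indicE; case: (_ \in _); rewrite ?normr1 ?normr0.
have pD z : psi z != 0 -> disc M z.
  by rewrite /psi indicE; case: (boolP (z \in disc M)) => [/set_mem//|_]; rewrite eqxx.
have [K K0 KE] := orbit_pair_bound' a lh mpsi ler01 p1 pD.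
exists K => // t b ta; apply: le_trans (KE t b ta).
rewrite integral_mkcond le_eqVlt; apply/orP; left; apply/eqP; apply: eq_integral => z _.
rewrite /patch /psi indicE; case: ifPn => _; first by rewrite mulr1.
by rewrite mulr0 cabs0.
Qed.

Lemma loc1_orbit_mode q t h : 0 <= t -> loc1 h -> loc1 (orbit_mode q t h).
Proof.
move=> t0 lh; have [mh _] := lh; split.
  exact: (measurable_circle_int (f := fun p => torus_weight q q p.1.1 p.1.2 * h (zeta p.1.1 p.1.2 *: p.2)) (mtwh q mh) t).
move=> M; have [K K0 KE] := disc_orbit_bound t M lh.
have mD : measurable (disc M : set (Cn R n)) by exact: measurable_disc.
have bK := @twbound t (fun t b z => h (zeta t b *: z)) q q (disc M) K 1 mD (fun t b => measurable_scaled _ mh) KE.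
pose K' := cabs (1 : R[i]) * (expR (`|q| * t) * 2) * K.
have K'0 : 0 <= K' by rewrite mulr_ge0// mulr_ge0 ?cabs_ge0// mulr_ge0// expR_ge0.
have tt : 0 <= t <= t by rewrite t0 lexx.
apply: le_lt_trans (_ : (K'%:E * mu J < +oo)%E); last first.
  by rewrite lte_mul_pinfty ?lee_fin// mu_circle_lty.
apply: (@circle_bound R n t (fun p => torus_weight q q p.1.1 p.1.2 * h (zeta p.1.1 p.1.2 *: p.2))) => //.
  exact: mtwh.
move=> s b sa; apply: le_trans (bK s b sa).
by under [leRHS]eq_integral do rewrite mul1r.
Qed.

Let mtwh2 q h : measurable_fun setT h -> measurable_fun setT
  (fun p : (R * R) * Cn R n => 2%:C * (torus_weight q q p.1.1 p.1.2 * h (zeta p.1.1 p.1.2 *: p.2))).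
Proof. by move=> mh; apply: measurable_complexM => //; exact: mtwh. Qed.

Lemma loc1_orbit_source q a h : 0 <= a -> loc1 h -> loc1 (orbit_source q a h).
Proof.
move=> a0 lh; have [mh _] := lh; split.
  exact: (measurable_triple_int a (mtwh2 q mh)).
move=> M; have [K K0 KE] := disc_orbit_bound a M lh.
have mD : measurable (disc M : set (Cn R n)) by exact: measurable_disc.
have bK := @twbound a (fun t b z => h (zeta t b *: z)) q q (disc M) K 2%:C mD (fun t b => measurable_scaled _ mh) KE.
have K'0 : 0 <= cabs (2%:C : R[i]) * (expR (`|q| * a) * 2) * K.
  by rewrite mulr_ge0// mulr_ge0 ?cabs_ge0// mulr_ge0// expR_ge0.
have tb := @triple_bound R n a _ (disc M) _ mD (mtwh2 q mh) K'0 bK.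
exact: tb.
Qed.

Lemma circle_const (x : R[i]) (G : R -> R[i]) (K : R) : measurable_fun setT G ->
  (forall b, cabs (G b) <= K) -> cint J (fun b => x * G b) = x * cint J G.
Proof.
move=> mG GK; apply: (@cI_Z R _ _ mu J x G) => //.
exact: (@cfin_bounded R _ _ mu J G K mJ (@mu_circle_lty R) mG (fun b _ => GK b)).
Qed.

Let J_fin : mu J \is a fin_num.
Proof. by rewrite ge0_fin_numE// mu_circle_lty. Qed.

Lemma cabs_circle (G : R -> R[i]) (K : R) : measurable_fun setT G ->
  (forall b, cabs (G b) <= K) -> cabs (cint J G) <= K * fine (mu J).
Proof.
move=> mG GK; rewrite -lee_fin EFinM fineK//.
apply: le_trans (@cabs_cI R _ _ mu J G mJ mG) _; rewrite -integral_cst//.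
exact: (@cfin_le _ _ _ mu J G (cst K) mJ mG (@measurable_cst _ _ _ _ _ K) (fun b _ => GK b)).
Qed.

Lemma cylinder_const a (x : R[i]) (G : R -> R -> R[i]) (K : R) : 0 <= a -> 0 <= K ->
  measurable_fun setT (fun p : R * R => G p.1 p.2) ->
  (forall t b, 0 <= t <= a -> cabs (G t b) <= K) ->
  cint `[0, a] (fun t => cint J (fun b => x * G t b)) = x * cint `[0, a] (fun t => cint J (G t)).
Proof.
move=> a0 K0 mG GK.
have mGt t : measurable_fun setT (G t) := measurable_sec t mG.
transitivity (cint `[0, a] (fun t => x * cint J (G t))).
  apply: eq_cint => t; rewrite /= in_itv/= => ta.
  by apply: (circle_const _ (mGt t)) => b; exact: GK.
have mcG : measurable_fun setT (fun t => cint J (G t)).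
  exact: (@measurable_cI R _ _ _ _ mu J (fun p : R * R => G p.1 p.2)).
apply: (@cI_Z R _ _ mu `[0, a] x (fun t => cint J (G t))) => //.
have itv_lty : (mu `[0%R, a] < +oo)%E.
  by rewrite lebesgue_measure_itv/=; case: ifP => _ //; rewrite -EFinB ltry.
apply: (@cfin_bounded R _ _ mu `[0, a] (fun t => cint J (G t)) (K * fine (mu J))) => //.
move=> t; rewrite /= in_itv/= => ta.
by apply: (cabs_circle (mGt t)) => b; exact: GK.
Qed.

Hypotheses (r0 : 0 < r) (lw : loc1 w) (lg : loc1 g).
Hypothesis weak : forall e, admissible r e ->
  cI nu setT (fun z => w z * homog e z) = - cI nu setT (fun z => g z * (seval e z)%:C).

Lemma loc1_supp_cfin h e : loc1 h -> admissible r e ->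
  cfin nu setT (fun z => (seval e z)%:C * h z).
Proof.
move=> lh /admissible_supp[M [B [M0 B0 eM _ [eB _]]]]; have [mh _] := lh.
have [K _ KE] := loc1_fine M lh.
have eM' z : (seval e z)%:C != 0 :> R[i] -> disc M z.
  by move=> h0; apply: eM; apply: contraNneq h0 => ->.
rewrite /cfin; under eq_integral do rewrite mulrC.
apply: le_lt_trans (integral_supp mh (mE e) B0 eB eM') _.
by rewrite KE -EFinM ltry.
Qed.

Let fK0 c a (x : R[i]) (K : R) : 0 <= K -> 0 <= cabs x * (expR (`|c| * a) * 2) * K.
Proof. by move=> K0; rewrite mulr_ge0// mulr_ge0 ?cabs_ge0// mulr_ge0// expR_ge0. Qed.

(** Fubini on both sides of [pairing]: testing an orbit mode of h against e is testing h against an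
    average of e over the circle. *)
Lemma circle_pairing h e q t : loc1 h -> admissible r e -> 0 <= t ->
  cI nu setT (fun z => h z * cint J (fun b =>
    torus_weight (q - 2 * n%:R) q t b * (seval e (orbit_inv z t b))%:C)) =
  cI nu setT (fun z => (seval e z)%:C * orbit_mode q t h z).
Proof.
move=> lh ae t0; have [M [B [M0 B0 eM _ [eB _]]]] := admissible_supp ae.
have [mh _] := lh; have tt : 0 <= t <= t by rewrite t0 lexx.
have eM' z : (seval e z)%:C != 0 :> R[i] -> disc M z.
  by move=> h0; apply: eM; apply: contraNneq h0 => ->.
have [K1 K10 k1] := orbit_pair_bound t lh (mE e) B0 eB eM'.
have [K2 K20 k2] := orbit_pair_bound' t lh (mE e) B0 eB eM'.
pose c := q - 2 * n%:R.
have b1 := @twbound t (fun t b z => h z * (seval e (orbit_inv z t b))%:C) c q setT K1 1 measurableT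
  (fun t b => measurable_complexM mh (measurable_scaled_inv t b (mE e))) k1.
have b2 := @twbound t (fun t b z => h (zeta t b *: z) * (seval e z)%:C) q q setT K2 1 measurableT
  (fun t b => measurable_complexM (measurable_scaled _ mh) (mE e)) k2.
have m1 : measurable_fun setT (fun p : (R * R) * Cn R n =>
    1 * (torus_weight c q p.1.1 p.1.2 * (h p.2 * (seval e (orbit_inv p.2 p.1.1 p.1.2))%:C))).
  apply: measurable_complexM => //; apply: measurable_complexM => //.
  by apply: measurable_complexM; [exact: mz|exact: (morbN (mE e))].
have m2 : measurable_fun setT (fun p : (R * R) * Cn R n =>
    1 * (torus_weight q q p.1.1 p.1.2 * (h (zeta p.1.1 p.1.2 *: p.2) * (seval e p.2)%:C))).
  apply: measurable_complexM => //; apply: measurable_complexM => //.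
  by apply: measurable_complexM; [exact: morb|exact: (mz (mE e))].
have s1 := @circle_swap R n t _ setT _ measurableT m1 (fK0 c t 1 K10) b1 t tt.
have s2 := @circle_swap R n t _ setT _ measurableT m2 (fK0 q t 1 K20) b2 t tt.
transitivity (cI nu setT (fun z => cint J (fun b =>
    1 * (torus_weight c q t b * (h z * (seval e (orbit_inv z t b))%:C))))).
  apply: eq_cI => z _; rewrite -(@circle_const (h z) (fun b => torus_weight c q t b * (seval e (orbit_inv z t b))%:C) (expR (`|c| * t) * 2 * B)).
  - by apply: eq_cint => b _; rewrite mul1r; ring.
  - have mp : measurable_fun setT (fun b => ((t, b), z) : (R * R) * Cn R n).
      by apply: measurable_fun_pair => //; exact: pair1_measurable.
    apply: measurable_complexM; first exact: (measurableT_comp (mtw c q) mp).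
    exact: (measurableT_comp (morbN (mE e)) mp).
  - move=> b; apply: (le_trans (cabsM _ _)); apply: ler_pM; rewrite ?cabs_ge0//.
    exact: cabs_torus_weight.
rewrite -s1; transitivity (cint J (fun b => cI nu setT (fun z =>
    1 * (torus_weight q q t b * (h (zeta t b *: z) * (seval e z)%:C))))).
  apply: eq_cint => b _.
  transitivity (cI nu setT (fun z => torus_weight c q t b * (h z * (seval e (orbit_inv z t b))%:C))).
    by apply: eq_cI => z _; rewrite mul1r.
  rewrite (pairing (r := r) q b lh ae t0); apply: eq_cI => z _; ring.
rewrite s2; apply: eq_cI => z _; rewrite /orbit_mode -cI_realZ//.
  by apply: eq_cint => b _; rewrite mul1r; ring.
have mp : measurable_fun setT (fun b => ((t, b), z) : (R * R) * Cn R n).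
  by apply: measurable_fun_pair => //; exact: pair1_measurable.
exact: (measurableT_comp (mtwh q mh) mp).
Qed.

Let half_line (t : R) : 0 <= t -> 0 <= t <= t. Proof. by rewrite lexx andbT. Qed.

Lemma measurable_orbit_average q t e : measurable_fun setT (fun z => cint J (fun b =>
  torus_weight (q - 2 * n%:R) q t b * (seval e (orbit_inv z t b))%:C)).
Proof.
have m : measurable_fun setT (fun p : (R * R) * Cn R n =>
    torus_weight (q - 2 * n%:R) q p.1.1 p.1.2 * (seval e (orbit_inv p.2 p.1.1 p.1.2))%:C).
  by apply: measurable_complexM; [exact: mtw|exact: (morbN (mE e))].
exact: (measurable_circle_int m t).
Qed.

Lemma orbit_average_cfin h e q t : loc1 h -> admissible r e -> 0 <= t ->
  cfin nu setT (fun z => h z * cint J (fun b =>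
    torus_weight (q - 2 * n%:R) q t b * (seval e (orbit_inv z t b))%:C)).
Proof.
move=> lh ae t0; have [M [B [M0 B0 eM _ [eB _]]]] := admissible_supp ae.
have [mh _] := lh; have tt := half_line t0.
have [K K0 KE] := loc1_fine (M * expR t) lh.
have K'0 : 0 <= expR (`|q - 2 * n%:R| * t) * 2 * B * fine (mu J).
  by rewrite !mulr_ge0 ?expR_ge0// fine_ge0.
apply: le_lt_trans (integral_supp mh (measurable_orbit_average q t e) K'0 _ _) _.
- move=> z; apply: cabs_circle.
    have m : measurable_fun setT (fun p : (R * R) * Cn R n =>
        torus_weight (q - 2 * n%:R) q p.1.1 p.1.2 * (seval e (orbit_inv p.2 p.1.1 p.1.2))%:C).
      by apply: measurable_complexM; [exact: mtw|exact: (morbN (mE e))].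
    have mp : measurable_fun setT (fun b => ((t, b), z) : (R * R) * Cn R n).
      by apply: measurable_fun_pair => //; exact: pair1_measurable.
    exact: (measurableT_comp m mp).
  move=> b; apply: (le_trans (cabsM _ _)); apply: ler_pM; rewrite ?cabs_ge0//.
  exact: cabs_torus_weight.
- move=> z; apply: contraNP => zM; apply/eqP; rewrite -[RHS](_ : cint J (fun=> 0) = 0).
    apply: eq_cint => b _; have -> : seval e (orbit_inv z t b) = 0.
      by apply/eqP; apply: contrapT => /negP /eM /(disc_orbit tt) /zM.
    exact: mulr0.
  by rewrite /cint/= /Rintegral integral0.
- by rewrite KE -EFinM ltry.
Qed.

(** As in [circle_pairing], with the weak equation applied at every point of the cylinder. The
    factor -2 of [orbit_identity] and the minus sign of the weak equation combine to the 2 in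
    [orbit_source]. *)
Lemma cylinder_pairing e q a : admissible r e -> 0 <= a ->
  cI nu setT (fun z => w z * cint `[0, a] (fun t => cint J (fun b =>
    (- 2)%:C * (torus_weight (q - 2 * n%:R) q t b * homog e (orbit_inv z t b))))) =
  cI nu setT (fun z => (seval e z)%:C * orbit_source q a g z).
Proof.
move=> ae a0; have [M [B [M0 B0 eM hM [eB hB]]]] := admissible_supp ae.
have [mw _] := lw; have [mg _] := lg.
have mh := measurable_homog e.
have eM' z : (seval e z)%:C != 0 :> R[i] -> disc M z.
  by move=> h0; apply: eM; apply: contraNneq h0 => ->.
have [K1 K10 k1] := orbit_pair_bound a lw mh B0 hB hM.
have [K2 K20 k2] := orbit_pair_bound' a lg (mE e) B0 eB eM'.
pose c := q - 2 * n%:R.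
have b1 := @twbound a (fun t b z => w z * homog e (orbit_inv z t b)) c q setT K1 (- 2)%:C measurableT
  (fun t b => measurable_complexM mw (measurable_scaled_inv t b mh)) k1.
have b2 := @twbound a (fun t b z => g (zeta t b *: z) * (seval e z)%:C) q q setT K2 2%:C measurableT
  (fun t b => measurable_complexM (measurable_scaled _ mg) (mE e)) k2.
have m1 : measurable_fun setT (fun p : (R * R) * Cn R n =>
    (- 2)%:C * (torus_weight c q p.1.1 p.1.2 * (w p.2 * homog e (orbit_inv p.2 p.1.1 p.1.2)))).
  apply: measurable_complexM => //; apply: measurable_complexM => //.
  by apply: measurable_complexM; [exact: mz|exact: (morbN mh)].
have m2 : measurable_fun setT (fun p : (R * R) * Cn R n =>
    2%:C * (torus_weight q q p.1.1 p.1.2 * (g (zeta p.1.1 p.1.2 *: p.2) * (seval e p.2)%:C))).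
  apply: measurable_complexM => //; apply: measurable_complexM => //.
  by apply: measurable_complexM; [exact: morb|exact: (mz (mE e))].
have s1 := @triple_swap R n a _ setT _ measurableT m1 (fK0 c a (- 2)%:C K10) b1.
have s2 := @triple_swap R n a _ setT _ measurableT m2 (fK0 q a 2%:C K20) b2.
transitivity (cI nu setT (fun z => cint `[0, a] (fun t => cint J (fun b =>
    (- 2)%:C * (torus_weight c q t b * (w z * homog e (orbit_inv z t b))))))).
  apply: eq_cI => z _.
  transitivity (cint `[0, a] (fun t => cint J (fun b =>
      w z * ((- 2)%:C * (torus_weight c q t b * homog e (orbit_inv z t b)))))); last first.
    by apply: eq_cint => t _; apply: eq_cint => b _; ring.
  symmetry; apply: (@cylinder_const a (w z)
    (fun t b => (- 2)%:C * (torus_weight c q t b * homog e (orbit_inv z t b)))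
    (2 * (expR (`|c| * a) * 2 * B)) a0).
  - by rewrite !mulr_ge0// expR_ge0.
  - have mp : measurable_fun setT (fun p => (p, z) : (R * R) * Cn R n) by exact: pair2_measurable.
    apply: measurable_complexM => //; apply: measurable_complexM.
      exact: (measurable_torus_weight c q).
    exact: (measurableT_comp (morbN mh) mp).
  - move=> t b ta; apply: (le_trans (cabsM _ _)); rewrite cabs_real normrN (ger0_norm (ler0n _ 2)).
    rewrite ler_pM2l//; apply: (le_trans (cabsM _ _)); apply: ler_pM; rewrite ?cabs_ge0//.
    exact: cabs_torus_weight.
rewrite -s1; transitivity (cint `[0, a] (fun t => cint J (fun b => cI nu setT (fun z =>
    2%:C * (torus_weight q q t b * (g (zeta t b *: z) * (seval e z)%:C)))))).
  apply: eq_cint => t; rewrite /= in_itv/= => ta; apply: eq_cint => b _.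
  have t0 : 0 <= t by case/andP: ta.
  rewrite cI_realZ//; last first.
    apply: measurable_complexM => //; apply: measurable_complexM => //; exact: measurable_scaled_inv.
  rewrite (pairing_homog (r := r) (g := g))// [RHS]cI_realZ//; last first.
    apply: measurable_complexM => //; apply: measurable_complexM => //; exact: measurable_scaled.
  rewrite (_ : (- 2)%:C = - 2%:C :> R[i]); last by apply: complex_ext; rewrite !ReImE/= ?oppr0.
  rewrite mulrNN; congr (_ * _); apply: eq_cI => z _; ring.
rewrite s2; apply: eq_cI => z _; rewrite /orbit_source.
have mp : measurable_fun setT (fun p => (p, z) : (R * R) * Cn R n) by exact: pair2_measurable.
have mG : measurable_fun setT (fun p : R * R => 2%:C * (torus_weight q q p.1 p.2 * g (zeta p.1 p.2 *: z))).
  exact: (measurableT_comp (mtwh2 q mg) mp).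
rewrite -cI_realZ//; last first.
  exact: (@measurable_cI R _ _ _ _ mu J _ mJ mG).
apply: eq_cint => t _; rewrite -cI_realZ//; last exact: (measurable_sec t mG).
by apply: eq_cint => b _; ring.
Qed.

Lemma loc1_sub h1 h2 : loc1 h1 -> loc1 h2 -> loc1 (fun z => h1 z - h2 z).
Proof.
move=> [m1 l1] [m2 l2]; have mN := measurable_complexN m2.
have mc h : measurable_fun setT h -> measurable_fun setT (fun z => (cabs (h z))%:E).
  by move=> mh; apply/measurable_EFinP; exact: measurable_cabs.
split; first exact: measurable_complexD.
move=> M; have mD : measurable (disc M : set (Cn R n)) by exact: measurable_disc.
apply: (@le_lt_trans _ _ (\int[nu]_(z in disc M) (cabs (h1 z))%:E + \int[nu]_(z in disc M) (cabs (h2 z))%:E)%E).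
  rewrite -ge0_integralD//; [|by move=> z _; rewrite lee_fin cabs_ge0|by apply: measurable_funTS; exact: mc
    |by move=> z _; rewrite lee_fin cabs_ge0|by apply: measurable_funTS; exact: mc].
  apply: (@cfin_le _ _ _ nu _ _ (fun z => cabs (h1 z) + cabs (h2 z))) => //.
  - exact: measurable_complexD.
  - by apply: measurable_funD; exact: measurable_cabs.
  - by move=> z _; rewrite (le_trans (cabsD _ _))// cabsN.
by apply: lte_add_pinfty; [exact: l1|exact: l2].
Qed.

Lemma fundamental_lemma_complex h : loc1 h ->
  (forall e, admissible r e -> cI nu setT (fun z => (seval e z)%:C * h z) = 0) ->
  {ae nu, forall z, exterior r z -> h z = 0}.
Proof.
move=> lh h0; have [mh fh] := lh.
have key (p : R[i] -> R) : measurable_fun setT (p \o h) ->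
    (forall x v, p (x%:C * v) = x * p v) ->
    (forall D f, measurable D -> measurable_fun setT f -> cfin nu D f -> nu.-integrable D (EFin \o (fun z => p (f z)))) ->
    (forall f, p (cI nu setT f) = \int[nu]_z p (f z)) -> p 0 = 0 ->
    {ae nu, forall z, exterior r z -> p (h z) = 0}.
  move=> mp pM pI pc p0; apply: (fundamental_lemma r0 mp).
    by move=> M; apply: pI => //; [exact: measurable_disc|exact: fh].
  move=> e ae; have := h0 e ae => /(congr1 p); rewrite pc p0.
  have mhe : measurable_fun setT (fun z => (seval e z)%:C * h z) by exact: measurable_complexM.
  have := pI setT _ measurableT mhe (loc1_supp_cfin lh ae).
  rewrite /Rintegral => I E.
  rewrite -[RHS](_ : (0%:E)%E = _)//= -E fineK; last exact: integrable_fin_num.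
  by apply: eq_integral => z _; rewrite pM mulrC.
have PR (x : R) (v : R[i]) : complex.Re (x%:C * v) = x * complex.Re v by rewrite ReM/= mul0r subr0.
have PI (x : R) (v : R[i]) : complex.Im (x%:C * v) = x * complex.Im v by rewrite ImM/= mul0r addr0.
have e1 := key (@complex.Re R) (measurable_Rec mh) PR (fun D f mD mf ff => (cfin_integrable mD mf ff).1) (fun f => erefl) erefl.
have e2 := key (@complex.Im R) (measurable_Imc mh) PI (fun D f mD mf ff => (cfin_integrable mD mf ff).2) (fun f => erefl) erefl.
apply: (@ae_mono _ _ _ nu _ _ _ (@ae_conj _ _ _ nu _ _ e1 e2)) => z [h1 h2] zr.
by apply: complex_ext; [exact: h1|exact: h2].
Qed.

(** The identity is tested against every admissible expression and follows by the fundamental lemma.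
    The exceptional null set of z depends on a; [ae_swap] exchanges the quantifiers later. *)
Theorem orbit_modes_ae q a : 0 <= a -> cis (q * (2 * pi)) = 1 ->
  {ae nu, forall z, exterior r z ->
    orbit_mode q a w z = orbit_mode q 0 w z + orbit_source q a g z}.
Proof.
move=> a0 q1.
have la := loc1_orbit_mode q a0 lw; have l0 := loc1_orbit_mode q (lexx 0) lw.
have ls := loc1_orbit_source q a0 lg.
have lh := loc1_sub (loc1_sub la l0) ls.
suff H : {ae nu, forall z, exterior r z -> orbit_mode q a w z - orbit_mode q 0 w z - orbit_source q a g z = 0}.
  apply: (@ae_mono _ _ _ nu _ _ _ H) => z /[apply] /eqP.
  by rewrite !subr_eq add0r addrC => /eqP.
apply: (fundamental_lemma_complex lh) => e ae.
have mM h : loc1 h -> measurable_fun setT (fun z => (seval e z)%:C * h z).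
  by move=> [mh _]; exact: measurable_complexM.
have fin h (lh' : loc1 h) := loc1_supp_cfin lh' ae.
have sub h1 h2 : loc1 h1 -> loc1 h2 -> cI nu setT (fun z => (seval e z)%:C * (h1 z - h2 z)) =
    cI nu setT (fun z => (seval e z)%:C * h1 z) - cI nu setT (fun z => (seval e z)%:C * h2 z).
  move=> l1 l2; rewrite -cI_N//; last exact: mM.
  rewrite -cI_D//; [|exact: mM|by apply: measurable_complexN; exact: mM|exact: fin|].
    by apply: eq_cI => z _; ring.
  by rewrite /cfin; under eq_integral do rewrite cabsN; exact: fin.
rewrite (sub _ _ (loc1_sub la l0) ls) (sub _ _ la l0).
have tr (x y s x' y' s' : R[i]) : x' = x -> y' = y -> s' = s -> x' - y' - s' = 0 -> x - y - s = 0.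
  by move=> -> -> ->.
(* All three terms become w paired with averages of e over the orbit, and these averages satisfy
   [orbit_identity] pointwise in z. *)
apply: (tr _ _ _ _ _ _ (circle_pairing q lw ae a0) (circle_pairing q lw ae (lexx 0)) (cylinder_pairing q ae a0)).
have [mw _] := lw.
have mav t := measurable_complexM mw (measurable_orbit_average q t e).
have fav t (t0 : 0 <= t) := orbit_average_cfin q lw ae t0.
apply/eqP; rewrite subr_eq0 -cI_N// -cI_D//; [|exact: measurable_complexN|exact: fav|]; last first.
  by rewrite /cfin; under eq_integral do rewrite cabsN; exact: fav.
apply/eqP; apply: eq_cI => z _; rewrite -mulrBr; congr (_ * _).
exact: orbit_identity.
Qed.

End orbit_modes.

(** * From modes to unique continuation *)

Section ae_swap.
Context d1 d2 (T1 : measurableType d1) (T2 : measurableType d2) (R : realType).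
Variables (m1 : {sigma_finite_measure set T1 -> \bar R}) (m2 : {sigma_finite_measure set T2 -> \bar R}).
Variables (A : set T1) (B : set T2).
Hypotheses (mA : measurable A) (mB : measurable B).

Lemma ge0_integral_eq0 d (T : measurableType d) (m : {measure set T -> \bar R}) (D : set T)
    (f : T -> \bar R) : measurable D -> measurable_fun setT f -> (forall x, 0 <= f x)%E ->
  (\int[m]_(x in D) f x = 0)%E -> {ae m, forall x, D x -> f x = 0%E}.
Proof.
move=> mD mf f0 I0.
have I0' : (\int[m]_(x in D) `|f x| = 0)%E by under eq_integral do rewrite gee0_abs//.
exact: (iffLR (ae_eq_integral_abs m mD (measurable_funTS mf)) I0').
Qed.

Lemma ae_swap0 (f : T1 * T2 -> \bar R) : measurable_fun setT f -> (forall p, 0 <= f p)%E ->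
  (\int[m1]_(x in A) \int[m2]_(y in B) f (x, y) = 0)%E ->
  {ae m2, forall y, B y -> {ae m1, forall x, A x -> f (x, y) = 0%E}}.
Proof.
move=> mf f0; rewrite (@tonelli_on _ _ _ _ _ m1 m2 A B f)// => I0.
have mswap : measurable_fun setT (fun p : T2 * T1 => f (p.2, p.1)).
  by apply: (measurableT_comp mf); apply: measurable_fun_pair; [exact: measurable_snd|exact: measurable_fst].
have mI : measurable_fun setT (fun y => \int[m1]_(x in A) f (x, y))%E.
  exact: (@measurable_int_section _ _ _ _ _ m1 A (fun p => f (p.2, p.1))).
have I1 y : (0 <= \int[m1]_(x in A) f (x, y))%E by apply: integral_ge0.
apply: (@ae_mono _ _ _ m2 _ _ _ (ge0_integral_eq0 mB mI I1 I0)) => y h By.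
apply: (ge0_integral_eq0 mA _ _ (h By)) => //.
exact: (measurableT_comp mf (pair2_measurable y)).
Qed.

(** Each x has its own null set of bad y. By joint measurability and Tonelli the double integral of
    [cabs] vanishes, so almost every y has only a null set of bad x. *)
Lemma ae_swap (f : T1 * T2 -> R[i]) : measurable_fun setT f ->
  (forall x, A x -> {ae m2, forall y, B y -> f (x, y) = 0}) ->
  {ae m2, forall y, B y -> {ae m1, forall x, A x -> f (x, y) = 0}}.
Proof.
move=> mf h.
have mc : measurable_fun setT (fun p => (cabs (f p))%:E) by apply/measurable_EFinP; exact: measurable_cabs.
have c0 p : (0 <= (cabs (f p))%:E)%E by rewrite lee_fin cabs_ge0.
have I0 : (\int[m1]_(x in A) \int[m2]_(y in B) (cabs (f (x, y)))%:E = 0)%E.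
  rewrite -[RHS](integral0 m1 A); apply: eq_integral => x /set_mem Ax.
  rewrite -[RHS](integral0 m2 B); apply: ae_eq_integral_gen.
  by apply: (@ae_mono _ _ _ m2 _ _ _ (h x Ax)) => y /[apply] ->; rewrite cabs0.
apply: (@ae_mono _ _ _ m2 _ _ _ (ae_swap0 mc c0 I0)) => y /[apply] H.
apply: (@ae_mono _ _ _ m1 _ _ _ H) => x /[apply] -[c].
have := normr_ge0 (complex.Re (f (x, y))); have := normr_ge0 (complex.Im (f (x, y))).
move: c; rewrite /cabs => c h1 h2.
by apply: complex_ext; apply/eqP; rewrite -normr_eq0; apply/eqP; lra.
Qed.

End ae_swap.

Section orbit_mass.
Variables (R : realType) (n : nat) (r : R).
Implicit Types (z : Cn R n) (S : Cn R n -> R) (a b : R).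
Notation mu := (@lebesgue_measure R).
Notation nu := (@lebesgue_Cn R n).
Notation J := (@circle R).
Let mJ : measurable J. Proof. exact: measurable_circle. Qed.
Hint Resolve mJ : core.
Hypothesis r0 : 0 < r.

Definition orbit_mass S a z : \bar R := (\int[mu]_(b in J) (S (zeta a b *: z))%:E)%E.

Lemma exterior_zeta a b z : exterior (r * expR a) (zeta a b *: z) <-> exterior r z.
Proof.
have ra : 0 <= r * expR a by rewrite mulr_ge0 ?expR_ge0// ltW.
split=> [/(exteriorE _ ra)|/(exteriorE _ (ltW r0))] h.
  apply/exteriorE; first exact: ltW.
  move: h; rewrite csqn_scale csq_zeta exprMn -expRM_natl mulrC ltr_pM2l//.
  exact: expR_gt0.
apply/exteriorE => //.
by rewrite csqn_scale csq_zeta exprMn -expRM_natl mulrC ltr_pM2l// expR_gt0.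
Qed.

Let mDr s : 0 <= s -> measurable (@exterior R n s). Proof. exact: measurable_exterior. Qed.

(** Multiplication by [zeta a b] maps the exterior of radius r onto the exterior of radius r e^a,
    with Jacobian e^(2 n a). *)
Lemma integral_exterior_orbit S a b : measurable_fun setT S -> (forall z, 0 <= S z) ->
  (\int[nu]_(z in exterior r) (S (zeta a b *: z))%:E =
   (expR (- (2 * n%:R * a)))%:E * \int[nu]_(z in exterior (r * expR a)) (S z)%:E)%E.
Proof.
move=> mS S0; have ra : 0 <= r * expR a by rewrite mulr_ge0 ?expR_ge0// ltW.
have mSE : measurable_fun setT (fun z => (S z)%:E) by apply/measurable_EFinP.
rewrite [X in (_ * X)%E]integral_mkcond (ge0_integral_scale (zeta_neq0 a b))/=; last 2 first.
- by apply/(measurable_restrictT _ (mDr ra)); exact: measurable_funTS.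
- by move=> z; rewrite /patch; case: ifP => _; rewrite lee_fin.
rewrite muleA -EFinM csq_zeta -expRM_natl -expRD.
rewrite (_ : _ + _ = 0); last by ring.
rewrite expR0 mul1e integral_mkcond; apply: eq_integral => z _; rewrite /patch.
have -> : (zeta a b *: z \in exterior (r * expR a)) = (z \in @exterior R n r).
  by apply/idP/idP => /set_mem h; apply/mem_set; [exact: (iffLR (exterior_zeta a b z))|exact: (iffRL (exterior_zeta a b z))].
by [].
Qed.

Let mSorb S : measurable_fun setT S ->
  measurable_fun setT (fun p : (R * R) * Cn R n => (S (zeta p.1.1 p.1.2 *: p.2))%:E).
Proof. by move=> mS; apply/measurable_EFinP; exact: (measurableT_comp mS (@measurable_orbit R n)). Qed.

Lemma measurable_orbit_mass S : measurable_fun setT S -> (forall z, 0 <= S z) ->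
  measurable_fun setT (fun p : R * Cn R n => orbit_mass S p.1 p.2).
Proof.
move=> mS S0.
apply: (@measurable_int_section _ _ _ _ _ mu J (fun p : (R * Cn R n) * R => (S (zeta p.1.1 p.2 *: p.1.2))%:E)) => //.
  have h : measurable_fun setT (fun p : (R * Cn R n) * R => ((p.1.1, p.2), p.1.2)).
    apply: measurable_fun_pair; first apply: measurable_fun_pair.
    - by apply: (measurableT_comp measurable_fst); exact: measurable_fst.
    - exact: measurable_snd.
    - by apply: (measurableT_comp measurable_snd); exact: measurable_fst.
  exact: (measurableT_comp (mSorb mS) h).
by move=> p; rewrite lee_fin.
Qed.

Lemma orbit_mass_ge0 S a z : (forall z, 0 <= S z) -> (0 <= orbit_mass S a z)%E.
Proof. by move=> S0; apply: integral_ge0 => b _; rewrite lee_fin. Qed.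

Lemma integral_orbit_mass S a : measurable_fun setT S -> (forall z, 0 <= S z) ->
  (\int[nu]_(z in exterior r) orbit_mass S a z =
   (expR (- (2 * n%:R * a)))%:E * \int[nu]_(z in exterior (r * expR a)) (S z)%:E * mu J)%E.
Proof.
move=> mS S0; have mE := mDr (ltW r0).
have m1 : measurable_fun setT (fun p : Cn R n * R => (S (zeta a p.2 *: p.1))%:E).
  have h : measurable_fun setT (fun p : Cn R n * R => ((a, p.2), p.1)).
    by apply: measurable_fun_pair; [apply: measurable_fun_pair => //; exact: measurable_snd|exact: measurable_fst].
  exact: (measurableT_comp (mSorb mS) h).
rewrite (@tonelli_on _ _ _ _ _ nu mu (exterior r) J (fun p => (S (zeta a p.2 *: p.1))%:E))//; last first.
  by move=> p; rewrite lee_fin.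
rewrite -integral_cst//; apply: eq_integral => b _; exact: integral_exterior_orbit.
Qed.

End orbit_mass.

Section exponential_integral.
Variable R : realType.
Notation mu := (@lebesgue_measure R).

Lemma integral_expRN_lty : (\int[mu]_(a in `[0%R, +oo[) (expR (- a))%:E < +oo)%E.
Proof.
have mE : measurable_fun setT (fun a : R => expR (- a)).
  by apply: (measurableT_comp (@measurable_expR R)).
rewrite (ge0_integral_ereal_sup mu (fun x => expR_ge0 (- x)) mE).
apply: le_lt_trans (ltry 1); apply: ge_ereal_sup => _ [i _ <-].
have i0 : (0 : R) <= i.+1%:R by [].
have d (x : R) : is_derive x 1 (fun a => - expR (- 1 * a)) (expR (- 1 * x)).
  by have h := is_deriveN (is_derive_expRM (- 1) x); apply: (is_derive_eq h); ring.
have c : continuous (fun a : R => expR (- 1 * a)) := is_derive_continuous (is_derive_expRM (- 1)).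
have [fi E] := FTC2_on i0 (fun x _ => d x) (fun x _ => c x).
have fn : (\int[mu]_(x in `[0%R, i.+1%:R]) (expR (- 1 * x))%:E)%E \is a fin_num.
  exact: integrable_fin_num fi.
under eq_integral do rewrite -mulN1r.
rewrite -[X in (X <= _)%E]fineK// lee_fin.
move: E; rewrite /Rintegral => ->.
by rewrite mulr0 expR0 opprK gerDr oppr_le0 expR_ge0.
Qed.

End exponential_integral.

Section orbit_restriction.
Variables (R : realType) (n N : nat) (C : R) (w g : 'I_N -> Cn R n -> R[i]).
Implicit Types (z : Cn R n) (a b t k : R).
Notation mu := (@lebesgue_measure R).
Notation nu := (@lebesgue_Cn R n).
Notation J := (@circle R).
Let mJ : measurable J. Proof. exact: measurable_circle. Qed.
Hint Resolve mJ : core.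

Hypotheses (C0 : 0 <= C) (mw : forall l, measurable_fun setT (w l))
  (mg : forall l, measurable_fun setT (g l))
  (gC : forall z, \sum_l csq (g l z) <= C ^+ 2 * \sum_l csq (w l z)).

Definition density z : R := \sum_l csq (w l z).

Lemma density_ge0 z : 0 <= density z.
Proof. by apply: sumr_ge0 => l _; exact: csq_ge0. Qed.

Lemma measurable_density : measurable_fun setT density.
Proof. by apply: measurable_sum => l; exact: (measurableT_comp (@measurable_csqC R) (mw l)). Qed.

Let T a z := orbit_mass density a z.

Let T0 a z : (0 <= T a z)%E.
Proof. by apply: orbit_mass_ge0 => ?; exact: density_ge0. Qed.

Let msec z : measurable_fun setT (fun a => T a z).
Proof.
exact: (measurableT_comp (measurable_orbit_mass measurable_density density_ge0) (pair2_measurable z)).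
Qed.

Lemma orbit_modeE q t (h : Cn R n -> R[i]) z : measurable_fun setT h ->
  orbit_mode q t h z = (expR (q * t))%:C * mode (- q) (fun b => h (zeta t b *: z)).
Proof.
move=> mh; rewrite /mode -cI_realZ//.
  by apply: eq_cint => b _; rewrite /torus_weight mulNr opprK mulrA.
have mp : measurable_fun setT (fun b => ((t, b), z) : (R * R) * Cn R n).
  by apply: measurable_fun_pair => //; exact: pair1_measurable.
apply: measurable_complexM; last exact: (measurableT_comp (measurableT_comp mh (@measurable_orbit R n)) mp).
have h2 : measurable_fun setT (fun b : R => (0 : R, - (- q * b))).
  by apply: measurable_fun_pair => //; apply: measurable_funN; apply: measurable_funM.
have := measurableT_comp (@measurable_zeta R) h2.
by congr measurable_fun; apply/funext => b /=; rewrite /zeta expR0 mul1r.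
Qed.

Lemma orbit_vanish z : (T 0 z < +oo)%E ->
  (forall k : nat, (\int[mu]_(a in `[0%R, +oo[) ((expR (k%:R * a))%:E * T a z) < +oo)%E) ->
  (forall l (j K : nat), {ae mu, forall a, `[0, +oo[%classic a ->
    orbit_mode (- (j%:R - K%:R)) a (w l) z - (orbit_mode (- (j%:R - K%:R)) 0 (w l) z +
      orbit_source (- (j%:R - K%:R)) a (g l) z) = 0}) ->
  N = 1%N \/ C < 1 / 4 ->
  {ae mu, forall a, `[0, +oo[%classic a -> T a z = 0%E}.
Proof.
move=> T0z Tk modes cases.
pose G := [set a | (T a z < +oo)%E].
have mG : measurable G.
  by have := emeasurable_fun_infty_o measurableT (msec z) +oo%E; rewrite setTI.
(* Slices of infinite mass are set to 0, so that every slice is in L2 as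
   [cylinder_unique_continuation] demands. They form a null set by the moment of order 0, and a = 0,
   where the initial value is read, is a good slice by hypothesis. *)
pose chi a : R[i] := (\1_G a : R)%:C.
have chi1 a : G a -> chi a = 1 by move=> Ga; rewrite /chi indicE mem_set.
have chi0 a : ~ G a -> chi a = 0 by move=> Ga; rewrite /chi indicE memNset.
have mp : measurable_fun setT (fun p => (p, z) : (R * R) * Cn R n) by exact: pair2_measurable.
have mor h : measurable_fun setT h -> mjoint (fun a b => h (zeta a b *: z)).
  move=> mh; have m := measurableT_comp (measurableT_comp mh (@measurable_orbit R n)) mp.
  by split; [exact: (measurable_Rec m)|exact: (measurable_Imc m)].
have mchi : mjoint (fun a (b : R) => chi a).
  split; last exact: measurable_cst.
  have mi : measurable_fun setT (\1_G : R -> R) by exact: measurable_indic.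
  exact: (measurableT_comp mi measurable_fst).
pose U l a b := chi a * w l (zeta a b *: z).
pose F l a b := chi a * g l (zeta a b *: z).
have mU l : mjoint (U l) by apply: mjointM => //; exact: mor.
have mF l : mjoint (F l) by apply: mjointM => //; exact: mor.
have mdens a : measurable_fun setT (fun b => density (zeta a b *: z)).
  have mp2 : measurable_fun setT (fun b => ((a, b), z) : (R * R) * Cn R n).
    by apply: measurable_fun_pair => //; exact: pair1_measurable.
  exact: (measurableT_comp (measurableT_comp measurable_density (@measurable_orbit R n)) mp2).
have idens a : G a -> mu.-integrable J (EFin \o (fun b => density (zeta a b *: z))).
  move=> Ga; apply/integrableP; split; first by apply/measurable_EFinP; exact: (measurable_funTS (mdens a)).
  apply: le_lt_trans Ga; rewrite le_eqVlt; apply/orP; left; apply/eqP.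
  by apply: eq_integral => b _; rewrite /= ger0_norm// density_ge0.
have sumU a b : \sum_l csq (U l a b) = csq (chi a) * density (zeta a b *: z).
  by rewrite /density mulr_sumr; apply: eq_bigr => l _; rewrite csqM.
have LU l a : L2c (U l a).
  have [m1 m2] := mjoint_sec a (mU l).
  have [Ga|Ga] := pselect (G a); last first.
    apply: (L2c_dom (h := cst 0) m1 m2); first exact: (@integrable0 _ _ _ mu).
    by move=> b; rewrite /U (chi0 a Ga) mul0r csq0.
  apply: (L2c_dom m1 m2 (idens a Ga)) => b; rewrite /U (chi1 a Ga) mul1r /density (bigD1 l)//= lerDl.
  by apply: sumr_ge0 => i _; exact: csq_ge0.
have FU a b : \sum_l csq (F l a b) <= C ^+ 2 * \sum_l csq (U l a b).
  rewrite sumU (_ : \sum_l csq (F l a b) = csq (chi a) * \sum_l csq (g l (zeta a b *: z))).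
    by rewrite mulrCA; apply: ler_wpM2l; [exact: csq_ge0|exact: gC].
  by rewrite mulr_sumr; apply: eq_bigr => l _; rewrite csqM.
have csq1 : csq (1 : R[i]) = 1 by rewrite -[RHS](expr1n R 2) -csq_real.
have nU a : G a -> (\sum_l n2 (U l a))%:E = T a z.
  move=> Ga; rewrite -(@Rintegral_sumR _ _ _ mu)//; last by move=> l; exact: L2c_integrable.
  have -> : \int[mu]_(b in J) \sum_l csq (U l a b) = \int[mu]_(b in J) density (zeta a b *: z).
    by apply: eq_Rintegral => b _; rewrite sumU (chi1 a Ga) csq1 mul1r.
  have fn : T a z \is a fin_num by rewrite ge0_fin_numE//; exact: T0.
  exact: fineK fn.
have nU0 a : ~ G a -> \sum_l n2 (U l a) = 0.
  move=> Ga; apply: big1 => l _; rewrite /n2 -[RHS](_ : \int[mu]_(b in J) 0 = 0); last by rewrite /Rintegral integral0.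
  by apply: eq_Rintegral => b _; rewrite /U (chi0 a Ga) mul0r csq0.
have Gae : {ae mu, forall a, `[0, +oo[%classic a -> G a}.
  have I0 : mu.-integrable `[0, +oo[ (fun a => T a z).
    apply/integrableP; split; first exact: (measurable_funTS (msec z)).
    apply: le_lt_trans (Tk 0%N); rewrite le_eqVlt; apply/orP; left; apply/eqP.
    by apply: eq_integral => a _; rewrite mul0r expR0 mul1e gee0_abs//; exact: T0.
  have fae : {ae mu, forall a, `[0, +oo[%classic a -> T a z \is a fin_num} by exact: (integrable_ae _ I0).
  apply: (@ae_mono _ _ _ mu _ _ _ fae) => a h /h.
  by rewrite ge0_fin_numE//; exact: T0.
have fin k : (\int[mu]_(a in `[0%R, +oo[) (expR (k * a) * \sum_l n2 (U l a))%:E < +oo)%E.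
  (* Real exponents are rounded up to natural ones, for which the moments are known; on a >= 0 this
     only increases the weight. *)
  pose k' := (Num.truncn `|k|).+1.
  have kk' : k <= k'%:R.
    by apply: le_trans (ler_norm k) _; apply/ltW; exact: truncnS_gt.
  apply: le_lt_trans (Tk k'); apply: ge0_le_integral => //.
  - move=> a _; rewrite lee_fin mulr_ge0 ?expR_ge0//; apply: sumr_ge0 => l _; exact: n2_ge0.
  - apply: measurable_funTS; apply/measurable_EFinP; apply: measurable_funM.
      by apply: (measurableT_comp (@measurable_expR R)); apply: measurable_funM.
    by apply: measurable_sum => l; exact: measurable_n2.
  - apply: measurable_funTS; apply: emeasurable_funM; last exact: msec.
    apply/measurable_EFinP.
    by apply: (measurableT_comp (@measurable_expR R)); apply: measurable_funM.
  - move=> a; rewrite /= in_itv/= andbT => a0; have [Ga|Ga] := pselect (G a); last first.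
      rewrite (nU0 a Ga) mulr0; apply: mule_ge0; last exact: T0.
      by rewrite lee_fin expR_ge0.
    rewrite EFinM (nU a Ga); apply: lee_wpmul2r; first exact: T0.
    by rewrite lee_fin ler_expR ler_wpM2r.
have eqU a l : G a -> U l a = fun b => w l (zeta a b *: z).
  by move=> Ga; apply/funext => b; rewrite /U (chi1 a Ga) mul1r.
have eqF a l : G a -> F l a = fun b => g l (zeta a b *: z).
  by move=> Ga; apply/funext => b; rewrite /F (chi1 a Ga) mul1r.
(* The mode k corresponds to [orbit_mode] with q = - k. On good slices the cut-off is 1; under the
   time integral the bad slices are discarded as a null set. *)
have ms l (j K : nat) : {ae mu, forall a, 0 <= a -> mode_solution (U l) (F l) (j%:R - K%:R) a}.
  apply: (@ae_mono _ _ _ mu _ _ _ (@ae_conj _ _ _ mu _ _ Gae (modes l j K))) => a [h1 h2] a0.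
  have aI : `[0, +oo[%classic a by rewrite /= in_itv/= a0.
  have Ga := h1 aI; have {h2} := h2 aI.
  set k := j%:R - K%:R; rewrite 2!(orbit_modeE _ _ _ (mw l)) opprK => /eqP; rewrite subr_eq0 => /eqP.
  rewrite !mulNr mulr0 oppr0 expR0 mul1r /mode_solution (eqU a l Ga) (eqU 0 l T0z) => ->.
  congr (_ + _).
  have Gae' : {ae mu, forall t, `[0, a]%classic t -> cint J (fun b => 2%:C * (torus_weight (- k) (- k) t b * g l (zeta t b *: z))) =
      2%:C * ((expR (- (k * t)))%:C * mode k (F l t))}.
    apply: (@ae_mono _ _ _ mu _ _ _ Gae) => t h.
    rewrite /= in_itv/= => /andP[t0 _]; have Gt : G t by apply: h; rewrite /= in_itv/= t0.
    rewrite (eqF t l Gt).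
    have mp2 : measurable_fun setT (fun b => ((t, b), z) : (R * R) * Cn R n).
      by apply: measurable_fun_pair => //; exact: pair1_measurable.
    have m : measurable_fun setT (fun b => torus_weight (- k) (- k) t b * g l (zeta t b *: z)).
      apply: measurable_complexM; last exact: (measurableT_comp (measurableT_comp (mg l) (@measurable_orbit R n)) mp2).
      exact: (measurable_sec t (measurable_torus_weight (- k) (- k))).
    apply: (eq_trans (@cI_realZ R _ _ mu J 2 _ mJ m)).
    have := @orbit_modeE (- k) t (g l) z (mg l); rewrite opprK mulNr => <-.
    by [].
  apply: complex_ext => /=; apply: (@ae_eq_Rintegral _ _ _ mu).
    by apply: (@ae_mono _ _ _ mu _ _ _ Gae') => t h /h /(congr1 (@complex.Re R)).
  by apply: (@ae_mono _ _ _ mu _ _ _ Gae') => t h /h /(congr1 (@complex.Im R)).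
have := cylinder_unique_continuation C0 mU mF LU FU fin ms cases => H.
apply: (@ae_mono _ _ _ mu _ _ _ (@ae_conj _ _ _ mu _ _ Gae H)) => a [h1 h2] aI.
have a0 : 0 <= a by move: aI; rewrite /= in_itv/= andbT.
by rewrite -(nU a (h1 aI)) (h2 a0).
Qed.

End orbit_restriction.

Lemma measurable_prim_joint d (T : measurableType d) (R : realType) (f : R * T -> R) :
  measurable_fun setT f ->
  measurable_fun setT (fun p : R * T => \int[@lebesgue_measure R]_(t in `[0, p.1]) f (t, p.2)).
Proof.
move=> mf; set mu := @lebesgue_measure R.
have mL : measurable [set q : (R * T) * R | q.2 <= q.1.1].
  rewrite (_ : [set q | _] = (fun q : (R * T) * R => q.1.1 - q.2) @^-1` `[0, +oo[).
    rewrite -[X in measurable X]setTI; apply: measurable_funB => //.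
    by apply: (measurableT_comp measurable_fst); exact: measurable_fst.
  by apply/seteqP; split => z /=; rewrite in_itv/= andbT subr_ge0.
have mF : measurable_fun setT (fun q : (R * T) * R => f (q.2, q.1.2) * \1_[set q : (R * T) * R | q.2 <= q.1.1] q).
  apply: measurable_funM; last exact: measurable_indic.
  apply: (measurableT_comp mf); apply: measurable_fun_pair; first exact: measurable_snd.
  by apply: (measurableT_comp measurable_snd); exact: measurable_fst.
have := @measurable_Rint_section _ _ _ _ _ mu `[0, +oo[%classic _ (measurable_itv _) mF.
congr measurable_fun; apply/funext => -[a y] /=.
have xe : `[0, a]%classic = `[0, +oo[%classic `&` [set t | t <= a].
  apply/seteqP; split => t /=; rewrite !in_itv/= ?andbT.
    by move=> /andP[t0 ta].
  by move=> [-> ->].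
rewrite xe Rintegral_mkcondr; apply: eq_Rintegral => t _.
rewrite indicE /patch; case: ifPn => [/set_mem h|h].
  by rewrite mem_set// mulr1.
by rewrite memNset ?mulr0// => h2; move/negP: h; apply; apply/mem_set.
Qed.

Section orbit_unique_continuation.
Variables (R : realType) (n N : nat) (r C : R) (w g : 'I_N -> Cn R n -> R[i]).
Implicit Types (z : Cn R n) (a b t k q : R).
Notation mu := (@lebesgue_measure R).
Notation nu := (@lebesgue_Cn R n).
Notation J := (@circle R).
Let mJ : measurable J. Proof. exact: measurable_circle. Qed.
Hint Resolve mJ : core.

Lemma measurable_orbit_mode q (h : Cn R n -> R[i]) : measurable_fun setT h ->
  measurable_fun setT (fun p : R * Cn R n => orbit_mode q p.1 h p.2).
Proof.
move=> mh.
apply: (@measurable_cI R _ _ _ _ mu J (fun p : (R * Cn R n) * R =>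
  torus_weight q q p.1.1 p.2 * h (zeta p.1.1 p.2 *: p.1.2))) => //.
have m1 : measurable_fun setT (fun p : (R * Cn R n) * R => (p.1.1, p.2)).
  by apply: measurable_fun_pair => //; apply: (measurableT_comp measurable_fst); exact: measurable_fst.
have m2 : measurable_fun setT (fun p : (R * Cn R n) * R => ((p.1.1, p.2), p.1.2)).
  by apply: measurable_fun_pair => //; apply: (measurableT_comp measurable_snd); exact: measurable_fst.
apply: measurable_complexM; first exact: (measurableT_comp (measurable_torus_weight q q) m1).
exact: (measurableT_comp (measurableT_comp mh (@measurable_orbit R n)) m2).
Qed.

Lemma measurable_orbit_source q (h : Cn R n -> R[i]) : measurable_fun setT h ->
  measurable_fun setT (fun p : R * Cn R n => orbit_source q p.1 h p.2).
Proof.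
move=> mh.
have m : measurable_fun setT (fun p : R * Cn R n => 2%:C * orbit_mode q p.1 h p.2).
  by apply: measurable_complexM => //; exact: measurable_orbit_mode.
have m' : measurable_fun setT (fun p : R * Cn R n => cint `[0, p.1] (fun t => 2%:C * orbit_mode q t h p.2)).
  apply: measurable_fun_complex => /=.
    exact: (measurable_prim_joint (measurable_Rec m)).
  exact: (measurable_prim_joint (measurable_Imc m)).
move: m'; congr measurable_fun; apply/funext => -[a z] /=.
apply: eq_cint => t _; symmetry; apply: (@cI_realZ R _ _ mu J 2) => //.
have mp : measurable_fun setT (fun b => ((t, b), z) : (R * R) * Cn R n).
  by apply: measurable_fun_pair => //; exact: pair1_measurable.
apply: measurable_complexM.
  exact: (measurable_sec t (measurable_torus_weight q q)).
exact: (measurableT_comp (measurableT_comp mh (@measurable_orbit R n)) mp).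
Qed.

Hypotheses (r0 : 0 < r) (C0 : 0 <= C) (mw : forall l, measurable_fun setT (w l))
  (mg : forall l, measurable_fun setT (g l))
  (w0 : forall l z, ~ exterior r z -> w l z = 0)
  (gC : forall z, \sum_l csq (g l z) <= C ^+ 2 * density w z)
  (decay : forall m : nat, exists2 K : R, 0 <= K & forall rho, r <= rho ->
    (\int[nu]_(z in exterior rho) (density w z)%:E <= (K * rho ^- m)%:E)%E)
  (weak : forall l e, admissible r e ->
    cI nu setT (fun z => w l z * homog e z) = - cI nu setT (fun z => g l z * (seval e z)%:C)).

Let S := density w.
Let T a z := orbit_mass S a z.
Let mS : measurable_fun setT S. Proof. exact: measurable_density. Qed.
Let S0 z : 0 <= S z. Proof. exact: density_ge0. Qed.
Let T0 a z : (0 <= T a z)%E. Proof. exact: orbit_mass_ge0. Qed.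
Let mT : measurable_fun setT (fun p : R * Cn R n => T p.1 p.2).
Proof. exact: measurable_orbit_mass. Qed.
Let mSE : measurable_fun setT (fun z => (S z)%:E). Proof. by apply/measurable_EFinP. Qed.
Let mE s : 0 <= s -> measurable (@exterior R n s). Proof. exact: measurable_exterior. Qed.
Let mEr : measurable (@exterior R n r). Proof. exact: (mE (ltW r0)). Qed.

Let intS_lty : (\int[nu]_z (S z)%:E < +oo)%E.
Proof.
have [K _ /(_ r (lexx r)) h] := decay 0.
apply: (le_lt_trans _ (ltry (K * r ^- 0))); apply: le_trans h.
rewrite [leRHS]integral_mkcond le_eqVlt; apply/orP; left; apply/eqP.
apply: eq_integral => z _; rewrite /patch; case: ifPn => // /negP zE.
rewrite /S /density big1// => l _; rewrite w0 ?csq0// => h2.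
by apply: zE; apply/mem_set.
Qed.

(** [cabs h] is at most 1 + |h|^2; the constant is integrable on a disc, which lies in a box of
    finite measure, and the density is integrable on the whole space. *)
Lemma loc1_of_density (c : R) (h : Cn R n -> R[i]) : 0 <= c -> measurable_fun setT h ->
  (forall z, csq (h z) <= c * S z) -> loc1 h.
Proof.
move=> c0 mh hS; split => // M.
have mD : measurable (disc M : set (Cn R n)) by exact: measurable_disc.
have D_lty : (nu (disc M) < +oo)%E.
  apply: le_lt_trans (@box_lty R n `|M|); apply: le_measure; rewrite ?inE//.
    exact: measurable_box.
  move=> z; rewrite /disc/= => zM; apply: csqn_box => //.
  by rewrite real_normK ?num_real.
apply: (@le_lt_trans _ _ (\int[nu]_(z in disc M) (1 + c * S z)%:E)%E).
  apply: (@cfin_le _ _ _ nu _ _ (fun z => 1 + c * S z)) => //.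
    by apply: measurable_funD => //; exact: measurable_funM.
  by move=> z _; apply: (le_trans (cabs_csq _)); rewrite lerD2l.
under eq_integral do rewrite EFinD.
rewrite ge0_integralD//; last 2 first.
- by move=> z _; rewrite lee_fin mulr_ge0.
- by apply: measurable_funTS; apply/measurable_EFinP; exact: measurable_funM.
apply: lte_add_pinfty; first by rewrite integral_cst// mul1e.
under eq_integral do rewrite EFinM.
rewrite ge0_integralZl//; [|exact: measurable_funTS|by move=> z _; rewrite lee_fin].
apply: lte_mul_pinfty; rewrite ?lee_fin//.
apply: le_lt_trans intS_lty; apply: ge0_subset_integral => //.
by move=> z _; rewrite lee_fin.
Qed.

Let lw l : loc1 (w l).
Proof.
apply: (loc1_of_density ler01 (mw l)) => z; rewrite mul1r /S /density (bigD1 l)//= lerDl.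
by apply: sumr_ge0 => i _; exact: csq_ge0.
Qed.

Let lg l : loc1 (g l).
Proof.
apply: (loc1_of_density (sqr_ge0 C) (mg l)) => z; apply: le_trans (gC z).
by rewrite (bigD1 l)//= lerDl; apply: sumr_ge0 => i _; exact: csq_ge0.
Qed.

Let half_line : measurable (`[0, +oo[%classic : set R). Proof. exact: measurable_itv. Qed.
Hint Resolve half_line mEr : core.

(** Almost every orbit satisfies all mode equations for almost every a: [orbit_modes_ae] for each
    fixed a, then [ae_swap], then a countable union over components and modes. The mode index is an
    integer, written as a difference of naturals. *)
Let modes_ae : {ae nu, forall z, forall i : 'I_N * (nat * nat), exterior r z ->
  {ae mu, forall a, `[0, +oo[%classic a ->
    orbit_mode (- (i.2.1%:R - i.2.2%:R)) a (w i.1) z - (orbit_mode (- (i.2.1%:R - i.2.2%:R)) 0 (w i.1) z +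
      orbit_source (- (i.2.1%:R - i.2.2%:R)) a (g i.1) z) = 0}}.
Proof.
apply: (@ae_all _ _ _ nu) => -[l [j K]] /=; set q := - _.
have q1 : cis (q * (2 * pi)) = 1 :> R[i].
  have E : cis (q * (2 * pi)) * cis (j%:R * (2 * pi)) = cis (K%:R * (2 * pi)) :> R[i].
    by rewrite -cisD; congr cis; rewrite /q; ring.
  by move: E; rewrite !cis_2pi mulr1.
pose f (p : R * Cn R n) := orbit_mode q p.1 (w l) p.2 -
  (orbit_mode q 0 (w l) p.2 + orbit_source q p.1 (g l) p.2).
have mf : measurable_fun setT f.
  apply: measurable_complexD; first exact: measurable_orbit_mode.
  apply: measurable_complexN; apply: measurable_complexD; last exact: measurable_orbit_source.
  have mp : measurable_fun setT (fun p : R * Cn R n => (0 : R, p.2)) by apply: measurable_fun_pair.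
  exact: (measurableT_comp (measurable_orbit_mode q (mw l)) mp).
apply: (@ae_swap _ _ _ _ R mu nu `[0, +oo[%classic (exterior r) half_line mEr f mf) => a.
rewrite /= in_itv/= andbT => a0.
have := orbit_modes_ae r0 (lw l) (lg l) (weak l) a0 q1 => H.
by apply: (@ae_mono _ _ _ nu _ _ _ H) => z /[apply]; rewrite /f/= => ->; rewrite subrr.
Qed.

Let muJ : (mu J < +oo)%E. Proof. exact: mu_circle_lty. Qed.

(** Decay of order k + 1 at radius r e^a beats the weight e^(k a) and leaves e^(- a). The Jacobian
    factor e^(- 2 n a) is at most 1. *)
Let mass_le (k : nat) : exists2 K : R, 0 <= K & forall a, 0 <= a ->
  (\int[nu]_(z in exterior r) ((expR (k%:R * a))%:E * T a z) <= (K * expR (- a))%:E)%E.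
Proof.
have [K K0 Kd] := decay k.+1.
have Jf : mu J \is a fin_num by rewrite ge0_fin_numE.
exists (K * r ^- k.+1 * fine (mu J)).
  by rewrite !mulr_ge0 ?fine_ge0// invr_ge0 exprn_ge0// ltW.
move=> a a0.
have mTa : measurable_fun setT (T a) := measurable_sec a mT.
rewrite ge0_integralZl; [|exact: mEr|exact: (measurable_funTS mTa)|by move=> z _; exact: T0|by rewrite lee_fin expR_ge0].
rewrite integral_orbit_mass// muleA -[X in (_ * X)%E](fineK Jf).
have rr : r <= r * expR a by rewrite ler_peMr ?(ltW r0)// -[leLHS]expR0 ler_expR.
have E : K * r ^- k.+1 * fine (mu J) * expR (- a) =
    expR (k%:R * a) * (K * (r * expR a) ^- k.+1) * fine (mu J).
  rewrite exprMn invfM -[expR a ^+ _]expRM_natl -expRN.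
  rewrite (_ : expR (- a) = expR (k%:R * a) * expR (- (k.+1%:R * a))); last first.
    by rewrite -expRD; congr expR; rewrite -natr1; ring.
  ring.
rewrite E EFinM; apply: lee_wpmul2r; first by rewrite lee_fin fine_ge0.
rewrite [leRHS]EFinM; apply: lee_wpmul2l; first by rewrite lee_fin expR_ge0.
apply: le_trans (Kd _ rr); rewrite -[leRHS]mul1e; apply: lee_wpmul2r.
  by apply: integral_ge0 => z _; rewrite lee_fin.
by rewrite lee_fin expR_le1 oppr_le0 !mulr_ge0.
Qed.

Let mkT (k : nat) : measurable_fun setT (fun p : R * Cn R n => (expR (k%:R * p.1))%:E * T p.1 p.2)%E.
Proof.
apply: emeasurable_funM; last exact: mT.
apply/measurable_EFinP; apply: (measurableT_comp (@measurable_expR R)).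
by apply: measurable_funM => //; exact: measurable_fst.
Qed.

Let kT0 (k : nat) (p : R * Cn R n) : (0 <= (expR (k%:R * p.1))%:E * T p.1 p.2)%E.
Proof. by rewrite mule_ge0 ?lee_fin ?expR_ge0//; exact: T0. Qed.

(** Tonelli and integrability of e^(- a): the moments are integrable in z, hence finite for almost
    every z. *)
Let moments_ae : {ae nu, forall z, forall k : nat, exterior r z ->
  (\int[mu]_(a in `[0%R, +oo[) ((expR (k%:R * a))%:E * T a z) < +oo)%E}.
Proof.
apply: (@ae_all _ _ _ nu) => k; have [K K0 Kd] := mass_le k.
pose I z := (\int[mu]_(a in `[0%R, +oo[) ((expR (k%:R * a))%:E * T a z))%E.
have mI : measurable_fun setT I.
  have mswap : measurable_fun setT (fun p : Cn R n * R => ((expR (k%:R * p.2))%:E * T p.2 p.1)%E).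
    have ms : measurable_fun setT (fun p : Cn R n * R => (p.2, p.1)).
      by apply: measurable_fun_pair; [exact: measurable_snd|exact: measurable_fst].
    exact: (measurableT_comp (mkT k) ms).
  apply: (@measurable_int_section _ _ _ _ _ mu `[0, +oo[%classic _ half_line mswap) => p.
  exact: (kT0 k (p.2, p.1)).
have I0 z : (0 <= I z)%E by apply: integral_ge0 => a _; exact: (kT0 k (a, z)).
have fin : (\int[nu]_(z in exterior r) I z < +oo)%E.
  rewrite -(@tonelli_on _ _ _ _ _ mu nu `[0, +oo[%classic (exterior r) _ half_line mEr (mkT k) (kT0 k)).
  apply: (@le_lt_trans _ _ (K%:E * \int[mu]_(a in `[0%R, +oo[) (expR (- a))%:E)%E); last first.
    by rewrite lte_mul_pinfty ?lee_fin// integral_expRN_lty.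
  have mexp : measurable_fun setT (fun a : R => (expR (- a))%:E).
    by apply/measurable_EFinP; apply: (measurableT_comp (@measurable_expR R)).
  rewrite -ge0_integralZl; [|exact: half_line|exact: (measurable_funTS mexp)|by move=> a _; rewrite lee_fin expR_ge0|by rewrite lee_fin].
  apply: ge0_le_integral => //.
  - by move=> a _; apply: integral_ge0 => z _; exact: (kT0 k (a, z)).
  - apply: measurable_funTS.
    exact: (@measurable_int_section _ _ _ _ _ nu (exterior r) _ mEr (mkT k) (kT0 k)).
  - by apply: measurable_funTS; exact: measurable_funeM.
  - by move=> a; rewrite /= in_itv/= andbT => a0; rewrite -EFinM; exact: Kd.
have II : nu.-integrable (exterior r) I.
  apply/integrableP; split; first exact: measurable_funTS.
  by under eq_integral do rewrite gee0_abs//.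
apply: (@ae_mono _ _ _ nu _ _ _ (integrable_ae mEr II)) => z h /h.
by rewrite ge0_fin_numE//; exact: I0.
Qed.

Let initial_ae : {ae nu, forall z, exterior r z -> (T 0 z < +oo)%E}.
Proof.
have [K K0 Kd] := mass_le 0; have := Kd 0 (lexx 0).
under eq_integral do rewrite mul0r expR0 mul1e.
move=> h; have m0 : measurable_fun setT (T 0) := measurable_sec (0 : R) mT.
have II : nu.-integrable (exterior r) (T 0).
  apply/integrableP; split; first exact: measurable_funTS.
  under eq_integral do rewrite gee0_abs//.
  exact: le_lt_trans h (ltry _).
apply: (@ae_mono _ _ _ nu _ _ _ (integrable_ae mEr II)) => z h2 /h2.
by rewrite ge0_fin_numE//; exact: T0.
Qed.

(** Almost every orbit carries no mass for almost every a. Tonelli converts this into vanishing of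
    the density on the exterior of radius r e^a for almost every a >= 0, and a is then sent to 0. *)
Theorem orbit_unique_continuation : N = 1%N \/ C < 1 / 4 ->
  {ae nu, forall z, forall l, w l z = 0}.
Proof.
move=> cases.
have vanish : {ae nu, forall z, exterior r z -> {ae mu, forall a, `[0, +oo[%classic a -> T a z = 0%E}}.
  have H := @ae_conj _ _ _ nu _ _ modes_ae (@ae_conj _ _ _ nu _ _ moments_ae initial_ae).
  apply: (@ae_mono _ _ _ nu _ _ _ H) => z [h1 [h2 h3]] zr.
  have ov := @orbit_vanish R n N C w g C0 mw mg gC z (h3 zr) (fun k : nat => h2 k zr).
  by apply: (ov _ cases) => l j K; exact: (h1 (l, (j, K)) zr).
have mTs : measurable_fun setT (fun p : Cn R n * R => T p.2 p.1).
  have ms : measurable_fun setT (fun p : Cn R n * R => (p.2, p.1)).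
    by apply: measurable_fun_pair; [exact: measurable_snd|exact: measurable_fst].
  exact: (measurableT_comp mT ms).
have I0 : (\int[nu]_(z in exterior r) \int[mu]_(a in `[0%R, +oo[) T a z = 0)%E.
  rewrite -[RHS](integral0 nu (exterior r)); apply: ae_eq_integral_gen.
  apply: (@ae_mono _ _ _ nu _ _ _ vanish) => z /[apply] h.
  rewrite -[RHS](integral0 mu `[0, +oo[); exact: ae_eq_integral_gen.
have I1 : {ae mu, forall a, `[0, +oo[%classic a -> (\int[nu]_(z in exterior r) T a z = 0)%E}.
  have mIa : measurable_fun setT (fun a => \int[nu]_(z in exterior r) T a z)%E.
    exact: (@measurable_int_section _ _ _ _ _ nu (exterior r) _ mEr mT (fun p => T0 p.1 p.2)).
  apply: (@ge0_integral_eq0 R _ _ mu `[0, +oo[%classic (fun a => \int[nu]_(z in exterior r) T a z)%E half_line mIa).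
    by move=> a; apply: integral_ge0 => z _; exact: T0.
  rewrite (@tonelli_on _ _ _ _ _ mu nu `[0, +oo[%classic (exterior r) (fun p => T p.1 p.2))//.
have muJ_gt0 : (0 < mu J)%E.
  have p2 : 0 < 2 * pi :> R by rewrite mulr_gt0// pi_gt0.
  by rewrite /circle lebesgue_measure_itv/= lte_fin p2 -EFinB subr0 lte_fin.
(* A good a exists below every 1/(k+1), since a null set cannot contain an interval of positive
   length. *)
have ext0 (k : nat) : exists2 a, 0 <= a <= k.+1%:R^-1 & (\int[nu]_(z in exterior (r * expR a)) (S z)%:E = 0)%E.
  apply: contrapT => nex.
  have [Z [mZ Z0 sZ]] := I1.
  have sub : `[0, k.+1%:R^-1]%classic `<=` Z.
    move=> a; rewrite /= in_itv/= => ak; apply: sZ => /= h; apply: nex; exists a => //.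
    have a0 : 0 <= a by case/andP: ak.
    have := h; rewrite in_itv/= a0 => /(_ isT).
    rewrite integral_orbit_mass// => /eqP; rewrite mule_eq0 => /orP[|/eqP J0]; last first.
      by move: muJ_gt0; rewrite J0 ltxx.
    by rewrite mule_eq0 => /orP[/eqP[] /eqP|/eqP //]; rewrite gt_eqF ?expR_gt0.
  pose I : set R := `[0, k.+1%:R^-1]%classic.
  have : (mu I <= mu Z)%E by apply: le_measure => //; rewrite inE//; exact: measurable_itv.
  rewrite /I.
  by rewrite Z0 lebesgue_measure_itv/= lte_fin invr_gt0 ltr0n/= oppr0 adde0 lee_fin leNgt invr_gt0 ltr0n.
have ext1 : {ae nu, forall z, forall k : nat, exterior (r * expR k.+1%:R^-1) z -> S z = 0}.
  apply: (@ae_all _ _ _ nu) => k; have [a /andP[a0 ak] Ia] := ext0 k.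
  have ra : 0 <= r * expR a by rewrite mulr_ge0 ?expR_ge0// ltW.
  have := @ge0_integral_eq0 R _ _ nu (exterior (r * expR a)) _ (mE ra) mSE (fun z => S0 z) Ia => H.
  apply: (@ae_mono _ _ _ nu _ _ _ H) => z h zk.
  have /h [] // : exterior (r * expR a) z.
  by apply: le_lt_trans zk; rewrite ler_pM2l// ler_expR.
apply: (@ae_mono _ _ _ nu _ _ _ ext1) => z h l.
have [zr|] := pselect (exterior r z); last exact: w0.
suff Sz : S z = 0.
  have := Sz; rewrite /S /density => /eqP; rewrite psumr_eq0; last by move=> i _; exact: csq_ge0.
  by move=> /allP /(_ l (mem_index_enum _)) /=; rewrite csq_eq0 => /eqP.
have e1 : 1 < enorm z / r by rewrite ltr_pdivlMr// mul1r.
have l0 : 0 < ln (enorm z / r) by rewrite ln_gt0.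
(* k + 1 exceeds 1 / ln (|z| / r), so that r e^(1/(k+1)) < |z|. *)
pose k := Num.truncn (ln (enorm z / r))^-1.
apply: (h k); rewrite /exterior/= mulrC -ltr_pdivlMr//.
rewrite -[ltRHS]lnK ?posrE ?(lt_trans _ e1)// ltr_expR invf_plt ?posrE//.
exact: truncnS_gt.
Qed.

End orbit_unique_continuation.

(** * The Euler field *)

Section finite_cauchy_schwarz.
Variable R : realType.

(** With A the sum of |a_i|^2 and P the pairing, the sum of |A b_i - P conj(a_i)|^2 expands to A
    times the difference of the two sides. If A = 0 then all a_i vanish. *)
Lemma csq_sum_le (I : finType) (a b : I -> R[i]) :
  csq (\sum_i a i * b i) <= (\sum_i csq (a i)) * \sum_i csq (b i).
Proof.
set A := \sum_i csq (a i); set P := \sum_i _.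
have A0 : 0 <= A by apply: sumr_ge0 => i _; exact: csq_ge0.
have [Az|An] := eqVneq A 0.
  have a0 i : a i = 0.
    move: Az => /eqP; rewrite psumr_eq0; last by move=> j _; exact: csq_ge0.
    by move=> /allP /(_ i (mem_index_enum _)) /=; rewrite csq_eq0 => /eqP.
  by rewrite Az mul0r /P big1 ?csq0// => i _; rewrite a0 mul0r.
have Ap : 0 < A by rewrite lt_neqAle eq_sym An.
rewrite -(ler_pM2l Ap) -subr_ge0.
rewrite (_ : _ - _ = \sum_i csq (A%:C * b i - P * (complex.Re (a i) -i* complex.Im (a i)))).
  by apply: sumr_ge0 => i _; exact: csq_ge0.
have E i : csq (A%:C * b i - P * (complex.Re (a i) -i* complex.Im (a i))) =
    A ^+ 2 * csq (b i) + csq P * csq (a i) -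
    2 * A * (complex.Re P * complex.Re (a i * b i) + complex.Im P * complex.Im (a i * b i)).
  by rewrite /csq !ReImE/=; ring.
have gen (f1 f2 f3 f4 : I -> R) (x y p q s : R) :
    \sum_i (x * f1 i + y * f2 i - s * (p * f3 i + q * f4 i)) =
    x * (\sum_i f1 i) + y * (\sum_i f2 i) - s * (p * (\sum_i f3 i) + q * (\sum_i f4 i)).
  by rewrite sumrB big_split/= -!mulr_sumr big_split/= -!mulr_sumr.
rewrite (eq_bigr _ (fun i _ => E i)) gen -Re_sum -Im_sum -/P -/A.
have -> : complex.Re P * complex.Re P + complex.Im P * complex.Im P = csq P by rewrite /csq; ring.
ring.
Qed.

End finite_cauchy_schwarz.

Section finite_sums.
Variables (R : realType) (d : measure_display) (T : measurableType d) (m : {measure set T -> \bar R}).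
Implicit Types (f g : T -> R[i]) (D : set T).

Lemma cfin_add D f g : measurable D -> measurable_fun setT f -> measurable_fun setT g ->
  cfin m D f -> cfin m D g -> cfin m D (fun x => f x + g x).
Proof.
move=> mD mf mg ff fg.
have mc h : measurable_fun setT h -> measurable_fun D (fun x => (cabs (h x))%:E).
  by move=> mh; apply: measurable_funTS; apply/measurable_EFinP; exact: measurable_cabs.
apply: (@le_lt_trans _ _ (\int[m]_(x in D) (cabs (f x))%:E + \int[m]_(x in D) (cabs (g x))%:E)%E).
  rewrite -ge0_integralD//; [|by move=> z _; rewrite lee_fin cabs_ge0|exact: mc
    |by move=> z _; rewrite lee_fin cabs_ge0|exact: mc].
  apply: (@cfin_le _ _ _ m _ _ (fun x => cabs (f x) + cabs (g x))) => //.
  - exact: measurable_complexD.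
  - by apply: measurable_funD; exact: measurable_cabs.
  - by move=> x _; exact: cabsD.
exact: lte_add_pinfty.
Qed.

Lemma cfin_const D (c : R[i]) f : measurable D -> measurable_fun setT f -> cfin m D f ->
  cfin m D (fun x => c * f x).
Proof.
move=> mD mf ff.
apply: (@le_lt_trans _ _ ((cabs c)%:E * \int[m]_(x in D) (cabs (f x))%:E)%E); last first.
  by rewrite lte_mul_pinfty ?lee_fin ?cabs_ge0.
have mc : measurable_fun setT (fun x => (cabs (f x))%:E) by apply/measurable_EFinP; exact: measurable_cabs.
rewrite -ge0_integralZl; [|exact: mD|exact: (measurable_funTS mc)|by move=> x _; rewrite lee_fin cabs_ge0|by rewrite lee_fin cabs_ge0].
apply: (@cfin_le _ _ _ m _ _ (fun x => cabs c * cabs (f x))) => //.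
- exact: measurable_complexM.
- by apply: measurable_funM => //; exact: measurable_cabs.
- by move=> x _; exact: cabsM.
Qed.

Lemma cI_sum D n (f : 'I_n -> T -> R[i]) : measurable D ->
  (forall i, measurable_fun setT (f i)) -> (forall i, cfin m D (f i)) ->
  cI m D (fun x => \sum_i f i x) = \sum_i cI m D (f i).
Proof.
move=> mD mf ff.
have H : forall s : seq 'I_n, [/\ cI m D (fun x => \sum_(i <- s) f i x) = \sum_(i <- s) cI m D (f i),
    measurable_fun setT (fun x => \sum_(i <- s) f i x) & cfin m D (fun x => \sum_(i <- s) f i x)]; last by have [] := H (index_enum _).
elim=> [|i s [ih1 ih2 ih3]].
  have E : (fun x => \sum_(i <- [::]) f i x) = (fun=> 0) by apply/funext => x; rewrite big_nil.
  rewrite E big_nil; split => //.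
    by apply: complex_ext => /=; rewrite /Rintegral integral0.
  by rewrite /cfin; under eq_integral do rewrite cabs0; rewrite integral0.
have E : (fun x => \sum_(j <- i :: s) f j x) = (fun x => f i x + \sum_(j <- s) f j x).
  by apply/funext => x; rewrite big_cons.
rewrite E big_cons; split.
- by rewrite cI_D// ih1.
- exact: measurable_complexD.
- exact: cfin_add.
Qed.

End finite_sums.

Section euler_field.
Variables (R : realType) (n : nat) (r : R).
Implicit Types (z : Cn R n) (e : sexpr R n) (h : Cn R n -> R[i]).
Notation nu := (@lebesgue_Cn R n).
Hypothesis r0 : 0 < r.

Lemma measurable_dbar j e : measurable_fun setT (dbar j (seval e)).
Proof.
rewrite (_ : dbar j (seval e) = fun z => 2^-1 * ((seval (sder (xdir R j) e) z)%:C + (0 +i* 1) * (seval (sder (ydir R j) e) z)%:C)).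
  have m v : measurable_fun setT (fun z => (seval (sder v e) z)%:C).
    by apply: real_complex_measurable; exact: measurable_seval.
  apply: measurable_complexM => //; apply: measurable_complexD => //; exact: measurable_complexM.
by apply/funext => z; exact: dbar_seval.
Qed.

Lemma dbar_cfin h j e : loc1 h -> admissible r e -> cfin nu setT (fun z => h z * dbar j (seval e) z).
Proof.
move=> lh [s [M [rs M0 sM]]]; have [mh _] := lh.
have eM z : seval e z != 0 -> disc M z by move=> /sM[].
have [B1 B10 b1] := seval_bounded (sder (xdir R j) e) M.
have [B2 B20 b2] := seval_bounded (sder (ydir R j) e) M.
have dE z : dbar j (seval e) z = (2^-1 * seval (sder (xdir R j) e) z) +i* (2^-1 * seval (sder (ydir R j) e) z).
  by rewrite dbar_seval half_half; apply: complex_ext; rewrite !ReImE/=; ring.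
have z0 z : ~ disc M z -> dbar j (seval e) z = 0.
  move=> zM; have s0 v : seval (sder v e) z = 0.
    by apply/eqP; apply: contrapT => /negP /(sder_supp eM).
  by rewrite dE !s0 mulr0.
have B0 : 0 <= B1 + B2 by rewrite addr_ge0.
have dB z : cabs (dbar j (seval e) z) <= B1 + B2.
  have [zM|/z0 ->] := pselect (disc M z); last by rewrite cabs0.
  rewrite dE /cabs/= !normrM ger0_norm ?invr_ge0//.
  have := b1 z zM; have := b2 z zM; have := normr_ge0 (seval (sder (xdir R j) e) z).
  by have := normr_ge0 (seval (sder (ydir R j) e) z); lra.
have dS z : dbar j (seval e) z != 0 -> disc M z by move=> /eqP h0; apply: contrapT => /z0.
apply: le_lt_trans (integral_supp mh (measurable_dbar j e) B0 dB dS) _.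
have [K _ KE] := loc1_fine M lh; by rewrite KE -EFinM ltry.
Qed.

Definition conj_coord z (j : 'I_n) : R[i] := complex.Re (z 0 j) -i* complex.Im (z 0 j).

(** The j-th equation is tested with conj z_j * e and summed over j, because the sum of d/d(conj
    z_j) (conj z_j e) is [homog e]. Test functions being real, conj z_j * e is split into two of
    them. *)
Lemma weak_euler h (v : 'I_n -> Cn R n -> R[i]) : loc1 h -> (forall j, loc1 (v j)) ->
  (forall j phi, test_function (exterior r) phi ->
    cI nu setT (fun z => h z * dbar j phi z) = - cI nu setT (fun z => v j z * (phi z)%:C)) ->
  forall e, admissible r e -> cI nu setT (fun z => h z * homog e z) =
    - cI nu setT (fun z => (\sum_j conj_coord z j * v j z) * (seval e z)%:C).
Proof.
move=> lh lv weak e ae; have [mh _] := lh.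
(* [SLin (ydir R j)] evaluates to minus the j-th imaginary part, so [ex j] plus i times [ey j] is
   conj z_j * e. *)
pose ex j := SMul (SLin (xdir R j)) e; pose ey j := SMul (SLin (ydir R j)) e.
have ax j : admissible r (ex j) by exact: admissible_mulr.
have ay j : admissible r (ey j) by exact: admissible_mulr.
have tx j := admissible_test r0 (ax j); have ty j := admissible_test r0 (ay j).
pose I : R[i] := 0 +i* 1.
have dE z : homog e z = \sum_j (dbar j (seval (ex j)) z + I * dbar j (seval (ey j)) z).
  rewrite /homog Ebar_dbar rmorphM rmorph_nat.
  rewrite (_ : n%:R = \sum_(j < n) (1 : R[i])); last by rewrite sumr_const card_ord.
  rewrite mulr_suml -big_split/=; apply: eq_bigr => j _.
  have lxx : lin (xdir R j) (xdir R j) = 1 by rewrite lin_xdir mxE !eqxx.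
  have lxy : lin (xdir R j) (ydir R j) = 0 by rewrite lin_ydir mxE !eqxx oppr0.
  have lyx : lin (ydir R j) (xdir R j) = 0 by rewrite linC.
  have lyy : lin (ydir R j) (ydir R j) = -1 by rewrite lin_ydir !mxE !eqxx mulr1.
  rewrite !dbar_mul_lin lxx lxy lyx lyy !(linC _ z) lin_xdir lin_ydir half_half.
  move: (dbar _ _ _) (seval e z) (z 0 j) => [d1 d2] x [z1 z2].
  by apply: complex_ext; rewrite !ReImE/=; field.
have cE z j : conj_coord z j * (v j z) * (seval e z)%:C =
    v j z * (seval (ex j) z)%:C + I * (v j z * (seval (ey j) z)%:C).
  rewrite /= !(linC _ z) lin_xdir lin_ydir /conj_coord.
  move: (v j z) (seval e z) (z 0 j) => [v1 v2] x [z1 z2].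
  by apply: complex_ext; rewrite !ReImE/=; ring.
have mE e' : measurable_fun setT (fun z => (seval e' z)%:C).
  by apply: real_complex_measurable; exact: measurable_seval.
have m1 j e' : measurable_fun setT (fun z => h z * dbar j (seval e') z).
  by apply: measurable_complexM => //; exact: measurable_dbar.
have m2 j e' : measurable_fun setT (fun z => v j z * (seval e' z)%:C).
  by apply: measurable_complexM => //; have [] := lv j.
have f2 j e' : admissible r e' -> cfin nu setT (fun z => v j z * (seval e' z)%:C).
  move=> ae'; have := loc1_supp_cfin (lv j) ae'.
  by rewrite /cfin; under eq_integral do rewrite mulrC.
have m3 j e' : measurable_fun setT (fun z => I * (h z * dbar j (seval e') z)) by exact: measurable_complexM.
have m4 j e' : measurable_fun setT (fun z => I * (v j z * (seval e' z)%:C)) by exact: measurable_complexM.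
have f3 j := cfin_const I measurableT (m1 j (ey j)) (dbar_cfin j lh (ay j)).
have f4 j := cfin_const I measurableT (m2 j (ey j)) (f2 j (ey j) (ay j)).
have L : cI nu setT (fun z => h z * homog e z) =
    \sum_j (cI nu setT (fun z => h z * dbar j (seval (ex j)) z) + I * cI nu setT (fun z => h z * dbar j (seval (ey j)) z)).
  transitivity (cI nu setT (fun z => \sum_j (h z * dbar j (seval (ex j)) z + I * (h z * dbar j (seval (ey j)) z)))).
    by apply: eq_cI => z _; rewrite dE mulr_sumr; apply: eq_bigr => j _; ring.
  rewrite cI_sum//.
  - apply: eq_bigr => j _; rewrite cI_D//; last by apply: dbar_cfin.
    by congr (_ + _); apply: cI_Z => //; apply: dbar_cfin.
  - by move=> j; exact: measurable_complexD.
  - by move=> j; apply: cfin_add => //; apply: dbar_cfin.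
have Rr : cI nu setT (fun z => (\sum_j conj_coord z j * v j z) * (seval e z)%:C) =
    \sum_j (cI nu setT (fun z => v j z * (seval (ex j) z)%:C) + I * cI nu setT (fun z => v j z * (seval (ey j) z)%:C)).
  transitivity (cI nu setT (fun z => \sum_j (v j z * (seval (ex j) z)%:C + I * (v j z * (seval (ey j) z)%:C)))).
    by apply: eq_cI => z _; rewrite mulr_suml; apply: eq_bigr => j _; exact: cE.
  rewrite cI_sum//.
  - apply: eq_bigr => j _; rewrite cI_D//; last by apply: f2.
    by congr (_ + _); apply: cI_Z => //; apply: f2.
  - by move=> j; exact: measurable_complexD.
  - by move=> j; apply: cfin_add => //; apply: f2.
rewrite L Rr -sumrN; apply: eq_bigr => j _.
by rewrite (weak j _ (tx j)) (weak j _ (ty j)); ring.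
Qed.

End euler_field.

Section borel_version.
Variables (R : realType) (n : nat).
Notation nu := (@lebesgue_Cn R n).

Lemma measurable_zero_extension (D : set (Cn R n)) (h : Cn R n -> R[i]) : measurable D ->
  measurable_fun D h -> measurable_fun setT (fun z => if z \in D then h z else 0).
Proof.
move=> mD mh.
have E (p : R[i] -> R) : p 0 = 0 -> (fun z => p (if z \in D then h z else 0)) = ((fun z => p (h z)) \_ D).
  by move=> p0; apply/funext => z; rewrite /patch; case: ifP.
apply: measurable_fun_complex.
  rewrite (E (@complex.Re R))//; apply/(measurable_restrictT _ mD).
  exact: (measurableT_comp (@measurable_Re R) mh).
rewrite (E (@complex.Im R))//; apply/(measurable_restrictT _ mD).
exact: (measurableT_comp (@measurable_Im R) mh).
Qed.

Lemma borel_version (D : set (Cn R n)) (f : Cn R n -> R[i]) : measurable D ->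
  lebesgue_measurable_fun D f -> exists h : Cn R n -> R[i], [/\ measurable_fun setT h,
    forall z, ~ D z -> h z = 0 & {ae nu, forall z, D z -> f z = h z}].
Proof.
move=> mD [g mg fg]; exists (fun z => if z \in D then g z else 0); split.
- exact: measurable_zero_extension.
- by move=> z zD; rewrite memNset.
- by apply: (@ae_mono _ _ _ nu _ _ _ fg) => z h zD; rewrite mem_set// h.
Qed.

End borel_version.

(** * Borel representatives and reduction to the orbit theorem *)

Section final.
Variables (R : realType) (n N : nat) (r C : R)
    (u : Cn R n -> 'cV[R[i]]_N) (V : 'I_n -> Cn R n -> 'M[R[i]]_N).
Notation nu := (@lebesgue_Cn R n).
Hypotheses (r0 : 0 < r) (C0 : 0 < C) (uW : vector_W12 (exterior r) u)
  (mV : measurable_form (exterior r) V)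
  (VC : {ae nu, forall z : Cn R n, exterior r z -> form_norm V z <= C / enorm z})
  (eqn : dbar_equation (exterior r) u V)
  (decay : vanishes_to_infinite_order_at_infinity u).

Let mE : measurable (@exterior R n r). Proof. exact: measurable_exterior (ltW r0). Qed.

Lemma borel_solution : exists w : 'I_N -> Cn R n -> R[i], [/\
  forall l, measurable_fun setT (w l), forall l z, ~ exterior r z -> w l z = 0 &
  {ae nu, forall z, exterior r z -> forall l, u z l 0 = w l z}].
Proof.
have H l := borel_version mE (uW l).1.1.
have [w wP] := choice H; exists w; split.
- by move=> l; have [] := wP l.
- by move=> l z; have [_ + _] := wP l; exact.
- have Q : {ae nu, forall z, forall l, exterior r z -> u z l 0 = w l z}.
    by apply: (@ae_all _ _ _ nu) => l; have [] := wP l.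
  by apply: (@ae_mono _ _ _ nu _ _ _ Q) => z h zr l; exact: h.
Qed.

Lemma form_normE (W : 'I_n -> Cn R n -> 'M[R[i]]_N) z :
  form_norm W z ^+ 2 = \sum_j \sum_k \sum_l csq (W j z k l).
Proof.
rewrite /form_norm sqr_sqrtr; last by apply: sumr_ge0 => j _; exact: sqr_ge0.
apply: eq_bigr => j _; rewrite /enorm sqr_sqrtr.
  by apply: eq_bigr => k _; apply: eq_bigr => l _; rewrite csqE.
by apply: sumr_ge0 => k _; apply: sumr_ge0 => l _; exact: sqr_ge0.
Qed.

(* The truncation makes the bound |V| <= C / |z| hold everywhere. *)
Lemma borel_potential : exists v : 'I_n -> 'I_N -> 'I_N -> Cn R n -> R[i], [/\
  forall j k l, measurable_fun setT (v j k l),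
  forall z, (\sum_j \sum_k \sum_l csq (v j k l z)) * csqn z <= C ^+ 2 &
  {ae nu, forall z, exterior r z -> forall j k l, V j z k l = v j k l z}].
Proof.
have H (i : 'I_n * ('I_N * 'I_N)) := borel_version mE (mV i.1 i.2.1 i.2.2).
have [v vP] := choice H.
pose Q z := (\sum_j \sum_k \sum_l csq (v (j, (k, l)) z)) * csqn z.
have mQ : measurable_fun setT Q.
  apply: measurable_funM; last exact: measurable_csqn.
  apply: measurable_sum => j; apply: measurable_sum => k; apply: measurable_sum => l.
  by have [mv _ _] := vP (j, (k, l)); exact: (measurableT_comp (@measurable_csqC R) mv).
pose G := [set z | Q z <= C ^+ 2].
have mG : measurable G.
  rewrite (_ : G = Q @^-1` `]-oo, C ^+ 2]); last by apply/seteqP; split => z; rewrite /G/= in_itv.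
  by rewrite -[X in measurable X]setTI; exact: mQ.
exists (fun j k l z => if z \in G then v (j, (k, l)) z else 0); split.
- move=> j k l; apply: (measurable_zero_extension mG).
  by have [mv _ _] := vP (j, (k, l)); exact: measurable_funTS.
- move=> z; have [zG|zG] := pselect (G z); first by rewrite mem_set.
  rewrite memNset// big1 ?mul0r ?sqr_ge0// => j _; apply: big1 => k _; apply: big1 => l _.
  exact: csq0.
have A : {ae nu, forall z, forall i, exterior r z -> V i.1 z i.2.1 i.2.2 = v i z}.
  by apply: (@ae_all _ _ _ nu) => i; have [] := vP i.
apply: (@ae_mono _ _ _ nu _ _ _ (@ae_conj _ _ _ nu _ _ A VC)) => z [h1 h2] zr j k l.
rewrite mem_set; first exact: (h1 (j, (k, l)) zr).
have z0 : 0 < enorm z by exact: lt_trans zr.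
have {h2} := h2 zr; rewrite ler_pdivlMr// => h2.
rewrite /G/= /Q -enorm_row.
have -> : \sum_j \sum_k \sum_l csq (v (j, (k, l)) z) = form_norm V z ^+ 2.
  rewrite form_normE; apply: eq_bigr => j' _; apply: eq_bigr => k' _; apply: eq_bigr => l' _.
  by rewrite (h1 (j', (k', l')) zr).
by rewrite -exprMn lerXn2r ?nnegrE ?(ltW C0)// mulr_ge0 ?sqrtr_ge0.
Qed.

Section with_borel_versions.
Variables (w : 'I_N -> Cn R n -> R[i]) (v : 'I_n -> 'I_N -> 'I_N -> Cn R n -> R[i]).
Hypotheses (mw : forall l, measurable_fun setT (w l)) (w0 : forall l z, ~ exterior r z -> w l z = 0)
  (uw : {ae nu, forall z, exterior r z -> forall l, u z l 0 = w l z})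
  (mv : forall j k l, measurable_fun setT (v j k l))
  (vC : forall z, (\sum_j \sum_k \sum_l csq (v j k l z)) * csqn z <= C ^+ 2)
  (Vv : {ae nu, forall z, exterior r z -> forall j k l, V j z k l = v j k l z}).

Let S := density w.
Let S0 z : 0 <= S z. Proof. exact: density_ge0. Qed.
Let mS : measurable_fun setT S. Proof. exact: measurable_density. Qed.

Lemma density_ae : {ae nu, forall z, exterior r z -> enorm (u z) ^+ 2 = S z}.
Proof.
apply: (@ae_mono _ _ _ nu _ _ _ uw) => z h zr.
rewrite /enorm sqr_sqrtr; last by apply: sumr_ge0 => k _; apply: sumr_ge0 => l _; exact: sqr_ge0.
by apply: eq_bigr => k _; rewrite big_ord1 -csqE h.
Qed.

Let I rho := (\int[nu]_(z in exterior rho) (S z)%:E)%E.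

Let IE rho : r <= rho -> I rho = (\int[nu]_(z in exterior rho) (enorm (u z) ^+ 2)%:E)%E.
Proof.
move=> rr; apply: ae_eq_integral_gen.
apply: (@ae_mono _ _ _ nu _ _ _ density_ae) => z h zr; rewrite h//.
exact: le_lt_trans zr.
Qed.

Let I_ge0 rho : (0 <= I rho)%E.
Proof. by apply: integral_ge0 => z _; rewrite lee_fin. Qed.

Let I_mono a b : 0 <= a -> a <= b -> (I b <= I a)%E.
Proof.
move=> a0 ab; apply: ge0_subset_integral.
- by apply: measurable_exterior; exact: le_trans ab.
- exact: measurable_exterior.
- by apply: measurable_funTS; apply/measurable_EFinP.
- by move=> z _; rewrite lee_fin.
- by move=> z; exact: le_lt_trans.
Qed.

Let Ir_lty : (I r < +oo)%E.
Proof.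
have E : I r = (\sum_l \int[nu]_(z in exterior r) (csq (w l z))%:E)%E.
  rewrite -(@ge0_integral_sum _ _ _ nu _ mE _ (fun l z => (csq (w l z))%:E)).
  - by apply: eq_integral => z _; rewrite -sumEFin.
  - move=> l; apply: measurable_funTS; apply/measurable_EFinP.
    exact: (measurableT_comp (@measurable_csqC R) (mw l)).
  - by move=> l z _; rewrite lee_fin csq_ge0.
rewrite E; apply: lte_sum_pinfty => l _.
have := (uW l).1.2; congr (_ < _)%E; apply: ae_eq_integral_gen.
by apply: (@ae_mono _ _ _ nu _ _ _ uw) => z h zr; rewrite -csqE h.
Qed.

(** The limit at infinity gives the bound for large rho; on the bounded range left over,
    monotonicity in rho and finiteness of the mass on the exterior of radius r suffice after
    enlarging the constant. *)
Lemma density_decay (m : nat) : exists2 K : R, 0 <= K & forall rho, r <= rho ->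
  (I rho <= (K * rho ^- m)%:E)%E.
Proof.
have Ifin : I r \is a fin_num by rewrite ge0_fin_numE; [exact: Ir_lty|exact: I_ge0].
have fI : 0 <= fine (I r) by apply: fine_ge0; exact: I_ge0.
(* The order m + 1 is used because infinite-order vanishing is stated for positive orders, while m
   may be 0; for rho >= 1 the extra power only helps. *)
have m0 : 0 < m.+1%:R :> R by [].
have /fine_cvgP[_ /cvgrPdist_lt /(_ 1 ltr01)] := decay m0.
move=> -[M [_ HM]].
have /fine_cvgP[[M' [_ HM']] _] := decay m0.
(* Beyond [r1] the value is both finite (threshold M') and within 1 of its limit (threshold M), and
   rho > 1. Finiteness must be used separately, as [fine] would hide an infinite mass. *)
pose r1 := Num.max (Num.max M M') (Num.max 1 r) + 1.
have [r1M r1M' r11 r1r] : [/\ M < r1, M' < r1, 1 < r1 & r < r1].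
  by rewrite /r1 !(ltr_pwDr ltr01)// !le_max lexx ?orbT.
have r1p : 0 <= r1 by exact: ltW (lt_trans ltr01 r11).
exists (1 + fine (I r) * r1 ^+ m).
  by rewrite addr_ge0// mulr_ge0 ?fI// exprn_ge0.
move=> rho rr; have rho0 : 0 < rho by exact: lt_le_trans rr.
have [rle|rgt] := lerP rho r1.
  apply: (le_trans (I_mono (ltW r0) rr)); rewrite -(fineK Ifin) lee_fin.
  rewrite ler_pdivlMr ?exprn_gt0//; apply: (@le_trans _ _ (fine (I r) * r1 ^+ m)).
    by rewrite ler_wpM2l ?fI// lerXn2r ?nnegrE// ltW.
  by rewrite lerDr.
have rho1 : 1 < rho by exact: lt_trans rgt.
have h1 := HM rho (lt_trans r1M rgt); have h2 := HM' rho (lt_trans r1M' rgt).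
move: h1 h2; rewrite /= -(IE rr) sub0r normrN powR_mulrn ?(ltW rho0)// => h1.
have p0 : 0 < rho ^+ m.+1 by rewrite exprn_gt0.
have := I_ge0 rho; case: (I rho) h1 => [x||] //; last first.
  by rewrite gt0_muley ?lte_fin.
rewrite lee_fin -EFinM/= => h1 x0 _.
have y0 : 0 <= rho ^+ m.+1 * x by rewrite mulr_ge0// ltW.
rewrite (ger0_norm y0) in h1.
rewrite lee_fin ler_pdivlMr ?exprn_gt0//.
apply: (@le_trans _ _ (rho ^+ m.+1 * x)).
  by rewrite mulrC ler_wpM2r// exprS ler_peMl ?exprn_ge0 ?ltW.
by apply: (le_trans (ltW h1)); rewrite lerDl mulr_ge0 ?fI// exprn_ge0.
Qed.

Definition potential_term (j : 'I_n) (k : 'I_N) z : R[i] := \sum_l v j k l z * w l z.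

Definition euler_source (k : 'I_N) z : R[i] := \sum_j conj_coord z j * potential_term j k z.

Lemma measurable_complex_sum (T : measurableType default_measure_display) (J : finType) (f : J -> T -> R[i]) :
  (forall i, measurable_fun setT (f i)) -> measurable_fun setT (fun x => \sum_i f i x).
Proof.
move=> mf; apply: measurable_fun_complex.
  by under eq_fun do rewrite Re_sum; apply: measurable_sum => i; exact: measurable_Rec.
by under eq_fun do rewrite Im_sum; apply: measurable_sum => i; exact: measurable_Imc.
Qed.

Lemma measurable_potential_term j k : measurable_fun setT (potential_term j k).
Proof. by apply: measurable_complex_sum => l; exact: measurable_complexM. Qed.

Lemma measurable_euler_source k : measurable_fun setT (euler_source k).
Proof.
apply: measurable_complex_sum => j; apply: measurable_complexM; last exact: measurable_potential_term.
have mj := @measurable_coord R n j.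
apply: measurable_fun_complex => /=; first exact: (measurableT_comp (@measurable_Re R) mj).
by apply: measurable_funN; exact: (measurableT_comp (@measurable_Im R) mj).
Qed.

(** A crude bound replacing 1 / |z| by 1 / r; it serves only to make each term locally
    integrable. *)
Lemma csq_potential_term j k z : csq (potential_term j k z) <= C ^+ 2 / r ^+ 2 * S z.
Proof.
have [zr|zr] := pselect (exterior r z); last first.
  rewrite /potential_term big1 ?csq0; first by rewrite mulr_ge0// divr_ge0 ?sqr_ge0.
  by move=> l _; rewrite w0// mulr0.
apply: (le_trans (csq_sum_le _ _)); apply: ler_wpM2r; first exact: S0.
rewrite ler_pdivlMr ?exprn_gt0//; apply: le_trans (vC z).
have s0 (i : 'I_n) : 0 <= \sum_k \sum_l csq (v i k l z).
  by apply: sumr_ge0 => k' _; apply: sumr_ge0 => l _; exact: csq_ge0.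
have s1 : 0 <= \sum_l csq (v j k l z) by apply: sumr_ge0 => l _; exact: csq_ge0.
apply: ler_pM; rewrite ?sqr_ge0//.
- apply: (@le_trans _ _ (\sum_k \sum_l csq (v j k l z))).
    rewrite [leRHS](bigD1 k)//= lerDl; apply: sumr_ge0 => k' _.
    by apply: sumr_ge0 => l _; exact: csq_ge0.
  by rewrite [leRHS](bigD1 j)//= lerDl; apply: sumr_ge0.
- by apply: ltW; apply/exteriorE => //; exact: ltW.
Qed.

(** Cauchy-Schwarz over the pairs (j, l) for each k bounds the square by the entries of V in row k
    times |z|^2 |w|^2. Summation over k produces the Euclidean norm of V, and |z| cancels the decay
    C / |z|, so the constant C is kept without loss. *)
Lemma csq_euler_source z : \sum_k csq (euler_source k z) <= C ^+ 2 * S z.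
Proof.
apply: (@le_trans _ _ ((\sum_j \sum_k \sum_l csq (v j k l z)) * csqn z * S z)); last first.
  by apply: ler_wpM2r => //; exact: S0.
rewrite exchange_big/= -mulrA mulr_suml; apply: ler_sum => k _.
have cc j : csq (conj_coord z j) = csq (z 0 j) by rewrite /csq/= sqrrN.
have -> : csqn z * S z = \sum_j \sum_l csq (conj_coord z j * w l z).
  rewrite /csqn mulr_suml; apply: eq_bigr => j _; rewrite /S /density mulr_sumr.
  by apply: eq_bigr => l _; rewrite csqM cc.
rewrite !pair_big/=.
have -> : euler_source k z = \sum_(p : 'I_n * 'I_N) v p.1 k p.2 z * (conj_coord z p.1 * w p.2 z).
  rewrite /euler_source -(pair_big xpredT xpredT (fun j l => v j k l z * (conj_coord z j * w l z)))/=.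
  by apply: eq_bigr => j _; rewrite /potential_term mulr_sumr; apply: eq_bigr => l _; ring.
exact: csq_sum_le.
Qed.

Lemma cintegral_cI f h : {ae nu, forall z, exterior r z -> f z = h z} ->
  (forall z, ~ exterior r z -> h z = 0) -> cintegral (exterior r) f = cI nu setT h.
Proof.
move=> fh h0.
have key (p : R[i] -> R) : p 0 = 0 -> \int[nu]_(z in exterior r) p (f z) = \int[nu]_z p (h z).
  move=> p0; transitivity (\int[nu]_(z in exterior r) p (h z)).
    apply: (@ae_eq_Rintegral _ _ _ nu).
    by apply: (@ae_mono _ _ _ nu _ _ _ fh) => z /[apply] ->.
  rewrite Rintegral_mkcond; apply: eq_Rintegral => z _; rewrite /patch.
  by case: ifPn => // /negP zr; rewrite h0 ?p0// => zr'; apply: zr; exact: mem_set.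
by congr (_ +i* _); [exact: (key (@complex.Re R))|exact: (key (@complex.Im R))].
Qed.

Lemma weak_potential k j phi : test_function (exterior r) phi ->
  cI nu setT (fun z => w k z * dbar j phi z) = - cI nu setT (fun z => potential_term j k z * (phi z)%:C).
Proof.
move=> tphi; have := eqn j k tphi.
rewrite (@cintegral_cI _ (fun z => w k z * dbar j phi z)); last 2 first.
- by apply: (@ae_mono _ _ _ nu _ _ _ uw) => z /[apply] ->.
- by move=> z zr; rewrite w0// mul0r.
rewrite (@cintegral_cI _ (fun z => potential_term j k z * (phi z)%:C))//.
- apply: (@ae_mono _ _ _ nu _ _ _ (@ae_conj _ _ _ nu _ _ uw Vv)) => z [h1 h2] zr.
  rewrite mxE /potential_term; congr (_ * _); apply: eq_bigr => l _.
  by rewrite h1// h2.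
- by move=> z zr; rewrite /potential_term big1 ?mul0r// => l _; rewrite w0// mulr0.
Qed.

Lemma solution_vanishes : N = 1%N \/ C < 1 / 4 -> {ae nu, forall z, exterior r z -> u z = 0}.
Proof.
move=> cases; have Cp := ltW C0.
have loc c h := @loc1_of_density R n N r w mw w0 density_decay c h.
have lw l : loc1 (w l).
  apply: (loc 1 _ ler01 (mw l)) => z; rewrite mul1r /density (bigD1 l)//= lerDl.
  by apply: sumr_ge0 => i _; exact: csq_ge0.
have lv j k : loc1 (potential_term j k).
  apply: (loc _ _ _ (measurable_potential_term j k) (csq_potential_term j k)).
  by rewrite divr_ge0 ?sqr_ge0.
have weak l e : admissible r e -> cI nu setT (fun z => w l z * homog e z) =
    - cI nu setT (fun z => euler_source l z * (seval e z)%:C).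
  by apply: (weak_euler r0 (lw l) (fun j => lv j l)) => j phi; exact: weak_potential.
have := orbit_unique_continuation r0 Cp mw measurable_euler_source w0 csq_euler_source density_decay weak cases.
move=> H; apply: (@ae_mono _ _ _ nu _ _ _ (@ae_conj _ _ _ nu _ _ uw H)) => z [h1 h2] zr.
by apply/colP => l; rewrite mxE h1// h2.
Qed.

End with_borel_versions.

End final.

Theorem theorem5p1 (R : realType) (n N : nat) (r C : R)
    (u : Cn R n -> 'cV[R[i]]_N) (V : 'I_n -> Cn R n -> 'M[R[i]]_N) :
  (1 <= n)%N -> (1 <= N)%N -> 0 < r -> 0 < C ->
  vector_W12 (exterior r) u ->
  measurable_form (exterior r) V ->
  {ae lebesgue_Cn R n, forall z : Cn R n,
    exterior r z -> form_norm V z <= C / enorm z} ->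
  dbar_equation (exterior r) u V ->
  vanishes_to_infinite_order_at_infinity u ->
  N = 1%N \/ (2 <= N)%N /\ C < 1 / 4 ->
  {ae lebesgue_Cn R n, forall z : Cn R n, exterior r z -> u z = 0}.
Proof.
move=> _ _ r0 C0 uW mV VC eqn decay cases.
have [w [mw w0 uw]] := borel_solution r0 uW.
have [v [mv vC Vv]] := borel_potential r0 C0 mV VC.
have cases' : N = 1%N \/ C < 1 / 4 by case: cases => [|[_]]; [left|right].
exact: (solution_vanishes r0 C0 uW eqn decay mw w0 uw mv vC Vv cases').
Qed.
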